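(* Let $\beta>1$ and $\{X_t\}_{t\in[0,1]}\in S_G^\beta(0,1)$. For $n\in\mathbb N$ let $t^n_k=k/2^n$ and $\mathcal I_n=\{t_k^n:k=0,1,\dots,2^n\}$, and define backwardly $V^n_1=X_1$ and $$V^n_{t^n_k}=\max(X_{t^n_k},\hat{\mathbb E}_{t_k^n}[V^n_{t^n_{k+1}}]),\qquad k=0,1,\dots,2^n-1.$$ Since $V^n_{t_k^n}\le V^{n+1}_{t_k^n}$, one may define $V^\infty_{t^n_k}=\lim_{m\ge n,\,m\to\infty}V^m_{t_k^n}$. Let $\mathcal I=\bigcup_n\mathcal I_n$. Then for each $t\in\mathcal I$ we have $V_t^\infty\in L_G^{*1}(\Omega_t)$. Moreover, $\{V_t^\infty,t\in\mathcal I\}$ is the smallest $G$-supermartingale dominating the process $\{X_t,t\in\mathcal I\}$.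
   Context: Framework. Fix $0\le\underline\sigma\le\bar\sigma<\infty$ and $G(a)=\frac12(\bar\sigma^2a^+-\underline\sigma^2a^-)$. $\Omega=C_0([0,\infty);\mathbb R)$ is the space of continuous paths starting at $0$ (locally uniform topology, Borel $\sigma$-field $\mathcal B(\Omega)$), $B$ the canonical process, $\Omega_t=\{\omega_{\cdot\wedge t}:\omega\in\Omega\}$. $L_{ip}(\Omega_t)=\{\varphi(B_{t_1},\dots,B_{t_m}): m\ge1,\ t_i\in[0,t],\ \varphi \text{ bounded Lipschitz}\}$, $L_{ip}(\Omega)=\bigcup_tL_{ip}(\Omega_t)$. $\hat{\mathbb E}$ is the $G$-expectation, with conditional $G$-expectations $\hat{\mathbb E}_t$: for $X=\varphi(B_{t_1},B_{t_2}-B_{t_1},\dots,B_{t_m}-B_{t_{m-1}})$ one sets $\hat{\mathbb E}_{t_j}[X]=\varphi_j(B_{t_1},\dots,B_{t_j}-B_{t_{j-1}})$, where $\varphi_m=\varphi$ and $\varphi_{i-1}(x_1,\dots,x_{i-1})=u(t_i-t_{i-1},0)$ with $u$ the viscosity solution of $\partial_tu=G(\partial^2_{yy}u)$, $u(0,y)=\varphi_i(x_1,\dots,x_{i-1},y)$; $\hat{\mathbb E}=\hat{\mathbb E}_0$. $L_G^p(\Omega_t)$ is the completion of $L_{ip}(\Omega_t)$ under $\hat{\mathbb E}[|\cdot|^p]^{1/p}$. $\mathcal P$ is the weakly compact set of all probability measures $P$ on $\Omega$ with $E^P[X]\le\hat{\mathbb E}[X]$ for all $X\in L_{ip}(\Omega)$;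 it represents $\hat{\mathbb E}$, and for Borel $X$ such that $E^P[X]$ exists for all $P\in\mathcal P$ one sets $\hat{\mathbb E}[X]=\sup_{P\in\mathcal P}E^P[X]$. $c(A)=\sup_{P\in\mathcal P}P(A)$; ''q.s.'' means outside a set of capacity $c$ zero. Relations between random variables are q.s. $S_G^p(0,T)$ is the completion of $S_G^0(0,T)=\{h(t,B_{t_1\wedge t},\dots,B_{t_n\wedge t}):t_1,\dots,t_n\in[0,T],\ h\ \text{bounded Lipschitz on }\mathbb R^{n+1}\}$ under $\|\eta\|_{S_G^p}=\{\hat{\mathbb E}[\sup_{t\in[0,T]}|\eta_t|^p]\}^{1/p}$. Spaces. $\mathbb L^1(\Omega)$: Borel $X:\Omega\to[-\infty,\infty]$ with $\hat{\mathbb E}[|X|]<\infty$; $L_G^{1^*}(\Omega)$: $X\in\mathbb L^1(\Omega)$ with $X_n\downarrow X$ q.s. for some $\{X_n\}\subset L_G^1(\Omega)$; $L_G^{*1}(\Omega)=\{X-Y:X,Y\in L_G^{1^*}(\Omega)\}$; $L_G^{1^*_*}(\Omega)$: $X\in\mathbb L^1(\Omega)$ with $X_n\uparrow X$ q.s. for some $\{X_n\}\subset L_G^{1^*}(\Omega)$; $\bar L_G^{1^*_*}(\Omega)$: $X\in\mathbb L^1(\Omega)$ with $\hat{\mathbb E}[|X_n-X|]\to0$ for some $\{X_n\}\subset L_G^{1^*_*}(\Omega)$. The same definitions with $\Omega_t$ give the spaces over $\Omega_t$. Conditional expectation on $\bar L_G^{1^*_*}(\Omega)$. $\hat{\mathbb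 E}_t$ is extended from $L_{ip}(\Omega)$ to $L^1_G(\Omega)$ and $\bar L_G^{1^*_*}(\Omega)$ by norm limits and monotone limits; it is characterized by $\hat{\mathbb E}_t[X]=\operatorname{ess\,sup}^P_{Q\in\mathcal P(t,P)}E^Q[X|\mathcal F_t]$ $P$-a.s. for every $P\in\mathcal P$, where $\mathcal F_t=\mathcal B(\Omega_t)$ and $\mathcal P(t,P)=\{Q\in\mathcal P:E^Q[X]=E^P[X]\ \forall X\in L_{ip}(\Omega_t)\}$. $\{M_t\}$ (indexed by $\mathcal I$) is a $G$-supermartingale if $M_t\in\bar L_G^{1^*_*}(\Omega_t)$ for each $t$ and $\hat{\mathbb E}_s[M_t]\le M_s$ for all $s\le t$. $V$ dominates $X$ if $V_t\ge X_t$ for all $t$; smallest means that every $G$-supermartingale $U$ dominating $X$ satisfies $U_t\ge V_t$ for all $t$. *)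

(* Defs.v *)
From HB Require Import structures.
From mathcomp Require Import all_boot all_order all_algebra.
From mathcomp Require Import all_classical all_reals all_analysis.
From mathcomp Require Import measurable_realfun.

Set Implicit Arguments.
Unset Strict Implicit.
Unset Printing Implicit Defensive.

Import Order.TTheory GRing.Theory Num.Theory.
Import numFieldNormedType.Exports.

Local Open Scope classical_set_scope.
Local Open Scope ring_scope.

(* A continuous path on [0, +oo[ starting at 0 is encoded as its extension by 0
   to the negative half-line, so that every path has exactly one code. *)
Record path (R : realType) := Path {
  pathfun : R -> R ;
  path_continuous : continuous pathfun ;
  path_eq0 : forall s, s <= 0 -> pathfun s = 0 }.

HB.instance Definition _ (R : realType) := gen_eqMixin (path R).
HB.instance Definition _ (R : realType) := gen_choiceMixin (path R).

Definition path0 (R : realType) : path R :=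
  @Path R (fun=> 0) (@cst_continuous R R 0) (fun _ _ => erefl).

HB.instance Definition _ (R : realType) := isPointed.Build (path R) (path0 R).

(* The open sets of the topology of locally uniform convergence. *)
Definition path_open (R : realType) : set (set (path R)) :=
  preimage_set_system setT (@pathfun R : path R -> {family compact, R -> R})
    open.

Notation Omega R := (g_sigma_algebraType (@path_open R)).

Definition B (R : realType) (t : R) (w : Omega R) : R := pathfun w t.

Section stopping.
Context {R : realType}.
Implicit Types (r : R) (w : Omega R).

Let stop_continuous r w : continuous (fun s => pathfun w (Num.min s r)).
Proof.
move=> s; apply: (@continuous_comp _ _ _ (fun s => Num.min s r) (pathfun w)).
  by apply: continuous_min; [exact: cvg_id | exact: cst_continuous].
exact: path_continuous.
Qed.

Let stop_eq0 r w s : s <= 0 -> pathfun w (Num.min s r) = 0.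
Proof. by move=> s0; apply: path_eq0; rewrite ge_min s0. Qed.

(* Times are extended reals so that Omega_{+oo} = Omega, and each space over
   Omega or Omega_t is obtained from a single definition. *)
Definition stop (t : \bar R) w : Omega R :=
  if t is r%:E then Path (@stop_continuous r w) (@stop_eq0 r w) else w.

(* Random variables on Omega_t = stop t @` Omega are regarded as random
   variables on Omega by composition with stop t. *)
Definition F (t : \bar R) : set (set (Omega R)) :=
  preimage_set_system setT (stop t) measurable.

End stopping.

Section cylinder.
Context {R : realType}.
Implicit Types (phi : seq R -> R) (ts : seq R) (t : \bar R).

(* Bounded Lipschitz functions on R^m; points of R^m are sequences of size m,
   and the values of phi on sequences of other sizes are irrelevant. *)
Definition bounded_lipschitz (m : nat) phi : Prop :=
  (exists M : R, forall x, size x = m -> `|phi x| <= M) /\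
  (exists L : R, forall x y, size x = m -> size y = m ->
     `|phi x - phi y| <= L * \sum_(i < m) `|x`_i - y`_i|).

Definition Lip t (X : Omega R -> R) : Prop :=
  exists ts phi,
    [/\ (0 < size ts)%N, all (fun s => (0 <= s) && (s%:E <= t)%E) ts,
        bounded_lipschitz (size ts) phi &
        X = fun w => phi [seq B s w | s <- ts]].

(* [:: x_1; x_2 - x_1; ..; x_m - x_{m-1}] *)
Definition increments (xs : seq R) : seq R := pairmap (fun a b => b - a) 0 xs.

End cylinder.

Section Gframework.
Context {R : realType}.
Variables (sl sb : R).

Definition G (a : R) : R :=
  2^-1 * (sb ^+ 2 * Num.max a 0 - sl ^+ 2 * Num.max (- a) 0).

(* f is of class C^{1,2} on ]0, +oo[ x R, with derivatives ft, fx and fxx. *)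
Definition C12 (f ft fx fxx : R -> R -> R) : Prop :=
  forall t x : R, 0 < t ->
    [/\ is_derive t 1 (f ^~ x) (ft t x),
        is_derive x 1 (f t) (fx t x) &
        is_derive x 1 (fx t) (fxx t x)] /\
    [/\ {for (t, x), continuous (fun p : R * R => f p.1 p.2)},
        {for (t, x), continuous (fun p : R * R => ft p.1 p.2)},
        {for (t, x), continuous (fun p : R * R => fx p.1 p.2)} &
        {for (t, x), continuous (fun p : R * R => fxx p.1 p.2)}].

Definition viscosity_subsolution (u : R -> R -> R) : Prop :=
  forall f ft fx fxx (t x : R), C12 f ft fx fxx -> 0 < t -> f t x = u t x ->
    (forall s y, 0 < s -> u s y <= f s y) -> ft t x - G (fxx t x) <= 0.

Definition viscosity_supersolution (u : R -> R -> R) : Prop :=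
  forall f ft fx fxx (t x : R), C12 f ft fx fxx -> 0 < t -> f t x = u t x ->
    (forall s y, 0 < s -> f s y <= u s y) -> 0 <= ft t x - G (fxx t x).

(* u is a viscosity solution of d_t u = G(d_yy u) with u(0, .) = f; since f is
   bounded, the solution is sought in the class of bounded functions, where it
   is unique on [0, +oo[ x R. *)
Definition Gheat_solution (f : R -> R) (u : R -> R -> R) : Prop :=
  [/\ {within [set p : R * R | 0 <= p.1], continuous (fun p => u p.1 p.2)},
      (exists M : R, forall t y, 0 <= t -> `|u t y| <= M),
      (forall y, u 0 y = f y),
      viscosity_subsolution u & viscosity_supersolution u].

Definition Gheat (f : R -> R) : R -> R -> R :=
  xget (fun _ _ => 0) [set u | Gheat_solution f u].

(* The passage from phi_i to phi_{i-1}, with d = t_i - t_{i-1}. *)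
Definition Gstep (d : R) (phi : seq R -> R) : seq R -> R :=
  fun xs => Gheat (fun y => phi (rcons xs y)) d 0.

(* The function phi_j, for the times ts = [:: t_1; ..; t_m]. *)
Definition Giter (ts : seq R) (j : nat) (phi : seq R -> R) : seq R -> R :=
  foldr Gstep phi (drop j (increments ts)).

Implicit Types X Y : Omega R -> \bar R.

Definition Pset : set (probability (Omega R) R) :=
  [set P | forall ts phi, path.sorted <=%R (0 :: ts) ->
     bounded_lipschitz (size ts) phi ->
     (\int[P]_w (phi (increments [seq B s w | s <- ts]))%:E
        <= (Giter ts 0 phi [::])%:E)%E].

Definition GE X : \bar R :=
  ereal_sup [set (\int[P]_w X w)%E | P in Pset].

Definition capacity (A : set (Omega R)) : \bar R :=
  ereal_sup [set P A | P in Pset].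

Definition qs (Q : Omega R -> Prop) : Prop :=
  exists N, [/\ measurable N, capacity N = 0%E & forall w, ~ N w -> Q w].

Definition qs_nonincreasing_cvg (Xn : nat -> Omega R -> \bar R) X : Prop :=
  qs (fun w => nonincreasing_seq (Xn ^~ w) /\ Xn ^~ w @ \oo --> X w).

Definition qs_nondecreasing_cvg (Xn : nat -> Omega R -> \bar R) X : Prop :=
  qs (fun w => nondecreasing_seq (Xn ^~ w) /\ Xn ^~ w @ \oo --> X w).

Definition norm_cvg (Xn : nat -> Omega R -> \bar R) X : Prop :=
  GE (fun w => `|Xn n w - X w|)%E @[n --> \oo] --> 0%E.

(* LL1 t, LG1 t, LG1_s t, LGs_1 t, LG1_ss t and LG1_ss_bar t stand for L^1,
   L_G^1, L_G^{1^*}, L_G^{*1}, L_G^{1^*_*} and its closure, over Omega_t.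
   As random variables are identified when they agree q.s., a random variable
   over Omega_t is a Borel one having an F_t-measurable version. *)
Definition LL1 (t : \bar R) X : Prop :=
  [/\ measurable_fun setT X,
      (exists2 X', forall A, measurable A -> F t (X' @^-1` A) &
                   qs (fun w => X w = X' w)) &
      (GE (fun w => `|X w|) < +oo)%E].

Definition LG1 (t : \bar R) X : Prop :=
  LL1 t X /\ exists2 Xn : nat -> Omega R -> R,
    forall n, Lip t (Xn n) & norm_cvg (fun n => EFin \o Xn n) X.

Definition LG1_s (t : \bar R) X : Prop :=
  LL1 t X /\ exists2 Xn, forall n, LG1 t (Xn n) & qs_nonincreasing_cvg Xn X.

Definition LGs_1 (t : \bar R) X : Prop :=
  LL1 t X /\ exists Y Z,
    [/\ LG1_s t Y, LG1_s t Z & qs (fun w => X w = Y w - Z w)%E].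

Definition LG1_ss (t : \bar R) X : Prop :=
  LL1 t X /\ exists2 Xn, forall n, LG1_s t (Xn n) & qs_nondecreasing_cvg Xn X.

Definition LG1_ss_bar (t : \bar R) X : Prop :=
  LL1 t X /\ exists2 Xn, forall n, LG1_ss t (Xn n) & norm_cvg Xn X.

(* condE_xxx t X Y : Y is the conditional G-expectation of X at time t, where X
   belongs successively to L_ip, L_G^1, L_G^{1^*}, L_G^{1^*_*} and the closure
   of the latter, over Omega. *)
Definition condE_Lip (t : R) (X Y : Omega R -> R) : Prop :=
  exists ts phi j,
    [/\ path.sorted <=%R (0 :: ts), bounded_lipschitz (size ts) phi,
        (j <= size ts)%N, t = (0 :: ts)`_j &
        (X = fun w => phi (increments [seq B s w | s <- ts])) /\
        (Y = fun w =>
           Giter ts j phi (take j (increments [seq B s w | s <- ts])))].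

Definition condE_LG1 (t : R) X Y : Prop :=
  [/\ LL1 +oo%E X, LL1 t%:E Y & exists Xn Yn : nat -> Omega R -> R,
    [/\ forall n, condE_Lip t (Xn n) (Yn n),
        norm_cvg (fun n => EFin \o Xn n) X &
        norm_cvg (fun n => EFin \o Yn n) Y]].

Definition condE_LG1_s (t : R) X Y : Prop :=
  [/\ LL1 +oo%E X, LL1 t%:E Y & exists Xn Yn,
    [/\ forall n, condE_LG1 t (Xn n) (Yn n),
        qs_nonincreasing_cvg Xn X & qs_nonincreasing_cvg Yn Y]].

Definition condE_LG1_ss (t : R) X Y : Prop :=
  [/\ LL1 +oo%E X, LL1 t%:E Y & exists Xn Yn,
    [/\ forall n, condE_LG1_s t (Xn n) (Yn n),
        qs_nondecreasing_cvg Xn X & qs_nondecreasing_cvg Yn Y]].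

Definition condE_LG1_ss_bar (t : R) X Y : Prop :=
  [/\ LL1 +oo%E X, LL1 t%:E Y & exists Xn Yn,
    [/\ forall n, condE_LG1_ss t (Xn n) (Yn n),
        norm_cvg Xn X & norm_cvg Yn Y]].

(* The conditional G-expectation at time t, which is determined up to q.s.
   equality on LG1_ss_bar +oo; the value is a version of it. *)
Definition condE (t : R) X : Omega R -> \bar R :=
  xget (fun=> 0%E) [set Y | condE_LG1_ss_bar t X Y].

Definition SG0 (T : R) (eta : R -> Omega R -> R) : Prop :=
  exists ts h,
    [/\ all (fun s => 0 <= s <= T) ts, bounded_lipschitz (size ts).+1 h &
        forall (t : R) w, 0 <= t <= T ->
          eta t w = h (t :: [seq B (Num.min s t) w | s <- ts])].

(* As the supremum of |eta_t| over t in [0, T] need not be Borel for a general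
   eta, its p-th moment is taken as the infimum of the p-th moments of its Borel
   majorants; this changes nothing when the supremum is Borel. *)
Definition SGnorm (p T : R) (eta : R -> Omega R -> R) : \bar R :=
  poweR (ereal_inf
    [set GE (fun w => poweR (Z w) p) | Z in
      [set Z : Omega R -> \bar R | measurable_fun setT Z /\
         qs (fun w => forall t : R, 0 <= t <= T -> (`|eta t w|%:E <= Z w)%E)]])
    p^-1.

Definition SG (p T : R) (eta : R -> Omega R -> R) : Prop :=
  (forall t : R, 0 <= t <= T -> measurable_fun setT (eta t)) /\
  exists2 etan : nat -> R -> Omega R -> R,
    forall n, SG0 T (etan n) &
    SGnorm p T (fun t w => etan n t w - eta t w) @[n --> \oo] --> 0%E.

Definition G_supermartingale (I : set R) (M : R -> Omega R -> \bar R) : Prop :=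
  (forall t, I t -> LG1_ss_bar t%:E (M t)) /\
  (forall s t, I s -> I t -> s <= t ->
     qs (fun w => (condE s (M t) w <= M s w)%E)).

Definition dominates (I : set R) (V X : R -> Omega R -> \bar R) : Prop :=
  forall t, I t -> qs (fun w => (X t w <= V t w)%E).

Definition smallest_G_supermartingale_dominating (I : set R)
    (V X : R -> Omega R -> \bar R) : Prop :=
  [/\ G_supermartingale I V, dominates I V X &
      forall U, G_supermartingale I U -> dominates I U X -> dominates I U V].

End Gframework.

Definition grid {R : realType} (n k : nat) : R := k%:R / 2 ^+ n.

Definition dyadic {R : realType} : set R :=
  [set t | exists n k : nat, (k <= 2 ^ n)%N /\ t = grid n k].

(* Main.v *)
(* On each space involved, [Y] is the conditional G-expectation of [X] at time t
   iff E^Q[X xi] <= E^P[Y xi] for all P, all Q in P(t, P) and all nonnegative xi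
   in L_ip(Omega_t), with equality up to epsilon for a suitable Q. On L_ip this
   rests on the comparison principle for the G-heat equation, and on the fact that
   every linear functional on L_ip dominated by the G-expectation is an
   expectation (Daniell-Stone, continuity coming from fourth moments and chaining),
   so that Hahn-Banach provides Q. The characterization passes to limits in norm,
   to decreasing limits from L_G^1 (by weak compactness) and to increasing limits.
   As L_ip(Omega_t) is dense in L^1(F_t, P), it makes the conditional G-expectation
   unique, monotone and Lipschitz in norm; it then exists by completeness.

   By backward induction V^n lies in L_G^1, increases with n, and is at most the
   conditional G-expectation of the maximum of |X| over the grid; hence it is
   bounded in norm. So - V^n decreases in L_G^1 to - V^oo, which gives
   V^oo = 0 - (- V^oo) in L_G^{*1}, and V^oo inherits the supermartingale property,
   while each supermartingale dominating X dominates every V^n by backward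
   induction. *)
Require Import Defs.
From HB Require Import structures.
From mathcomp Require Import all_boot all_order all_algebra.
From mathcomp Require Import all_classical all_reals all_analysis.
From mathcomp Require Import measurable_realfun.
From mathcomp Require Import ring lra zify.

Set Implicit Arguments.
Unset Strict Implicit.
Unset Printing Implicit Defensive.

Import Order.TTheory GRing.Theory Num.Theory.
Import numFieldNormedType.Exports.

Local Open Scope classical_set_scope.
Local Open Scope ring_scope.

(** * Calculus and the function G *)

(** [Gheat] and [condE] are defined by choice among all solutions of a relation, so nothing can be
    said about them before existence and uniqueness are established. For the G-heat equation,
    uniqueness avoids doubling of variables: [G] is the maximum of two linear functions, so a
    supersolution satisfies one linear inequality per extreme volatility, namely that it dominates
    the corresponding binomial walk. Such inequalities survive averaging in time and space, the
    averaged function is a classical supersolution, and a comparison in which one function is smooth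
    only takes a penalised minimum. Existence comes from the tree that takes the larger of the two
    walks at each node, by a limit along a fixed ultrafilter. The same ultrafilter replaces the
    extraction of subsequences for paths in Daniell's condition and for sequences of priors. For
    [condE], the approximating sequences in the definition are arbitrary, whereas the relation [CE]
    mentions none; each level has one lemma saying that the definition implies [CE] and one that
    constructs a value. *)

Section calculus.
Context {R : realType}.
Implicit Types (f g df dg : R -> R) (x y z c : R).

Lemma is_derive_continuous f x d : is_derive x 1 f d -> {for x, continuous f}.
Proof.
move=> fd; apply: differentiable_continuous; apply/derivable1_diffP.
by case: fd.
Qed.

Lemma is_derive_conv f x d d' : is_derive x 1 f d -> d = d' -> is_derive x 1 f d'.
Proof. by move=> + <-. Qed.

Lemma is_derive_add f g x d e : is_derive x 1 f d -> is_derive x 1 g e ->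
  is_derive x 1 (fun y => f y + g y) (d + e).
Proof. by move=> fd ge; have := @is_deriveD _ _ _ f g x 1 d e fd ge. Qed.

Lemma is_derive_opp f x d : is_derive x 1 f d ->
  is_derive x 1 (fun y => - f y) (- d).
Proof. by move=> fd; have := @is_deriveN _ _ _ f x 1 d fd. Qed.

Lemma is_derive_mul f g x d e : is_derive x 1 f d -> is_derive x 1 g e ->
  is_derive x 1 (fun y => f y * g y) (d * g x + f x * e).
Proof.
move=> fd ge; have := @is_deriveM _ _ f g x 1 d e fd ge.
by move/is_derive_conv; apply; rewrite /GRing.scale/= addrC mulrC.
Qed.

Lemma is_derive_exp f x d n : is_derive x 1 f d ->
  is_derive x 1 (fun y => f y ^+ n) (n%:R * f x ^+ n.-1 * d).
Proof.
move=> fd; have := @is_deriveX _ _ f n x 1 d fd.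
by rewrite exprfctE.
Qed.

Lemma is_derive_const c x : is_derive x 1 (fun=> c) 0.
Proof. exact: is_derive_cst. Qed.

Lemma is_derive_idR x : is_derive x 1 (fun y => y) 1.
Proof. exact: is_derive_id. Qed.

Lemma is_derive_comp f g x d e : is_derive x 1 g e -> is_derive (g x) 1 f d ->
  is_derive x 1 (fun y => f (g y)) (d * e).
Proof. by move=> ge fd; have := @is_derive1_comp _ f g x d e fd ge. Qed.

Lemma is_derive_near f g x d : (\forall y \near x, f y = g y) ->
  is_derive x 1 f d -> is_derive x 1 g d.
Proof. by move=> fg; apply: near_eq_is_derive => //; exact: oner_neq0. Qed.

End calculus.

Ltac der_rec := first
  [ eassumption
  | eapply is_derive_const
  | eapply is_derive_idR
  | eapply is_derive_add; [der_rec|der_rec]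
  | eapply is_derive_opp; der_rec
  | eapply is_derive_mul; [der_rec|der_rec]
  | eapply is_derive_exp; der_rec ].
Ltac der := eapply is_derive_conv; [der_rec|rewrite /=].

Ltac pos := first
  [ lazymatch goal with
    | |- is_true (Order.le _ (GRing.add _ _)) => apply: addr_ge0; pos
    | |- is_true (Order.le _ (GRing.mul _ _)) => apply: mulr_ge0; pos
    | |- is_true (Order.le _ (GRing.inv _)) => rewrite invr_ge0; pos
    | |- is_true (Order.le _ (GRing.exp _ _)) => apply: exprn_ge0; pos
    | |- is_true (Order.lt _ (GRing.mul _ _)) => apply: mulr_gt0; pos
    | |- is_true (Order.lt _ (GRing.inv _)) => rewrite invr_gt0; pos
    | |- is_true (Order.lt _ (GRing.exp _ _)) => apply: exprn_gt0; pos
    | |- is_true (Order.lt _ (GRing.add _ _)) =>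
        first [ apply: ltr_wpDl; pos | apply: ltr_wpDr; pos ]
    end
  | assumption | by [] | (apply: ltW; assumption) | exact: sqr_ge0
  | exact: normr_ge0 | exact: sqrtr_ge0 ].

Section taylor.
Context {R : realType}.
Implicit Types (f g df : R -> R) (x y z c : R).

Lemma mvt f df (a b : R) : (forall x, is_derive x 1 f (df x)) -> a <= b ->
  exists c, [/\ a <= c, c <= b & f b - f a = df c * (b - a)].
Proof.
move=> fd ab.
have cf : {within `[a, b], continuous f}.
  by apply: continuous_subspaceT => x; exact: is_derive_continuous (fd x).
have [c] := MVT_segment ab (fun x _ => fd x) cf.
by rewrite in_itv/= => /andP[ac cb] e; exists c.
Qed.

Lemma mvt_abs f df (C : R) z : (forall x, is_derive x 1 f (df x)) ->
  (forall y, `|y| <= `|z| -> `|df y| <= C) -> `|f z - f 0| <= C * `|z|.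
Proof.
move=> fd dfC; have [z0|z0] := leP 0 z.
  have [c [c0 cz ->]] := mvt fd z0.
  rewrite subr0 normrM ler_wpM2r// dfC//.
  by rewrite !ger0_norm.
have [c [c0 cz]] := mvt fd (ltW z0).
rewrite distrC => ->; rewrite sub0r normrM normrN ler_wpM2r// dfC//.
by rewrite !ler0_norm ?lerN2// ltW.
Qed.

Lemma is_derive_shift f df x : (forall y, is_derive y 1 f (df y)) ->
  forall z, is_derive z 1 (fun z => f (x + z)) (df (x + z)).
Proof.
move=> fd z.
have e : is_derive z 1 (fun z => x + z) 1 by der; ring.
by have := @is_derive_comp _ f (fun z => x + z) z _ _ e (fd (x + z)); rewrite mulr1.
Qed.

(** The bound on the third derivative is pushed up by three applications of the mean value
    inequality. This loses the factor 1/6 of the usual remainder, which is harmless: only the order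
    of the remainder matters. *)
Lemma taylor3 f f1 f2 f3 (K : R) :
  (forall x, is_derive x 1 f (f1 x)) -> (forall x, is_derive x 1 f1 (f2 x)) ->
  (forall x, is_derive x 1 f2 (f3 x)) -> (forall x, `|f3 x| <= K) ->
  forall x z, `|f (x + z) - f x - f1 x * z - f2 x / 2 * z ^+ 2| <= K * `|z| ^+ 3.
Proof.
move=> d1 d2 d3 f3K x.
have B2 z : `|f2 (x + z) - f2 x| <= K * `|z|.
  have /= := mvt_abs (z := z) (C := K) (is_derive_shift x d3).
  by rewrite addr0; apply => y _; exact: f3K.
have B1 z : `|f1 (x + z) - f1 x - f2 x * z| <= K * `|z| ^+ 2.
  have /= h := @mvt_abs (fun z => f1 (x + z) - f1 x - f2 x * z)
    (fun z => f2 (x + z) - f2 x) (K * `|z|) z.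
  have /= := h _ _; rewrite addr0 mulr0 subrr !subr0 expr2 mulrA; apply.
    move=> y; have e := is_derive_shift x d2 y; der; ring.
  move=> y yz; apply: (le_trans (B2 y)); rewrite ler_wpM2l//.
  by apply: le_trans (f3K 0).
move=> z; have /= h := @mvt_abs (fun z => f (x + z) - f x - f1 x * z - f2 x / 2 * z ^+ 2)
    (fun z => f1 (x + z) - f1 x - f2 x * z) (K * `|z| ^+ 2) z.
have -> : K * `|z| ^+ 3 = K * `|z| ^+ 2 * `|z| by ring.
move: h; rewrite addr0 expr0n/= !mulr0 subrr !subr0; apply.
  by move=> y; have e := is_derive_shift x d1 y; der; field.
move=> y yz; apply: (le_trans (B1 y)); rewrite ler_wpM2l//.
  by apply: le_trans (f3K 0).
by rewrite lerXn2r ?nnegrE.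
Qed.

(** The second derivative is bounded on one side only and only near the base point, which is what
    continuity of a test function provides. The difference from the parabola has a derivative of
    sign opposite to [z]. *)
Lemma taylor2_le f f1 f2 (c r z : R) :
  (forall x, is_derive x 1 f (f1 x)) -> (forall x, is_derive x 1 f1 (f2 x)) ->
  (forall y, `|y| <= r -> f2 y <= c) -> `|z| <= r ->
  f z <= f 0 + f1 0 * z + c / 2 * z ^+ 2.
Proof.
move=> d1 d2 f2c zr.
pose g1 y := f1 y - f1 0 - c * y.
have g1d y : is_derive y 1 g1 (f2 y - c).
  by have e := d2 y; rewrite /g1; der; ring.
pose g y := f y - f 0 - f1 0 * y - c / 2 * y ^+ 2.
have gd y : is_derive y 1 g (g1 y).
  by have e := d1 y; rewrite /g /g1; der; field.
suff : g z <= g 0 by rewrite /g expr0n/= !mulr0; lra.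
have g10 : g1 0 = 0 by rewrite /g1; ring.
have [z0|z0] := leP 0 z.
  have [y [y0 yz e]] := mvt gd z0.
  have [w [w0 wy e']] := mvt g1d y0.
  have : f2 w <= c by apply: f2c; rewrite ger0_norm//; move: zr; rewrite ger0_norm//; lra.
  move=> h; rewrite -subr_le0 e.
  have : g1 y <= 0 by rewrite -(subr0 (g1 y)) -g10 e'; nra.
  nra.
have [y [y0 yz e]] := mvt gd (ltW z0).
have [w [w0 wy e']] := mvt g1d yz.
have : f2 w <= c by apply: f2c; rewrite ler0_norm//; move: zr; rewrite ltr0_norm//; lra.
move=> h; rewrite -subr_ge0 e.
have : g1 y >= 0 by rewrite -oppr_le0 -(sub0r (g1 y)) -g10 e'; nra.
nra.
Qed.

Lemma taylor2_ge f f1 f2 (c r z : R) :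
  (forall x, is_derive x 1 f (f1 x)) -> (forall x, is_derive x 1 f1 (f2 x)) ->
  (forall y, `|y| <= r -> c <= f2 y) -> `|z| <= r ->
  f 0 + f1 0 * z + c / 2 * z ^+ 2 <= f z.
Proof.
move=> d1 d2 f2c zr.
have := @taylor2_le (fun y => - f y) (fun y => - f1 y) (fun y => - f2 y) (- c) r z.
have h1 y : is_derive y 1 (fun y => - f y) (- f1 y) by have e := d1 y; der.
have h2 y : is_derive y 1 (fun y => - f1 y) (- f2 y) by have e := d2 y; der.
move=> /(_ h1 h2 _ zr) H; suff: - f z <= - f 0 + - f1 0 * z + - c / 2 * z ^+ 2 by lra.
by apply: H => y /f2c; rewrite lerN2.
Qed.

End taylor.

Section Gfun.
Context {R : realType}.
Variables (sl sb : R).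
Hypotheses (sl_ge0 : 0 <= sl) (sl_le_sb : sl <= sb).
Local Notation G := (G sl sb).

Lemma sqr_sl_sb : sl ^+ 2 <= sb ^+ 2.
Proof. by rewrite lerXn2r// nnegrE// (le_trans sl_ge0). Qed.

Lemma G_nneg (a : R) : 0 <= a -> G a = 2^-1 * sb ^+ 2 * a.
Proof.
move=> a0; rewrite /Defs.G (max_idPl a0) max_r ?oppr_le0//; ring.
Qed.

Lemma G_npos (a : R) : a <= 0 -> G a = 2^-1 * sl ^+ 2 * a.
Proof.
move=> a0; rewrite /Defs.G (max_idPr a0) max_l ?oppr_ge0//; ring.
Qed.

(** Together with [G_le], this exhibits [G] as the maximum of two linear functions, one per extreme
    volatility. Arguments on supersolutions then split into two linear ones. *)
Lemma G_ge (s a : R) : s = sl \/ s = sb -> 2^-1 * s ^+ 2 * a <= G a.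
Proof.
have := sqr_sl_sb; have := G_nneg (a := a); have := G_npos (a := a).
move=> h2 h1 uv se; have [a0|a0] := leP 0 a.
  by rewrite h1//; case: se => ->; nra.
rewrite h2; last exact: ltW.
case: se => -> //; apply: ler_wnM2r; first exact: ltW.
by rewrite ler_wpM2l.
Qed.

Lemma G_le (a b : R) : 2^-1 * sl ^+ 2 * a <= b -> 2^-1 * sb ^+ 2 * a <= b -> G a <= b.
Proof. by have [/G_nneg -> | /ltW/G_npos ->] := leP 0 a. Qed.

Lemma G_mono (a b : R) : a <= b -> G a <= G b.
Proof.
move=> ab; apply: G_le.
  apply: le_trans (G_ge b (or_introl erefl)).
  by rewrite ler_wpM2l// mulr_ge0// sqr_ge0.
apply: le_trans (G_ge b (or_intror erefl)).
by rewrite ler_wpM2l// mulr_ge0// sqr_ge0.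
Qed.

Lemma G_add (a b : R) : G (a + b) <= G a + G b.
Proof.
by apply: G_le; rewrite mulrDr lerD// G_ge//; [left|left|right|right].
Qed.

Lemma G_le_eps (a b : R) : (forall e, 0 < e -> b <= G (a + e)) -> b <= G a.
Proof.
move=> h; apply/ler_addgt0Pr => e e0.
pose d := e / (2^-1 * sb ^+ 2 + 1).
have p : 0 < 2^-1 * sb ^+ 2 + 1 by rewrite ltr_wpDl// mulr_ge0// sqr_ge0.
have d0 : 0 < d by rewrite divr_gt0.
apply: (le_trans (h _ d0)); apply: (le_trans (G_add _ _)); rewrite lerD2l.
rewrite G_nneg ?(ltW d0)// /d mulrC -mulrA ger_pMr// mulrC ler_pdivrMr// mul1r.
lra.
Qed.

End Gfun.

Section continuity.
Context {R : realType} {T : topologicalType}.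
Implicit Types (f g : T -> R) (p : T).

Lemma cont_cst (c : R) p : {for p, continuous (fun _ : T => c)}.
Proof. exact: cst_continuous. Qed.

Lemma cont_add f g p : {for p, continuous f} -> {for p, continuous g} ->
  {for p, continuous (fun q => f q + g q)}.
Proof. by move=> cf cg; apply: cvgD. Qed.

Lemma cont_opp f p : {for p, continuous f} -> {for p, continuous (fun q => - f q)}.
Proof. by move=> cf; apply: cvgN. Qed.

Lemma cont_mul f g p : {for p, continuous f} -> {for p, continuous g} ->
  {for p, continuous (fun q => f q * g q)}.
Proof. by move=> cf cg; apply: cvgM. Qed.

Lemma cont_exp f p n : {for p, continuous f} -> {for p, continuous (fun q => f q ^+ n)}.
Proof.
move=> cf; elim: n => [|n ih].
  suff -> : (fun q => f q ^+ 0) = fun=> 1 by exact: cont_cst.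
  by apply/funext => q; rewrite expr0.
suff -> : (fun q => f q ^+ n.+1) = fun q => f q * f q ^+ n by exact: cont_mul.
by apply/funext => q; rewrite exprS.
Qed.

Lemma cont_max f g p : {for p, continuous f} -> {for p, continuous g} ->
  {for p, continuous (fun q => Num.max (f q) (g q))}.
Proof. by move=> cf cg; exact: (continuous_max cf cg). Qed.

Lemma cont_near f g p : (\forall q \near p, f q = g q) ->
  {for p, continuous f} -> {for p, continuous g}.
Proof.
move=> fg cf; have fgp := nbhs_singleton fg.
have h : g @ p --> g p.
  rewrite -fgp; apply: cvg_trans cf; apply: near_eq_cvg.
  by apply: filterS fg => q ->.
exact: h.
Qed.

Lemma cont_comp (S : topologicalType) (h : T -> S) (k : S -> R) p :
  {for p, continuous h} -> {for h p, continuous k} ->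
  {for p, continuous (fun q => k (h q))}.
Proof. by move=> ch ck; exact: (continuous_comp ch ck). Qed.

End continuity.

Section continuity2.
Context {R : realType}.

Lemma cont_fst (p : R * R) : {for p, continuous (fun q : R * R => q.1)}.
Proof. exact: cvg_fst. Qed.

Lemma cont_snd (p : R * R) : {for p, continuous (fun q : R * R => q.2)}.
Proof. exact: cvg_snd. Qed.

Lemma cont_id (p : R) : {for p, continuous (fun q : R => q)}.
Proof. exact: cvg_id. Qed.

Lemma cont_pair (T : topologicalType) (f g : T -> R) p :
  {for p, continuous f} -> {for p, continuous g} ->
  {for p, continuous (fun q => (f q, g q) : R * R)}.
Proof. by move=> cf cg; exact: (cvg_pair cf cg). Qed.

End continuity2.

Ltac cont := lazy beta delta [prop_for]; first [ eassumption |
  match goal with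
  | |- continuous_at _ (fun _ => ?a) => exact: cont_cst
  | |- continuous_at _ (fun q => fst q) => exact: cont_fst
  | |- continuous_at _ fst => exact: cont_fst
  | |- continuous_at _ (fun q => snd q) => exact: cont_snd
  | |- continuous_at _ snd => exact: cont_snd
  | |- continuous_at _ (fun q => q) => exact: cont_id
  | |- continuous_at _ (fun q => @GRing.add _ (@?a q) (@?b q)) =>
      apply: (@cont_add _ _ a b); cont
  | |- continuous_at _ (fun q => @GRing.opp _ (@?a q)) =>
      apply: (@cont_opp _ _ a); cont
  | |- continuous_at _ (fun q => @GRing.mul _ (@?a q) (@?b q)) =>
      apply: (@cont_mul _ _ a b); cont
  | |- continuous_at _ (fun q => @Order.max _ _ (@?a q) (@?b q)) =>
      apply: (@cont_max _ _ a b); cont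
  | |- continuous_at _ (fun q => @GRing.exp _ (@?a q) ?n) =>
      apply: (@cont_exp _ _ a _ n); cont
  | H : continuous ?f |- continuous_at ?p ?f => exact: (H p)
  end].

(** * Comparison for the G-heat equation *)

Section max_principle.
Context {R : realType}.
Implicit Types (u v f : R -> R -> R) (M t x y : R).

(** Freezing [u] at its initial value for negative times turns continuity on the closed half-plane
    into plain continuity on the plane. *)
Definition ext u t x : R := u (Num.max t 0) x.
Definition ext_continuous u := continuous (fun p : R * R => ext u p.1 p.2).

Lemma extE u t x : 0 <= t -> ext u t x = u t x.
Proof. by move=> t0; rewrite /ext (max_idPl t0). Qed.

Lemma within_ext u :
  {within [set p : R * R | 0 <= p.1], continuous (fun p => u p.1 p.2)} <->
  ext_continuous u.
Proof.
split=> [/subspace_continuousP cu p|cu].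
  have qp : {for p, continuous (fun p : R * R => (Num.max p.1 0, p.2))}.
    by apply: cont_pair; cont.
  have A : [set p : R * R | 0 <= p.1] (Num.max p.1 0, p.2) by rewrite /= le_max lexx orbT.
  move=> B /(cu _ A) h; have := qp _ h; rewrite /= !nbhs_simpl/= => h'.
  by apply: filterS h' => q /=; apply; rewrite le_max lexx orbT.
apply/subspace_continuousP => p /= p0.
have e : ext u p.1 p.2 = u p.1 p.2 by rewrite extE.
have := cu p; rewrite /continuous_at e => h B /h.
by rewrite /= !nbhs_simpl/= => h'; apply: filterS h' => q /= hq q0; move: hq; rewrite /= extE.
Qed.

(** The lower bound confines the set where [D] is negative to a compact box, so the minimum over the
    box is the minimum over the whole half-plane. *)
Lemma coercive_min (D : R * R -> R) (a b t0 x0 : R) : continuous D -> 0 < a ->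
  (forall t x, 0 <= t -> a * (t + x ^+ 2) - b <= D (t, x)) ->
  0 <= t0 -> D (t0, x0) < 0 ->
  exists t1 x1, [/\ 0 <= t1, D (t1, x1) < 0 &
    forall t x, 0 <= t -> D (t1, x1) <= D (t, x)].
Proof.
move=> cD a0 Db t00 D0.
pose N := b / a.
have out t x : 0 <= t -> N <= t + x ^+ 2 -> 0 <= D (t, x).
  move=> t1 h; apply: le_trans (Db t x t1); rewrite subr_ge0 mulrC.
  by rewrite -ler_pdivrMr.
(* From x^2 < N follows |x| <= N + 1, which avoids a square root in the box. *)
have inN t x : 0 <= t -> D (t, x) < 0 -> 0 <= t <= N /\ - (N + 1) <= x <= N + 1.
  move=> t1 Dn; have h : t + x ^+ 2 < N by rewrite ltNge; apply/negP => /(out _ _ t1); lra.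
  by split; [nra|apply/andP; split; nra].
pose K : set (R * R) := `[0, N] `*` `[- (N + 1), N + 1].
have cK : compact K by apply: compact_setX; exact: segment_compact.
have [h1 h2] := inN _ _ t00 D0.
have K0 : K (t0, x0) by split; rewrite /= in_itv.
have [||[t1 x1]] := @compact_EVT_min _ R D K _ cK; [by exists (t0, x0)|
  exact: continuous_subspaceT|].
rewrite inE => -[/=]; rewrite !in_itv/= => /andP[t10 _] _ h.
have D1 : D (t1, x1) <= D (t0, x0) by apply: h; rewrite inE.
exists t1, x1; split=> //; first exact: le_lt_trans D0.
move=> t x tge; have [D'0|] := leP 0 (D (t, x)).
  by apply: le_trans D1 (ltW (lt_le_trans D0 _)).
move=> D'0; apply: h; rewrite inE; have [? ?] := inN _ _ tge D'0.
by split; rewrite /= in_itv.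
Qed.

Lemma C12_add f ft fx fxx v vt vx vxx : C12 f ft fx fxx -> C12 v vt vx vxx ->
  C12 (fun t x => f t x + v t x) (fun t x => ft t x + vt t x)
    (fun t x => fx t x + vx t x) (fun t x => fxx t x + vxx t x).
Proof.
move=> cf cv t x t0; have [[a1 a2 a3] [b1 b2 b3 b4]] := cf t x t0.
have [[c1 c2 c3] [d1 d2 d3 d4]] := cv t x t0.
by split; split; first [exact: is_derive_add|exact: cont_add].
Qed.

Lemma C12_penalty (e c d : R) :
  C12 (fun t x => e * (x ^+ 2 + c * t) + d) (fun _ _ => e * c)
    (fun _ x => e * (2 * x)) (fun _ _ => e * 2).
Proof.
move=> t x t0; split; split.
- by der; ring.
- by der; ring.
- by der; ring.
- by cont.
- by cont.
- by cont.
- by cont.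
Qed.

Variables (sl sb : R).
Hypotheses (sl_ge0 : 0 <= sl) (sl_le_sb : sl <= sb).
Local Notation G := (G sl sb).

Lemma small_eta (d q : R) : 0 < d -> 0 <= q -> exists2 e : R, 0 < e & e * q < d.
Proof.
move=> d0 q0; exists (d / (q + 1)); first by rewrite divr_gt0// ltr_wpDl.
by rewrite -mulrA gtr_pMr// mulrC ltr_pdivrMr ?ltr_wpDl// mul1r ltrDl.
Qed.

Lemma G_penalty (e a : R) : 0 <= e -> G (a + e * 2) <= G a + e * sb ^+ 2.
Proof.
move=> e0; apply: (le_trans (G_add sl_ge0 sl_le_sb _ _)).
rewrite (@G_nneg _ sl sb (e * 2)) ?mulr_ge0//; lra.
Qed.

(** If [u] exceeded [v] somewhere, the penalised difference v - u + e (x^2 + c t) would have a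
    negative minimum at a positive time. There a smooth function touches [u] from above, and the
    subsolution inequality contradicts the one for [v]. *)
Lemma sub_le_classical u v vt vx vxx M :
  ext_continuous u -> (forall t x, 0 <= t -> `|u t x| <= M) ->
  viscosity_subsolution sl sb u ->
  ext_continuous v -> (forall t x, 0 <= t -> - M <= v t x) ->
  C12 v vt vx vxx -> (forall t x, 0 < t -> G (vxx t x) <= vt t x) ->
  (forall x, u 0 x <= v 0 x) -> forall t x, 0 <= t -> u t x <= v t x.
Proof.
move=> cu bu su cv bv Cv Gv uv0 t0 x0 t00; rewrite leNgt; apply/negP => lt0.
(* The penalty raises the time derivative by e c and [G] of the second derivative by at most e sb^2,
   so any c > sb^2 makes the inequality strict. *)
pose c := sb ^+ 2 + 1.
have c1 : 1 <= c by rewrite /c lerDr sqr_ge0.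
have [||e e0 eq] := @small_eta (u t0 x0 - v t0 x0) (x0 ^+ 2 + c * t0).
- by rewrite subr_gt0.
- by apply: addr_ge0; [exact: sqr_ge0|apply: mulr_ge0 => //; lra].
pose D (p : R * R) := ext v p.1 p.2 - ext u p.1 p.2 + e * (p.2 ^+ 2 + c * Num.max p.1 0).
have cD : continuous D.
  by move=> p; have cup := cu p; have cvp := cv p; rewrite /D; cont.
have [||t1 [x1 [t10 D1 min]]] := @coercive_min D e (2 * M) t0 x0 cD e0 _ t00.
- move=> t x tge; rewrite /D/= !extE// (max_idPl tge).
  have := bu t x tge; have := bv t x tge; rewrite ler_norml => ? /andP[? ?].
  have : e * (t + x ^+ 2) <= e * (x ^+ 2 + c * t) by rewrite ler_pM2l//; nra.
  lra.
- by rewrite /D/= !extE// (max_idPl t00); lra.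
have t1p : 0 < t1.
  rewrite lt_neqAle t10 andbT; apply/eqP => t1e; move: D1; rewrite /D/= -t1e !extE//.
  rewrite maxxx mulr0 addr0 => h; have := uv0 x1; have : 0 <= e * x1 ^+ 2 by rewrite mulr_ge0 ?sqr_ge0// ltW.
  lra.
have := su _ _ _ _ t1 x1 (C12_add Cv (C12_penalty e c (- D (t1, x1)))) t1p.
have E : D (t1, x1) = v t1 x1 - u t1 x1 + e * (x1 ^+ 2 + c * t1).
  by rewrite /D/= !extE// (max_idPl t10).
rewrite {}E in D1 min * => h.
have : vt t1 x1 + e * c - G (vxx t1 x1 + e * 2) <= 0.
  apply: h; first by lra.
  move=> s y s0; have := min s y (ltW s0); rewrite /D/= !extE ?(ltW s0)//.
  by rewrite (max_idPl (ltW s0)) ; lra.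
have := G_penalty (vxx t1 x1) (ltW e0); have := Gv t1 x1 t1p; rewrite /c; nra.
Qed.

Lemma classical_le_super u v vt vx vxx M :
  ext_continuous u -> (forall t x, 0 <= t -> `|u t x| <= M) ->
  viscosity_supersolution sl sb u ->
  ext_continuous v -> (forall t x, 0 <= t -> v t x <= M) ->
  C12 v vt vx vxx -> (forall t x, 0 < t -> vt t x <= G (vxx t x)) ->
  (forall x, v 0 x <= u 0 x) -> forall t x, 0 <= t -> v t x <= u t x.
Proof.
move=> cu bu su cv bv Cv Gv uv0 t0 x0 t00; rewrite leNgt; apply/negP => lt0.
pose c := sb ^+ 2 + 1.
have c1 : 1 <= c by rewrite /c lerDr sqr_ge0.
have [||e e0 eq] := @small_eta (v t0 x0 - u t0 x0) (x0 ^+ 2 + c * t0).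
- by rewrite subr_gt0.
- by apply: addr_ge0; [exact: sqr_ge0|apply: mulr_ge0 => //; lra].
pose D (p : R * R) := ext u p.1 p.2 - ext v p.1 p.2 + e * (p.2 ^+ 2 + c * Num.max p.1 0).
have cD : continuous D.
  by move=> p; have cup := cu p; have cvp := cv p; rewrite /D; cont.
have [||t1 [x1 [t10 D1 min]]] := @coercive_min D e (2 * M) t0 x0 cD e0 _ t00.
- move=> t x tge; rewrite /D/= !extE// (max_idPl tge).
  have := bu t x tge; have := bv t x tge; rewrite ler_norml => ? /andP[? ?].
  have : e * (t + x ^+ 2) <= e * (x ^+ 2 + c * t) by rewrite ler_pM2l//; nra.
  lra.
- by rewrite /D/= !extE// (max_idPl t00); lra.
have t1p : 0 < t1.
  rewrite lt_neqAle t10 andbT; apply/eqP => t1e; move: D1; rewrite /D/= -t1e !extE//.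
  rewrite maxxx mulr0 addr0 => h; have := uv0 x1; have : 0 <= e * x1 ^+ 2 by rewrite mulr_ge0 ?sqr_ge0// ltW.
  lra.
have := su _ _ _ _ t1 x1 (C12_add Cv (C12_penalty (- e) c (D (t1, x1)))) t1p.
have E : D (t1, x1) = u t1 x1 - v t1 x1 + e * (x1 ^+ 2 + c * t1).
  by rewrite /D/= !extE// (max_idPl t10).
rewrite {}E in D1 min * => h.
have : 0 <= vt t1 x1 + - e * c - G (vxx t1 x1 + - e * 2).
  apply: h; first by lra.
  move=> s y s0; have := min s y (ltW s0); rewrite /D/= !extE ?(ltW s0)//.
  by rewrite (max_idPl (ltW s0)) ; lra.
have := G_penalty (vxx t1 x1 + - e * 2) (ltW e0); have := Gv t1 x1 t1p.
have -> : vxx t1 x1 + - e * 2 + e * 2 = vxx t1 x1 by ring.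
rewrite /c; nra.
Qed.

End max_principle.

(** * Restarting a viscosity solution at a later time *)

Section time_shift.
Context {R : realType}.

(** The square of the positive part is of class C^1, which is all the regularity in time asked of a
    C^{1,2} test function. *)
Definition sqr_pos (y : R) := Num.max y 0 ^+ 2.

Lemma is_derive_sqr_pos (x : R) : is_derive x 1 sqr_pos (2 * Num.max x 0).
Proof.
have [x0|x0|->] := ltgtP x 0.
- rewrite mulr0; apply: (@is_derive_near _ (fun=> 0)).
  by near=> y; rewrite /sqr_pos max_r ?expr0n//; apply/ltW; near: y; exact: lt_nbhsl.
- have e : is_derive x 1 (fun y => y ^+ 2) (2 * x) by der; ring.
  apply: (is_derive_near _ e).
  by near=> y; rewrite /sqr_pos max_l//; apply/ltW; near: y; exact: lt_nbhsr.
- rewrite mulr0.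
  have n0 : (fun h : R => `|h|) @ 0^' --> (0 : R).
    have := @norm_continuous R R 0; rewrite /continuous_at normr0 => n0.
    by move=> B /n0; exact: nbhs_dnbhs.
  have h : (fun h : R => h^-1 *: (sqr_pos (h *: 1 + 0) - sqr_pos 0)) @ 0^' --> (0 : R).
    apply: (@squeeze_cvgr _ _ _ _ (fun h => - `|h|) (fun h => `|h|)).
    + near=> h; rewrite -ler_norml /sqr_pos maxxx expr0n/= subr0 addr0 /GRing.scale/= mulr1.
      have [h0|h0] := leP 0 h; last first.
        by rewrite expr0n/= mulr0 normr0.
      rewrite normrM normfV normrX expr2 mulrA.
      by have [->|hn] := eqVneq h 0; rewrite ?normr0 ?mulr0// mulVf ?mul1r// normr_eq0.
    + rewrite -[X in _ --> X]oppr0; apply: cvgN.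
      exact: n0.
    + exact: n0.
  apply: DeriveDef; first by apply/cvg_ex; exists 0.
  by apply/cvg_lim.
Unshelve. all: by end_near.
Qed.

(** Supported in [1/2, 3/2], with maximum 1 at r = 1, where its derivative vanishes: as a factor it
    leaves value and derivatives unchanged at that point. *)
Definition bump (r : R) := sqr_pos (1 - 4 * (r - 1) ^+ 2).
Definition bump' (r : R) := 2 * Num.max (1 - 4 * (r - 1) ^+ 2) 0 * (- (8 * (r - 1))).

Lemma is_derive_bump (r : R) : is_derive r 1 bump (bump' r).
Proof.
have e : is_derive r 1 (fun r => 1 - 4 * (r - 1) ^+ 2) (- (8 * (r - 1))).
  by der; ring.
exact: (@is_derive_comp _ sqr_pos _ _ _ _ e (is_derive_sqr_pos _)).
Qed.

Lemma bump_ge0 r : 0 <= bump r. Proof. exact: sqr_ge0. Qed.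

Lemma bump_le1 r : bump r <= 1.
Proof.
rewrite /bump /sqr_pos expr_le1// ?le_max ?lexx ?orbT// ge_max ler01 andbT.
by rewrite gerBl mulr_ge0// sqr_ge0.
Qed.

Lemma bump_eq0 r : r <= 1 / 2 -> bump r = 0 /\ bump' r = 0.
Proof.
move=> h; have e : Num.max (1 - 4 * (r - 1) ^+ 2) 0 = 0 by apply/max_idPr; nra.
by rewrite /bump /bump' /sqr_pos e expr0n/= mulr0 mul0r.
Qed.

Lemma bump1 : bump 1 = 1 /\ bump' 1 = 0.
Proof.
by rewrite /bump /bump' /sqr_pos subrr expr0n/= !mulr0 subr0 max_l// expr1n oppr0 mulr0.
Qed.

(** A test function for the shifted solution says nothing about times before [t0], whereas the
    original solution must be touched on all positive times. The function is therefore blended with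
    a constant [c], to be taken as a lower or an upper bound of the solution, by a cut-off in time
    that vanishes up to [t0] and equals 1 with zero derivative at the time of contact. *)
Lemma shift_test (f ft fx fxx : R -> R -> R) (t0 t c : R) : C12 f ft fx fxx ->
  0 <= t0 -> 0 < t -> exists th : R -> R,
  [/\ forall s, 0 <= th s <= 1, th (t0 + t) = 1, forall s, s <= t0 -> th s = 0 &
  exists gt gx gxx, C12 (fun s y => th s * f (s - t0) y + (1 - th s) * c) gt gx gxx /\
    forall y, gt (t0 + t) y = ft t y /\ gxx (t0 + t) y = fxx t y].
Proof.
move=> Cf t00 t_gt0.
pose th s := bump ((s - t0) / t); pose th' s := bump' ((s - t0) / t) / t.
have thd (s : R) : is_derive s 1 th (th' s).
  have e : is_derive s 1 (fun s => (s - t0) / t) (t^-1) by der; ring.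
  exact: (@is_derive_comp _ bump _ _ _ _ e (is_derive_bump _)).
have th'c s : {for s, continuous th'}.
  rewrite /th' /bump'; by cont.
have thc s : {for s, continuous th} by exact: is_derive_continuous (thd s).
have th0 s : s < t0 + t / 2 -> th s = 0 /\ th' s = 0.
  move=> h; have [|a b] := @bump_eq0 ((s - t0) / t); first by rewrite ler_pdivrMr//; lra.
  by rewrite /th /th' a b mul0r.
have th1 : th (t0 + t) = 1 /\ th' (t0 + t) = 0.
  have -> : th (t0 + t) = bump 1 by rewrite /th (addrC t0) addrK divff// gt_eqF.
  have -> : th' (t0 + t) = bump' 1 / t by rewrite /th' (addrC t0) addrK divff// gt_eqF.
  by have [-> ->] := bump1; rewrite mul0r.
exists th; split.
- by move=> s; rewrite bump_ge0 bump_le1.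
- by have [] := th1.
- by move=> s h; have [] := th0 s _; first by lra.
exists (fun s y => th' s * f (s - t0) y + th s * ft (s - t0) y - th' s * c),
  (fun s y => th s * fx (s - t0) y), (fun s y => th s * fxx (s - t0) y).
split; last first.
  move=> y; have [-> ->] := th1; rewrite (addrC t0) addrK; split; ring.
move=> s y s0; have [h|h] := ltP s (t0 + t / 2).
  have near0 : \forall s' \near s, s' < t0 + t / 2 by exact: lt_nbhsl.
  have near0' : \forall p \near (s, y), (p : R * R).1 < t0 + t / 2.
    by have := @cont_fst R (s, y) _ near0.
  have [e1 e2] := th0 s h.
  split; split.
  - rewrite e1 e2 !mul0r subr0 addr0; apply: (@is_derive_near _ (fun=> c)).
      by apply: filterS near0 => s' /th0[-> _]; rewrite mul0r subr0 mul1r add0r.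
  - rewrite e1 !mul0r; apply: (@is_derive_near _ (fun=> c)).
      by near=> s'; rewrite mul0r subr0 mul1r add0r.
  - rewrite e1 !mul0r; apply: (@is_derive_near _ (fun=> 0)).
      by near=> s'; rewrite mul0r.
  - apply: (@cont_near _ _ (fun=> c)); last exact: cont_cst.
    by apply: filterS near0' => p /th0[-> _]; rewrite mul0r subr0 mul1r add0r.
  - apply: (@cont_near _ _ (fun=> 0)); last exact: cont_cst.
    by apply: filterS near0' => p /th0[-> ->]; rewrite !mul0r subr0 addr0.
  - apply: (@cont_near _ _ (fun=> 0)); last exact: cont_cst.
    by apply: filterS near0' => p /th0[-> _]; rewrite !mul0r.
  - apply: (@cont_near _ _ (fun=> 0)); last exact: cont_cst.
    by apply: filterS near0' => p /th0[-> _]; rewrite !mul0r.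
have st0 : 0 < s - t0 by lra.
have [[a1 a2 a3] [b1 b2 b3 b4]] := Cf (s - t0) y st0.
have sh : {for (s, y), continuous (fun p : R * R => (p.1 - t0, p.2))}.
  by apply: cont_pair; cont.
have thc1 : {for (s, y), continuous (fun p : R * R => th p.1)}.
  exact: (cont_comp (@cont_fst R (s, y)) (thc s)).
have thc2 : {for (s, y), continuous (fun p : R * R => th' p.1)}.
  exact: (cont_comp (@cont_fst R (s, y)) (th'c s)).
have c1 := cont_comp sh b1; have c2 := cont_comp sh b2.
have c3 := cont_comp sh b3; have c4 := cont_comp sh b4.
split; split; last 4 first.
- by cont.
- by cont.
- by cont.
- by cont.
- have e1 : is_derive s 1 (fun s => s - t0) 1 by der; ring.
  have e2 := @is_derive_comp _ (f ^~ y) _ _ _ _ e1 a1; have e3 := thd s.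
  by der; ring.
- by der; ring.
- by der; ring.
Unshelve. all: by end_near.
Qed.

Variables (sl sb : R).

Lemma super_shift (u : R -> R -> R) (M t0 : R) : 0 <= t0 ->
  (forall t x, 0 <= t -> `|u t x| <= M) ->
  viscosity_supersolution sl sb u ->
  viscosity_supersolution sl sb (fun s => u (t0 + s)).
Proof.
move=> t00 bu su f ft fx fxx t x Cf tp fu fle.
have [th [th01 th1 th0 [gt [gx [gxx [Cg /(_ x)[<- <-]]]]]]] := shift_test (- M) Cf t00 tp.
apply: (su _ _ _ _ (t0 + t) x Cg).
- by rewrite ltr_wpDl.
- by rewrite th1 mul1r subrr mul0r addr0 (addrC t0) addrK (addrC t) -fu.
move=> s y sp.
have := bu s y (ltW sp); rewrite ler_norml => /andP[h1 h2].
have [h|h] := leP s t0; first by rewrite th0// mul0r subr0 mul1r add0r.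
have := fle (s - t0) y; rewrite (addrC t0) subrK subr_gt0 => /(_ h) h3.
by have /andP[? ?] := th01 s; nra.
Qed.

Lemma sub_shift (u : R -> R -> R) (M t0 : R) : 0 <= t0 ->
  (forall t x, 0 <= t -> `|u t x| <= M) ->
  viscosity_subsolution sl sb u ->
  viscosity_subsolution sl sb (fun s => u (t0 + s)).
Proof.
move=> t00 bu su f ft fx fxx t x Cf tp fu fle.
have [th [th01 th1 th0 [gt [gx [gxx [Cg /(_ x)[<- <-]]]]]]] := shift_test M Cf t00 tp.
apply: (su _ _ _ _ (t0 + t) x Cg).
- by rewrite ltr_wpDl.
- by rewrite th1 mul1r subrr mul0r addr0 (addrC t0) addrK (addrC t) -fu.
move=> s y sp.
have := bu s y (ltW sp); rewrite ler_norml => /andP[h1 h2].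
have [h|h] := leP s t0; first by rewrite th0// mul0r subr0 mul1r add0r.
have := fle (s - t0) y; rewrite (addrC t0) subrK subr_gt0 => /(_ h) h3.
by have /andP[? ?] := th01 s; nra.
Qed.

End time_shift.

(** * Primitives and Steklov averages *)

Section primitive.
Context {R : realType}.
Implicit Types (f g : R -> R) (x y d : R).

Let mu := @lebesgue_measure R.

Let right_primitive g : continuous g -> exists P : R -> R,
  forall x, -1 < x -> is_derive x 1 P (g x).
Proof.
move=> cg; exists (fun x => \int[mu]_(t in `[-1, x]) g t) => x x1.
have [||||h1 h2] := @continuous_FTC1_closed R g (-1) x (x + 1).
- by rewrite ltrDl.
- apply: continuous_compact_integrable; first exact: segment_compact.
  exact: continuous_subspaceT.
- exact: x1.
- exact: cg.
apply: DeriveDef; first exact: h1.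
by rewrite -derive1E.
Qed.

(** The integral from -1 is a primitive to the right of -1. The same construction for the reflected
    function gives a primitive to the left of 1. They differ by a constant on ]-1, 1[, so both are
    normalised at 0 and glued there. *)
Lemma primitive_ex g : continuous g ->
  exists P : R -> R, forall x, is_derive x 1 P (g x).
Proof.
move=> cg; have [P dP] := right_primitive cg.
have cg' : continuous (fun x => g (- x)).
  move=> x; apply: (@continuous_comp _ _ _ (fun x => - x) g); last exact: cg.
  exact: opp_continuous.
have [Q' dQ'] := right_primitive cg'.
pose Q x := - Q' (- x).
have dQ x : x < 1 -> is_derive x 1 Q (g x).
  move=> x1; have e : is_derive x 1 (fun x : R => - x) (-1) by der.
  have := dQ' (- x) _; rewrite ltrN2 => /(_ x1) e1.
  have e2 := @is_derive_comp _ Q' _ _ _ _ e e1.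
  by rewrite /Q; der; rewrite opprK; ring.
have PQ x : -1 < x -> x < 1 -> P x - Q x = P 0 - Q 0.
  move=> x1 x2.
  have dPQ y : -1 < y -> y < 1 -> is_derive y 1 (fun y => P y - Q y) 0.
    by move=> y1 y2; have a := dP y y1; have b := dQ y y2; der; ring.
  have cPQ (a b : R) : -1 < a -> b < 1 -> {within `[a, b], continuous (fun y => P y - Q y)}.
    move=> a1 b1; apply: continuous_in_subspaceT => y; rewrite inE/= in_itv/= => /andP[? ?].
    by apply: (@is_derive_continuous _ _ _ 0); apply: dPQ; lra.
  have [x0|x0] := leP 0 x.
    have l : -1 < 0 :> R by lra.
    have [|c _] := @MVT_segment R (fun y => P y - Q y) (fun=> 0) 0 x x0 _ (cPQ _ _ l x2).
      by move=> y; rewrite in_itv/= => /andP[? ?]; apply: dPQ; lra.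
    lra.
  have [|c _] := @MVT_segment R (fun y => P y - Q y) (fun=> 0) x 0 (ltW x0) _ (cPQ _ _ x1 ltr01).
    by move=> y; rewrite in_itv/= => /andP[? ?]; apply: dPQ; lra.
  lra.
exists (fun x => if 0 <= x then P x - P 0 else Q x - Q 0) => x.
have [x0|x0] := ltP (-1) x.
  have e : is_derive x 1 (fun y => P y - P 0) (g x) by have a := dP x x0; der; ring.
  apply: (is_derive_near _ e); near=> y.
  case: ifPn => //; rewrite -ltNge => y0.
  have y1 : -1 < y by near: y; exact: lt_nbhsr.
  have := PQ y y1 _; have : y < 1 by lra.
  by move=> h /(_ h); lra.
have e : is_derive x 1 (fun y => Q y - Q 0) (g x).
  have x1 : x < 1 by lra.
  by have a := dQ x x1; der; ring.
apply: (is_derive_near _ e); near=> y.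
rewrite ifN// -ltNge; near: y; apply: lt_nbhsl; lra.
Unshelve. all: by end_near.
Qed.

Definition prim g : R -> R := xget (fun=> 0) [set P | forall x, is_derive x 1 P (g x)].

Lemma is_derive_prim g : continuous g -> forall x, is_derive x 1 (prim g) (g x).
Proof.
move=> /primitive_ex[P dP]; rewrite /prim.
by case: xgetP => [Q _ //|/(_ P)/=]; move=> /(_ dP).
Qed.

Lemma primitive_unique g P Q (a b : R) : (forall x, is_derive x 1 P (g x)) ->
  (forall x, is_derive x 1 Q (g x)) -> P b - P a = Q b - Q a.
Proof.
move=> dP dQ; have h x : is_derive x 1 (fun y => P y - Q y) 0.
  by have a1 := dP x; have a2 := dQ x; der; ring.
by have := is_derive_0_is_cst a b h; lra.
Qed.

(* The Steklov average of g over [x, x + d]; each averaging gains a derivative. *)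
Definition avg d g x := (prim g (x + d) - prim g x) / d.

Lemma avgE g P d x : continuous g -> (forall x, is_derive x 1 P (g x)) ->
  avg d g x = (P (x + d) - P x) / d.
Proof. by move=> cg dP; rewrite /avg (primitive_unique x (x + d) (is_derive_prim cg) dP). Qed.

Lemma is_derive_avg g d : continuous g ->
  forall x, is_derive x 1 (avg d g) ((g (x + d) - g x) / d).
Proof.
move=> cg x; have a := is_derive_prim cg x.
have b := is_derive_shift d (is_derive_prim cg) x.
have b' : is_derive x 1 (fun x => prim g (x + d)) (g (x + d)).
  by move: b; rewrite addrC; apply: is_derive_near; near=> y; rewrite addrC.
by rewrite /avg; der; ring.
Unshelve. all: by end_near.
Qed.

Lemma avg_continuous g d : continuous g -> continuous (avg d g).
Proof. by move=> cg x; exact: is_derive_continuous (is_derive_avg d cg x). Qed.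

(** This replaces integral estimates: bounds on averages are read off from a value of [g] in the
    window. *)
Lemma avg_mvt g d x : continuous g -> 0 < d ->
  exists c, [/\ x <= c, c <= x + d & avg d g x = g c].
Proof.
move=> cg d0; have [|c [c1 c2 e]] := mvt (a := x) (b := x + d) (is_derive_prim cg); first lra.
by exists c; split=> //; rewrite /avg e addrAC subrr add0r mulfK// gt_eqF.
Qed.

Lemma avgD f g d x : continuous f -> continuous g ->
  avg d (fun y => f y + g y) x = avg d f x + avg d g x.
Proof.
move=> cf cg; have h y : is_derive y 1 (fun y => prim f y + prim g y) (f y + g y).
  by have a := is_derive_prim cf y; have b := is_derive_prim cg y; der.
rewrite (avgE d x _ h); first by rewrite /avg; ring.
by move=> y; exact: cvgD (cf y) (cg y).
Qed.

Lemma avgZ f d x (k : R) : continuous f -> avg d (fun y => k * f y) x = k * avg d f x.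
Proof.
move=> cf; have h y : is_derive y 1 (fun y => k * prim f y) (k * f y).
  by have a := is_derive_prim cf y; der; ring.
rewrite (avgE d x _ h); first by rewrite /avg; ring.
by move=> y; apply: cvgM; [exact: cvg_cst|exact: cf].
Qed.

Lemma avg_cst d x (k : R) : 0 < d -> avg d (fun=> k) x = k.
Proof. by move=> d0; have [|c [_ _ ->]] := avg_mvt (g := fun=> k) x _ d0; first exact: cst_continuous. Qed.

Lemma avg_shift g d e x : continuous g -> avg d (fun y => g (y + e)) x = avg d g (x + e).
Proof.
move=> cg; have h y : is_derive y 1 (fun y => prim g (y + e)) (g (y + e)).
  have b := is_derive_shift e (is_derive_prim cg) y.
  by move: b; rewrite addrC; apply: is_derive_near; near=> z; rewrite addrC.
rewrite (avgE d x _ h) ?/avg 1?addrAC// => y.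
apply: (@continuous_comp _ _ _ (fun y => y + e) g); last exact: cg.
by apply: cvgD; [exact: cvg_id|exact: cvg_cst].
Unshelve. all: by end_near.
Qed.

Lemma avg_le f g d x : continuous f -> continuous g -> 0 < d ->
  (forall y, x <= y -> y <= x + d -> f y <= g y) -> avg d f x <= avg d g x.
Proof.
move=> cf cg d0 fg.
have cgf : continuous (fun y => g y + -1 * f y).
  by move=> y; apply: cvgD (cg y) _; apply: cvgM; [exact: cvg_cst|exact: cf].
have [c [c1 c2]] := avg_mvt x cgf d0.
rewrite avgD// ?avgZ//; last by move=> y; apply: cvgM; [exact: cvg_cst|exact: cf].
by have := fg c c1 c2; lra.
Qed.

Lemma avg_abs f g d x (K : R) : continuous f -> continuous g -> 0 < d ->
  (forall y, x <= y -> y <= x + d -> `|f y - g y| <= K) -> `|avg d f x - avg d g x| <= K.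
Proof.
move=> cf cg d0 fg.
have cfg : continuous (fun y => f y + -1 * g y).
  by move=> y; apply: cvgD (cf y) _; apply: cvgM; [exact: cvg_cst|exact: cg].
have [c [c1 c2]] := avg_mvt x cfg d0.
rewrite avgD// ?avgZ//; last by move=> y; apply: cvgM; [exact: cvg_cst|exact: cg].
by rewrite !mulN1r => ->; exact: fg.
Qed.

End primitive.

(** * Binomial random walks and their moments *)

Section random_walk.
Context {R : realType}.
Implicit Types (f g : R -> R) (a b x z K : R).

Definition walk a g x := 2^-1 * (g (x + a) + g (x - a)).

Lemma walk_le a f g : (forall x, f x <= g x) -> forall x, walk a f x <= walk a g x.
Proof. by move=> fg x; rewrite /walk; have := fg (x + a); have := fg (x - a); lra. Qed.

Lemma walkB_cst a g (c : R) x : walk a (fun y => g y - c) x = walk a g x - c.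
Proof. by rewrite /walk; field. Qed.

Lemma iter_walk_le a f g n : (forall x, f x <= g x) ->
  forall x, iter n (walk a) f x <= iter n (walk a) g x.
Proof. by move=> fg; elim: n => [//|n ih] x; rewrite !iterS; exact: walk_le. Qed.

Lemma iter_walkB_cst a g (c : R) n x :
  iter n (walk a) (fun y => g y - c) x = iter n (walk a) g x - c.
Proof.
elim: n x => [//|n ih] x; rewrite !iterS -walkB_cst; congr walk.
exact/funext.
Qed.

(** A second-order expansion at every point with a uniform cubic remainder; [p2] is half the second
    derivative. *)
Definition near_quad K (p1 p2 g : R -> R) :=
  forall x z, `|g (x + z) - g x - p1 x * z - p2 x * z ^+ 2| <= K * `|z| ^+ 3.

Lemma near_quad_walk K p1 p2 g a : near_quad K p1 p2 g ->
  near_quad K (walk a p1) (walk a p2) (walk a g).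
Proof.
move=> h x z; rewrite /walk.
have := h (x + a) z; have := h (x - a) z; rewrite !ler_norml.
rewrite (addrAC x z a) (addrAC x z (- a)) => /andP[? ?] /andP[? ?]; apply/andP; split; lra.
Qed.

Lemma near_quadB_cst K p1 p2 g (c : R) : near_quad K p1 p2 g ->
  near_quad K p1 p2 (fun y => g y - c).
Proof. by move=> h x z; have := h x z; congr (`| _ | <= _); ring. Qed.

(** Trades a cubic remainder for a combination of squares and fourth powers, whose means under the
    walk are explicit. *)
Lemma cube_le (a y : R) : 0 < a -> 0 <= y -> y ^+ 3 <= (y ^+ 4 / a + a * y ^+ 2) / 2.
Proof.
move=> a0 y0; rewrite -subr_ge0.
have -> : (y ^+ 4 / a + a * y ^+ 2) / 2 - y ^+ 3 = y ^+ 2 * (y - a) ^+ 2 / (2 * a).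
  by field; rewrite gt_eqF.
by pos.
Qed.

Lemma walk_upper K p1 p2 g b x : near_quad K p1 p2 g -> 0 <= b ->
  walk b g x <= g x + p2 x * b ^+ 2 + K * b ^+ 3.
Proof.
move=> h b0; have := h x b; have := h x (- b); rewrite normrN !(ger0_norm b0) sqrrN !ler_norml.
by rewrite /walk => /andP[? ?] /andP[? ?]; lra.
Qed.

(* Moments of the walk started at x: the polynomials z^2 and z^4. *)
Lemma iter_walk_quartic (b c0 c1 c2 c4 x : R) n :
  exists r, 0 <= r <= n%:R * b ^+ 2 /\
  forall y, iter n (walk b) (fun y => c0 + c1 * (y - x) + c2 * (y - x) ^+ 2 + c4 * (y - x) ^+ 4) y
   = c0 + c1 * (y - x) + c2 * ((y - x) ^+ 2 + n%:R * b ^+ 2)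
    + c4 * ((y - x) ^+ 4 + 6 * (n%:R * b ^+ 2) * (y - x) ^+ 2 + 3 * (n%:R * b ^+ 2) ^+ 2
      - 2 * r * b ^+ 2).
Proof.
elim: n => [|n [r [/andP[r0 rn] ih]]].
  by exists 0; rewrite mul0r lexx; split=> // y /=; ring.
exists (r + n.+1%:R * b ^+ 2 - n%:R * b ^+ 2); split.
  rewrite -natr1 mulrDl mul1r; apply/andP; split; last by lra.
  by have := sqr_ge0 b; lra.
by move=> y; rewrite iterS /walk !ih -natr1; field.
Qed.

(** The walk preserves order, so [g] may be replaced by a quartic minorant that equals it at [x], on
    which the iterates are explicit. Here [q] is the total variance and [a] a free parameter, later
    the square root of the elapsed time. *)
Lemma iter_walk_lower K p1 p2 g b a n x : near_quad K p1 p2 g -> 0 <= K -> 0 < a ->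
  forall q, q = n%:R * b ^+ 2 ->
  g x + p2 x * q - K * (3 * q ^+ 2 / a + a * q) / 2 <= iter n (walk b) g x.
Proof.
move=> h K0 a0 q qE.
pose Q y := g x + p1 x * (y - x) + (p2 x - K * a / 2) * (y - x) ^+ 2
  + - (K / a / 2) * (y - x) ^+ 4.
have Qg y : Q y <= g y.
  have := h x (y - x); rewrite ler_norml => /andP[h1 _].
  have := @cube_le a `|y - x| a0 (normr_ge0 _).
  have -> : `|y - x| ^+ 4 = (y - x) ^+ 4 by rewrite -normrX ger0_norm// exprn_even_ge0.
  have -> : `|y - x| ^+ 2 = (y - x) ^+ 2 by rewrite -normrX ger0_norm// sqr_ge0.
  move/(ler_wpM2l K0); move: h1; rewrite (addrC x) subrK /Q; lra.
apply: le_trans (iter_walk_le b n Qg x).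
have [r [/andP[r0 rn] ->]] := @iter_walk_quartic b (g x) (p1 x) (p2 x - K * a / 2) (- (K / a / 2)) x n.
rewrite -qE subrr expr0n/= !expr0n/= !mulr0 !addr0 !add0r.
rewrite -subr_ge0.
have -> : g x + (p2 x - K * a / 2) * q + - (K / a / 2) * (3 * q ^+ 2 - 2 * r * b ^+ 2) -
  (g x + p2 x * q - K * (3 * q ^+ 2 / a + a * q) / 2) = K / a * (r * b ^+ 2).
  by field; rewrite gt_eqF.
by rewrite mulr_ge0 ?divr_ge0 ?(ltW a0)// mulr_ge0 ?sqr_ge0.
Qed.

End random_walk.

(** * Smoothing in space by three averages *)

Section smoothing.
Context {R : realType}.
Implicit Types (f g : R -> R) (d k x y z M : R).

Definition smooth d g := avg d (avg d (avg d g)).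

Definition dquot d g x := (g (x + d) - g x) / d.

Lemma is_derive_dquot d g dg : (forall x, is_derive x 1 g (dg x)) ->
  forall x, is_derive x 1 (dquot d g) (dquot d dg x).
Proof.
move=> h x; have a := h x; have b := is_derive_shift d h x.
have b' : is_derive x 1 (fun x => g (x + d)) (dg (x + d)).
  by move: b; rewrite addrC; apply: is_derive_near; near=> y; rewrite addrC.
by rewrite /dquot; der; ring.
Unshelve. all: by end_near.
Qed.

Lemma is_derive_smooth d g : continuous g -> forall x,
  [/\ is_derive x 1 (smooth d g) (dquot d (avg d (avg d g)) x),
      is_derive x 1 (dquot d (avg d (avg d g))) (dquot d (dquot d (avg d g)) x) &
      is_derive x 1 (dquot d (dquot d (avg d g))) (dquot d (dquot d (dquot d g)) x)].
Proof.
move=> cg x; have c1 := @avg_continuous _ g d cg; have c2 := @avg_continuous _ _ d c1.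
split; first exact: is_derive_avg.
  by apply: is_derive_dquot => y; exact: is_derive_avg.
by apply: is_derive_dquot => y; apply: is_derive_dquot => z; exact: is_derive_avg.
Qed.

(** Each average gains a derivative, so the third derivative of the triple average is the third
    difference quotient of [g], with coefficients 1, 3, 3, 1 whose sum is the 8 of the constant. *)
Lemma near_quad_smooth d g M : continuous g -> 0 < d -> (forall x, `|g x| <= M) ->
  near_quad (8 * M / d ^+ 3) (dquot d (avg d (avg d g)))
    (fun x => dquot d (dquot d (avg d g)) x / 2) (smooth d g).
Proof.
move=> cg d0 gM.
have h1 x : is_derive x 1 (smooth d g) (dquot d (avg d (avg d g)) x).
  by have [] := is_derive_smooth d cg x.
have h2 x : is_derive x 1 (dquot d (avg d (avg d g))) (dquot d (dquot d (avg d g)) x).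
  by have [] := is_derive_smooth d cg x.
have h3 x : is_derive x 1 (dquot d (dquot d (avg d g))) (dquot d (dquot d (dquot d g)) x).
  by have [] := is_derive_smooth d cg x.
apply: (@taylor3 R _ _ _ _ _ h1 h2 h3) => x; rewrite /dquot.
have -> : (((g (x + d + d + d) - g (x + d + d)) / d - (g (x + d + d) - g (x + d)) / d) / d -
  ((g (x + d + d) - g (x + d)) / d - (g (x + d) - g x) / d) / d) / d =
  (g (x + d + d + d) - 3 * g (x + d + d) + 3 * g (x + d) - g x) / d ^+ 3.
  by field; rewrite gt_eqF.
rewrite normrM (ger0_norm (x := _^-1)) ?invr_ge0 ?exprn_ge0 ?(ltW d0)//.
rewrite ler_wpM2r ?invr_ge0 ?exprn_ge0 ?(ltW d0)//.
have := gM (x + d + d + d); have := gM (x + d + d); have := gM (x + d); have := gM x.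
rewrite !ler_norml => /andP[? ?] /andP[? ?] /andP[? ?] /andP[? ?]; apply/andP; split; lra.
Qed.

Definition lipschitz1 k g := forall x y, `|g x - g y| <= k * `|x - y|.

Lemma lipschitz1_continuous k g : lipschitz1 k g -> continuous g.
Proof.
move=> gk x; apply/cvgrPdist_le => e e0.
have k1 : 0 < `|k| + 1 by rewrite ltr_wpDl.
near=> y; apply: (le_trans (gk x y)).
apply: (@le_trans _ _ ((`|k| + 1) * `|x - y|)).
  by rewrite ler_wpM2r// (le_trans (ler_norm k))// lerDl.
rewrite mulrC -ler_pdivlMr//; near: y; apply: cvgr_dist_le; first exact: cvg_id.
by rewrite divr_gt0.
Unshelve. all: by end_near.
Qed.

Lemma lipschitz1_avg d k g : 0 < d -> lipschitz1 k g -> lipschitz1 k (avg d g).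
Proof.
move=> d0 gk x y; have cg := lipschitz1_continuous gk.
have cg' : continuous (fun z => g (z + (x - y))).
  move=> z; apply: (@continuous_comp _ _ _ (fun y0 => y0 + (x - y)) g); last exact: cg.
  by apply: cvgD; [exact: cvg_id|exact: cvg_cst].
have -> : avg d g x = avg d (fun z => g (z + (x - y))) y by rewrite avg_shift// addrC subrK.
apply: avg_abs => // z _ _; apply: (le_trans (gk _ _)).
by rewrite addrAC subrr add0r.
Qed.

Lemma avg_close d k g x : 0 < d -> 0 <= k -> lipschitz1 k g -> `|avg d g x - g x| <= k * d.
Proof.
move=> d0 k0 gk; have [c [c1 c2 ->]] := avg_mvt x (lipschitz1_continuous gk) d0.
apply: (le_trans (gk _ _)); rewrite ler_wpM2l// ger0_norm; lra.
Qed.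

Lemma smooth_close d k g x : 0 < d -> 0 <= k -> lipschitz1 k g ->
  `|smooth d g x - g x| <= 3 * k * d.
Proof.
move=> d0 k0 gk; have k1 := lipschitz1_avg d0 gk; have k2 := lipschitz1_avg d0 k1.
have := avg_close x d0 k0 gk; have := avg_close x d0 k0 k1; have := avg_close x d0 k0 k2.
by rewrite /smooth !ler_norml => /andP[? ?] /andP[? ?] /andP[? ?]; apply/andP; split; lra.
Qed.

End smoothing.

(** * Supersolutions dominate random walks *)

Section super_walk.
Context {R : realType}.
Variables (sl sb s : R).
Hypotheses (sl_ge0 : 0 <= sl) (sl_le_sb : sl <= sb) (sE : s = sl \/ s = sb).
Variables (u : R -> R -> R) (M : R).
Implicit Types t : R.
Hypotheses (cu : ext_continuous u) (bu : forall t x, 0 <= t -> `|u t x| <= M).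
Hypothesis su : viscosity_supersolution sl sb u.

Let s_ge0 : 0 <= s.
Proof. by case: sE => -> //; exact: le_trans sl_le_sb. Qed.

Lemma ext_continuous_shift (w : R -> R -> R) t0 : 0 <= t0 -> ext_continuous w ->
  ext_continuous (fun t => w (t0 + t)).
Proof.
move=> t00 cw p.
have e : (fun q : R * R => ext (fun t => w (t0 + t)) q.1 q.2) =
  (fun q : R * R => ext w (t0 + Num.max q.1 0) q.2).
  by apply/funext => q; rewrite [RHS]extE// addr_ge0// le_max lexx orbT.
rewrite e.
apply: (cont_comp (h := fun q : R * R => (t0 + Num.max q.1 0, q.2))
  (k := fun q : R * R => ext w q.1 q.2)); last exact: cw.
by apply: cont_pair; cont.
Qed.

(* Comparison with the heat polynomial generated by a quartic. *)
Lemma super_quartic (t0 x c0 p1 p2 K t : R) : 0 <= t0 -> 0 < K ->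
  (forall z, c0 + p1 * z + p2 * z ^+ 2 - K * z ^+ 4 <= u t0 (x + z)) -> 0 <= t ->
  c0 + s ^+ 2 * t * p2 - 3 * K * s ^+ 4 * t ^+ 2 <= u (t0 + t) x.
Proof.
move=> t00 K0 h tge0.
pose v (t y : R) := c0 + p1 * (y - x) + p2 * (y - x) ^+ 2 + s ^+ 2 * t * p2
  - K * ((y - x) ^+ 4 + 6 * s ^+ 2 * t * (y - x) ^+ 2 + 3 * s ^+ 4 * t ^+ 2).
pose vt (t y : R) := s ^+ 2 * p2 - K * (6 * s ^+ 2 * (y - x) ^+ 2 + 6 * s ^+ 4 * t).
pose vx (t y : R) := p1 + 2 * p2 * (y - x) - K * (4 * (y - x) ^+ 3 + 12 * s ^+ 2 * t * (y - x)).
pose vxx (t y : R) := 2 * p2 - K * (12 * (y - x) ^+ 2 + 12 * s ^+ 2 * t).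
have Cv : C12 v vt vx vxx.
  move=> t' y t'0; rewrite /v /vt /vx /vxx; split; split.
  - by der; ring.
  - by der; ring.
  - by der; ring.
  - by cont.
  - by cont.
  - by cont.
  - by cont.
pose P := `|p1| + `|p2|.
pose N := `|c0| + `|p1| + P ^+ 2 / (4 * K) + p2 ^+ 2 / (12 * K).
have vN t' y : 0 <= t' -> v t' y <= N.
  move=> t'0; rewrite /v /N; set z := y - x; set w := z ^+ 2.
  have -> : z ^+ 4 = w ^+ 2 by rewrite /w -exprM.
  have -> : s ^+ 4 = (s ^+ 2) ^+ 2 by rewrite -exprM.
  set r := s ^+ 2.
  have w0 : 0 <= w by exact: sqr_ge0.
  have r0 : 0 <= r by exact: sqr_ge0.
  have h1 : p1 * z <= `|p1| * (1 + w).
    apply: (le_trans (ler_norm _)); rewrite normrM ler_wpM2l// /w -(real_normK (num_real z)).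
    by have := normr_ge0 z; nra.
  have h2 : p2 * w <= `|p2| * w by rewrite ler_wpM2r// ler_norm.
  have h3 : P * w - K * w ^+ 2 <= P ^+ 2 / (4 * K).
    rewrite -subr_ge0.
    have -> : P ^+ 2 / (4 * K) - (P * w - K * w ^+ 2) = K * (w - P / (2 * K)) ^+ 2.
      by field; rewrite gt_eqF.
    by rewrite mulr_ge0 ?sqr_ge0// ltW.
  have h4 : r * t' * p2 - 3 * K * (r * t') ^+ 2 <= p2 ^+ 2 / (12 * K).
    rewrite -subr_ge0.
    have -> : p2 ^+ 2 / (12 * K) - (r * t' * p2 - 3 * K * (r * t') ^+ 2) =
       3 * K * (r * t' - p2 / (6 * K)) ^+ 2.
      by field; rewrite gt_eqF.
    by rewrite mulr_ge0 ?sqr_ge0// mulr_ge0// ltW.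
  have h5 : 0 <= K * (r * t' * w) by pos.
  have := ler_norm c0; move: h3; rewrite {1}/P; nra.
have main := @classical_le_super R sl sb sl_ge0 sl_le_sb (fun t => u (t0 + t)) v vt vx vxx (Num.max M N).
have -> : c0 + s ^+ 2 * t * p2 - 3 * K * s ^+ 4 * t ^+ 2 = v t x by rewrite /v; ring.
apply: main => //.
- exact: ext_continuous_shift.
- by move=> t' y t'0; rewrite le_max bu// addr_ge0.
- exact: super_shift t00 bu su.
- by move=> p; rewrite /ext /v; cont.
- by move=> t' y t'0; rewrite le_max vN ?orbT.
- move=> t' y t'0; apply: le_trans (G_ge sl_ge0 sl_le_sb (vxx t' y) sE).
  by rewrite /vt /vxx; lra.
- move=> y; have := h (y - x); rewrite (addrC x) subrK addr0 /v; lra.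
Qed.

Let C := s ^+ 2 / 2 + 3 * s ^+ 4 / 2 + s ^+ 3.

(** A walk step of size s sqrt(t) and the heat flow of volatility [s] over time [t] have the same
    second moment. With [cube_le] at a = sqrt(t), all other terms are of order t^{3/2}, so their sum
    over many small steps tends to 0. *)
Lemma super_walk_step (t0 K t x : R) p1 p2 g : 0 <= t0 -> 0 < K -> 0 < t ->
  near_quad K p1 p2 g -> (forall x, g x <= u t0 x) ->
  walk (s * Num.sqrt t) g x - C * K * (t * Num.sqrt t) <= u (t0 + t) x.
Proof.
move=> t00 K0 tgt0 qg gu; set a := Num.sqrt t.
have a0 : 0 < a by rewrite sqrtr_gt0.
have aE : a ^+ 2 = t by rewrite sqr_sqrtr// ltW.
have h1 := @super_quartic t0 x (g x) (p1 x) (p2 x - K * a / 2) (K / a / 2) t t00 _ _ (ltW tgt0).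
have h2 := walk_upper x qg (mulr_ge0 s_ge0 (ltW a0)).
apply: le_trans (h1 _ _).
- rewrite -aE in h2 *.
  have -> : g x + s ^+ 2 * a ^+ 2 * (p2 x - K * a / 2) - 3 * (K / a / 2) * s ^+ 4 * (a ^+ 2) ^+ 2
    = g x + p2 x * (s * a) ^+ 2 + K * (s * a) ^+ 3 - C * K * (a ^+ 2 * a).
    by rewrite /C; field; rewrite gt_eqF.
  lra.
- by rewrite !divr_gt0.
move=> z; apply: le_trans (gu (x + z)).
have := qg x z; rewrite ler_norml => /andP[h3 _].
have := @cube_le _ a `|z| a0 (normr_ge0 _).
have -> : `|z| ^+ 4 = z ^+ 4 by rewrite -normrX ger0_norm// exprn_even_ge0.
have -> : `|z| ^+ 2 = z ^+ 2 by rewrite -normrX ger0_norm// sqr_ge0.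
move/(ler_wpM2l (ltW K0)); move: h3; lra.
Qed.

Lemma super_walk_iter (K t : R) j : 0 < K -> 0 < t -> forall t0 p1 p2 g x, 0 <= t0 ->
  near_quad K p1 p2 g -> (forall x, g x <= u t0 x) ->
  iter j (walk (s * Num.sqrt t)) g x - j%:R * (C * K * (t * Num.sqrt t)) <= u (t0 + j%:R * t) x.
Proof.
move=> K0 tgt0; elim: j => [|j ih] t0 p1 p2 g x t00 qg gu.
  by rewrite !mul0r subr0 addr0 /=.
pose e := C * K * (t * Num.sqrt t).
have := ih (t0 + t) _ _ (fun y => walk (s * Num.sqrt t) g y - e) x _
  (near_quadB_cst e (near_quad_walk (s * Num.sqrt t) qg)) _.
have t1 : 0 <= t0 + t by rewrite addr_ge0// ltW.
have -> : t0 + t + j%:R * t = t0 + j.+1%:R * t by rewrite -natr1; ring.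
rewrite iter_walkB_cst iterSr -/e -[in X in X -> _]/e => /(_ t1) h.
have -> : j.+1%:R * e = e + j%:R * e by rewrite -natr1; ring.
rewrite opprD addrA; apply: h => y; exact: super_walk_step.
Qed.

(** The datum is smoothed at a fixed scale [d], at a cost proportional to [k] and [d]; then m steps
    of length h/m accumulate an error of order h sqrt(h/m). The bound [m0] is uniform in [t0] and
    [x], which is what later allows the inequality to be averaged. *)
Lemma super_walk_limit (k e h : R) : (forall t, 0 <= t -> lipschitz1 k (u t)) -> 0 <= k ->
  0 < e -> 0 < h -> exists m0 : nat, forall m, (m0 <= m)%N -> forall t0 x, 0 <= t0 ->
  iter m (walk (s * Num.sqrt (h / m%:R))) (u t0) x - e <= u (t0 + h) x.
Proof.
move=> uk k0 e0 h0.
(* Smoothing is paid twice, 3 k d each time: half of the allowed error [e]. *)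
pose d := e / (12 * (k + 1)).
have d0 : 0 < d by rewrite divr_gt0// mulr_gt0// ltr_wpDl.
have kd : 6 * k * d <= e / 2.
  have dE : d * (12 * (k + 1)) = e by rewrite mulfVK// mulf_neq0// gt_eqF// ltr_wpDl.
  by rewrite -dE; nra.
have M0 : 0 <= M by apply: le_trans (bu 0 (lexx 0)).
pose K := 8 * M / d ^+ 3 + 1.
have K0 : 0 < K.
  by rewrite /K; pos.
have C0 : 0 <= C.
  by rewrite /C !addr_ge0// ?divr_ge0 ?mulr_ge0// exprn_ge0.
(* The bound imposed on sqrt(h/m), for which the accumulated error C K h sqrt(h/m) stays below
   e/2. *)
pose r := e / (2 * (C * K * h + 1)).
have q0 : 0 < C * K * h + 1 by rewrite ltr_wpDl// !mulr_ge0// ltW.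
have r0 : 0 < r by rewrite divr_gt0// mulr_gt0.
exists (Num.bound (h / r ^+ 2)).+1 => m mm t0 x t00.
have m0 : (0 < m)%N by apply: leq_ltn_trans mm.
have mR : 0 < m%:R :> R by rewrite ltr0n.
have sq : Num.sqrt (h / m%:R) <= r.
  have -> : r = Num.sqrt (r ^+ 2) by rewrite sqrtr_sqr gtr0_norm.
  rewrite ler_wsqrtr// ler_pdivrMr// mulrC -ler_pdivrMr ?exprn_gt0//.
  apply: le_trans (ltW (archi_boundP _)) _; first by rewrite divr_ge0 ?exprn_ge0 ?ltW.
  by rewrite ler_nat ltnW.
have cu0 := lipschitz1_continuous (uk t0 t00).
have qg := near_quad_smooth cu0 d0 (fun x => bu x t00).
have qg' : near_quad K (dquot d (avg d (avg d (u t0))))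
    (fun x => dquot d (dquot d (avg d (u t0))) x / 2) (fun y => smooth d (u t0) y - 3 * k * d).
  apply: near_quadB_cst => y z; apply: (le_trans (qg y z)).
  by rewrite ler_wpM2r ?exprn_ge0// /K lerDl.
have close y := smooth_close y d0 k0 (uk t0 t00).
have gu y : smooth d (u t0) y - 3 * k * d <= u t0 y.
  by have := close y; rewrite ler_norml => /andP[? ?]; lra.
have := @super_walk_iter K (h / m%:R) m K0 (divr_gt0 h0 mR) t0 _ _ _ x t00 qg' gu.
have -> : m%:R * (h / m%:R) = h by rewrite mulrC mulfVK// gt_eqF.
rewrite iter_walkB_cst.
set S := Num.sqrt _ in sq *.
have -> : m%:R * (C * K * (h / m%:R * S)) = C * K * h * S by field; rewrite gt_eqF.
have lower : iter m (walk (s * S)) (u t0) x - 3 * k * d <= iter m (walk (s * S)) (smooth d (u t0)) x.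
  rewrite -iter_walkB_cst; apply: iter_walk_le => y.
  by have := close y; rewrite ler_norml => /andP[? ?]; lra.
have err : C * K * h * S <= e / 2.
  apply: (@le_trans _ _ ((C * K * h + 1) * r)).
    by apply: ler_pM => //; rewrite ?sqrtr_ge0// ?lerDl// !mulr_ge0// ltW.
  suff -> : (C * K * h + 1) * r = e / 2 by [].
  by rewrite /r; field; rewrite gt_eqF.
lra.
Qed.

End super_walk.

(** * Averages of functions depending on a parameter, and one-sided increments *)

Section parameter.
Context {R : realType}.
Implicit Types (F dF : R -> R -> R) (d e t x y : R).

Definition jcontinuous F := continuous (fun p : R * R => F p.1 p.2).

Lemma jcontinuous_snd F : jcontinuous F -> forall t, continuous (F t).
Proof.
move=> cF t y; apply: (cont_comp (h := fun y : R => (t, y)) (k := fun p : R * R => F p.1 p.2)).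
  by apply: cont_pair; cont.
exact: cF.
Qed.

Arguments jcontinuous_snd {F} cF t.

Lemma jcontinuous_swap F : jcontinuous F -> jcontinuous (fun x t => F t x).
Proof.
move=> cF p; apply: (cont_comp (h := fun q : R * R => (q.2, q.1)) (k := fun q : R * R => F q.1 q.2)).
  by apply: cont_pair; cont.
exact: cF.
Qed.

(** Uniformity in [y] comes from compactness of the interval. The translation by [p.2 - x0] carries
    the averaging window from one base point to the other. *)
Lemma jcontinuous_tube F (a b t0 x0 e : R) : jcontinuous F -> 0 < e ->
  \forall p \near (t0, x0), forall y, a <= y -> y <= b ->
    `|F p.1 (y + (p.2 - x0)) - F t0 y| <= e.
Proof.
move=> cF e0.
have cK : compact (`[a, b] : set R) by exact: segment_compact.
pose P (p : R * R) y := `|F p.1 (y + (p.2 - x0)) - F t0 y| <= e.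
have H : forall y, `[a, b]%classic y -> \forall y' \near y & p \near (t0, x0), P p y'.
  move=> y _.
  have h1 : continuous_at (y, (t0, x0)) (fun q : R * (R * R) =>
      F q.2.1 (q.1 + (q.2.2 - x0)) + - F t0 q.1).
    apply: (@cont_add R _ (fun q : R * (R * R) => F q.2.1 (q.1 + (q.2.2 - x0)))
      (fun q => - F t0 q.1)).
      apply: (cont_comp (h := fun q : R * (R * R) => (q.2.1, q.1 + (q.2.2 - x0)))
        (k := fun q : R * R => F q.1 q.2)); last exact: cF.
      have c1 : continuous_at (y, (t0, x0)) (fun q : R * (R * R) => q.1) by exact: cvg_fst.
      have c2 : continuous_at (y, (t0, x0)) (fun q : R * (R * R) => q.2) by exact: cvg_snd.
      have c3 : continuous_at (y, (t0, x0)) (fun q : R * (R * R) => q.2.1).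
        exact: (continuous_comp c2 (@cvg_fst _ _ _ _ _)).
      have c4 : continuous_at (y, (t0, x0)) (fun q : R * (R * R) => q.2.2).
        exact: (continuous_comp c2 (@cvg_snd _ _ _ _ _)).
      by apply: cont_pair; cont.
    apply: (@cont_opp R _ (fun q : R * (R * R) => F t0 q.1)).
    apply: (cont_comp (h := fun q : R * (R * R) => q.1) (k := F t0)).
      exact: cvg_fst.
    exact: jcontinuous_snd.
  have /cvgrPdist_le /(_ e e0) := h1.
  by apply: filterS => q /=; rewrite subrr addr0 subrr sub0r normrN.
have := (compact_near_coveringP _).1 cK _ (nbhs (t0, x0)) P (nbhs_filter _) H.
by apply: filterS => p h y ay yb; apply: h; rewrite /= in_itv/= ay yb.
Qed.

Lemma avg_jcontinuous d F : 0 < d -> jcontinuous F ->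
  jcontinuous (fun t => avg d (F t)).
Proof.
move=> d0 cF [t0 x0]; apply/cvgrPdist_le => e e0.
have := jcontinuous_tube x0 (x0 + d) t0 x0 cF e0; apply: filterS => -[t x] /= h.
have ct := jcontinuous_snd cF t; have ct0 := jcontinuous_snd cF t0.
have -> : avg d (F t) x = avg d (fun y => F t (y + (x - x0))) x0.
  by rewrite avg_shift// addrC subrK.
rewrite distrC; apply: avg_abs => //.
move=> y; apply: (cont_comp (h := fun y => y + (x - x0))); last exact: ct.
by cont.
Qed.

(** Differentiation under the average: the mean value theorem in time turns the quotient, point by
    point of the window, into a value of [dF] at a nearby time, and [jcontinuous_tube] makes this
    uniform. *)
Lemma is_derive_avg_param d F dF t x : 0 < d -> jcontinuous F -> jcontinuous dF ->
  (forall t x, is_derive t 1 (F ^~ x) (dF t x)) ->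
  is_derive t 1 (fun t => avg d (F t) x) (avg d (dF t) x).
Proof.
move=> d0 cF cdF h.
have cF' s := jcontinuous_snd cF s; have cdF' s := jcontinuous_snd cdF s.
suff lim : (fun h : R => h^-1 *: (avg d (F (h *: 1 + t)) x - avg d (F t) x)) @ 0^' -->
    avg d (dF t) x.
  apply: DeriveDef; first by apply/cvg_ex; exists (avg d (dF t) x).
  exact/cvg_lim.
apply/cvgrPdist_le => e e0.
have [[U W] /= [/nbhs_ballP[r /= r0 tr] Wx] tb] := jcontinuous_tube x (x + d) t x cdF e0.
near=> s.
have s0 : s != 0 by near: s; exact: nbhs_dnbhs_neq.
have sr : `|s| < r by near: s; apply: dnbhs0_lt.
rewrite /GRing.scale/= mulr1.
have -> : s^-1 * (avg d (F (s + t)) x - avg d (F t) x) =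
  avg d (fun y => s^-1 * (F (s + t) y + -1 * F t y)) x.
  rewrite avgZ ?avgD ?avgZ ?mulN1r// => y.
    by have a2 := cF' t y; cont.
  by have a1 := cF' (s + t) y; have a2 := cF' t y; cont.
apply: avg_abs => // [y|y xy yd].
  by have a1 := cF' (s + t) y; have a2 := cF' t y; cont.
have [c [cs ->]] : exists c, `|c - t| <= `|s| /\ s^-1 * (F (s + t) y + -1 * F t y) = dF c y.
  have [sp|sn] := leP 0 s.
    have ts : t <= s + t by lra.
    have [c [c1 c2 e1]] := mvt (h ^~ y) ts.
    exists c; split; first by rewrite !ger0_norm; lra.
    by rewrite mulN1r e1 addrK mulrC mulfK.
  have ts : s + t <= t by lra.
  have [c [c1 c2 e1]] := mvt (h ^~ y) ts.
  exists c; split; first by rewrite !ler0_norm; lra.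
  have -> : F (s + t) y + -1 * F t y = - (F t y - F (s + t) y) by ring.
  by rewrite e1; field.
rewrite distrC; have := tb (c, x) _ y xy yd; rewrite /= subrr addr0; apply.
split; last exact: nbhs_singleton Wx.
by apply: tr; rewrite /ball/= distrC; apply: le_lt_trans sr.
Unshelve. all: by end_near.
Qed.

(** The relative error of order sqrt(h) is the one left by the estimates on walks and on the
    scheme. *)
Lemma is_derive_ge (f : R -> R) (t l c C rho : R) : is_derive t 1 f l -> 0 < rho -> 0 <= C ->
  (forall h, 0 < h -> h < rho -> h * (c - C * Num.sqrt h) <= f (t + h) - f t) -> c <= l.
Proof.
move=> [fd <-] rho0 C0 hf; rewrite leNgt; apply/negP => lc.
set l' := 'D_1 f t in lc.
have lim : (fun h : R => h^-1 *: (f (h *: 1 + t) - f t)) @ 0^' --> l' by exact: fd.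
pose e := (c - l') / 2; have e0 : 0 < e by rewrite /e; lra.
have /cvgrPdist_lt /(_ e e0) := lim.
move=> /nbhs_ballP[r /= r0 hr].
pose h := Num.min (Num.min (rho / 2) (r / 2)) ((e / (C + 1)) ^+ 2).
have C1 : 0 < C + 1 by lra.
have h0 : 0 < h by rewrite /h !lt_min; apply/andP; split; [apply/andP; split|]; pos.
have hr2 : h < r by apply: (@le_lt_trans _ _ (r / 2)); [rewrite /h !ge_min lexx orbT|lra].
have hrho : h < rho by apply: (@le_lt_trans _ _ (rho / 2)); [rewrite /h !ge_min lexx|lra].
have := hr h; rewrite /ball/= sub0r normrN gtr0_norm// => /(_ hr2).
rewrite gt_eqF// => /(_ isT); rewrite /GRing.scale/= mulr1 (addrC h) ltr_norml => /andP[h1 _].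
have h2 : Num.sqrt h <= e / (C + 1).
  rewrite -(ger0_norm (x := e / (C + 1))); last by pos.
  by rewrite -sqrtr_sqr ler_wsqrtr// /h ge_min lexx orbT.
have h3 : c - C * Num.sqrt h <= h^-1 * (f (t + h) - f t).
  by rewrite [leRHS]mulrC ler_pdivlMr// mulrC hf.
have h4 : C * Num.sqrt h <= e.
  apply: (@le_trans _ _ ((C + 1) * (e / (C + 1)))).
    by apply: ler_pM => //; rewrite ?sqrtr_ge0//; lra.
  by rewrite mulrC mulfVK// gt_eqF.
by rewrite /e in h1 h4; lra.
Qed.

Lemma is_derive_ge_left (f : R -> R) (t l c C rho : R) : is_derive t 1 f l -> 0 < rho -> 0 <= C ->
  (forall h, 0 < h -> h < rho -> h * (c - C * Num.sqrt h) <= f t - f (t - h)) -> c <= l.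
Proof.
move=> fl rho0 C0 hf.
have e : is_derive (- t) 1 (fun x : R => - x) (-1) by der.
have fl' : is_derive (- - t) 1 f l by rewrite opprK.
have e2 := @is_derive_comp _ f _ _ _ _ e fl'.
have e3 : is_derive (- t) 1 (fun x => - f (- x)) l by der; ring.
apply: (is_derive_ge e3 rho0 C0) => h h0 hr; have := hf h h0 hr; rewrite opprD !opprK; lra.
Qed.

Lemma is_derive_le_left (f : R -> R) (t l c C rho : R) : is_derive t 1 f l -> 0 < rho -> 0 <= C ->
  (forall h, 0 < h -> h < rho -> f t - f (t - h) <= h * (c + C * Num.sqrt h)) -> l <= c.
Proof.
move=> fl rho0 C0 hf.
have e3 : is_derive t 1 (fun x => - f x) (- l) by der.
rewrite -lerN2; apply: (is_derive_ge_left e3 rho0 C0) => h h0 hr.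
by have := hf h h0 hr; lra.
Qed.

End parameter.

Section walk_avg.
Context {R : realType}.
Implicit Types (f g : R -> R) (a d e t x y : R).

Lemma cont_shift f (a : R) : continuous f -> continuous (fun y => f (y + a)).
Proof.
move=> cf y; apply: (cont_comp (h := fun y => y + a)); last exact: cf.
by cont.
Qed.

Lemma walk_continuous a f : continuous f -> continuous (walk a f).
Proof.
move=> cf y; have c1 := @cont_shift f a cf y; have c2 := @cont_shift f (- a) cf y.
by rewrite /walk; cont.
Qed.

Lemma iter_walk_continuous a f n : continuous f -> continuous (iter n (walk a) f).
Proof. by move=> cf; elim: n => // n; exact: walk_continuous. Qed.

Lemma avg_walk d a f x : continuous f -> avg d (walk a f) x = walk a (avg d f) x.
Proof.
move=> cf; rewrite /walk; have c1 := cont_shift (a := a) cf; have c2 := cont_shift (a := - a) cf.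
rewrite avgZ; last by move=> y; have := c1 y; have := c2 y => ? ?; cont.
by rewrite avgD// !avg_shift.
Qed.

Lemma avg_iter_walk d a f n : continuous f ->
  forall x, avg d (iter n (walk a) f) x = iter n (walk a) (avg d f) x.
Proof.
move=> cf; elim: n => // n ih x; rewrite !iterS avg_walk; last exact: iter_walk_continuous.
by congr walk; apply/funext.
Qed.

Lemma avgB_cst d f (c : R) x : 0 < d -> continuous f ->
  avg d (fun y => f y - c) x = avg d f x - c.
Proof.
move=> d0 cf; rewrite (avgD d x cf) ?avg_cst//.
by move=> y; exact: cvg_cst.
Qed.

Lemma smooth_iter_walk d a f n : continuous f ->
  smooth d (iter n (walk a) f) = iter n (walk a) (smooth d f).
Proof.
move=> cf; have c1 := @avg_continuous _ f d cf; have c2 := @avg_continuous _ _ d c1.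
rewrite /smooth.
have -> : avg d (iter n (walk a) f) = iter n (walk a) (avg d f).
  by apply/funext => x; rewrite avg_iter_walk.
have -> : avg d (iter n (walk a) (avg d f)) = iter n (walk a) (avg d (avg d f)).
  by apply/funext => x; rewrite avg_iter_walk.
by apply/funext => x; rewrite avg_iter_walk.
Qed.

Lemma smoothB_cst d f (c : R) x : 0 < d -> continuous f ->
  smooth d (fun y => f y - c) x = smooth d f x - c.
Proof.
move=> d0 cf; have c1 := @avg_continuous _ f d cf; have c2 := @avg_continuous _ _ d c1.
rewrite /smooth.
have -> : avg d (fun y => f y - c) = fun y => avg d f y - c.
  by apply/funext => y; rewrite avgB_cst.
have -> : avg d (fun y => avg d f y - c) = fun y => avg d (avg d f) y - c.
  by apply/funext => y; rewrite avgB_cst.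
by rewrite avgB_cst.
Qed.

Lemma smooth_le d f g : 0 < d -> continuous f -> continuous g ->
  (forall x, f x <= g x) -> forall x, smooth d f x <= smooth d g x.
Proof.
move=> d0 cf cg fg x; apply: avg_le => //; [by do 2 apply: avg_continuous..|] => y _ _.
by apply: avg_le => //; [by apply: avg_continuous..|] => z _ _; exact: avg_le.
Qed.

End walk_avg.

(** * Mollified supersolutions are classical supersolutions *)

Section mollification.
Context {R : realType}.
Variables (sl sb : R).
Hypotheses (sl_ge0 : 0 <= sl) (sl_le_sb : sl <= sb).
Variables (u : R -> R -> R) (M k : R).
Implicit Types (d e s t x y : R).
Hypotheses (cu : ext_continuous u) (bu : forall t x, 0 <= t -> `|u t x| <= M).
Hypothesis su : viscosity_supersolution sl sb u.
Hypotheses (k0 : 0 <= k) (uk : forall t, 0 <= t -> lipschitz1 k (u t)).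

Let ju : jcontinuous (ext u). Proof. exact: cu. Qed.

Let ube t x : `|ext u t x| <= M.
Proof. by apply: bu; rewrite le_max lexx orbT. Qed.

Let uke t : lipschitz1 k (ext u t).
Proof. by apply: uk; rewrite le_max lexx orbT. Qed.

Let cue x : continuous (ext u ^~ x).
Proof. exact: (jcontinuous_snd (jcontinuous_swap ju)). Qed.

(** One average in time yields a continuous time derivative. The three averages in space of [molly]
    yield the second-order expansion used by the walk estimates. *)
Definition tavg d t x := avg d (ext u ^~ x) t.
Definition molly d t x := smooth d (tavg d t) x.

Variable d : R.
Hypothesis d0 : 0 < d.

Let jF : jcontinuous (tavg d).
Proof.
exact: (jcontinuous_swap (avg_jcontinuous d0 (jcontinuous_swap ju))).
Qed.

Lemma tavg_lip t : lipschitz1 k (tavg d t).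
Proof. by move=> x y; apply: avg_abs => // s _ _; exact: uke. Qed.

Lemma tavg_bnd t x : `|tavg d t x| <= M.
Proof. by have [c [_ _]] := avg_mvt t (@cue x) d0; rewrite /tavg => ->. Qed.

Let cF t : continuous (tavg d t). Proof. exact: lipschitz1_continuous (@tavg_lip t). Qed.

Definition tavg' t x := dquot d (ext u ^~ x) t.

Let jF' : jcontinuous tavg'.
Proof.
move=> p; have c1 := @ju p.
have c2 : continuous_at p (fun q : R * R => ext u (q.1 + d) q.2).
  apply: (cont_comp (h := fun q : R * R => (q.1 + d, q.2)) (k := fun q : R * R => ext u q.1 q.2)).
    by apply: cont_pair; cont.
  exact: ju.
by rewrite /tavg' /dquot; cont.
Qed.

Let dF t x : is_derive t 1 (tavg d ^~ x) (tavg' t x).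
Proof. exact: (@is_derive_avg _ _ d (@cue x) t). Qed.

Let jsmooth (F : R -> R -> R) : jcontinuous F -> jcontinuous (fun t => smooth d (F t)).
Proof. by move=> jf; do 3 apply: (avg_jcontinuous d0). Qed.

Lemma is_derive_molly_t t x : is_derive t 1 (molly d ^~ x) (smooth d (tavg' t) x).
Proof.
have j1 := avg_jcontinuous d0 jF; have j1' := avg_jcontinuous d0 jF'.
have j2 := avg_jcontinuous d0 j1; have j2' := avg_jcontinuous d0 j1'.
rewrite /molly /smooth.
have h1 t' x' := is_derive_avg_param t' x' d0 jF jF' dF.
have h2 t' x' := is_derive_avg_param t' x' d0 j1 j1' h1.
exact: (is_derive_avg_param t x d0 j2 j2' h2).
Qed.

Definition mollyx t := dquot d (avg d (avg d (tavg d t))).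
Definition mollyxx t := dquot d (dquot d (avg d (tavg d t))).

Let jdquot (F : R -> R -> R) : jcontinuous F -> jcontinuous (fun t => dquot d (F t)).
Proof.
move=> jf p; have c1 := jf p.
have c2 : continuous_at p (fun q : R * R => F q.1 (q.2 + d)).
  apply: (cont_comp (h := fun q : R * R => (q.1, q.2 + d)) (k := fun q : R * R => F q.1 q.2)).
    by apply: cont_pair; cont.
  exact: jf.
by rewrite /dquot; cont.
Qed.

Lemma C12_molly : C12 (molly d) (fun t x => smooth d (tavg' t) x) mollyx mollyxx.
Proof.
move=> t x _; split; split.
- exact: is_derive_molly_t.
- by have [] := is_derive_smooth d (@cF t) x.
- by have [] := is_derive_smooth d (@cF t) x.
- exact: (jsmooth jF).
- exact: (jsmooth jF').
- exact: (jdquot (avg_jcontinuous d0 (avg_jcontinuous d0 jF))).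
- exact: (jdquot (jdquot (avg_jcontinuous d0 jF))).
Qed.

Let s_cond s := s = sl \/ s = sb.
Let s_ge0 s : s_cond s -> 0 <= s.
Proof. by case=> -> //; exact: le_trans sl_le_sb. Qed.

Let M0 : 0 <= M. Proof. by apply: le_trans (bu 0 (lexx 0)). Qed.

(** The number of steps in [super_walk_limit] does not depend on the base time and the walk is
    linear, so the inequality may be averaged over a window of base times. *)
Lemma tavg_walk s e h : s_cond s -> 0 < e -> 0 < h ->
  exists m0 : nat, forall m, (m0 <= m)%N -> forall t x, 0 <= t ->
  iter m (walk (s * Num.sqrt (h / m%:R))) (tavg d t) x - e <= tavg d (t + h) x.
Proof.
move=> sE e0 h0.
have [m0 mh] := super_walk_limit sl_ge0 sl_le_sb sE cu bu su uk k0 e0 h0.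
exists m0 => m /mh {}mh t x t0; set a := s * _ in mh *.
have jw n : jcontinuous (fun t => iter n (walk a) (ext u t)).
  elim: n => [|n ih]; first exact: ju.
  move=> p; rewrite /= /walk.
  have c1 : continuous_at p (fun q : R * R => iter n (walk a) (ext u q.1) (q.2 + a)).
    apply: (cont_comp (h := fun q : R * R => (q.1, q.2 + a)) (k := fun q : R * R => iter n (walk a) (ext u q.1) q.2)).
      by apply: cont_pair; cont.
    exact: ih.
  have c2 : continuous_at p (fun q : R * R => iter n (walk a) (ext u q.1) (q.2 - a)).
    apply: (cont_comp (h := fun q : R * R => (q.1, q.2 - a)) (k := fun q : R * R => iter n (walk a) (ext u q.1) q.2)).
      by apply: cont_pair; cont.
    exact: ih.
  by cont.
have cw n y : continuous (fun t => iter n (walk a) (ext u t) y).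
  exact: (jcontinuous_snd (jcontinuous_swap (jw n))).
have wE n y : iter n (walk a) (tavg d t) y = avg d (fun t => iter n (walk a) (ext u t) y) t.
  elim: n y => [//|n ih] y; rewrite iterS /walk !ih.
  rewrite (avgZ (f := fun t => iter n (walk a) (ext u t) (y + a) + iter n (walk a) (ext u t) (y - a))).
    by rewrite avgD.
  by move=> z; have c1 := cw n (y + a) z; have c2 := cw n (y - a) z; cont.
rewrite wE -(avgB_cst e t d0 (@cw m x)).
rewrite /tavg -avg_shift; last exact: cue.
apply: avg_le => //.
- by move=> z; have c1 := cw m x z; cont.
- exact: (@cont_shift _ _ h (@cue x)).
move=> y ty _; have y0 := le_trans t0 ty; rewrite (extE u); last by pos.
have -> : ext u y = u y by apply/funext => z; rewrite extE// (le_trans t0).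
by apply: mh; exact: le_trans ty.
Qed.

Lemma molly_walk s e h : s_cond s -> 0 < e -> 0 < h ->
  exists m0 : nat, forall m, (m0 <= m)%N -> forall t x, 0 <= t ->
  iter m (walk (s * Num.sqrt (h / m%:R))) (molly d t) x - e <= molly d (t + h) x.
Proof.
move=> sE e0 h0; have [m0 mh] := tavg_walk sE e0 h0.
exists m0 => m /mh {}mh t x t0; rewrite /molly -smooth_iter_walk// -smoothB_cst//; last first.
  exact: iter_walk_continuous.
apply: smooth_le => //.
  by move=> z; have c1 := @iter_walk_continuous _ (s * Num.sqrt (h / m%:R)) _ m (@cF t) z; cont.
by move=> y; exact: mh.
Qed.

(** The walk has total variance s^2 h, and [iter_walk_lower] is used with a = sqrt(h). The error [e]
    of the walk inequality is arbitrary, hence disappears, and a remainder of order h sqrt(h) is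
    left. *)
Lemma molly_incr s t x h : s_cond s -> 0 <= t -> 0 < h ->
  h * (2^-1 * s ^+ 2 * mollyxx t x - 8 * M / d ^+ 3 * (3 * s ^+ 4 + s ^+ 2) / 2 * Num.sqrt h)
  <= molly d (t + h) x - molly d t x.
Proof.
move=> sE t0 h0; apply/ler_addgt0Pr => e e0.
have [m0 /(_ m0.+1 (leqnSn _) t x t0) mh] := molly_walk sE e0 h0.
have qg := near_quad_smooth (@cF t) d0 (@tavg_bnd t).
have K0 : 0 <= 8 * M / d ^+ 3 by pos.
have a0 : 0 < Num.sqrt h by rewrite sqrtr_gt0.
have aE : Num.sqrt h ^+ 2 = h by rewrite sqr_sqrtr// ltW.
have := iter_walk_lower (b := s * Num.sqrt (h / m0.+1%:R)) (n := m0.+1) x qg K0 a0 (q := s ^+ 2 * h).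
rewrite exprMn sqr_sqrtr; last by rewrite divr_ge0// ltW.
have -> : m0.+1%:R * (s ^+ 2 * (h / m0.+1%:R)) = s ^+ 2 * h by field.
move=> /(_ erefl); rewrite -/(mollyxx t x) -/(molly d t x).
have -> : 3 * (s ^+ 2 * h) ^+ 2 / Num.sqrt h + Num.sqrt h * (s ^+ 2 * h) =
  h * Num.sqrt h * (3 * s ^+ 4 + s ^+ 2).
  have E b : 0 < b -> b ^+ 2 = h ->
    3 * (s ^+ 2 * h) ^+ 2 / b + b * (s ^+ 2 * h) = h * b * (3 * s ^+ 4 + s ^+ 2).
    by move=> b0 <-; field; rewrite gt_eqF.
  exact: E.
by lra.
Qed.

(* [u >= walk^n u] up to small errors is, for each volatility, a family of linear
   inequalities; hence it survives averaging, and a smooth function satisfying it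
   is a classical supersolution. *)
Lemma molly_super t x : 0 < t -> G sl sb (mollyxx t x) <= smooth d (tavg' t) x.
Proof.
move=> t0; apply: G_le.
  apply: (is_derive_ge (is_derive_molly_t t x) ltr01 (C := 8 * M / d ^+ 3 * (3 * sl ^+ 4 + sl ^+ 2) / 2)).
    by pos.
  by move=> h h0 _; apply: molly_incr => //; [left|exact: ltW].
have sb0 : 0 <= sb by apply: s_ge0; right.
apply: (is_derive_ge (is_derive_molly_t t x) ltr01 (C := 8 * M / d ^+ 3 * (3 * sb ^+ 4 + sb ^+ 2) / 2)).
  by pos.
by move=> h h0 _; apply: molly_incr => //; [right|exact: ltW].
Qed.

(** A quantitative lower modulus at time 0: the Lipschitz datum lies above a parabola with vertex at
    [x], by Young's inequality with parameter sqrt(h), and the mean of the parabola under the walk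
    is explicit. *)
Lemma super_initial h x : 0 < h ->
  u 0 x - k * (sb ^+ 2 + 1) * Num.sqrt h <= u h x.
Proof.
move=> h0; apply/ler_addgt0Pr => e e0.
have sE : sb = sl \/ sb = sb by right.
have [m0 /(_ m0.+1 (leqnSn _) 0 x (lexx 0))] := super_walk_limit sl_ge0 sl_le_sb sE cu bu su uk k0 e0 h0.
rewrite add0r => mh.
have a0 : 0 < Num.sqrt h by rewrite sqrtr_gt0.
set a := Num.sqrt h in a0 *.
have aE : a ^+ 2 = h by rewrite sqr_sqrtr// ltW.
pose Q y := (u 0 x - k * a / 2) + 0 * (y - x) + - (k / a / 2) * (y - x) ^+ 2 + 0 * (y - x) ^+ 4.
have Qu y : Q y <= u 0 y.
  have := uk (lexx 0) x y; rewrite ler_norml => /andP[_ h1].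
  have h2 : `|x - y| <= ((y - x) ^+ 2 / a + a) / 2.
    have -> : (y - x) ^+ 2 = `|x - y| ^+ 2 by rewrite distrC -normrX ger0_norm ?sqr_ge0.
    set z := `|x - y|; rewrite -subr_ge0.
    have -> : (z ^+ 2 / a + a) / 2 - z = (z - a) ^+ 2 / (2 * a) by field; rewrite gt_eqF.
    by pos.
  by move/(ler_wpM2l k0): h2; rewrite /Q; lra.
have := iter_walk_le (sb * Num.sqrt (h / m0.+1%:R)) m0.+1 Qu x.
have [r [_ ->]] := iter_walk_quartic (sb * Num.sqrt (h / m0.+1%:R)) (u 0 x - k * a / 2) 0 (- (k / a / 2)) 0 x m0.+1.
rewrite exprMn sqr_sqrtr; last by rewrite divr_ge0// ltW.
have -> : m0.+1%:R * (sb ^+ 2 * (h / m0.+1%:R)) = sb ^+ 2 * h by field.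
move: mh => /= mh.
rewrite subrr expr0n/= !mul0r !addr0 add0r.
have -> : - (k / a / 2) * (sb ^+ 2 * h) = - (k * sb ^+ 2 * a / 2).
  by rewrite -aE; field; rewrite gt_eqF.
have := mulr_ge0 k0 (mulr_ge0 (sqr_ge0 sb) (ltW a0)).
by have := mulr_ge0 k0 (ltW a0); lra.
Qed.

Lemma molly_initial x : u 0 x - k * (sb ^+ 2 + 1) * Num.sqrt d - 3 * k * d <= molly d 0 x.
Proof.
have := smooth_close x d0 k0 (@tavg_lip 0); rewrite ler_norml => /andP[h1 _].
rewrite /molly.
suff : u 0 x - k * (sb ^+ 2 + 1) * Num.sqrt d <= tavg d 0 x by lra.
have [c [c1 c2]] := avg_mvt 0 (@cue x) d0; rewrite /tavg => ->.
rewrite extE//; rewrite add0r in c2.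
have [c00|cp] := eqVneq c 0.
  by rewrite c00 gerBl; pos.
apply: le_trans (super_initial x _); last by rewrite lt_neqAle eq_sym cp.
by rewrite lerD2l lerN2 ler_wpM2l ?ler_wsqrtr//; pos.
Qed.

Lemma molly_le t x : 0 <= t -> exists c, [/\ t <= c, c <= t + d & molly d t x <= u c x + 3 * k * d].
Proof.
move=> t0; have := smooth_close x d0 k0 (@tavg_lip t); rewrite ler_norml => /andP[_ h1].
have [c [c1 c2 e]] := avg_mvt t (@cue x) d0.
exists c; split=> //; move: h1; rewrite -/(molly d t x) /tavg e extE ?(le_trans t0)//; lra.
Qed.

End mollification.

(** * Comparison of viscosity sub- and supersolutions *)

Section comparison.
Context {R : realType}.
Variables (sl sb : R).
Hypotheses (sl_ge0 : 0 <= sl) (sl_le_sb : sl <= sb).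
Variables (u1 : R -> R -> R) (M : R).
Implicit Types (d e k s t x y : R) (u : R -> R -> R) (f : R -> R).
Hypotheses (cu1 : ext_continuous u1) (bu1 : forall t x, 0 <= t -> `|u1 t x| <= M).
Hypothesis su1 : viscosity_subsolution sl sb u1.

Lemma C12_cst (c : R) : C12 (fun _ _ => c) (fun _ _ => 0) (fun _ _ => 0) (fun _ _ => 0).
Proof.
move=> t x _; split; split;
  by [exact: is_derive_const | exact: cont_cst].
Qed.

Lemma C12_shiftx (g gt gx gxx : R -> R -> R) (a c : R) : C12 g gt gx gxx ->
  C12 (fun t x => g t (x + a) + c) (fun t x => gt t (x + a))
    (fun t x => gx t (x + a)) (fun t x => gxx t (x + a)).
Proof.
move=> Cg t x t0; have [[a1 a2 a3] [b1 b2 b3 b4]] := Cg t (x + a) t0.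
have e : is_derive x 1 (fun x => x + a) 1 by der; ring.
have sh : continuous_at (t, x) (fun q : R * R => (q.1, q.2 + a)) by apply: cont_pair; cont.
have e2 := @is_derive_comp _ (g t) _ _ _ _ e a2.
have e3 := @is_derive_comp _ (gx t) _ _ _ _ e a3.
split; split.
- by der; ring.
- by der; ring.
- by der; ring.
- have := cont_comp sh b1 => b1'; by cont.
- exact: cont_comp sh b2.
- exact: cont_comp sh b3.
- exact: cont_comp sh b4.
Qed.

(** The mollified supersolution, raised by a constant that vanishes with [d], lies above [u1] at
    time 0 and is classical, so [sub_le_classical] applies. It is close to [u] at a time within [d]
    of [t], and [d] tends to 0. *)
Lemma comparison_lip u k :
  ext_continuous u -> (forall t x, 0 <= t -> `|u t x| <= M) ->
  viscosity_supersolution sl sb u ->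
  0 <= k -> (forall t, 0 <= t -> lipschitz1 k (u t)) ->
  (forall x, u1 0 x <= u 0 x) -> forall t x, 0 <= t -> u1 t x <= u t x.
Proof.
move=> cu bu su k0 uk u10 t x t0.
have M0 : 0 <= M by apply: le_trans (bu 0 0 (lexx 0)).
have key d : 0 < d -> exists c, [/\ t <= c, c <= t + d &
    u1 t x <= u c x + (k * (sb ^+ 2 + 1) * Num.sqrt d + 3 * k * d) + 3 * k * d].
  move=> d0; set r := k * _ * _ + _.
  have r0 : 0 <= r by rewrite /r; pos.
  have [c [c1 c2 h]] := molly_le cu k0 uk d0 x t0.
  exists c; split=> //.
  suff : u1 t x <= molly u d t x + r by lra.
  have Cm := C12_add (C12_molly cu uk d0) (C12_cst r).
  apply: (sub_le_classical sl_ge0 sl_le_sb (v := fun t x => molly u d t x + r)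
    cu1 bu1 su1 _ _ Cm) => //.
  - have j : jcontinuous (molly u d).
      do 3 apply: (avg_jcontinuous d0).
      exact: (jcontinuous_swap (avg_jcontinuous d0 (jcontinuous_swap cu))).
    move=> p.
    have c3 : continuous_at p (fun q : R * R => molly u d (Num.max q.1 0) q.2).
      apply: (cont_comp (h := fun q : R * R => (Num.max q.1 0, q.2)) (k := fun q : R * R => molly u d q.1 q.2)).
        by apply: cont_pair; cont.
      exact: j.
    by rewrite /ext; cont.
  - move=> t' y t'0; have b := tavg_bnd cu bu d0 t'.
    have cF : continuous (tavg u d t') by exact: lipschitz1_continuous (tavg_lip cu uk d0 t').
    have := @smooth_le _ d (fun=> - M) (tavg u d t') d0 (@cst_continuous _ _ _) cF _ y.
    rewrite /smooth (_ : avg d (fun=> - M) = fun=> - M); last by apply/funext => z; rewrite avg_cst.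
    rewrite (_ : avg d (fun=> - M) = fun=> - M); last by apply/funext => z; rewrite avg_cst.
    rewrite avg_cst// => h'.
    have : - M <= molly u d t' y by apply: h' => z; have := b z; rewrite ler_norml => /andP[].
    by lra.
  - by move=> t' y t'0; rewrite !addr0; exact: (molly_super sl_ge0 sl_le_sb cu bu su k0 uk d0).
  - move=> y; have := molly_initial sl_ge0 sl_le_sb cu bu su k0 uk d0 y.
    by have := u10 y; rewrite /r; lra.
apply/ler_addgt0Pr => e e0.
have cux : continuous_at t (ext u ^~ x).
  exact: (jcontinuous_snd (jcontinuous_swap (cu : jcontinuous (ext u)))).
have e2 : 0 < e / 2 by lra.
have /cvgrPdist_lt /(_ _ e2) /nbhs_ballP[r /= r0 hr] := cux.
have [|q q0 hq] := @small_eta _ (e / 2) (k * (sb ^+ 2 + 1) + 6 * k) e2; first by pos.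
(* Both [d] and its square root are at most [q], so the error terms are bounded linearly in [q]. *)
pose d := Num.min (r / 2) (Num.min (q ^+ 2) q).
have d0 : 0 < d by rewrite /d !lt_min; apply/andP; split; [pos|apply/andP; split; pos].
have dr : d < r by apply: (@le_lt_trans _ _ (r / 2)); [rewrite /d ge_min lexx|lra].
have dq : d <= q by rewrite /d !ge_min lexx !orbT.
have sdq : Num.sqrt d <= q.
  rewrite -(ger0_norm (ltW q0)) -sqrtr_sqr ler_wsqrtr// /d !ge_min lexx !orbT//.
have [c [c1 c2 h]] := key d d0.
have : `|ext u t x - ext u c x| < e / 2.
  by apply: hr; rewrite /ball/= distrC ger0_norm; lra.
rewrite !extE ?(le_trans t0)// ltr_norml => /andP[h1 h2].
have h3 : k * (sb ^+ 2 + 1) * Num.sqrt d <= k * (sb ^+ 2 + 1) * q by rewrite ler_wpM2l//; pos.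
have h4 : k * d <= k * q by rewrite ler_wpM2l.
lra.
Qed.

(* The inf-convolution of [u] in space is a supersolution that is Lipschitz in
   space and lies above [f] at time 0. *)
Lemma comparison u f k :
  ext_continuous u -> (forall t x, 0 <= t -> `|u t x| <= M) ->
  viscosity_supersolution sl sb u -> lipschitz1 k f ->
  (forall x, u1 0 x <= f x) -> (forall x, f x <= u 0 x) ->
  forall t x, 0 <= t -> u1 t x <= u t x.
Proof.
move=> cu bu su fk' u1f fu.
have [K K0 fk] : exists2 K : R, 0 < K & lipschitz1 K f.
  exists (`|k| + 1); first by pos.
  move=> x y; apply: (le_trans (fk' x y)); rewrite ler_wpM2r//.
  by apply: (le_trans (ler_norm k)); rewrite lerDl.
have M0 : 0 <= M by apply: le_trans (bu 0 0 (lexx 0)).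
have ju : jcontinuous (ext u) by exact: cu.
have ube t x : `|ext u t x| <= M by apply: bu; rewrite le_max lexx orbT.
(* Beyond this distance the cost K |x - y| exceeds the oscillation 2 M of [u], so the infimum over
   [y] is attained within distance [E]. *)
pose E := 2 * M / K.
have E0 : 0 <= E by rewrite /E; pos.
have minex (p : R * R) : exists y0, forall y,
    ext u p.1 y0 + K * `|p.2 - y0| <= ext u p.1 y + K * `|p.2 - y|.
  have [||y0 _ hy0] := @EVT_min R (fun y => ext u p.1 y + K * `|p.2 - y|) (p.2 - E) (p.2 + E) _ _.
  - lra.
  - apply: continuous_subspaceT => y.
    have c1 := @jcontinuous_snd _ _ ju p.1 y.
    have c2 : continuous_at y (fun y => `|p.2 - y|).
      apply: (cont_comp (h := fun y => p.2 - y) (k := fun y : R => `|y|)).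
        by cont.
      exact: norm_continuous.
    by cont.
  exists y0 => y.
  have [yE|yE] := leP `|p.2 - y| E.
    by apply: hy0; rewrite in_itv/=; move: yE; rewrite ler_norml => /andP[? ?]; apply/andP; split; lra.
  have := hy0 p.2; rewrite in_itv/= subrr normr0 mulr0 addr0 => h.
  have : K * E < K * `|p.2 - y| by rewrite ltr_pM2l.
  rewrite {1}/E mulrC mulfVK ?gt_eqF// => h'.
  have := ube p.1 y; have := ube p.1 p.2; rewrite !ler_norml => /andP[? ?] /andP[? ?].
  have : ext u p.1 y0 + K * `|p.2 - y0| <= ext u p.1 p.2.
    by apply: h; apply/andP; split; lra.
  lra.
have {minex} [m hm] := choice minex.
pose I t x := ext u t (m (t, x)) + K * `|x - m (t, x)|.
have I_le t x y : I t x <= ext u t y + K * `|x - y| by exact: (hm (t, x)).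
have mE t x : `|x - m (t, x)| <= E.
  have := I_le t x x; rewrite subrr normr0 mulr0 addr0 /I => h.
  rewrite /E ler_pdivlMr// mulrC.
  by have := ube t x; have := ube t (m (t, x)); rewrite !ler_norml => /andP[? ?] /andP[? ?]; lra.
have Iu t x : I t x <= ext u t x by have := I_le t x x; rewrite subrr normr0 mulr0 addr0.
have IM t x : `|I t x| <= M.
  have := Iu t x; have := ube t x; have := ube t (m (t, x)).
  rewrite !ler_norml => /andP[? ?] /andP[? ?] ?.
  have : 0 <= K * `|x - m (t, x)| by pos.
  by move=> ?; apply/andP; split; [rewrite /I|]; lra.
have Ilip t : lipschitz1 K (I t).
  have half x y : I t x - I t y <= K * `|x - y|.
    have := I_le t x (m (t, y)); rewrite {3}/I.
    have : K * `|x - m (t, y)| <= K * (`|x - y| + `|y - m (t, y)|).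
      by rewrite ler_wpM2l ?(ltW K0)// ler_distD.
    lra.
  move=> x y; rewrite ler_norml half andbT.
  by have := half y x; rewrite distrC; lra.
(* The selected minimiser [m] need not be continuous; but the minimiser for one point, translated,
   is a competitor for the other one. *)
have jI : jcontinuous I.
  move=> [t0 x0]; apply/cvgrPdist_le => e e0.
  have := jcontinuous_tube (x0 - E) (x0 + E) t0 x0 ju e0; apply: filterS => -[t x] /= tb.
  have h1 : I t0 x0 <= I t x + e.
    have := I_le t0 x0 (m (t, x) - (x - x0)).
    have := mE t x; rewrite ler_norml => /andP[? ?].
    have := tb (m (t, x) - (x - x0)); rewrite subrK ler_norml => h.
    have {h} := h ltac:(lra) ltac:(lra) => /andP[? ?].
    have -> : x0 - (m (t, x) - (x - x0)) = x - m (t, x) by ring.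
    by rewrite /I; lra.
  have h2 : I t x <= I t0 x0 + e.
    have := I_le t x (m (t0, x0) + (x - x0)).
    have := mE t0 x0; rewrite ler_norml => /andP[? ?].
    have := tb (m (t0, x0)); rewrite ler_norml => h.
    have {h} := h ltac:(lra) ltac:(lra) => /andP[? ?].
    have -> : x - (m (t0, x0) + (x - x0)) = x0 - m (t0, x0) by ring.
    by rewrite /I; lra.
  by rewrite ler_norml; apply/andP; split; lra.
(* A test function touching [I] from below at x, translated by x - m(t, x) and lowered by the cost,
   touches [u] from below at m(t, x). *)
have sI : viscosity_supersolution sl sb I.
  move=> g gt gx gxx t x Cg t0 gI gle.
  pose a := x - m (t, x).
  have h := su _ _ _ _ t (m (t, x)) (C12_shiftx a (- (K * `|a|)) Cg) t0.
  move: h; rewrite /a (addrC (m (t, x))) subrK; apply.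
    by rewrite gI /I addrK extE// ltW.
  move=> s y s0; have := gle s (y + a) s0; have := I_le s (y + a) y.
  by rewrite (addrAC y) subrr add0r extE ?(ltW s0)// /a; lra.
move=> t x t0; rewrite -(extE u)//; apply: le_trans (Iu t x).
apply: (@comparison_lip I K _ _ sI (ltW K0)) => //.
- move=> p; apply: (cont_comp (h := fun q : R * R => (Num.max q.1 0, q.2)) (k := fun q : R * R => I q.1 q.2)).
    by apply: cont_pair; cont.
  exact: jI.
- move=> y; apply: (le_trans (u1f y)).
  have := fk y (m (0, y)); rewrite ler_norml => /andP[_ h].
  by have := fu (m (0, y)); rewrite /I extE//; lra.
Qed.

End comparison.

(** * Existence for the G-heat equation *)

Section ultrafilter.

Lemma ultra_nat_ex : exists U : set_system nat, UltraFilter U /\ \oo `<=` U.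
Proof. by apply: ultraFilterLemma; exact: eventually_filter. Qed.

(** A fixed ultrafilter finer than the eventuality filter. Every bounded real sequence converges
    along it, and all such limits are taken simultaneously, without subsequences. *)
Definition UN : set_system nat := proj1_sig (cid ultra_nat_ex).

#[global] Instance UN_ultra : UltraFilter UN.
Proof. by rewrite /UN; case: cid => U []. Qed.

#[global] Instance UN_proper : ProperFilter UN.
Proof. exact: ultra_proper. Qed.

Lemma UN_eventually : \oo `<=` UN.
Proof. by rewrite /UN; case: cid => U []. Qed.

Context {R : realType}.
Implicit Types (a b : nat -> R).

Lemma UN_cvg a (l : R) : a @ \oo --> l -> a @ UN --> l.
Proof. by move=> al B /al; exact: UN_eventually. Qed.

Lemma ultra_cvg a (M : R) : (forall n, `|a n| <= M) ->
  a @ UN --> lim (a @ UN).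
Proof.
move=> aM; apply/cvg_ex.
have aU : UltraFilter (a @ UN).
  split; first exact: fmap_proper_filter.
  move=> G GF aG; apply/seteqP; split=> // A GA; apply: contrapT => nA.
  have [//|UC] := in_ultra_setVsetC (a @^-1` A) UN_ultra.
  have GC : G (~` A) by exact: aG.
  have h : G (A `&` ~` A) by exact: filterI.
  by rewrite setICr in h; case: (filter_not_empty G h).
have := @segment_compact R (- M) M; rewrite compact_ultra => /(_ (a @ UN) aU).
have h : (a @ UN) `[- M, M]%classic.
  suff : \forall n \near UN, `[- M, M]%classic (a n) by [].
  apply: nearW => n; have := aM n.
  by rewrite ler_norml => /andP[h1 h2]; rewrite /= in_itv/= h1 h2.
by move=> /(_ h)[l [_ al]]; exists l.
Qed.

Lemma UN_le a b (l m : R) : a @ UN --> l -> b @ UN --> m ->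
  (\forall n \near UN, a n <= b n) -> l <= m.
Proof. by move=> al bm ab; exact: (ler_cvg_to al bm ab). Qed.

Lemma UN_le_cst a (l m : R) : a @ UN --> l -> (\forall n \near UN, a n <= m) -> l <= m.
Proof. by move=> al; apply: UN_le al _; exact: cvg_cst. Qed.

Lemma UN_ge_cst a (l m : R) : a @ UN --> l -> (\forall n \near UN, m <= a n) -> m <= l.
Proof. by move=> al; apply: UN_le al; exact: cvg_cst. Qed.

End ultrafilter.

(** * The binomial-tree scheme and its limit *)

Section scheme.
Context {R : realType}.
Variables (sl sb : R).
Hypotheses (sl_ge0 : 0 <= sl) (sl_le_sb : sl <= sb).
Implicit Types (f g : R -> R) (h k t x y z M : R) (n : nat).
Local Notation G := (G sl sb).

Let sb_ge0 : 0 <= sb. Proof. exact: le_trans sl_le_sb. Qed.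

(** One step of a binomial tree in which the volatility is chosen at each node, between the two
    extreme values, so as to maximise the mean. *)
Definition scheme h f x := Num.max (walk (sl * Num.sqrt h) f x) (walk (sb * Num.sqrt h) f x).

Lemma scheme_le h f g : (forall x, f x <= g x) -> forall x, scheme h f x <= scheme h g x.
Proof. by move=> fg x; rewrite /scheme ge_max !le_max !walk_le ?orbT. Qed.

Lemma iter_scheme_le h f g n : (forall x, f x <= g x) ->
  forall x, iter n (scheme h) f x <= iter n (scheme h) g x.
Proof. by move=> fg; elim: n => // n ih x; exact: scheme_le. Qed.

Lemma schemeB_cst h f (c : R) x : scheme h (fun y => f y - c) x = scheme h f x - c.
Proof. by rewrite /scheme !walkB_cst addr_maxl. Qed.

Lemma iter_schemeB_cst h f (c : R) n x :
  iter n (scheme h) (fun y => f y - c) x = iter n (scheme h) f x - c.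
Proof.
by elim: n x => // n ih x; rewrite !iterS -schemeB_cst; congr scheme; apply/funext.
Qed.

Lemma scheme_shift h f (e : R) x : scheme h (fun y => f (y + e)) x = scheme h f (x + e).
Proof.
by rewrite /scheme /walk !(addrAC x e).
Qed.

Lemma iter_scheme_shift h f (e : R) n x :
  iter n (scheme h) (fun y => f (y + e)) x = iter n (scheme h) f (x + e).
Proof.
by elim: n x => // n ih x; rewrite !iterS -scheme_shift; congr scheme; apply/funext.
Qed.

Lemma scheme_ge_walk h f s x : s = sl \/ s = sb -> walk (s * Num.sqrt h) f x <= scheme h f x.
Proof. by case=> ->; rewrite /scheme le_max lexx ?orbT. Qed.

Lemma iter_scheme_ge_walk h f s n x : s = sl \/ s = sb ->
  iter n (walk (s * Num.sqrt h)) f x <= iter n (scheme h) f x.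
Proof.
move=> sE; elim: n x => // n ih x; rewrite !iterS.
by apply: le_trans (scheme_ge_walk _ _ _ sE); exact: walk_le.
Qed.

(** The scheme is monotone and commutes with translations and with the subtraction of constants;
    these facts alone preserve the Lipschitz constant. *)
Lemma iter_scheme_lip h f k n : lipschitz1 k f -> lipschitz1 k (iter n (scheme h) f).
Proof.
move=> fk x y.
have shift b e : iter n (scheme h) f (b + e) - k * `|e| <= iter n (scheme h) f b.
  rewrite -iter_scheme_shift -iter_schemeB_cst; apply: iter_scheme_le => c.
  have := fk (c + e) c; rewrite ler_norml => /andP[_].
  by rewrite (addrAC c) subrr add0r; lra.
have half a b : iter n (scheme h) f a - iter n (scheme h) f b <= k * `|a - b|.
  by have := shift b (a - b); rewrite (addrC b) subrK; lra.
rewrite ler_norml half andbT; have := half y x; rewrite distrC; lra.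
Qed.

Lemma iter_scheme_cst h (c : R) n x : iter n (scheme h) (fun=> c) x = c.
Proof.
elim: n x => // n ih x; rewrite iterS.
have -> : iter n (scheme h) (fun=> c) = fun=> c by apply/funext.
by rewrite /scheme /walk maxxx; field.
Qed.

Lemma iter_scheme_bnd h f M n x : (forall x, `|f x| <= M) -> `|iter n (scheme h) f x| <= M.
Proof.
move=> fM; rewrite ler_norml -[X in X <= _ <= _](iter_scheme_cst h _ n x).
rewrite -[X in _ <= _ <= X](iter_scheme_cst h _ n x).
by apply/andP; split; apply: iter_scheme_le => y; have := fM y; rewrite ler_norml => /andP[].
Qed.

(** Each step sends a quartic below a quartic of the same form, the coefficient of the square
    growing by 6 c4 sb^2 h. The horizon [T] allows [G] to be evaluated once, at the final and
    largest coefficient. *)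
Lemma iter_scheme_quartic h (c0 c1 c2 c4 x T : R) n : 0 <= h -> 0 <= c4 -> n%:R * h <= T ->
  forall y, iter n (scheme h) (fun y => c0 + c1 * (y - x) + c2 * (y - x) ^+ 2 + c4 * (y - x) ^+ 4) y
   <= c0 + n%:R * h * (G (2 * (c2 + 6 * c4 * sb ^+ 2 * T)) + c4 * sb ^+ 4 * h)
    + c1 * (y - x) + (c2 + 6 * c4 * sb ^+ 2 * (n%:R * h)) * (y - x) ^+ 2 + c4 * (y - x) ^+ 4.
Proof.
move=> h0 c40; elim: n => [|n ih] nT y.
  by rewrite /= !mul0r !mulr0 !addr0.
have nT' : n%:R * h <= T.
  by apply: le_trans nT; rewrite ler_wpM2r// ler_nat.
rewrite iterS; apply: (le_trans (scheme_le h (ih nT') y)).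
set g := G _; set A := c0 + _ * (g + _).
set B := c2 + 6 * c4 * sb ^+ 2 * (n%:R * h).
have BT : G (2 * B) <= g.
  apply: G_mono => //; rewrite ler_pM2l// lerD2l ler_wpM2l//; pos.
have hn : 0 <= n%:R * h by pos.
have step s : s = sl \/ s = sb -> walk (s * Num.sqrt h) (fun y => A + c1 * (y - x) +
    B * (y - x) ^+ 2 + c4 * (y - x) ^+ 4) y <=
    A + h * (g + c4 * sb ^+ 4 * h) + c1 * (y - x) + (B + 6 * c4 * sb ^+ 2 * h) * (y - x) ^+ 2
    + c4 * (y - x) ^+ 4.
  move=> sE; set z := y - x; set b := s * Num.sqrt h.
  have b2 : b ^+ 2 = s ^+ 2 * h by rewrite /b exprMn sqr_sqrtr.
  have s0 : 0 <= s by case: sE => ->.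
  have ss : s ^+ 2 <= sb ^+ 2.
    by rewrite lerXn2r ?nnegrE//; case: sE => ->.
  have -> : walk b (fun y => A + c1 * (y - x) + B * (y - x) ^+ 2 + c4 * (y - x) ^+ 4) y =
    A + c1 * z + B * (z ^+ 2 + b ^+ 2) + c4 * (z ^+ 4 + 6 * z ^+ 2 * b ^+ 2 + (b ^+ 2) ^+ 2).
    by rewrite /walk /z; field.
  rewrite b2.
  have h1 : 2^-1 * s ^+ 2 * (2 * B) <= g by apply: le_trans BT; exact: G_ge.
  have h2 : (s ^+ 2) ^+ 2 <= (sb ^+ 2) ^+ 2 by rewrite lerXn2r ?nnegrE ?sqr_ge0.
  have e1 : h * (2^-1 * s ^+ 2 * (2 * B)) <= h * g by rewrite ler_wpM2l.
  have e2 : c4 * (h * h) * (s ^+ 2) ^+ 2 <= c4 * (h * h) * (sb ^+ 2) ^+ 2.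
    by rewrite ler_wpM2l//; pos.
  have e3 : c4 * z ^+ 2 * h * s ^+ 2 <= c4 * z ^+ 2 * h * sb ^+ 2.
    by rewrite ler_wpM2l//; pos.
  have -> : sb ^+ 4 = (sb ^+ 2) ^+ 2 by rewrite -exprM.
  lra.
have -> : c0 + n.+1%:R * h * (g + c4 * sb ^+ 4 * h) = A + h * (g + c4 * sb ^+ 4 * h).
  by rewrite /A -natr1; ring.
have -> : c2 + 6 * c4 * sb ^+ 2 * (n.+1%:R * h) = B + 6 * c4 * sb ^+ 2 * h.
  by rewrite /B -natr1; ring.
by rewrite /scheme ge_max; apply/andP; split; apply: step; [left|right].
Qed.

Lemma young_abs (a z : R) : 0 < a -> `|z| <= (z ^+ 2 / a + a) / 2.
Proof.
move=> a0; have -> : z ^+ 2 = `|z| ^+ 2 by rewrite -normrX ger0_norm ?sqr_ge0.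
set w := `|z|; rewrite -subr_ge0.
have -> : (w ^+ 2 / a + a) / 2 - w = (w - a) ^+ 2 / (2 * a) by field; rewrite gt_eqF.
by pos.
Qed.

(** By Young's inequality with parameter sqrt(T), [f] lies between two parabolas with vertex at [x];
    the walk of volatility [sb] handles the lower one and [iter_scheme_quartic] the upper one. *)
Lemma iter_scheme_time h f k T n x : 0 <= h -> 0 <= k -> lipschitz1 k f -> 0 < T ->
  n%:R * h <= T -> `|iter n (scheme h) f x - f x| <= k * (sb ^+ 2 + 1) * Num.sqrt T.
Proof.
move=> h0 k0 fk T0 nT; set a := Num.sqrt T.
have a0 : 0 < a by rewrite sqrtr_gt0.
have aE : a ^+ 2 = T by rewrite sqr_sqrtr// ltW.
have fa y : `|f y - f x| <= k * ((y - x) ^+ 2 / a + a) / 2.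
  by rewrite -mulrA; apply: (le_trans (fk y x)); rewrite ler_wpM2l// young_abs.
have ka0 : 0 <= k / a by pos.
have nh0 : 0 <= n%:R * h by pos.
rewrite ler_norml; apply/andP; split.
  pose Q y := (f x - k * a / 2) + 0 * (y - x) + - (k / a / 2) * (y - x) ^+ 2 + 0 * (y - x) ^+ 4.
  have Qf y : Q y <= f y.
    by have := fa y; rewrite ler_norml /Q => /andP[? _]; lra.
  have h1 := iter_scheme_le h n Qf x.
  have h2 := @iter_scheme_ge_walk h Q sb n x (or_intror erefl).
  move: h1 h2.
  have [r [_ E]] := iter_walk_quartic (sb * Num.sqrt h) (f x - k * a / 2) 0 (- (k / a / 2)) 0 x n.
  rewrite E subrr expr0n/= !mul0r !addr0 add0r exprMn sqr_sqrtr// => h1 h2.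
  have h3 : k / a * (n%:R * h) <= k * a.
    have : k / a * (n%:R * h) <= k / a * a ^+ 2 by rewrite ler_wpM2l// aE.
    by have -> : k / a * a ^+ 2 = k * a by field; rewrite gt_eqF.
  have h4 : sb ^+ 2 * (k / a * (n%:R * h)) <= sb ^+ 2 * (k * a) by rewrite ler_wpM2l// sqr_ge0.
  have : 0 <= k * a by pos.
  have : 0 <= k * sb ^+ 2 * a by pos.
  lra.
pose Q y := (f x + k * a / 2) + 0 * (y - x) + (k / a / 2) * (y - x) ^+ 2 + 0 * (y - x) ^+ 4.
have fQ y : f y <= Q y.
  by have := fa y; rewrite ler_norml /Q => /andP[_ ?]; lra.
have h1 := iter_scheme_le h n fQ x.
have h2 := @iter_scheme_quartic h (f x + k * a / 2) 0 (k / a / 2) 0 x T n h0 (lexx 0) nT x.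
move: h1 h2; rewrite subrr expr0n/= !mul0r !mulr0 !mul0r !addr0.
have -> : G (2 * (k / a / 2)) = 2^-1 * sb ^+ 2 * (2 * (k / a / 2)) by apply: G_nneg; pos.
move=> h1 h2.
have h3 : k / a * (n%:R * h) <= k * a.
  have : k / a * (n%:R * h) <= k / a * a ^+ 2 by rewrite ler_wpM2l// aE.
  by have -> : k / a * a ^+ 2 = k * a by field; rewrite gt_eqF.
have h4 : sb ^+ 2 * (k / a * (n%:R * h)) <= sb ^+ 2 * (k * a) by rewrite ler_wpM2l// sqr_ge0.
have : 0 <= k * a by pos.
have : 0 <= k * sb ^+ 2 * a by pos.
lra.
Qed.

Definition mesh n : R := n.+1%:R^-1.
Definition steps n t : nat := Num.truncn (t / mesh n).
Definition wapp f n t x := iter (steps n t) (scheme (mesh n)) f x.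
(** Boundedness alone yields this limit; uniqueness of the viscosity solution identifies it
    afterwards. *)
Definition wsol f t x := lim (wapp f n t x @[n --> UN]).

Lemma mesh_gt0 n : 0 < mesh n. Proof. by rewrite invr_gt0. Qed.

Lemma steps_itv n t : 0 <= t -> (steps n t)%:R * mesh n <= t < (steps n t)%:R * mesh n + mesh n.
Proof.
move=> t0; have m0 := mesh_gt0 n.
have /truncn_itv/andP[h1 h2] : 0 <= t / mesh n by pos.
rewrite -ler_pdivlMr// h1/= -[X in _ < _ + X]mul1r -mulrDl natr1.
by rewrite -ltr_pdivrMr.
Qed.

Lemma mesh_near (e : R) : 0 < e -> \forall n \near UN, mesh n < e.
Proof.
move=> e0; apply: UN_eventually.
have := @cvg_harmonic R => /cvgrPdist_lt /(_ e e0).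
by apply: filterS => n; rewrite sub0r normrN gtr0_norm ?mesh_gt0.
Qed.

Lemma wapp_add f n s t : 0 <= s -> s <= t -> exists j : nat,
  `|j%:R * mesh n - (t - s)| <= mesh n /\
  forall x, wapp f n t x = iter j (scheme (mesh n)) (wapp f n s) x.
Proof.
move=> s0 st; exists (steps n t - steps n s)%N.
have /andP[a1 a2] := steps_itv n s0.
have /andP[b1 b2] := steps_itv n (le_trans s0 st).
have le : (steps n s <= steps n t)%N.
  by apply: le_truncn; rewrite ler_wpM2r// invr_ge0 ltW// mesh_gt0.
split; last by move=> x; rewrite /wapp -iterD subnK.
by rewrite natrB// mulrBl ler_norml; apply/andP; split; lra.
Qed.

Variables (f : R -> R) (M k : R).
Hypotheses (fM : forall x, `|f x| <= M) (k0 : 0 <= k) (fk : lipschitz1 k f).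

Lemma wapp_bnd n t x : `|wapp f n t x| <= M.
Proof. exact: iter_scheme_bnd. Qed.

Lemma wapp_lip n t : lipschitz1 k (wapp f n t).
Proof. exact: iter_scheme_lip. Qed.

Lemma wapp_cvg t x : wapp f n t x @[n --> UN] --> wsol f t x.
Proof. by apply: (ultra_cvg (M := M)) => n; exact: wapp_bnd. Qed.

Lemma UN_norm_le (a b : nat -> R) (l m c : R) : a @ UN --> l -> b @ UN --> m ->
  (\forall n \near UN, `|a n - b n| <= c) -> `|l - m| <= c.
Proof.
move=> al bm ab; have h : (fun n => a n - b n) @ UN --> l - m by exact: cvgB.
rewrite ler_norml; apply/andP; split.
  by apply: (UN_ge_cst h); apply: filterS ab => n; rewrite ler_norml => /andP[].
by apply: (UN_le_cst h); apply: filterS ab => n; rewrite ler_norml => /andP[].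
Qed.

Lemma wsol_bnd t x : `|wsol f t x| <= M.
Proof.
rewrite -[X in `|X|]subr0; apply: (UN_norm_le (@wapp_cvg t x) (@cvg_cst _ _ _ _ _)).
by apply: nearW => n; rewrite subr0 wapp_bnd.
Qed.

Lemma wsol_lip t : lipschitz1 k (wsol f t).
Proof.
move=> x y; apply: (UN_norm_le (@wapp_cvg t x) (@wapp_cvg t y)).
by apply: nearW => n; exact: wapp_lip.
Qed.

Lemma wsol0 x : wsol f 0 x = f x.
Proof.
have h : wapp f n 0 x @[n --> UN] --> f x.
  apply: cvg_near_cst; apply: nearW => n.
  by rewrite /wapp /steps mul0r truncn0.
exact: (cvg_unique _ (@wapp_cvg 0 x) h).
Qed.

Lemma wsol_time s t T x : 0 <= s -> s <= t -> t - s < T ->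
  `|wsol f t x - wsol f s x| <= k * (sb ^+ 2 + 1) * Num.sqrt T.
Proof.
move=> s0 st tT; apply: (UN_norm_le (@wapp_cvg t x) (@wapp_cvg s x)).
have e0 : 0 < T - (t - s) by lra.
have := mesh_near e0; apply: filterS => n hn.
have [j [jh ->]] := wapp_add f n s0 st.
apply: iter_scheme_time => //; first exact/ltW/mesh_gt0.
- exact: wapp_lip.
- by lra.
- by move: jh; rewrite ler_norml => /andP[_]; lra.
Qed.

Lemma wsol_continuous : ext_continuous (wsol f).
Proof.
move=> [t0 x0]; apply/cvgrPdist_le => e e0 /=.
pose c := k * (sb ^+ 2 + 1).
have [|q q0 hq] := @small_eta _ e (c + k) e0; first by rewrite /c; pos.
have nt : \forall p \near (t0, x0), `|Num.max t0 0 - Num.max (p : R * R).1 0| < q ^+ 2.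
  have h : continuous_at (t0, x0) (fun p : R * R => Num.max p.1 0) by cont.
  by have /cvgrPdist_lt /(_ (q ^+ 2)) := h; apply; pos.
have nx : \forall p \near (t0, x0), `|x0 - (p : R * R).2| < q.
  have h : continuous_at (t0, x0) (fun p : R * R => p.2) by cont.
  by have /cvgrPdist_lt /(_ q) := h; apply.
apply: filterS2 nt nx => -[t x] /= ht hx; rewrite /ext.
set s0 := Num.max t0 0 in ht *; set s := Num.max t 0 in ht *.
have s00 : 0 <= s0 by rewrite le_max lexx orbT.
have sge : 0 <= s by rewrite le_max lexx orbT.
have h1 : `|wsol f s0 x0 - wsol f s x0| <= c * q.
  have {1}-> : q = Num.sqrt (q ^+ 2) by rewrite sqrtr_sqr gtr0_norm.
  have [ss|ss] := leP s0 s.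
    by rewrite distrC; apply: wsol_time => //; rewrite distrC ger0_norm// in ht; lra.
  by apply: wsol_time => //; [exact: ltW|rewrite gtr0_norm// in ht; lra].
have h2 : `|wsol f s x0 - wsol f s x| <= k * q.
  by apply: (le_trans (wsol_lip s x0 x)); rewrite ler_wpM2l// ltW.
apply: (le_trans (ler_distD (wsol f s x0) _ _)); lra.
Qed.

(** Pointwise convergence of functions with a common Lipschitz constant is uniform on compact
    intervals, also along an ultrafilter. *)
Lemma wapp_uniform s x (A e : R) : 0 < e ->
  \forall n \near UN, forall y, `|y - x| <= A -> `|wapp f n s y - wsol f s y| <= e.
Proof.
move=> e0.
have cK : compact (`[x - A, x + A] : set R) by exact: segment_compact.
pose P n y := `|wapp f n s y - wsol f s y| <= e.
have H y : `[x - A, x + A]%classic y -> \forall y' \near y & n \near UN, P n y'.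
  move=> _; have e2 : 0 < e / 2 by lra.
  have hn : \forall n \near UN, `|wsol f s y - wapp f n s y| < e / 2.
    by have /cvgrPdist_lt /(_ _ e2) := @wapp_cvg s y.
  have q0 : 0 < e / 2 / (2 * k + 1) by pos.
  have hy : \forall y' \near y, `|y - y'| < e / 2 / (2 * k + 1).
    by have /cvgrPdist_lt /(_ _ q0) := @cont_id R y.
  exists ([set y' | `|y - y'| < e / 2 / (2 * k + 1)], [set n | `|wsol f s y - wapp f n s y| < e / 2]) => //.
  move=> [y' n] /= [h1 h2]; rewrite /P.
  have h3 := wapp_lip n s y' y; have h4 := wsol_lip s y y'.
  move: h1; rewrite ltr_pdivlMr; last by pos.
  rewrite (distrC y y') in h4 *; move: h3 h4 h2; rewrite !ler_norml !ltr_norml.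
  have : 0 <= k * `|y' - y| by pos.
  have := normr_ge0 (y' - y).
  move=> ? ? /andP[? ?] /andP[? ?] /andP[? ?] ?; apply/andP; split; nra.
have FU : Filter UN by apply _.
have := (compact_near_coveringP _).1 cK _ UN P FU H.
apply: filterS => n h y hy; apply: h; rewrite /= in_itv/=.
by move: hy; rewrite ler_norml => /andP[? ?]; apply/andP; split; lra.
Qed.

Lemma quartic_coercive (c0 c1 c2 c4 : R) : 0 < c4 -> exists2 A, 1 <= A &
  forall z, A <= `|z| -> M <= c0 + c1 * z + c2 * z ^+ 2 + c4 * z ^+ 4.
Proof.
move=> c40; have M0 : 0 <= M by apply: le_trans (fM 0).
pose A := Num.max 1 ((`|c0| + `|c1| + `|c2| + M) / c4).
exists A; first by rewrite /A le_max lexx.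
move=> z Az; set w := `|z| in Az.
have A1 : 1 <= w by apply: le_trans Az; rewrite /A le_max lexx.
have A2 : `|c0| + `|c1| + `|c2| + M <= c4 * w.
  by rewrite mulrC -ler_pdivrMr//; apply: le_trans Az; rewrite /A le_max lexx orbT.
have -> : z ^+ 4 = w ^+ 4 by rewrite /w -normrX ger0_norm// exprn_even_ge0.
have -> : z ^+ 2 = w ^+ 2 by rewrite /w -normrX ger0_norm// sqr_ge0.
have h0 : - `|c0| <= c0 by have := ler_norm (- c0); rewrite normrN; lra.
have h1 : - (`|c1| * w) <= c1 * z by rewrite /w -normrM; have := ler_norm (- (c1 * z)); rewrite normrN; lra.
have h2 : - (`|c2| * w ^+ 2) <= c2 * w ^+ 2.
  by rewrite -mulNr ler_wpM2r ?sqr_ge0//; have := ler_norm (- c2); rewrite normrN; lra.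
have w2 : w <= w ^+ 2 by rewrite expr2 ler_peMl//; lra.
have w1 : 1 <= w ^+ 2 by lra.
have n0 := normr_ge0 c0; have n1 := normr_ge0 c1; have n2 := normr_ge0 c2.
have h3 : (`|c0| + `|c1| + `|c2| + M) * w ^+ 2 <= c4 * w ^+ 3.
  have -> : c4 * w ^+ 3 = c4 * w * w ^+ 2 by ring.
  by rewrite ler_wpM2r// sqr_ge0.
have h4 : c4 * w ^+ 3 <= c4 * w ^+ 4.
  by rewrite ler_pM2l// (exprS w 3) ler_peMl//; pos.
have e1 : `|c0| <= `|c0| * w ^+ 2 by rewrite ler_peMr.
have e2 : `|c1| * w <= `|c1| * w ^+ 2 by rewrite ler_wpM2l.
have e3 : M <= M * w ^+ 2 by rewrite ler_peMr.
lra.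
Qed.

(** The quartic bound holds for the approximations as well, up to e/2: near [x] by uniform
    convergence, far away because the quartic exceeds [M]. Then [iter_scheme_quartic] propagates it,
    and the mesh tends to 0. *)
Lemma wsol_upper s t T x (c0 c1 c2 c4 : R) : 0 <= s -> s <= t -> t - s < T -> 0 < c4 ->
  (forall y, wsol f s y <= c0 + c1 * (y - x) + c2 * (y - x) ^+ 2 + c4 * (y - x) ^+ 4) ->
  wsol f t x <= c0 + (t - s) * G (2 * (c2 + 6 * c4 * sb ^+ 2 * T)).
Proof.
move=> s0 st tT c40 wQ; apply/ler_addgt0Pr => e e0.
have [A A1 hA] := quartic_coercive c0 c1 c2 c40.
have e2 : 0 < e / 2 by lra.
set g := G _.
pose D := `|g| + 2 * (c4 * sb ^+ 4) * (T + 1).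
have T0 : 0 <= T by lra.
have D0 : 0 <= D by rewrite /D; pos.
have [q q0 hq] := small_eta e2 D0.
have Tp : 0 < T - (t - s) by lra.
apply: (UN_le_cst (@wapp_cvg t x)).
apply: filterS3 (wapp_uniform s x A e2) (mesh_near q0) (mesh_near Tp) => n hu hq' hT.
have m0 := mesh_gt0 n; set h := mesh n in m0 hq' hT *.
have [j [jh ->]] := wapp_add f n s0 st; rewrite -/h in jh *.
have le y : wapp f n s y - e / 2 <= c0 + c1 * (y - x) + c2 * (y - x) ^+ 2 + c4 * (y - x) ^+ 4.
  have [yA|yA] := leP `|y - x| A.
    by have := hu y yA; have := wQ y; rewrite ler_norml => ? /andP[_ ?]; lra.
  have := hA (y - x) (ltW yA); have := wapp_bnd n s y; rewrite ler_norml => /andP[_ ?]; lra.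
have h1 := iter_scheme_le h j le x.
have jT : j%:R * h <= T by move: jh; rewrite ler_norml => /andP[_ ?]; lra.
have h2 := @iter_scheme_quartic h c0 c1 c2 c4 x T j (ltW m0) (ltW c40) jT x.
move: h1 h2; rewrite iter_schemeB_cst -/g subrr expr0n/= !mulr0 !addr0 => h1 h2.
have h3 : j%:R * h * g <= (t - s) * g + h * `|g|.
  have : (j%:R * h - (t - s)) * g <= h * `|g|.
    by apply: (le_trans (ler_norm _)); rewrite normrM ler_wpM2r.
  by lra.
have h4 : j%:R * h * (c4 * sb ^+ 4 * h) <= 2 * (c4 * sb ^+ 4) * (T + 1) * h.
  have -> : j%:R * h * (c4 * sb ^+ 4 * h) = (c4 * sb ^+ 4 * h) * (j%:R * h) by ring.
  have -> : 2 * (c4 * sb ^+ 4) * (T + 1) * h = (c4 * sb ^+ 4 * h) * (2 * (T + 1)) by ring.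
  rewrite ler_wpM2l//; first by move: (ltW m0) (ltW c40) => ? ?; pos.
  by lra.
have h5 : D * h <= D * q by rewrite ler_wpM2l// ltW.
have h6 : D * h = h * `|g| + 2 * (c4 * sb ^+ 4) * (T + 1) * h by rewrite /D; ring.
rewrite mulrDr in h2; lra.
Qed.

Lemma wsol_lower r s t x (c0 c1 c2 c4 : R) : r = sl \/ r = sb -> 0 <= s -> s <= t -> 0 < c4 ->
  (forall y, c0 + c1 * (y - x) + c2 * (y - x) ^+ 2 - c4 * (y - x) ^+ 4 <= wsol f s y) ->
  c0 + (t - s) * (r ^+ 2 * c2) - 3 * c4 * r ^+ 4 * (t - s) ^+ 2 <= wsol f t x.
Proof.
move=> rE s0 st c40 wQ; apply/ler_addgt0Pr => e e0.
have [A A1 hA] := quartic_coercive (- c0) (- c1) (- c2) c40.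
have e2 : 0 < e / 2 by lra.
have r0 : 0 <= r by case: rE => ->.
pose D := r ^+ 2 * `|c2| + 3 * c4 * r ^+ 4 * (2 * (t - s) + 2).
have ts0 : 0 <= t - s by lra.
have D0 : 0 <= D by rewrite /D; pos.
have [q q0 hq] := small_eta e2 D0.
rewrite -lerBlDr; apply: (UN_ge_cst (@wapp_cvg t x)).
apply: filterS3 (wapp_uniform s x A e2) (mesh_near q0) (mesh_near ltr01) => n hu hq' h1.
have m0 := mesh_gt0 n; set h := mesh n in m0 hq' h1 *.
have [j [jh ->]] := wapp_add f n s0 st; rewrite -/h in jh *.
have le y : c0 + c1 * (y - x) + c2 * (y - x) ^+ 2 + (- c4) * (y - x) ^+ 4 - e / 2 <= wapp f n s y.
  have [yA|yA] := leP `|y - x| A.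
    by have := hu y yA; have := wQ y; rewrite ler_norml => ? /andP[? _]; lra.
  have := hA (y - x) (ltW yA); have := wapp_bnd n s y; rewrite ler_norml => /andP[? _]; lra.
have i1 := iter_scheme_le h j le x.
have i2 := @iter_scheme_ge_walk h (fun y => c0 + c1 * (y - x) + c2 * (y - x) ^+ 2 + (- c4) * (y - x) ^+ 4 - e / 2) r j x rE.
have [u [/andP[u0 _] E]] := iter_walk_quartic (r * Num.sqrt h) c0 c1 c2 (- c4) x j.
move: i1 i2; rewrite iter_walkB_cst E subrr exprMn sqr_sqrtr ?(ltW m0)// expr0n/= !mulr0 !addr0 !add0r => i1 i2.
set v := j%:R * h in jh.
have vE : j%:R * (r ^+ 2 * h) = r ^+ 2 * v by rewrite /v; ring.
rewrite vE in i2.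
move: jh; rewrite ler_norml => /andP[jh1 jh2].
have h3 : (t - s) * (r ^+ 2 * c2) - r ^+ 2 * `|c2| * h <= r ^+ 2 * v * c2.
  have : (t - s - v) * c2 <= h * `|c2|.
    apply: (le_trans (ler_norm _)); rewrite normrM ler_wpM2r// ler_norml; apply/andP; split; lra.
  by move/(ler_wpM2l (sqr_ge0 r)); lra.
have h4 : 0 <= c4 * (2 * u * (r ^+ 2 * h)).
  by move: (ltW m0) (ltW c40) => ? ?; pos.
have v0 : 0 <= v by rewrite /v; move: (ltW m0) => ?; pos.
have h5 : v ^+ 2 <= (t - s) ^+ 2 + (2 * (t - s) + 2) * h by nra.
have h6 : 3 * c4 * r ^+ 4 * v ^+ 2 <= 3 * c4 * r ^+ 4 * ((t - s) ^+ 2 + (2 * (t - s) + 2) * h).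
  by rewrite ler_wpM2l//; pos.
have h7 : D * h <= D * q by rewrite ler_wpM2l// ltW.
have h8 : D * h = r ^+ 2 * `|c2| * h + 3 * c4 * r ^+ 4 * (2 * (t - s) + 2) * h by rewrite /D; ring.
have h9 : (r ^+ 2 * v) ^+ 2 = r ^+ 4 * v ^+ 2 by ring.
rewrite h9 in i2; lra.
Qed.

End scheme.

Section UN_limits.
Context {R : realType}.

Lemma UN_unique (a : nat -> R) (l m : R) : a @ UN --> l -> a @ UN --> m -> l = m.
Proof.
move=> al am; apply/eqP; rewrite eq_le.
by rewrite (UN_le al am) ?(UN_le am al)//; apply: nearW => n.
Qed.

Lemma UN_ext (a b : nat -> R) (l : R) : (forall n, a n = b n) -> a @ UN --> l -> b @ UN --> l.
Proof. by move=> /funext ->. Qed.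

Lemma UN_add (a b : nat -> R) (l m : R) : a @ UN --> l -> b @ UN --> m ->
  (fun n => a n + b n) @ UN --> l + m.
Proof. by move=> al bm; exact: cvgD. Qed.

Lemma UN_cst (c : R) : (fun=> c) @ UN --> c.
Proof. exact: cvg_cst. Qed.

Lemma UN_scale (a : nat -> R) (l c : R) : a @ UN --> l -> (fun n => c * a n) @ UN --> c * l.
Proof. by move=> al; apply: cvgM al; exact: UN_cst. Qed.

End UN_limits.

(** * The limit of the scheme is the viscosity solution *)

Section viscosity.
Context {R : realType}.
Variables (sl sb : R).
Hypotheses (sl_ge0 : 0 <= sl) (sl_le_sb : sl <= sb).
Implicit Types (h k t x y z M : R) (n : nat).
Local Notation G := (G sl sb).

Let sb_ge0 : 0 <= sb. Proof. exact: le_trans sl_le_sb. Qed.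

Lemma near_box (t x : R) (P : R * R -> Prop) : (\forall p \near (t, x), P p) ->
  exists2 rho : R, 0 < rho & forall s y, `|t - s| < rho -> `|x - y| < rho -> P (s, y).
Proof. by move=> /nbhs_ballP[r /= r0 h]; exists r => // s y ts xy; apply: h. Qed.

Lemma C12_box (g gt gx gxx : R -> R -> R) t x (e : R) : C12 g gt gx gxx -> 0 < t -> 0 < e ->
  exists2 rho, 0 < rho & forall s y, `|t - s| < rho -> `|x - y| < rho ->
    [/\ 0 < s, `|g s y| <= `|g t x| + 1, `|gx s y| <= `|gx t x| + 1 & `|gxx s y - gxx t x| <= e].
Proof.
move=> Cg t0 e0; have [_ [c1 _ c3 c4]] := Cg t x t0.
have n1 : \forall p \near (t, x), `|g t x - g (p : R * R).1 p.2| < 1.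
  by have /cvgrPdist_lt /(_ 1) := c1; apply.
have n3 : \forall p \near (t, x), `|gx t x - gx (p : R * R).1 p.2| < 1.
  by have /cvgrPdist_lt /(_ 1) := c3; apply.
have n4 : \forall p \near (t, x), `|gxx t x - gxx (p : R * R).1 p.2| < e.
  by have /cvgrPdist_lt /(_ e) := c4; apply.
have [r1 r10 h1] := near_box n1; have [r3 r30 h3] := near_box n3.
have [r4 r40 h4] := near_box n4.
exists (Num.min t (Num.min r1 (Num.min r3 r4))); first by rewrite !lt_min t0 r10 r30 r40.
move=> s y; rewrite !lt_min => /and4P[a0 a1 a3 a4] /and4P[b0 b1 b3 b4].
have := h1 s y a1 b1; have := h3 s y a3 b3; have := h4 s y a4 b4 => /= k4 k3 k1.
split.
- by move: a0; rewrite ltr_norml => /andP[]; lra.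
- have := ler_normB (g t x) (g t x - g s y).
  have -> : g t x - (g t x - g s y) = g s y by ring.
  by lra.
- have := ler_normB (gx t x) (gx t x - gx s y).
  have -> : gx t x - (gx t x - gx s y) = gx s y by ring.
  by lra.
- by rewrite distrC ltW.
Qed.

(** Away from the base point a large multiple of the fourth power dominates all other terms; adding
    it makes a local Taylor bound global. *)
Lemma quartic_tail (M C0 C1 b r w : R) : 0 <= M -> 0 <= C0 -> 0 <= C1 -> 0 < r -> r <= w ->
  M + C0 + C1 * w + `|b| * w ^+ 2 <=
  ((M + C0) / r ^+ 4 + C1 / r ^+ 3 + `|b| / r ^+ 2 + 1) * w ^+ 4.
Proof.
move=> M0 C00 C10 r0 rw; have w0 : 0 <= w by lra.
have b0 := normr_ge0 b.
have e1 : M + C0 <= (M + C0) / r ^+ 4 * w ^+ 4.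
  by rewrite mulrAC ler_pdivlMr ?exprn_gt0// ler_wpM2l ?addr_ge0// lerXn2r// nnegrE ltW.
have e2 : C1 * w <= C1 / r ^+ 3 * w ^+ 4.
  rewrite mulrAC ler_pdivlMr ?exprn_gt0// -mulrA ler_wpM2l// (exprS w 3) ler_wpM2l//.
  by rewrite lerXn2r// nnegrE ltW.
have e3 : `|b| * w ^+ 2 <= `|b| / r ^+ 2 * w ^+ 4.
  rewrite mulrAC ler_pdivlMr ?exprn_gt0// -mulrA ler_wpM2l//.
  have -> : w ^+ 4 = w ^+ 2 * w ^+ 2 by rewrite -exprD.
  by rewrite ler_wpM2l ?sqr_ge0// lerXn2r// nnegrE ltW.
have : 0 <= w ^+ 4 by pos.
lra.
Qed.

Variables (f : R -> R) (M k : R).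
Hypotheses (fM : forall x, `|f x| <= M) (k0 : 0 <= k) (fk : lipschitz1 k f).

Let M0 : 0 <= M. Proof. exact: le_trans (fM 0). Qed.

Let sq_le h : 0 < h -> h < 1 -> h <= Num.sqrt h.
Proof.
move=> h0 h1; have a0 : 0 < Num.sqrt h by rewrite sqrtr_gt0.
have aE : Num.sqrt h ^+ 2 = h by rewrite sqr_sqrtr// ltW.
have a1 : Num.sqrt h < 1 by rewrite -[X in _ < X]sqrtr1 ltr_sqrt.
by rewrite -{1}aE expr2 ger_pMr// ltW.
Qed.

(** At the earlier time t - h the solution lies below the Taylor parabola of the test function plus
    a quartic. Propagating this bound up to [t] by [wsol_upper] controls the backward increment of
    the test function, hence its time derivative. *)
Lemma wsol_sub : viscosity_subsolution sl sb (wsol sl sb f).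
Proof.
move=> g gt gx gxx t x Cg t0 gw gle.
suff : gt t x <= G (gxx t x) by lra.
apply: G_le_eps => // e e0.
have [rho rho0 hrho] := C12_box x Cg t0 e0.
pose r := rho / 2; have r0 : 0 < r by rewrite /r; lra.
pose C0 := `|g t x| + 1; pose C1 := `|gx t x| + 1; pose b := (gxx t x + e) / 2.
have C00 : 0 <= C0 by rewrite /C0; pos.
have C10 : 0 <= C1 by rewrite /C1; pos.
pose K := (M + C0) / r ^+ 4 + C1 / r ^+ 3 + `|b| / r ^+ 2 + 1.
have K0 : 0 < K by rewrite /K; pos.
have [[d1 _ _] _] := Cg t x t0.
apply: (is_derive_le_left (rho := Num.min rho 1) (C := 12 * K * sb ^+ 4) d1).
- by rewrite lt_min rho0 ltr01.
- by move: (ltW K0) => ?; pos.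
move=> h h0; rewrite lt_min => /andP[hr h1]; set s := t - h.
have ts : `|t - s| < rho by rewrite /s opprB addrC subrK gtr0_norm.
have [|s0 B0 B1 _] := hrho s x ts; first by rewrite subrr normr0.
have main y : wsol sl sb f s y <= g s x + gx s x * (y - x) + b * (y - x) ^+ 2 + K * (y - x) ^+ 4.
  have [yr|yr] := leP `|y - x| r.
    apply: (le_trans (gle s y s0)).
    have d2' z : is_derive z 1 (g s) (gx s z) by have [[]] := Cg s z s0.
    have d3' z : is_derive z 1 (gx s) (gxx s z) by have [[]] := Cg s z s0.
    have := @taylor2_le R (fun z => g s (x + z)) (fun z => gx s (x + z)) (fun z => gxx s (x + z))
      (gxx t x + e) r (y - x) (is_derive_shift x d2') (is_derive_shift x d3') _ yr.
    rewrite addr0 (addrC x) subrK => H.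
    have : 0 <= K * (y - x) ^+ 4 by rewrite mulr_ge0 ?(ltW K0)// exprn_even_ge0.
    have : g s y <= g s x + gx s x * (y - x) + (gxx t x + e) / 2 * (y - x) ^+ 2.
      apply: H => z zr; have [|_ _ _] := hrho s (x + z) ts.
        by rewrite opprD addrA subrr add0r normrN /r in zr *; lra.
      by rewrite ler_norml => /andP[_]; lra.
    by rewrite /b; lra.
  have := quartic_tail b M0 C00 C10 r0 (ltW yr); rewrite -/K.
  have -> : `|y - x| ^+ 4 = (y - x) ^+ 4 by rewrite -normrX ger0_norm// exprn_even_ge0.
  have -> : `|y - x| ^+ 2 = (y - x) ^+ 2 by rewrite -normrX ger0_norm// sqr_ge0.
  have := wsol_bnd sl sb fM s y; rewrite ler_norml => /andP[_ wM].
  have h2 : - (C1 * `|y - x|) <= gx s x * (y - x).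
    have : `|gx s x * (y - x)| <= C1 * `|y - x| by rewrite normrM ler_wpM2r.
    by rewrite ler_norml => /andP[].
  have h3 : - (`|b| * (y - x) ^+ 2) <= b * (y - x) ^+ 2.
    by rewrite -mulNr ler_wpM2r ?sqr_ge0// lerNl -normrN ler_norm.
  by move: B0; rewrite ler_norml -/C0 => /andP[]; lra.
have st : s <= t by rewrite /s; lra.
have tT : t - s < 2 * h by rewrite /s; lra.
have := wsol_upper sl_ge0 sl_le_sb fM k0 fk (ltW s0) st tT K0 main.
rewrite -gw -/s.
have -> : t - s = h by rewrite /s; ring.
have -> : 2 * (b + 6 * K * sb ^+ 2 * (2 * h)) = gxx t x + e + 24 * K * sb ^+ 2 * h.
  by rewrite /b; field.
move=> H.
have h3 := G_add sl_ge0 sl_le_sb (gxx t x + e) (24 * K * sb ^+ 2 * h).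
have h4 : G (24 * K * sb ^+ 2 * h) = 12 * K * sb ^+ 4 * h.
  rewrite G_nneg; first by field.
  by move: (ltW K0) (ltW h0) => ? ?; pos.
have h5 : 12 * K * sb ^+ 4 * h <= 12 * K * sb ^+ 4 * Num.sqrt h.
  rewrite ler_wpM2l ?sq_le//; first by move: (ltW K0) => ?; pos.
have : h * G (gxx t x + e + 24 * K * sb ^+ 2 * h) <= h * (G (gxx t x + e) + 12 * K * sb ^+ 4 * Num.sqrt h).
  by rewrite ler_wpM2l ?(ltW h0)//; lra.
lra.
Qed.

Lemma wsol_super : viscosity_supersolution sl sb (wsol sl sb f).
Proof.
move=> g gt gx gxx t x Cg t0 gw gle.
suff main q : q = sl \/ q = sb -> 2^-1 * q ^+ 2 * gxx t x <= gt t x.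
  by rewrite subr_ge0; apply: G_le; apply: main; [left|right].
move=> qE; have q0 : 0 <= q by case: qE => ->.
apply/ler_addgt0Pr => e' e'0.
have [|e e0 he] := @small_eta _ e' (2^-1 * q ^+ 2) e'0; first by pos.
suff : 2^-1 * q ^+ 2 * (gxx t x - e) <= gt t x by lra.
have [rho rho0 hrho] := C12_box x Cg t0 e0.
pose r := rho / 2; have r0 : 0 < r by rewrite /r; lra.
pose C0 := `|g t x| + 1; pose C1 := `|gx t x| + 1; pose b := (gxx t x - e) / 2.
have C00 : 0 <= C0 by rewrite /C0; pos.
have C10 : 0 <= C1 by rewrite /C1; pos.
pose K := (M + C0) / r ^+ 4 + C1 / r ^+ 3 + `|b| / r ^+ 2 + 1.
have K0 : 0 < K by rewrite /K; pos.
have [[d1 _ _] _] := Cg t x t0.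
apply: (is_derive_ge_left (rho := Num.min rho 1) (C := 3 * K * q ^+ 4) d1).
- by rewrite lt_min rho0 ltr01.
- by move: (ltW K0) => ?; pos.
move=> h h0; rewrite lt_min => /andP[hr h1]; set s := t - h.
have ts : `|t - s| < rho by rewrite /s opprB addrC subrK gtr0_norm.
have [|s0 B0 B1 _] := hrho s x ts; first by rewrite subrr normr0.
have main y : g s x + gx s x * (y - x) + b * (y - x) ^+ 2 - K * (y - x) ^+ 4 <= wsol sl sb f s y.
  have [yr|yr] := leP `|y - x| r.
    apply: le_trans (gle s y s0).
    have d2' z : is_derive z 1 (g s) (gx s z) by have [[]] := Cg s z s0.
    have d3' z : is_derive z 1 (gx s) (gxx s z) by have [[]] := Cg s z s0.
    have := @taylor2_ge R (fun z => g s (x + z)) (fun z => gx s (x + z)) (fun z => gxx s (x + z))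
      (gxx t x - e) r (y - x) (is_derive_shift x d2') (is_derive_shift x d3') _ yr.
    rewrite addr0 (addrC x) subrK => H.
    have : 0 <= K * (y - x) ^+ 4 by rewrite mulr_ge0 ?(ltW K0)// exprn_even_ge0.
    have : g s x + gx s x * (y - x) + (gxx t x - e) / 2 * (y - x) ^+ 2 <= g s y.
      apply: H => z zr; have [|_ _ _] := hrho s (x + z) ts.
        by rewrite opprD addrA subrr add0r normrN /r in zr *; lra.
      by rewrite ler_norml => /andP[? _]; lra.
    by rewrite /b; lra.
  have := quartic_tail b M0 C00 C10 r0 (ltW yr); rewrite -/K.
  have -> : `|y - x| ^+ 4 = (y - x) ^+ 4 by rewrite -normrX ger0_norm// exprn_even_ge0.
  have -> : `|y - x| ^+ 2 = (y - x) ^+ 2 by rewrite -normrX ger0_norm// sqr_ge0.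
  have := wsol_bnd sl sb fM s y; rewrite ler_norml => /andP[wM _].
  have h2 : gx s x * (y - x) <= C1 * `|y - x|.
    by apply: (le_trans (ler_norm _)); rewrite normrM ler_wpM2r.
  have h3 : b * (y - x) ^+ 2 <= `|b| * (y - x) ^+ 2.
    by rewrite ler_wpM2r ?sqr_ge0// ler_norm.
  by move: B0; rewrite ler_norml -/C0 => /andP[]; lra.
have st : s <= t by rewrite /s; lra.
have := wsol_lower sl_ge0 sl_le_sb fM k0 fk qE (ltW s0) st K0 main.
rewrite -gw -/s.
have -> : t - s = h by rewrite /s; ring.
move=> H.
have h5 : 3 * K * q ^+ 4 * h <= 3 * K * q ^+ 4 * Num.sqrt h.
  rewrite ler_wpM2l ?sq_le//; first by move: (ltW K0) => ?; pos.
have : h * (2^-1 * q ^+ 2 * (gxx t x - e) - 3 * K * q ^+ 4 * Num.sqrt h) <=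
  h * (2^-1 * q ^+ 2 * (gxx t x - e) - 3 * K * q ^+ 4 * h).
  by rewrite ler_wpM2l ?(ltW h0)//; lra.
by rewrite /b in H; lra.
Qed.

Lemma wsol_solution : Gheat_solution sl sb f (wsol sl sb f).
Proof.
split.
- by apply/within_ext; exact: wsol_continuous k0 fk.
- by exists M => t y _; exact: wsol_bnd.
- by move=> y; exact: wsol0 fM y.
- exact: wsol_sub.
- exact: wsol_super.
Qed.

Lemma Gheat_solution_wsol (u : R -> R -> R) : Gheat_solution sl sb f u ->
  forall t x, 0 <= t -> u t x = wsol sl sb f t x.
Proof.
move=> [/within_ext cu [N bu] u0 subu supu] t x t0.
have [/within_ext cw _ w0 subw supw] := wsol_solution.
pose L := Num.max N M.
have bu' s y : 0 <= s -> `|u s y| <= L by move=> s0; rewrite /L le_max bu.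
have bw s y : 0 <= s -> `|wsol sl sb f s y| <= L.
  by move=> s0; rewrite /L le_max (wsol_bnd sl sb fM) orbT.
apply/eqP; rewrite eq_le; apply/andP; split.
  by apply: (comparison sl_ge0 sl_le_sb cu bu' subu cw bw supw fk) => // y; rewrite ?u0 ?w0.
by apply: (comparison sl_ge0 sl_le_sb cw bw subw cu bu' supu fk) => // y; rewrite ?u0 ?w0.
Qed.

Lemma GheatE t x : 0 <= t -> Gheat sl sb f t x = wsol sl sb f t x.
Proof.
move=> t0; rewrite /Gheat; case: xgetP => [u _ /Gheat_solution_wsol|/(_ _ wsol_solution)//].
exact.
Qed.

End viscosity.

(** * The G-heat semigroup *)

Section Gheat_properties.
Context {R : realType}.
Variables (sl sb : R).
Hypotheses (sl_ge0 : 0 <= sl) (sl_le_sb : sl <= sb).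
Implicit Types (f g : R -> R) (d e k s t x y z M : R) (n : nat).
Local Notation T := (Gheat sl sb).

Let sb_ge0 : 0 <= sb. Proof. exact: le_trans sl_le_sb. Qed.

Definition bdlip M k f := [/\ forall x, `|f x| <= M, 0 <= k & lipschitz1 k f].

Lemma Gheat_cvg M k f d : bdlip M k f -> 0 <= d ->
  forall x, wapp sl sb f n d x @[n --> UN] --> T f d x.
Proof. by case=> fM k0 fk d0 x; rewrite (GheatE sl_ge0 sl_le_sb fM k0 fk)//; exact: wapp_cvg fM _ _. Qed.

Arguments Gheat_cvg {M k f d} _ _ x.

Lemma Gheat_bdlip M k f d : bdlip M k f -> 0 <= d -> bdlip M k (T f d).
Proof.
move=> fb d0; have [fM k0 fk] := fb.
have E : T f d = wsol sl sb f d by apply/funext => x; exact: (GheatE sl_ge0 sl_le_sb fM k0 fk).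
by rewrite E; split=> //; [exact: wsol_bnd|exact: wsol_lip].
Qed.

Lemma Gheat0 M k f : bdlip M k f -> T f 0 = f.
Proof.
by case=> fM k0 fk; apply/funext => x; rewrite (GheatE sl_ge0 sl_le_sb fM k0 fk)// (wsol0 sl sb fM).
Qed.

Lemma Gheat_le M k N l f g d x : bdlip M k f -> bdlip N l g -> 0 <= d ->
  (forall y, f y <= g y) -> T f d x <= T g d x.
Proof.
move=> fb gb d0 fg; apply: (UN_le (Gheat_cvg fb d0 x) (Gheat_cvg gb d0 x)).
by apply: nearW => n; exact: iter_scheme_le.
Qed.

Lemma Gheat_cst (c d x : R) : 0 <= d -> T (fun=> c) d x = c.
Proof.
move=> d0; have cb : bdlip `|c| 0 (fun=> c) by split=> // y z; rewrite subrr normr0 mul0r.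
apply: (UN_unique (Gheat_cvg cb d0 x)); have E n : c = wapp sl sb (fun=> c) n d x by rewrite /wapp iter_scheme_cst.
exact: (UN_ext E (@UN_cst R c)).
Qed.

Lemma iter_scheme_add h f g n x :
  iter n (scheme sl sb h) (fun y => f y + g y) x <=
  iter n (scheme sl sb h) f x + iter n (scheme sl sb h) g x.
Proof.
elim: n x => // n ih x; rewrite !iterS.
apply: (le_trans (scheme_le _ _ _ ih x)); rewrite /scheme ge_max.
have ad a (p q : R -> R) : walk a (fun y => p y + q y) x = walk a p x + walk a q x.
  by rewrite /walk; ring.
by rewrite !ad !lerD ?le_max ?lexx ?orbT.
Qed.

Lemma Gheat_add M k N l f g d x : bdlip M k f -> bdlip N l g -> 0 <= d ->
  T (fun y => f y + g y) d x <= T f d x + T g d x.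
Proof.
move=> fb gb d0.
have fgb : bdlip (M + N) (k + l) (fun y => f y + g y).
  have [fM k0 fk] := fb; have [gM l0 gl] := gb; split.
  - by move=> y; apply: (le_trans (ler_normD _ _)); exact: lerD.
  - exact: addr_ge0.
  - move=> y z; have -> : f y + g y - (f z + g z) = (f y - f z) + (g y - g z) by ring.
    by apply: (le_trans (ler_normD _ _)); rewrite mulrDl lerD.
have c := UN_add (Gheat_cvg fb d0 x) (Gheat_cvg gb d0 x).
apply: (UN_le (Gheat_cvg fgb d0 x) c); apply: nearW => n; exact: iter_scheme_add.
Qed.

Lemma Gheat_scale M k f d (c : R) x : bdlip M k f -> 0 <= d -> 0 <= c ->
  T (fun y => c * f y) d x = c * T f d x.
Proof.
move=> fb d0 c0.
have cfb : bdlip (c * M) (c * k) (fun y => c * f y).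
  have [fM k0 fk] := fb; split.
  - by move=> y; rewrite normrM (ger0_norm c0) ler_wpM2l.
  - exact: mulr_ge0.
  - by move=> y z; rewrite -mulrBr normrM (ger0_norm c0) -mulrA ler_wpM2l.
have E h n y : iter n (scheme sl sb h) (fun y => c * f y) y = c * iter n (scheme sl sb h) f y.
  elim: n y => // n ih y; rewrite !iterS.
  have -> : iter n (scheme sl sb h) (fun y => c * f y) = fun y => c * iter n (scheme sl sb h) f y.
    exact/funext.
  have w a : walk a (fun y => c * iter n (scheme sl sb h) f y) y = c * walk a (iter n (scheme sl sb h) f) y.
    by rewrite /walk; ring.
  by rewrite /scheme !w maxr_pMr.
apply: (UN_unique (Gheat_cvg cfb d0 x)); have E' n : c * wapp sl sb f n d x = wapp sl sb (fun y => c * f y) n d x by rewrite /wapp E.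
exact: (UN_ext E' (@UN_scale R _ _ c (Gheat_cvg fb d0 x))).
Qed.

Lemma GheatB_cst M k f d (c : R) x : bdlip M k f -> 0 <= d ->
  T (fun y => f y - c) d x = T f d x - c.
Proof.
move=> fb d0.
have fcb : bdlip (M + `|c|) k (fun y => f y - c).
  have [fM k0 fk] := fb; split => //.
  - by move=> y; apply: (le_trans (ler_normB _ _)); rewrite lerD2r.
  - by move=> y z; rewrite opprB addrA subrK; exact: fk.
apply: (UN_unique (Gheat_cvg fcb d0 x)).
have E n : wapp sl sb f n d x - c = wapp sl sb (fun y => f y - c) n d x by rewrite /wapp iter_schemeB_cst.
exact: (UN_ext E (UN_add (Gheat_cvg fb d0 x) (@UN_cst R (- c)))).
Qed.

Lemma Gheat_shift M k f d e x : bdlip M k f -> 0 <= d ->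
  T (fun y => f (y + e)) d x = T f d (x + e).
Proof.
move=> fb d0.
have fcb : bdlip M k (fun y => f (y + e)).
  have [fM k0 fk] := fb; split => // y z.
  by apply: (le_trans (fk _ _)); rewrite opprD addrACA subrr addr0.
apply: (UN_unique (Gheat_cvg fcb d0 x)); apply: (UN_ext _ (Gheat_cvg fb d0 (x + e))) => n.
by rewrite /wapp iter_scheme_shift.
Qed.

Lemma Gheat_dist M k N l f g d (c : R) x : bdlip M k f -> bdlip N l g -> 0 <= d ->
  (forall y, `|f y - g y| <= c) -> `|T f d x - T g d x| <= c.
Proof.
move=> fb gb d0 fg; apply: (UN_norm_le (Gheat_cvg fb d0 x) (Gheat_cvg gb d0 x)).
apply: nearW => n; rewrite /wapp.
have h1 : iter (steps n d) (scheme sl sb (mesh n)) f x - c <= iter (steps n d) (scheme sl sb (mesh n)) g x.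
  rewrite -iter_schemeB_cst; apply: iter_scheme_le => y.
  by have := fg y; rewrite ler_norml => /andP[]; lra.
have h2 : iter (steps n d) (scheme sl sb (mesh n)) g x - c <= iter (steps n d) (scheme sl sb (mesh n)) f x.
  rewrite -iter_schemeB_cst; apply: iter_scheme_le => y.
  by have := fg y; rewrite ler_norml => /andP[]; lra.
by rewrite ler_norml; apply/andP; split; lra.
Qed.

(** The solution restarted at time [s] is again a viscosity solution, by [sub_shift] and
    [super_shift], with initial value [T f s]; uniqueness concludes. *)
Lemma Gheat_semigroup M k f s t : bdlip M k f -> 0 <= s -> 0 <= t ->
  T (T f s) t = T f (s + t).
Proof.
move=> fb s0 t0; apply/funext => x; have [fM k0 fk] := fb.
have [gM _ gk] := Gheat_bdlip fb s0.
have [/within_ext cw _ w0 subw supw] := wsol_solution sl_ge0 sl_le_sb fM k0 fk.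
have bw s' y : 0 <= s' -> `|wsol sl sb f s' y| <= M by move=> ?; exact: wsol_bnd.
have shift : Gheat_solution sl sb (T f s) (fun t => wsol sl sb f (s + t)).
  split.
  - by apply/(within_ext (fun t => wsol sl sb f (s + t))); exact: ext_continuous_shift.
  - by exists M => t' y t'0; apply: bw; exact: addr_ge0.
  - by move=> y; rewrite addr0 (GheatE sl_ge0 sl_le_sb fM k0 fk).
  - exact: sub_shift s0 bw subw.
  - exact: super_shift s0 bw supw.
rewrite (GheatE sl_ge0 sl_le_sb gM k0 gk)//.
rewrite -(Gheat_solution_wsol sl_ge0 sl_le_sb gM k0 gk shift)//.
by rewrite (GheatE sl_ge0 sl_le_sb fM k0 fk)// addr_ge0.
Qed.

Lemma Gheat_moment M k f d x (c0 c2 c4 : R) : bdlip M k f -> 0 <= d -> 0 <= c2 -> 0 < c4 ->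
  (forall y, f y <= c0 + c2 * (y - x) ^+ 2 + c4 * (y - x) ^+ 4) ->
  T f d x <= c0 + d * (sb ^+ 2 * (c2 + 6 * c4 * sb ^+ 2 * d)).
Proof.
move=> fb d0 c20 c40 fQ; have [fM k0 fk] := fb.
apply/ler_addgt0Pr => e e0.
have [|q q0 hq] := @small_eta _ e (d * (6 * c4 * sb ^+ 4)) e0.
  by move: (ltW c40) => ?; pos.
rewrite (GheatE sl_ge0 sl_le_sb fM k0 fk)//.
have main y : wsol sl sb f 0 y <= c0 + 0 * (y - x) + c2 * (y - x) ^+ 2 + c4 * (y - x) ^+ 4.
  by rewrite (wsol0 sl sb fM) mul0r addr0.
have := @wsol_upper R sl sb sl_ge0 sl_le_sb f M k fM k0 fk 0 d (d + q) x c0 0 c2 c4 (lexx 0) d0 _ c40 main.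
rewrite subr0 G_nneg; last by move: (ltW c40) (ltW q0) => ? ?; pos.
have dq : d < d + q by lra.
by move=> /(_ dq); lra.
Qed.

End Gheat_properties.

(** * Conditional G-expectations of cylindrical variables *)

Section cylinder_functionals.
Context {R : realType}.
Implicit Types (f g : R -> R) (Phi Psi : (R -> R) -> R) (ts us : seq R).

Definition upd f (t x : R) : R -> R := fun s => if s == t then x else f s.

Lemma upd_same f t x : upd f t x t = x.
Proof. by rewrite /upd eqxx. Qed.

Lemma upd_id f t : upd f t (f t) = f.
Proof. by apply/funext => s; rewrite /upd; case: eqP => [->|]. Qed.

(* A cylindrical random variable is encoded by a functional of arbitrary real
   functions, which may be changed at one time at will; see [cyl_eq]. *)
Definition cyl (M L : R) ts Phi : Prop :=
  [/\ forall f, `|Phi f| <= M, 0 <= L &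
      forall f g, `|Phi f - Phi g| <= L * \sum_(s <- ts) `|f s - g s|].

Lemma cyl_agree M L ts Phi f g : cyl M L ts Phi ->
  (forall s, s \in ts -> f s = g s) -> Phi f = Phi g.
Proof.
case=> _ _ PL fg; apply/eqP; rewrite -subr_eq0 -normr_le0.
apply: (le_trans (PL f g)); rewrite big_seq big1 ?mulr0// => s sts.
by rewrite fg// subrr normr0.
Qed.

Lemma cyl_le M L ts Phi M' L' ts' : M <= M' -> L <= L' -> subseq ts ts' ->
  cyl M L ts Phi -> cyl M' L' ts' Phi.
Proof.
move=> MM LL sub [PM L0 PL]; split.
- by move=> f; apply: (le_trans (PM f)).
- exact: le_trans LL.
- move=> f g; apply: (le_trans (PL f g)).
  apply: ler_pM => //; first exact: sumr_ge0.
  elim: ts' ts sub {PL} => [|a ts' ih] [|b ts]//= sub; rewrite ?big_nil//.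
    exact: sumr_ge0.
  rewrite [leRHS]big_cons; case: eqP sub => [<-|_] sub.
    by rewrite big_cons lerD2l; exact: ih.
  by apply: (le_trans (ih _ sub)); rewrite lerDr.
Qed.

Lemma cyl_upd M L ts Phi f t : cyl M L ts Phi ->
  bdlip M (L * (size ts)%:R) (fun y => Phi (upd f t y)).
Proof.
move=> [PM L0 PL]; split => //; first by rewrite mulr_ge0.
move=> y z; apply: (le_trans (PL _ _)).
rewrite -mulrA ler_wpM2l//.
have -> : (size ts)%:R * `|y - z| = \sum_(s <- ts) `|y - z|.
  by rewrite big_const_seq count_predT iter_addr_0 mulr_natl.
apply: ler_sum => s _; rewrite /upd; case: eqP => // _.
by rewrite subrr normr0.
Qed.

Lemma cyl_add M L ts Phi N K us Psi : cyl M L ts Phi -> cyl N K us Psi ->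
  cyl (M + N) (L + K) (ts ++ us) (fun f => Phi f + Psi f).
Proof.
move=> [PM L0 PL] [QM K0 QL]; split.
- by move=> f; apply: (le_trans (ler_normD _ _)); exact: lerD.
- exact: addr_ge0.
- move=> f g; rewrite opprD addrACA; apply: (le_trans (ler_normD _ _)).
  rewrite big_cat mulrDl /= !mulrDr.
  have s0 (u : seq R) : 0 <= \sum_(s <- u) `|f s - g s| by exact: sumr_ge0.
  move: (PL f g) (QL f g) (mulr_ge0 L0 (s0 us)) (mulr_ge0 K0 (s0 ts)).
  lra.
Qed.

Lemma cyl_comp2 M L ts Phi N K us Psi (h : R -> R -> R) (k M' : R) :
  cyl M L ts Phi -> cyl N K us Psi -> 0 <= k ->
  (forall x y, `|x| <= M -> `|y| <= N -> `|h x y| <= M') ->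
  (forall x y x' y', `|x| <= M -> `|y| <= N -> `|x'| <= M -> `|y'| <= N ->
     `|h x y - h x' y'| <= k * (`|x - x'| + `|y - y'|)) ->
  cyl M' (k * (L + K)) (ts ++ us) (fun f => h (Phi f) (Psi f)).
Proof.
move=> [PM L0 PL] [QM K0 QL] k0 hM hk; split.
- by move=> f; exact: hM.
- by rewrite mulr_ge0// addr_ge0.
- move=> f g; apply: (le_trans (hk _ _ _ _ (PM f) (QM f) (PM g) (QM g))).
  rewrite -mulrA ler_wpM2l// big_cat mulrDl /= !mulrDr.
  have s0 (u : seq R) : 0 <= \sum_(s <- u) `|f s - g s| by exact: sumr_ge0.
  move: (PL f g) (QL f g) (mulr_ge0 L0 (s0 us)) (mulr_ge0 K0 (s0 ts)).
  lra.
Qed.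

End cylinder_functionals.

(** * Backward induction on functionals of functions *)

Section backward_induction.
Context {R : realType}.
Variables (sl sb : R).
Hypotheses (sl_ge0 : 0 <= sl) (sl_le_sb : sl <= sb).
Implicit Types (f g : R -> R) (Phi Psi : (R -> R) -> R) (ts us : seq R).

Local Notation T f := (Gheat sl sb f).

(** The backward induction written on values instead of increments: [f] is known at time [t], its
    value at the next observation time [a] is integrated out by the heat flow of duration a - t
    started at [f t], and [upd] records that value. *)
Fixpoint Ev (t : R) us Phi f : R :=
  if us is a :: us' then T (fun y => Ev a us' Phi (upd f a y)) (a - t) (f t)
  else Phi f.

Lemma Ev_cyl M L ts Phi t us : path.path <=%R t us -> cyl M L ts Phi ->
  exists L', cyl M L' (t :: ts) (Ev t us Phi).
Proof.
move=> + PC; elim: us t => [t _|a us ih t /= /andP[ta ps]].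
  by exists L; exact: cyl_le (subseq_cons _ _) PC.
have [L' PC'] := ih a ps; have [PM L0 PL] := PC'.
have d0 : 0 <= a - t by rewrite subr_ge0.
have b f := cyl_upd f a PC'.
exists (L' + L' * (size (a :: ts))%:R); split.
- by move=> f; have [] := Gheat_bdlip sl_ge0 sl_le_sb (b f) d0.
- by rewrite addr_ge0// mulr_ge0.
move=> f g; rewrite big_cons.
have h1 : `|T (fun y => Ev a us Phi (upd f a y)) (a - t) (f t)
          - T (fun y => Ev a us Phi (upd g a y)) (a - t) (f t)|
    <= L' * \sum_(s <- ts) `|f s - g s|.
  apply: (Gheat_dist sl_ge0 sl_le_sb _ (b f) (b g) d0) => y.
  apply: (le_trans (PL _ _)); rewrite ler_wpM2l// big_cons !upd_same subrr normr0 add0r.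
  apply: ler_sum => s _; rewrite /upd; case: eqP => // _.
  by rewrite subrr normr0.
have h2 := (let: And3 _ _ h := Gheat_bdlip sl_ge0 sl_le_sb (b g) d0 in h) (f t) (g t).
have s0 : 0 <= \sum_(s <- ts) `|f s - g s| by exact: sumr_ge0.
have := ler_distD (T (fun y => Ev a us Phi (upd g a y)) (a - t) (f t))
  (T (fun y => Ev a us Phi (upd f a y)) (a - t) (f t))
  (T (fun y => Ev a us Phi (upd g a y)) (a - t) (g t)).
move: h1 h2 => /=; set x := `|f t - g t|; have x0 : 0 <= x by exact: normr_ge0.
have n0 : 0 <= (size ts).+1%:R :> R by [].
move: (mulr_ge0 L0 x0) (mulr_ge0 L0 s0) (mulr_ge0 (mulr_ge0 L0 n0) s0); lra.
Qed.

Lemma Ev_bdlip M L ts Phi t us f s : path.path <=%R t us -> cyl M L ts Phi ->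
  exists k, bdlip M k (fun y => Ev t us Phi (upd f s y)).
Proof.
move=> ps PC; have [L' PC'] := Ev_cyl ps PC.
by eexists; exact: cyl_upd PC'.
Qed.

Lemma Ev_ext Phi Psi t us f : path.path <%R t us ->
  (forall g, (forall s, s <= t -> g s = f s) -> Phi g = Psi g) ->
  Ev t us Phi f = Ev t us Psi f.
Proof.
elim: us t f => [t f _ e|a us ih t f /= /andP[ta ps] e]; first exact: e.
congr (Gheat _ _ _ _ _); apply/funext => y; apply: ih => // g gf.
apply: e => s st; rewrite gf /upd ?(le_trans st (ltW ta))//.
by case: eqP => // sa; move: st; rewrite sa leNgt ta.
Qed.

Lemma Ev_dep M L ts Phi t us f g : path.path <%R t us -> cyl M L ts Phi ->
  f t = g t -> (forall s, s \in ts -> s \notin us -> f s = g s) ->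
  Ev t us Phi f = Ev t us Phi g.
Proof.
move=> + PC; elim: us t f g => [t f g _ _ fg|a us ih t f g /= /andP[ta ps] ft fg].
  by apply: (cyl_agree PC) => s /fg; exact.
rewrite ft; congr (Gheat _ _ _ _ _); apply/funext => y; apply: ih => //.
  by rewrite !upd_same.
move=> s sts sus; rewrite /upd; case: eqP => // /eqP sa.
by rewrite fg// inE negb_or sa.
Qed.

Lemma lt_path_le (t : R) us : path.path <%R t us -> path.path <=%R t us.
Proof. by apply: sub_path => x y; exact: ltW. Qed.

Lemma lt_path_gt (t : R) us s : path.path <%R t us -> s \in us -> t < s.
Proof. by move=> /(order_path_min lt_trans)/allP; exact. Qed.

Lemma le_path_ge (t : R) us s : path.path <=%R t us -> s \in us -> t <= s.
Proof. by move=> /(order_path_min le_trans)/allP; exact. Qed.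

Lemma Ev_skip M L ts Phi t us f a : path.path <%R a us -> t <= a ->
  cyl M L ts Phi -> a \notin ts ->
  T (fun y => Ev a us Phi (upd f a y)) (a - t) (f t) = Ev t us Phi f.
Proof.
move=> + ta PC ats.
have d0 : 0 <= a - t by rewrite subr_ge0.
case: us => [_|b us /= /andP[ab ps]].
  transitivity (T (fun=> Phi f) (a - t) (f t)).
    congr (Gheat _ _ _ _ _); apply/funext => y; apply: (cyl_agree PC) => s sts.
    by rewrite /upd; case: eqP sts ats => // -> ->.
  exact: Gheat_cst.
have bl g : exists k, bdlip M k (fun z => Ev b us Phi (upd g b z)).
  exact: Ev_bdlip (lt_path_le ps) PC.
transitivity (T (T (fun z => Ev b us Phi (upd f b z)) (b - a)) (a - t) (f t)).
  congr (Gheat _ _ _ _ _); apply/funext => y; rewrite upd_same.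
  congr (Gheat _ _ _ _ _); apply/funext => z.
  apply: (Ev_dep ps PC); first by rewrite !upd_same.
  move=> s sts sus; rewrite /upd; case: eqP => // _; case: eqP => // sa.
  by move: sts ats; rewrite sa => ->.
have [k bk] := bl f.
rewrite (Gheat_semigroup sl_ge0 sl_le_sb bk) ?subr_ge0//; last exact: ltW.
by congr (Gheat _ _ _ _ _); ring.
Qed.

Lemma Ev_merge M L ts Phi t us us2 f : cyl M L ts Phi ->
  path.path <%R t us -> path.path <=%R t us2 -> {subset us <= us2} ->
  (forall s, s \in ts -> t < s -> s \in us) ->
  Ev t us2 Phi f = Ev t us Phi f.
Proof.
move=> PC; elim: us2 t us f => [|a us2 ih] t us f pus.
  by case: us pus => // b us _ _ /(_ b); rewrite !inE eqxx => /(_ isT).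
move=> /= /andP[ta ps] sub cov.
have [at_|at_] := eqVneq a t.
  subst a; rewrite subrr.
  have [k bk] := Ev_bdlip f t ps PC.
  rewrite (Gheat0 sl_ge0 sl_le_sb bk) upd_id; apply: ih => // s sus.
  by move: (sub s sus); rewrite inE => /orP[/eqP st|//]; move: (lt_path_gt pus sus); rewrite st ltxx.
have {}ta : t < a by rewrite lt_neqAle eq_sym at_.
case: us pus sub cov => [_ _ cov|b us /= /andP[tb pus] sub cov].
  have E y : Ev a us2 Phi (upd f a y) = Ev a [::] Phi (upd f a y).
    apply: ih => // s sts sa; exact: (cov s sts (lt_trans ta sa)).
  rewrite (funext E); apply: (Ev_skip f _ (ltW ta) PC) => //.
  by apply/negP => /cov/(_ ta).
have [ba|ba] := eqVneq b a.
  subst b; congr (Gheat _ _ _ _ _); apply/funext => y; apply: ih => //.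
  - move=> s sus; move: (sub s); rewrite !inE sus orbT => /(_ isT)/orP[/eqP sa|//].
    by move: (lt_path_gt pus sus); rewrite sa ltxx.
  - move=> s sts sa; move: (cov s sts (lt_trans ta sa)); rewrite inE => /orP[/eqP e|//].
    by move: sa; rewrite e ltxx.
have ab : a < b.
  rewrite lt_neqAle eq_sym ba /=; move: (sub b); rewrite !inE eqxx => /(_ isT).
  by rewrite (negbTE ba) /=; exact: le_path_ge.
have pb : path.path <%R a (b :: us) by rewrite /= ab.
have E y : Ev a us2 Phi (upd f a y) = Ev a (b :: us) Phi (upd f a y).
  apply: ih => //.
  - move=> s sus; move: (sub s sus); rewrite inE => /orP[/eqP sa|//].
    by move: (lt_path_gt pb sus); rewrite sa ltxx.
  - by move=> s sts sa; exact: (cov s sts (lt_trans ta sa)).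
rewrite (funext E); apply: (Ev_skip f pb (ltW ta) PC).
apply/negP => /cov/(_ ta); rewrite inE eq_sym (negbTE ba) /= => aus.
by move: (lt_path_gt pb (mem_behead (s := b :: us) aus)); rewrite ltxx.
Qed.

Lemma Ev_cat t us1 us2 Phi f :
  Ev t (us1 ++ us2) Phi f = Ev t us1 (Ev (last t us1) us2 Phi) f.
Proof.
elim: us1 t f => //= a us1 ih t f.
by congr (Gheat _ _ _ _ _); apply/funext => y; exact: ih.
Qed.

Lemma Ev_le M L ts Phi N K ts' Psi t us f : cyl M L ts Phi -> cyl N K ts' Psi ->
  path.path <%R t us -> (forall g, (forall s, s <= t -> g s = f s) -> Phi g <= Psi g) ->
  Ev t us Phi f <= Ev t us Psi f.
Proof.
move=> PC QC; elim: us t f => [t f _ /(_ f)|a us ih t f /= /andP[ta ps] e]; first exact.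
have [k bk] := Ev_bdlip f a (lt_path_le ps) PC.
have [j bj] := Ev_bdlip f a (lt_path_le ps) QC.
apply: (Gheat_le sl_ge0 sl_le_sb _ bk bj); first by rewrite subr_ge0 ltW.
move=> y; apply: ih => // g gf; apply: e => s st.
rewrite gf /upd ?(le_trans st (ltW ta))//.
by case: eqP => // sa; move: st; rewrite sa leNgt ta.
Qed.

Lemma Ev_add M L ts Phi N K ts' Psi t us f : cyl M L ts Phi -> cyl N K ts' Psi ->
  path.path <%R t us ->
  Ev t us (fun g => Phi g + Psi g) f <= Ev t us Phi f + Ev t us Psi f.
Proof.
move=> PC QC; elim: us t f => //= a us ih t f /andP[ta ps].
have [k bk] := Ev_bdlip f a (lt_path_le ps) PC.
have [j bj] := Ev_bdlip f a (lt_path_le ps) QC.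
have [i bi] := Ev_bdlip f a (lt_path_le ps) (cyl_add PC QC).
have d0 : 0 <= a - t by rewrite subr_ge0 ltW.
apply: le_trans (Gheat_add sl_ge0 sl_le_sb _ bk bj d0).
suff bs : bdlip (M + N) (k + j)
    (fun y => Ev a us Phi (upd f a y) + Ev a us Psi (upd f a y)).
  exact: (Gheat_le sl_ge0 sl_le_sb _ bi bs d0 (fun y => ih _ _ ps)).
have [[fM k0 fk] [gM j0 gj]] := (bk, bj); split.
- by move=> y; apply: (le_trans (ler_normD _ _)); exact: lerD.
- exact: addr_ge0.
move=> y z; rewrite opprD addrACA; apply: (le_trans (ler_normD _ _)).
by rewrite mulrDl; apply: lerD; [exact: fk|exact: gj].
Qed.

Lemma Ev_scale M L ts Phi t us f c : cyl M L ts Phi -> 0 <= c ->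
  path.path <%R t us ->
  Ev t us (fun g => c * Phi g) f = c * Ev t us Phi f.
Proof.
move=> PC c0; elim: us t f => //= a us ih t f /andP[ta ps].
have [k bk] := Ev_bdlip f a (lt_path_le ps) PC.
have d0 : 0 <= a - t by rewrite subr_ge0 ltW.
rewrite -(Gheat_scale sl_ge0 sl_le_sb _ bk d0 c0).
by congr (Gheat _ _ _ _ _); apply/funext => y; exact: ih.
Qed.

Lemma Ev_subc M L ts Phi t us f c : cyl M L ts Phi ->
  path.path <%R t us ->
  Ev t us (fun g => Phi g - c) f = Ev t us Phi f - c.
Proof.
move=> PC; elim: us t f => //= a us ih t f /andP[ta ps].
have [k bk] := Ev_bdlip f a (lt_path_le ps) PC.
have d0 : 0 <= a - t by rewrite subr_ge0 ltW.
rewrite -(GheatB_cst sl_ge0 sl_le_sb c _ bk d0).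
by congr (Gheat _ _ _ _ _); apply/funext => y; exact: ih.
Qed.

Lemma le_path_last (t : R) us s : path.path <=%R t us -> s \in t :: us -> s <= last t us.
Proof.
elim: us t s => [t s _|a us ih t s /= /andP[ta ps]]; first by rewrite inE => /eqP ->.
rewrite inE => /orP[/eqP ->|]; last exact: ih.
by apply: (le_trans ta); apply: ih => //; rewrite inE eqxx.
Qed.

Lemma bounded_lipschitz_rcons m phi (xs : seq R) : size xs = m ->
  bounded_lipschitz m.+1 phi -> exists M k, bdlip M k (fun y => phi (rcons xs y)).
Proof.
move=> sx [[M PM] [L PL]]; exists M, `|L|; split => //.
  by move=> y; apply: PM; rewrite size_rcons sx.
move=> y z; apply: (le_trans (PL _ _ _ _)); rewrite ?size_rcons ?sx//.
rewrite big_ord_recr /= !nth_rcons sx ltnn eqxx big1 ?add0r.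
  by rewrite ler_wpM2r// ler_norm.
by move=> i _; rewrite !nth_rcons sx ltn_ord subrr normr0.
Qed.

Lemma bounded_lipschitz_Gstep m d phi : 0 <= d ->
  bounded_lipschitz m.+1 phi -> bounded_lipschitz m (Gstep sl sb d phi).
Proof.
move=> d0 Pb; have [[M PM] [L PL]] := Pb; split.
  exists M => xs sx; have [N [k bN]] := bounded_lipschitz_rcons sx Pb.
  have b : bdlip M k (fun y => phi (rcons xs y)).
    by case: bN => ? ? ?; split => // y; apply: PM; rewrite size_rcons sx.
  by have [/(_ 0)] := Gheat_bdlip sl_ge0 sl_le_sb b d0.
exists L => xs ys sx sy.
have [N [k bN]] := bounded_lipschitz_rcons sx Pb.
have [N' [k' bN']] := bounded_lipschitz_rcons sy Pb.
apply: (Gheat_dist sl_ge0 sl_le_sb _ bN bN' d0) => y.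
apply: (le_trans (PL _ _ _ _)); rewrite ?size_rcons ?sx ?sy//.
rewrite big_ord_recr /= !nth_rcons sx sy ltnn eqxx subrr normr0 addr0.
rewrite le_eqVlt; apply/orP; left; apply/eqP; congr (_ * _); apply: eq_bigr => i _.
by rewrite !nth_rcons sx sy ltn_ord.
Qed.

Lemma bounded_lipschitz_Gsteps m phi ds : all (fun d => 0 <= d) ds ->
  bounded_lipschitz (m + size ds) phi -> bounded_lipschitz m (foldr (Gstep sl sb) phi ds).
Proof.
elim: ds m => [m _|d ds ih m /= /andP[d0 ds0]]; first by rewrite addn0.
by rewrite -addSnnS => /(ih _ ds0); exact: bounded_lipschitz_Gstep.
Qed.

(** [Giter] integrates the next increment starting from 0, [Ev] the next value starting from the
    current one; translation invariance of the heat flow relates the two. *)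
Lemma Giter_Ev M L ts Phi phi f ts1 ts2 : cyl M L ts Phi ->
  bounded_lipschitz (size ts1 + size ts2) phi ->
  (forall f, f 0 = 0 -> Phi f = phi (increments (map f (ts1 ++ ts2)))) ->
  path.sorted <=%R (0 :: ts1 ++ ts2) -> f 0 = 0 ->
  foldr (Gstep sl sb) phi (pairmap (fun a b => b - a) (last 0 ts1) ts2)
    (increments (map f ts1)) = Ev (last 0 ts1) ts2 Phi f.
Proof.
move=> PC; elim: ts2 ts1 f => [|s ts2 ih] ts1 f Pb PE so f0 /=.
  by rewrite PE ?cats0.
have PE' g : g 0 = 0 -> Phi g = phi (increments (map g (rcons ts1 s ++ ts2))).
  by rewrite cat_rcons; exact: PE.
have so' : path.sorted <=%R (0 :: rcons ts1 s ++ ts2) by rewrite cat_rcons.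
have Pb' : bounded_lipschitz (size (rcons ts1 s) + size ts2) phi.
  by rewrite size_rcons addSnnS.
have [so1 ls ps] : [/\ path.path <=%R 0 ts1, last 0 ts1 <= s & path.path <=%R s ts2].
  by move: so; rewrite /= cat_path /= => /and3P[].
have step y : rcons (increments (map f ts1)) y =
    increments (rcons (map f ts1) (y + f (last 0 ts1))).
  rewrite /increments -!cats1 pairmap_cat /=.
  suff -> : last 0 (map f ts1) = f (last 0 ts1) by rewrite addrK.
  by rewrite -[in LHS]f0 last_map.
have IH g : g 0 = 0 -> foldr (Gstep sl sb) phi (pairmap (fun a b => b - a) s ts2)
    (increments (map g (rcons ts1 s))) = Ev s ts2 Phi g.
  by move=> g0; have := ih (rcons ts1 s) g Pb' PE' so' g0; rewrite last_rcons.
rewrite /Gstep -/(Gstep sl sb).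
have [k bk] := Ev_bdlip f s ps PC.
(* A repeated time is treated apart, since [upd] would overwrite a value that is already known; the
   flow then has duration 0. *)
have [sE|sn] := eqVneq s (last 0 ts1).
  rewrite -sE subrr (Gheat0 sl_ge0 sl_le_sb bk) upd_id -IH//.
  have ds0 : all (fun d => 0 <= d) (pairmap (fun a b => b - a) s ts2).
    elim: ts2 s ps {so ih Pb PE PE' so' Pb' ls IH bk sE} => //= a ts2 ih s /andP[sa pa].
    by rewrite subr_ge0 sa ih.
  have [||N [j bj]] := @bounded_lipschitz_rcons (size ts1) (foldr (Gstep sl sb) phi
      (pairmap (fun a b => b - a) s ts2)) (increments (map f ts1)).
  - by rewrite size_pairmap size_map.
  - by apply: bounded_lipschitz_Gsteps => //; rewrite size_pairmap addSnnS.
  rewrite (Gheat0 sl_ge0 sl_le_sb bj) step add0r -sE map_rcons.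
  by [].
have lts : last 0 ts1 < s by rewrite lt_neqAle eq_sym sn.
have d0 : 0 <= s - last 0 ts1 by rewrite subr_ge0.
have l0 : 0 <= last 0 ts1 by apply: le_path_last so1 _; rewrite inE eqxx.
have E y : foldr (Gstep sl sb) phi (pairmap (fun a b => b - a) s ts2)
    (rcons (increments (map f ts1)) y) = Ev s ts2 Phi (upd f s (y + f (last 0 ts1))).
  rewrite step -IH; last first.
    by rewrite /upd; case: eqP => // s0; move: (le_lt_trans l0 lts); rewrite s0 ltxx.
  congr (foldr _ _ _ (increments _)); rewrite map_rcons upd_same; congr rcons.
  apply/eq_in_map => z zt; rewrite /upd; case: eqP => // zs.
  have : z <= last 0 ts1 by apply: le_path_last so1 _; rewrite inE zt orbT.
  by rewrite zs leNgt lts.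
by rewrite (funext E) (Gheat_shift sl_ge0 sl_le_sb _ _ bk d0) add0r.
Qed.

End backward_induction.

(** * Cylindrical variables and their functionals *)

Section interpolation.
Context {R : realType}.
Implicit Types (f g : R -> R) (Phi Psi : (R -> R) -> R) (ts us : seq R).

(** The Newton polynomial with nodes [ts], times the positive part, so that adding a multiple of it
    to a path yields a path with unchanged values at the nodes. *)
Fixpoint bumpf ts (s : R) : R := if ts is a :: ts' then (s - a) * bumpf ts' s else Num.max s 0.

Lemma bumpf_continuous ts : continuous (bumpf ts).
Proof.
elim: ts => [|a ts ih] s /=.
  by apply: (@continuous_max _ _ id (fun=> 0)); [exact: cvg_id|exact: cvg_cst].
by apply: cvgM; [apply: cvgB; [exact: cvg_id|exact: cvg_cst]|exact: ih].
Qed.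

Lemma bumpf_le0 ts s : s <= 0 -> bumpf ts s = 0.
Proof. by move=> s0; elim: ts => [|a ts /= ->] /=; rewrite ?mulr0//; apply/max_r. Qed.

Lemma bumpf_mem ts s : s \in ts -> bumpf ts s = 0.
Proof.
elim: ts => //= a ts ih; rewrite inE => /orP[/eqP ->|/ih ->]; last by rewrite mulr0.
by rewrite subrr mul0r.
Qed.

Lemma bumpf_neq0 ts s : 0 < s -> s \notin ts -> bumpf ts s != 0.
Proof.
move=> s0; elim: ts => [|a ts ih] /=; first by rewrite max_l ?gt_eqF// ltW.
by rewrite inE negb_or => /andP[sa /ih ?]; rewrite mulf_neq0// subr_eq0.
Qed.

Lemma path_interpolation f ts : (forall s, s <= 0 -> f s = 0) ->
  exists w : Omega R, forall s, s \in ts -> pathfun w s = f s.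
Proof.
move=> f0; elim: ts => [|t ts [w wf]]; first by exists (path0 R).
have [tts|tts] := boolP (t \in ts).
  by exists w => s; rewrite inE => /orP[/eqP ->|]; exact: wf.
have [t0|t0] := leP t 0.
  exists w => s; rewrite inE => /orP[/eqP ->|]; last exact: wf.
  by rewrite f0// path_eq0.
pose g s := pathfun w s + (f t - pathfun w t) / bumpf ts t * bumpf ts s.
have gc : continuous g.
  move=> s; apply: cvgD; first exact: path_continuous.
  by apply: cvgM; [exact: cvg_cst|exact: bumpf_continuous].
have g0 s : s <= 0 -> g s = 0 by move=> s0; rewrite /g path_eq0// (bumpf_le0 ts s0) mulr0 addr0.
exists (Path gc g0) => s; rewrite inE /= /g => /orP[/eqP ->|sts].
  by rewrite divfK ?bumpf_neq0//; ring.
by rewrite (bumpf_mem sts) mulr0 addr0; exact: wf.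
Qed.

(** Random variables only see continuous paths, while [Ev] evaluates functionals at modified
    functions. The gap is closed by interpolation: the finitely many coordinates involved are those
    of a path. *)
Lemma cyl_eq M L ts Phi N K us Psi g : cyl M L ts Phi -> cyl N K us Psi ->
  (forall w : Omega R, Phi (pathfun w) = Psi (pathfun w)) ->
  (forall s, s <= 0 -> g s = 0) -> Phi g = Psi g.
Proof.
move=> PC QC PQ g0; have [w wg] := path_interpolation (ts ++ us) g0.
rewrite -(cyl_agree (f := pathfun w) PC)//; last by move=> s sts; rewrite wg// mem_cat sts.
by rewrite PQ (cyl_agree (g := g) QC)// => s sts; rewrite wg// mem_cat sts orbT.
Qed.

Lemma cyl_le_on M L ts Phi N K us Psi g : cyl M L ts Phi -> cyl N K us Psi ->
  (forall w : Omega R, Phi (pathfun w) <= Psi (pathfun w)) ->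
  (forall s, s <= 0 -> g s = 0) -> Phi g <= Psi g.
Proof.
move=> PC QC PQ g0; have [w wg] := path_interpolation (ts ++ us) g0.
rewrite -(cyl_agree (f := pathfun w) PC)//; last by move=> s sts; rewrite wg// mem_cat sts.
rewrite -(cyl_agree (f := pathfun w) QC)// => s sts.
by rewrite wg// mem_cat sts orbT.
Qed.

Definition cylindrical (t : \bar R) (X : Omega R -> R) : Prop :=
  exists M L ts Phi, [/\ cyl M L ts Phi, all (fun s => (0 <= s) && (s%:E <= t)%E) ts &
    X = fun w => Phi (pathfun w)].

Lemma sum_nth_map (h : R -> R -> R) f g ts :
  \sum_(i < size ts) h (map f ts)`_i (map g ts)`_i = \sum_(s <- ts) h (f s) (g s).
Proof.
rewrite (big_nth 0) big_mkord; apply: eq_bigr => i _.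
by rewrite !(nth_map 0).
Qed.

Lemma bounded_lipschitz_cyl ts phi : bounded_lipschitz (size ts) phi ->
  exists M L, cyl M L ts (fun f => phi (map f ts)).
Proof.
case=> -[M PM] [L PL]; exists M, `|L|; split => //.
  by move=> f; apply: PM; rewrite size_map.
move=> f g; apply: (le_trans (PL _ _ _ _)); rewrite ?size_map//.
rewrite (sum_nth_map (fun x y => `|x - y|)) ler_wpM2r ?ler_norm//.
exact: sumr_ge0.
Qed.

Lemma Lip_cylindrical (t : \bar R) X : Lip t X -> cylindrical t X.
Proof.
move=> [ts [phi [_ tst Pb ->]]]; have [M [L PC]] := bounded_lipschitz_cyl Pb.
by exists M, L, ts, (fun f => phi (map f ts)).
Qed.

Lemma ler_sum_nth (F : nat -> R) n i : (forall j, 0 <= F j) -> (i < n)%N ->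
  F i <= \sum_(j < n) F j.
Proof.
by move=> F0 ni; rewrite (bigD1 (Ordinal ni))//= lerDl; exact: sumr_ge0.
Qed.

Lemma cylindrical_Lip (t : \bar R) X : (0 <= t)%E -> cylindrical t X -> Lip t X.
Proof.
move=> t0 [M [L [ts [Phi [PC tst ->]]]]]; have [PM L0 PL] := PC.
(* Time 0 is put in front because [Lip] requires a nonempty list; a coordinate is read at the
   position of its time. *)
exists (0 :: ts), (fun xs => Phi (fun s => xs`_(index s (0 :: ts)))); split => //.
- by rewrite /= lexx t0.
- split; first by exists M => xs _; exact: PM.
  exists (L * (size ts)%:R) => xs ys sx sy; apply: (le_trans (PL _ _)).
  rewrite -mulrA ler_wpM2l//.
  pose d := \sum_(i < (size ts).+1) `|xs`_i - ys`_i|.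
  have -> : (size ts)%:R * d = \sum_(s <- ts) d.
    by rewrite big_const_seq count_predT iter_addr_0 mulr_natl.
  rewrite big_seq [leRHS]big_seq; apply: ler_sum => s sts.
  apply: (@ler_sum_nth (fun i => `|xs`_i - ys`_i|)) => //.
  by rewrite -[X in (_ < X)%N]/(size (0 :: ts)) index_mem inE sts orbT.
apply/funext => w; apply: (cyl_agree PC) => s sts.
by rewrite (nth_map 0) ?index_mem ?inE ?sts ?orbT// nth_index// inE sts orbT.
Qed.

Lemma Lip_le (s t : \bar R) X : (s <= t)%E -> Lip s X -> Lip t X.
Proof.
move=> st [ts [phi [t0 tst Pb ->]]]; exists ts, phi; split => //.
by apply/allP => r /(allP tst)/andP[-> rs] /=; exact: le_trans st.
Qed.

(** Lipschitz and bounded on bounded boxes: this covers the product, and cylindrical variables are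
    bounded. *)
Definition loc_lip (h : R -> R -> R) : Prop :=
  forall M N : R, exists k M', [/\ 0 <= k,
     forall x y, `|x| <= M -> `|y| <= N -> `|h x y| <= M' &
     forall x y x' y', `|x| <= M -> `|y| <= N -> `|x'| <= M -> `|y'| <= N ->
     `|h x y - h x' y'| <= k * (`|x - x'| + `|y - y'|)].

Lemma loc_lip_add : loc_lip (fun x y => x + y).
Proof.
move=> M N; exists 1, (M + N); split => //.
- by move=> x y xM yN; apply: (le_trans (ler_normD _ _)); exact: lerD.
- by move=> x y x' y' _ _ _ _; rewrite mul1r opprD addrACA; exact: ler_normD.
Qed.

Lemma loc_lip_mul : loc_lip (fun x y => x * y).
Proof.
move=> M N; exists (`|M| + `|N|), (M * N); split => //.
- by move=> x y xM yN; rewrite normrM ler_pM.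
- move=> x y x' y' xM yN xM' yN'.
  have -> : x * y - x' * y' = (x - x') * y + x' * (y - y') by ring.
  apply: (le_trans (ler_normD _ _)); rewrite !normrM.
  have h1 : `|x - x'| * `|y| <= `|x - x'| * `|N|.
    by rewrite ler_wpM2l//; apply: (le_trans yN); exact: ler_norm.
  have h2 : `|x'| * `|y - y'| <= `|M| * `|y - y'|.
    by rewrite ler_wpM2r//; apply: (le_trans xM'); exact: ler_norm.
  have := mulr_ge0 (normr_ge0 M) (normr_ge0 (x - x')).
  have := mulr_ge0 (normr_ge0 N) (normr_ge0 (y - y')).
  lra.
Qed.

Lemma loc_lip_max : loc_lip (fun x y => Num.max x y).
Proof.
move=> M N; exists 1, (Num.max M N); split => //.
- move=> x y xM yN; rewrite le_max.
  by case: (leP x y) => _; [rewrite yN orbT|rewrite xM].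
- have h a b a' b' : Num.max a b <= Num.max a' b' + (`|a - a'| + `|b - b'|) :> R.
    move: (ler_norm (a - a')) (ler_norm (b - b')) (normr_ge0 (a - a')) (normr_ge0 (b - b')).
    have m1 : a' <= Num.max a' b' by rewrite le_max lexx.
    have m2 : b' <= Num.max a' b' by rewrite le_max lexx orbT.
    by rewrite ge_max => *; apply/andP; split; lra.
  move=> x y x' y' _ _ _ _; rewrite mul1r ler_norml.
  by move: (h x y x' y') (h x' y' x y); rewrite !(distrC x') !(distrC y') => *; apply/andP; split; lra.
Qed.

Lemma Lip_comp2 (t : \bar R) X Y (h : R -> R -> R) : (0 <= t)%E -> loc_lip h ->
  Lip t X -> Lip t Y -> Lip t (fun w => h (X w) (Y w)).
Proof.
move=> t0 hh /Lip_cylindrical[M [L [ts [Phi [PC tst ->]]]]].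
move=> /Lip_cylindrical[N [K [us [Psi [QC ust ->]]]]].
have [k [M' [k0 hM hk]]] := hh M N.
apply: cylindrical_Lip => //.
exists M', (k * (L + K)), (ts ++ us), (fun f => h (Phi f) (Psi f)); split => //.
  exact: cyl_comp2 PC QC k0 hM hk.
by rewrite all_cat tst ust.
Qed.

Lemma Lip_cst (t : \bar R) (c : R) : (0 <= t)%E -> Lip t (fun=> c).
Proof.
move=> t0; apply: cylindrical_Lip => //.
by exists `|c|, 0, [::], (fun=> c); split => //; split => // f g; rewrite subrr normr0 mul0r.
Qed.

Lemma Lip_add (t : \bar R) X Y : (0 <= t)%E -> Lip t X -> Lip t Y -> Lip t (fun w => X w + Y w).
Proof. by move=> t0; exact: (Lip_comp2 t0 loc_lip_add). Qed.

Lemma Lip_mul (t : \bar R) X Y : (0 <= t)%E -> Lip t X -> Lip t Y -> Lip t (fun w => X w * Y w).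
Proof. by move=> t0; exact: (Lip_comp2 t0 loc_lip_mul). Qed.

Lemma Lip_max (t : \bar R) X Y : (0 <= t)%E -> Lip t X -> Lip t Y ->
  Lip t (fun w => Num.max (X w) (Y w)).
Proof. by move=> t0; exact: (Lip_comp2 t0 loc_lip_max). Qed.

Lemma Lip_scale (t : \bar R) X (c : R) : (0 <= t)%E -> Lip t X -> Lip t (fun w => c * X w).
Proof. by move=> t0 LX; apply: Lip_mul => //; exact: Lip_cst. Qed.

Lemma Lip_opp (t : \bar R) X : (0 <= t)%E -> Lip t X -> Lip t (fun w => - X w).
Proof.
move=> t0 LX; have -> : (fun w => - X w) = fun w => -1 * X w by apply/funext => w; rewrite mulN1r.
exact: Lip_scale.
Qed.

Lemma Lip_sub (t : \bar R) X Y : (0 <= t)%E -> Lip t X -> Lip t Y -> Lip t (fun w => X w - Y w).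
Proof. by move=> t0 LX LY; apply: Lip_add => //; exact: Lip_opp. Qed.

Lemma Lip_bounded (t : \bar R) X : Lip t X -> exists2 M : R, 0 <= M & forall w, `|X w| <= M.
Proof.
move=> /Lip_cylindrical[M [L [ts [Phi [[PM _ _] _ ->]]]]].
by exists M => [|w //]; exact: le_trans (PM (pathfun (path0 R))).
Qed.

End interpolation.

(** * Conditional G-expectation as an operator on random variables *)

Section conditional_expectation.
Context {R : realType}.
Variables (sl sb : R).
Hypotheses (sl_ge0 : 0 <= sl) (sl_le_sb : sl <= sb).
Implicit Types (X Y Z xi : Omega R -> R) (t : R) (ts us : seq R).

Local Notation Ev := (Ev sl sb).
Local Notation LipO := (Lip +oo%E).

Definition cE t Z (w : Omega R) : R :=
  xget 0 [set v | exists M L ts Phi us, [/\ cyl M L ts Phi,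
    Z = fun w => Phi (pathfun w), path.path <%R t us,
    (forall s, s \in ts -> t < s -> s \in us) & v = Ev t us Phi (pathfun w)]].

Definition cover t ts := sort <=%R (undup (seq.filter (fun s => t < s) ts)).

Lemma cover_path t ts : path.path <%R t (cover t ts).
Proof.
rewrite path_min_sorted ?sort_lt_sorted ?undup_uniq//.
by apply/allP => s; rewrite mem_sort mem_undup mem_filter => /andP[].
Qed.

Lemma cover_mem t ts s : s \in ts -> t < s -> s \in cover t ts.
Proof. by move=> sts st; rewrite mem_sort mem_undup mem_filter st. Qed.

(** Independence of the representation chosen in [cE]: both lists of times are refined to a common
    one by [Ev_merge], and the two functionals then agree on the functions that extend the path up
    to [t], since these vanish on negative times. *)
Lemma cE_Ev M L ts Phi us t Z w : 0 <= t -> cyl M L ts Phi ->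
  Z = (fun w => Phi (pathfun w)) -> path.path <%R t us ->
  (forall s, s \in ts -> t < s -> s \in us) -> cE t Z w = Ev t us Phi (pathfun w).
Proof.
move=> t0 PC ZE pus cov.
have : exists v, exists M L ts Phi us, [/\ cyl M L ts Phi,
    Z = fun w => Phi (pathfun w), path.path <%R t us,
    (forall s, s \in ts -> t < s -> s \in us) & v = Ev t us Phi (pathfun w)].
  by exists (Ev t us Phi (pathfun w)), M, L, ts, Phi, us.
move=> /(xgetPex 0); rewrite -/(cE t Z w).
move=> -[M' [L' [ts' [Phi' [us' [PC' ZE' pus' cov' ->]]]]]].
pose us2 := cover t (us ++ us').
have sub u : path.path <%R t u -> {subset u <= us ++ us'} -> {subset u <= us2}.
  by move=> pu uu s su; apply: cover_mem; [exact: uu|exact: lt_path_gt pu su].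
have p2 := lt_path_le (cover_path t (us ++ us')).
rewrite -(Ev_merge sl_ge0 sl_le_sb (pathfun w) PC' pus' p2 _ cov'); last first.
  by apply: sub => // s su; rewrite mem_cat su orbT.
rewrite -(Ev_merge sl_ge0 sl_le_sb (pathfun w) PC pus p2 _ cov); last first.
  by apply: sub => // s su; rewrite mem_cat su.
apply: Ev_ext; first exact: cover_path.
move=> g gw; apply: (cyl_eq PC' PC) => [v|s s0].
  by rewrite -[RHS]/((fun w => Phi (pathfun w)) v) -ZE ZE'.
by rewrite gw ?path_eq0// (le_trans s0).
Qed.

Lemma cE_le t X Y w : 0 <= t -> LipO X -> LipO Y ->
  (forall v, X v <= Y v) -> cE t X w <= cE t Y w.
Proof.
move=> t0 /Lip_cylindrical[M [L [ts [Phi [PC _ XE]]]]] /Lip_cylindrical[N [K [us [Psi [QC _ YE]]]]] XY.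
have c s : s \in ts ++ us -> t < s -> s \in cover t (ts ++ us) by exact: cover_mem.
rewrite (cE_Ev w t0 PC XE (cover_path t (ts ++ us))); last by move=> s su; apply: c; rewrite mem_cat su.
rewrite (cE_Ev w t0 QC YE (cover_path t (ts ++ us))); last by move=> s su; apply: c; rewrite mem_cat su orbT.
apply: (Ev_le sl_ge0 sl_le_sb PC QC (cover_path _ _)) => g gw.
apply: (cyl_le_on PC QC) => [v|s s0]; first by have := XY v; rewrite XE YE.
by rewrite gw ?path_eq0// (le_trans s0).
Qed.

Lemma cE_add t X Y w : 0 <= t -> LipO X -> LipO Y ->
  cE t (fun v => X v + Y v) w <= cE t X w + cE t Y w.
Proof.
move=> t0 /Lip_cylindrical[M [L [ts [Phi [PC _ XE]]]]] /Lip_cylindrical[N [K [us [Psi [QC _ YE]]]]].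
have c s : s \in ts ++ us -> t < s -> s \in cover t (ts ++ us) by exact: cover_mem.
rewrite (cE_Ev w t0 PC XE (cover_path t (ts ++ us))); last by move=> s su; apply: c; rewrite mem_cat su.
rewrite (cE_Ev w t0 QC YE (cover_path t (ts ++ us))); last by move=> s su; apply: c; rewrite mem_cat su orbT.
rewrite (cE_Ev w t0 (cyl_add PC QC) _ (cover_path t (ts ++ us)) c) ?XE ?YE//.
exact: (Ev_add sl_ge0 sl_le_sb _ PC QC (cover_path _ _)).
Qed.

(** Along all functions that agree with the path up to [t], the factor [xi] keeps the value [xi w]
    and comes out as a scalar. Only the sign of this one value matters. *)
Lemma cE_mul t xi X w : 0 <= t -> Lip t%:E xi -> LipO X -> 0 <= xi w ->
  cE t (fun v => xi v * X v) w = xi w * cE t X w.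
Proof.
move=> t0 Lxi LX xi0.
have Lx : LipO xi by apply: Lip_le Lxi; rewrite leey.
have := Lip_mul (leey 0%E) Lx LX.
move=> /Lip_cylindrical[M' [L' [ts' [Phi' [PC' _ XE']]]]].
move: LX Lxi => /Lip_cylindrical[M [L [ts [Phi [PC _ XE]]]]] /Lip_cylindrical[N [K [us [Psi [QC ust YE]]]]].
have c s : s \in ts' ++ ts -> t < s -> s \in cover t (ts' ++ ts) by exact: cover_mem.
rewrite (cE_Ev w t0 PC' XE' (cover_path t (ts' ++ ts))); last by move=> s su; apply: c; rewrite mem_cat su.
rewrite (cE_Ev w t0 PC XE (cover_path t (ts' ++ ts))); last by move=> s su; apply: c; rewrite mem_cat su orbT.
rewrite -(Ev_scale sl_ge0 sl_le_sb _ PC xi0 (cover_path t (ts' ++ ts))).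
apply: Ev_ext => [|g gw]; first exact: cover_path.
have g0 s : s <= 0 -> g s = 0 by move=> s0; rewrite gw ?path_eq0// (le_trans s0).
have -> : Phi' g = Psi g * Phi g.
  have [w' wg] := path_interpolation (ts' ++ ts ++ us) g0.
  rewrite -(cyl_agree (f := pathfun w') PC'); last by move=> s sts; rewrite wg// mem_cat sts.
  rewrite -(cyl_agree (f := pathfun w') PC); last by move=> s sts; rewrite wg// !mem_cat sts orbT.
  rewrite -(cyl_agree (f := pathfun w') QC); last by move=> s sts; rewrite wg// !mem_cat sts !orbT.
  by have := congr1 (fun h => h w') XE'; rewrite XE YE.
congr (_ * _); rewrite YE; apply: (cyl_agree QC) => s sus; apply: gw.
by move: (allP ust _ sus) => /andP[_]; rewrite lee_fin.
Qed.

Lemma cE_addLip t xi X w : 0 <= t -> Lip t%:E xi -> LipO X ->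
  cE t (fun v => X v - xi v) w = cE t X w - xi w.
Proof.
move=> t0 Lxi LX.
have Lx : LipO xi by apply: Lip_le Lxi; rewrite leey.
have := Lip_sub (leey 0%E) LX Lx.
move=> /Lip_cylindrical[M' [L' [ts' [Phi' [PC' _ XE']]]]].
move: LX Lxi => /Lip_cylindrical[M [L [ts [Phi [PC _ XE]]]]] /Lip_cylindrical[N [K [us [Psi [QC ust YE]]]]].
have c s : s \in ts' ++ ts -> t < s -> s \in cover t (ts' ++ ts) by exact: cover_mem.
rewrite (cE_Ev w t0 PC' XE' (cover_path t (ts' ++ ts))); last by move=> s su; apply: c; rewrite mem_cat su.
rewrite (cE_Ev w t0 PC XE (cover_path t (ts' ++ ts))); last by move=> s su; apply: c; rewrite mem_cat su orbT.
rewrite -(Ev_subc sl_ge0 sl_le_sb _ (xi w) PC (cover_path t (ts' ++ ts))).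
apply: Ev_ext => [|g gw]; first exact: cover_path.
have g0 s : s <= 0 -> g s = 0 by move=> s0; rewrite gw ?path_eq0// (le_trans s0).
have -> : Phi' g = Phi g - Psi g.
  have [w' wg] := path_interpolation (ts' ++ ts ++ us) g0.
  rewrite -(cyl_agree (f := pathfun w') PC'); last by move=> s sts; rewrite wg// mem_cat sts.
  rewrite -(cyl_agree (f := pathfun w') PC); last by move=> s sts; rewrite wg// !mem_cat sts orbT.
  rewrite -(cyl_agree (f := pathfun w') QC); last by move=> s sts; rewrite wg// !mem_cat sts !orbT.
  by have := congr1 (fun h => h w') XE'; rewrite XE YE.
congr (_ - _); rewrite YE; apply: (cyl_agree QC) => s sus; apply: gw.
by move: (allP ust _ sus) => /andP[_]; rewrite lee_fin.
Qed.

Lemma cE_id t xi w : 0 <= t -> Lip t%:E xi -> cE t xi w = xi w.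
Proof.
move=> t0 /Lip_cylindrical[N [K [us [Psi [QC ust YE]]]]].
rewrite (@cE_Ev _ _ _ _ [::] _ _ w t0 QC YE)//= ?YE// => s sus.
by move: (allP ust _ sus) => /andP[_]; rewrite lee_fin leNgt => /negP.
Qed.

Lemma cE_functional t Z : 0 <= t -> LipO Z -> exists M L ts Phi,
  [/\ cyl M L (t :: ts) (Ev t (cover t ts) Phi), cyl M L ts Phi,
      Z = (fun w => Phi (pathfun w)) &
      cE t Z = (fun w => Ev t (cover t ts) Phi (pathfun w))].
Proof.
move=> t0 /Lip_cylindrical[M [L [ts [Phi [PC _ ZE]]]]].
have [L' PC'] := Ev_cyl sl_ge0 sl_le_sb (lt_path_le (cover_path t ts)) PC.
have [_ L0 _] := PC; have [_ L'0 _] := PC'.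
exists M, (L + L'), ts, Phi; split => //.
- by apply: cyl_le PC' => //; rewrite lerDr.
- by apply: cyl_le PC => //; rewrite lerDl.
- apply/funext => w; apply: (cE_Ev w t0 PC ZE (cover_path _ _)) => s; exact: cover_mem.
Qed.

(** By [Ev_dep], the value ignores the coordinates integrated out. Cutting the function to 0 outside
    [0, t] therefore changes nothing on paths and leaves a functional with times in [0, t]. *)
Lemma cE_cylindrical t Z : 0 <= t -> LipO Z -> cylindrical t%:E (cE t Z).
Proof.
move=> t0 LZ; have := LZ => /Lip_cylindrical[_ [_ [ts0 [_ [_ _ _]]]]].
have [M [L [ts [Phi [FC PC ZE ->]]]]] := cE_functional t0 LZ.
have [FM L0 FL] := FC.
pose us := seq.filter (fun s => (0 <= s) && (s <= t)) (t :: ts).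
pose cut (f : R -> R) s := if (0 <= s) && (s <= t) then f s else 0.
have cutE w : Ev t (cover t ts) Phi (pathfun w) = Ev t (cover t ts) Phi (cut (pathfun w)).
  apply: (Ev_dep _ _ (cover_path t ts) PC); first by rewrite /cut t0 lexx.
  move=> s sts sc; rewrite /cut; have [s0|s0] /= := leP 0 s; last by rewrite path_eq0// ltW.
  by case: leP => // /(cover_mem sts); rewrite (negbTE sc).
exists M, L, us, (fun f => Ev t (cover t ts) Phi (cut f)); split.
- split => // f g; apply: (le_trans (FL _ _)); rewrite ler_wpM2l//.
  rewrite big_filter [leRHS]big_mkcond; apply: ler_sum => s _.
  by rewrite /cut; case: ifP => // _; rewrite subrr normr0.
- by apply/allP => s; rewrite mem_filter lee_fin => /andP[].
- exact/funext.
Qed.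

Lemma cE_Lip t Z : 0 <= t -> LipO Z -> Lip t%:E (cE t Z).
Proof. by move=> t0 LZ; apply: cylindrical_Lip; [rewrite lee_fin|exact: cE_cylindrical]. Qed.

(** The observation times are split at [t], which is itself appended to the earlier ones so that the
    inner induction starts there; [Ev_cat] then factors the full induction. *)
Lemma cE_tower t Z w : 0 <= t -> LipO Z -> cE 0 (cE t Z) w = cE 0 Z w.
Proof.
rewrite le_eqVlt => /predU1P[<-|t0] LZ.
  by rewrite cE_id//; exact: cE_Lip.
have [M [L [ts [Phi [FC PC ZE FE]]]]] := cE_functional (ltW t0) LZ.
pose us1 := rcons (cover 0 (seq.filter (fun s => s < t) ts)) t.
have us1p : path.path <%R 0 us1.
  rewrite rcons_path cover_path /=.
  set c := cover _ _; have : last 0 c \in 0 :: c by exact: mem_last.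
  rewrite inE => /orP[/eqP -> //|]; rewrite /c mem_sort mem_undup !mem_filter.
  by case/and3P.
have l1 : last 0 us1 = t by rewrite last_rcons.
have p12 : path.path <%R 0 (us1 ++ cover t ts) by rewrite cat_path us1p l1 cover_path.
have c1 s : s \in ts -> 0 < s -> s < t -> s \in us1.
  by move=> sts s0 st; rewrite mem_rcons inE cover_mem ?orbT// mem_filter st.
rewrite (cE_Ev w (lexx 0) PC ZE p12); last first.
  move=> s sts s0; rewrite mem_cat; have [st|st|->] := ltgtP s t.
  - by rewrite c1.
  - by rewrite (cover_mem sts st) orbT.
  - by rewrite mem_rcons inE eqxx.
have [N [K [ts' [Psi [QC ts't QE]]]]] := cE_cylindrical (ltW t0) LZ.
pose us2 := cover 0 (us1 ++ ts').
rewrite Ev_cat l1.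
have sub : {subset us1 <= us2}.
  by move=> s su; apply: cover_mem; [rewrite mem_cat su|exact: lt_path_gt us1p su].
have us2t s : s \in us2 -> s <= t.
  rewrite mem_sort mem_undup mem_filter mem_cat => /andP[_ /orP[su|/(allP ts't)/andP[_]]].
    by rewrite -l1; apply: le_path_last (lt_path_le us1p) _; rewrite inE su orbT.
  by rewrite lee_fin.
rewrite (cE_Ev w (lexx 0) QC QE (cover_path 0 (us1 ++ ts'))); last first.
  by move=> s sts s0; apply: cover_mem; rewrite // mem_cat sts orbT.
pose cut (f : R -> R) s := if s <= t then f s else 0.
have cutE f : (forall s, s <= 0 -> f s = 0) -> Psi f = Ev t (cover t ts) Phi f.
  move=> f0; apply: (cyl_eq QC FC) f0 => v.
  by have := congr1 (fun h => h v) QE; rewrite FE.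
transitivity (Ev 0 us2 (Ev t (cover t ts) Phi) (pathfun w)).
  apply: Ev_ext; first exact: cover_path.
  by move=> g gw; apply: cutE => s s0; rewrite gw ?path_eq0.
pose Fc f := Ev t (cover t ts) Phi (fun s => if s <= t then f s else 0).
have FcE f : Ev t (cover t ts) Phi f = Fc f.
  apply: (Ev_dep _ _ (cover_path t ts) PC); first by rewrite lexx.
  by move=> s sts sc; case: leP => // /(cover_mem sts); rewrite (negbTE sc).
have FcC : cyl M L (seq.filter (fun s => s <= t) (t :: ts)) Fc.
  have [FM L0 FL] := FC; split => [f|//|f g]; first exact: FM.
  apply: (le_trans (FL _ _)); rewrite ler_wpM2l//.
  rewrite big_filter [leRHS]big_mkcond; apply: ler_sum => s _.
  by case: ifP => // _; rewrite subrr normr0.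
rewrite (funext FcE); apply: (Ev_merge sl_ge0 sl_le_sb _ FcC us1p (lt_path_le (cover_path _ _)) sub).
move=> s; rewrite mem_filter inE => /andP[st /orP[/eqP -> _|sts s0]].
  by rewrite mem_rcons inE eqxx.
move: st; rewrite le_eqVlt => /predU1P[->|st]; last exact: c1.
by rewrite mem_rcons inE eqxx.
Qed.

End conditional_expectation.

(** * Agreement with the definition by increments *)

Section Giter.
Context {R : realType}.
Variables (sl sb : R).
Hypotheses (sl_ge0 : 0 <= sl) (sl_le_sb : sl <= sb).
Implicit Types (X Y Z xi : Omega R -> R) (t : R) (ts us : seq R).

Local Notation LipO := (Lip +oo%E).
Local Notation cE := (cE sl sb).

(** At time 0 all paths coincide, so any path may serve as the point of evaluation. *)
Definition E0 Z := cE 0 Z (path0 R).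

Lemma increments_lip n (xs ys : seq R) : size xs = n -> size ys = n ->
  \sum_(i < n) `|(increments xs)`_i - (increments ys)`_i| <=
  2 * \sum_(i < n) `|xs`_i - ys`_i|.
Proof.
move=> sx sy; rewrite mulrDl !mul1r.
apply: (@le_trans _ _ (\sum_(i < n) (`|xs`_i - ys`_i| + `|(0 :: xs)`_i - (0 :: ys)`_i|))).
  apply: ler_sum => i _; rewrite /increments !(nth_pairmap 0) ?sx ?sy//.
  have -> : xs`_i - (0 :: xs)`_i - (ys`_i - (0 :: ys)`_i) =
    xs`_i - ys`_i - ((0 :: xs)`_i - (0 :: ys)`_i) by ring.
  exact: ler_normB.
rewrite big_split /= lerD2l; case: n {sx sy} => [|n]; first by rewrite !big_ord0.
rewrite big_ord_recl /= subrr normr0 add0r [leRHS]big_ord_recr /=.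
by rewrite lerDl.
Qed.

Lemma increments_cyl ts phi : bounded_lipschitz (size ts) phi ->
  exists M L, cyl M L ts (fun f => phi (increments (map f ts))).
Proof.
case=> -[M PM] [L PL]; exists M, (`|L| * 2); split.
- by move=> f; apply: PM; rewrite size_pairmap size_map.
- by rewrite mulr_ge0.
move=> f g; apply: (le_trans (PL _ _ _ _)); rewrite ?size_pairmap ?size_map//.
rewrite -mulrA -(sum_nth_map (fun x y => `|x - y|)).
apply: (@le_trans _ _ (`|L| * \sum_(i < size ts)
    `|(increments (map f ts))`_i - (increments (map g ts))`_i|)).
  by rewrite ler_wpM2r ?ler_norm//; exact: sumr_ge0.
by rewrite ler_wpM2l//; apply: increments_lip; rewrite size_map.
Qed.

Lemma increments_cat ts1 ts2 :
  increments (ts1 ++ ts2) = increments ts1 ++ pairmap (fun a b : R => b - a) (last 0 ts1) ts2.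
Proof. by rewrite /increments pairmap_cat. Qed.

Lemma Giter_cE ts phi j (w : Omega R) : path.sorted <=%R (0 :: ts) ->
  bounded_lipschitz (size ts) phi -> (j <= size ts)%N ->
  Giter sl sb ts j phi (take j (increments [seq B s w | s <- ts])) =
  cE (0 :: ts)`_j (fun w => phi (increments [seq B s w | s <- ts])) w.
Proof.
move=> so Pb js; have [M [L PC]] := increments_cyl Pb.
have st : size (take j ts) = j by rewrite size_takel.
have tE : (0 :: ts)`_j = last 0 (take j ts).
  by rewrite (last_nth 0) st; case: j st {js} => //= j st; rewrite nth_take.
have := so; rewrite /= -{1}(cat_take_drop j ts) cat_path -tE => /andP[p1 p2].
have t0 : 0 <= (0 :: ts)`_j.
  by rewrite tE; apply: le_path_last p1 _; rewrite inE eqxx.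
rewrite (cE_Ev sl_ge0 sl_le_sb w t0 PC _ (cover_path _ ts)) //; last by move=> s; exact: cover_mem.
rewrite -(Ev_merge sl_ge0 sl_le_sb _ PC (cover_path _ ts) p2); last 2 first.
- move=> s; rewrite mem_sort mem_undup mem_filter => /andP[js'].
  rewrite -{1}(cat_take_drop j ts) mem_cat => /orP[sj|//].
  have : s <= last 0 (take j ts) by apply: le_path_last p1 _; rewrite inE sj orbT.
  by rewrite -tE leNgt js'.
- by move=> s; exact: cover_mem.
rewrite /Giter -{1}(cat_take_drop j ts) increments_cat drop_size_cat ?size_pairmap//.
have -> : take j (increments [seq B s w | s <- ts]) = increments (map (pathfun w) (take j ts)).
  rewrite -[in LHS](cat_take_drop j ts) map_cat increments_cat take_size_cat//.
  by rewrite size_pairmap size_map.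
rewrite tE; apply: (Giter_Ev sl_ge0 sl_le_sb PC).
- by rewrite -size_cat cat_take_drop.
- by move=> f _; rewrite cat_take_drop.
- by rewrite cat_take_drop.
- by rewrite path_eq0.
Qed.

Lemma scanl_lip (a b : R) (xs ys : seq R) i : size xs = size ys ->
  `|(scanl +%R a xs)`_i - (scanl +%R b ys)`_i| <=
  `|a - b| + \sum_(j < size xs) `|xs`_j - ys`_j|.
Proof.
elim: xs ys a b i => [|x xs ih] [|y ys] a b i //=.
  by rewrite nth_nil subrr normr0 big_ord0 addr0.
case=> sxy; rewrite big_ord_recl /= addrA.
have h : `|a + x - (b + y)| <= `|a - b| + `|x - y|.
  by rewrite opprD addrACA; exact: ler_normD.
case: i => [|i] /=; first by apply: (le_trans h); rewrite lerDl; exact: sumr_ge0.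
by apply: (le_trans (ih _ _ _ _ sxy)); rewrite lerD2r.
Qed.

Lemma scanl_increments (xs : seq R) : scanl +%R 0 (increments xs) = xs.
Proof. by apply: pairmapK => x y; rewrite addrC subrK. Qed.

(** The times are sorted after [t] is added to them, and values are recovered from increments as
    partial sums by [scanl]. *)
Lemma Lip_increments t Z : 0 <= t -> LipO Z -> exists ts phi j,
  [/\ path.sorted <=%R (0 :: ts), bounded_lipschitz (size ts) phi,
     (j <= size ts)%N, t = (0 :: ts)`_j &
     Z = fun w => phi (increments [seq B s w | s <- ts])].
Proof.
move=> t0 /Lip_cylindrical[M [L [ts [Phi [PC ts0 ZE]]]]]; have [PM L0 PL] := PC.
pose us := cover 0 (t :: ts).
pose phi (xs : seq R) := Phi (fun s => (scanl +%R 0 xs)`_(index s us)).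
(* The list [us] contains only positive times, so time 0 has position 0 in [0 :: us] and any other
   time is moved by one. *)
exists us, phi, (if t == 0 then 0%N else (index t us).+1); split.
- exact/lt_path_le/cover_path.
- split; first by exists M => xs _; exact: PM.
  exists (L * (size ts)%:R) => xs ys sx sy; apply: (le_trans (PL _ _)).
  rewrite -mulrA ler_wpM2l//.
  pose d := \sum_(i < size us) `|xs`_i - ys`_i|.
  have -> : (size ts)%:R * d = \sum_(s <- ts) d.
    by rewrite big_const_seq count_predT iter_addr_0 mulr_natl.
  apply: ler_sum => s _; apply: (le_trans (scanl_lip _ _ _ _)); rewrite ?sx ?sy//.
  by rewrite subrr normr0 add0r.
- by case: ifP => // t0'; rewrite index_mem cover_mem ?inE ?eqxx// lt_neqAle eq_sym t0'.
- case: eqP => // /eqP t0'; rewrite /= nth_index// cover_mem ?inE ?eqxx//.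
  by rewrite lt_neqAle eq_sym t0'.
- apply/funext => w; rewrite ZE /phi scanl_increments; apply: (cyl_agree PC) => s sts.
  have [sus|sus] := boolP (s \in us).
    by rewrite (nth_map 0) ?index_mem// nth_index.
  rewrite nth_default ?size_map ?memNindex// path_eq0// leNgt.
  by apply: contra sus => s0; rewrite cover_mem// inE sts orbT.
Qed.

Lemma condE_Lip_cE t Z : 0 <= t -> LipO Z -> condE_Lip sl sb t Z (cE t Z).
Proof.
move=> t0 LZ; have [ts [phi [j [so Pb js tE ZE]]]] := Lip_increments t0 LZ.
exists ts, phi, j; split => //; split => //.
by apply/funext => w; rewrite Giter_cE// -tE -ZE.
Qed.

Lemma increments_LipO ts phi : path.sorted <=%R (0 :: ts) -> bounded_lipschitz (size ts) phi ->
  LipO (fun w : Omega R => phi (increments [seq B s w | s <- ts])).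
Proof.
move=> so Pb; have [M [L PC]] := increments_cyl Pb.
apply: cylindrical_Lip; first by rewrite leey.
exists M, L, ts, (fun f => phi (increments (map f ts))); split => //.
by apply/allP => s sts; rewrite leey andbT (le_path_ge so).
Qed.

Lemma condE_LipP t X Y : condE_Lip sl sb t X Y -> [/\ 0 <= t, LipO X & Y = cE t X].
Proof.
move=> [ts [phi [j [so Pb js tE [XE YE]]]]].
have t0 : 0 <= t.
  rewrite tE; case: j {js YE} tE => //= j tE.
  have [/(mem_nth 0)|] := ltnP j (size ts); last by move=> /(nth_default 0) ->.
  exact: le_path_ge.
split => //; first by rewrite XE; exact: increments_LipO.
by apply/funext => w; rewrite YE XE Giter_cE// -tE.
Qed.

Lemma Pset_le (P : probability (Omega R) R) Z : Pset sl sb P -> LipO Z ->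
  (\int[P]_w (Z w)%:E <= (E0 Z)%:E)%E.
Proof.
move=> PP LZ; have [ts [phi [j [so Pb _ _ ZE]]]] := Lip_increments (lexx 0) LZ.
have := PP ts phi so Pb; have := Giter_cE (path0 R) so Pb (leq0n (size ts)).
by rewrite take0 /= => ->; rewrite ZE.
Qed.

Lemma Pset_intro (P : probability (Omega R) R) :
  (forall Z, LipO Z -> (\int[P]_w (Z w)%:E <= (E0 Z)%:E)%E) -> Pset sl sb P.
Proof.
move=> h ts phi so Pb; have := Giter_cE (path0 R) so Pb (leq0n (size ts)).
by rewrite take0 /= => ->; exact: (h _ (increments_LipO so Pb)).
Qed.

End Giter.

(** * The G-expectation on cylindrical variables and fourth moments *)

Section sublinear_expectation.
Context {R : realType}.
Variables (sl sb : R).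
Hypotheses (sl_ge0 : 0 <= sl) (sl_le_sb : sl <= sb).
Implicit Types (X Y Z xi : Omega R -> R) (t : R) (ts us : seq R).

Local Notation LipO := (Lip +oo%E).
Local Notation cE := (cE sl sb).
Local Notation E0 := (E0 sl sb).

Lemma E0_le X Y : LipO X -> LipO Y -> (forall v, X v <= Y v) -> E0 X <= E0 Y.
Proof. exact: cE_le. Qed.

Lemma E0_add X Y : LipO X -> LipO Y -> E0 (fun v => X v + Y v) <= E0 X + E0 Y.
Proof. exact: cE_add. Qed.

Lemma E0_cst c : E0 (fun=> c) = c.
Proof. by apply: cE_id => //; apply: Lip_cst; rewrite lee_fin. Qed.

Lemma E0_scale c X : 0 <= c -> LipO X -> E0 (fun w => c * X w) = c * E0 X.
Proof.
move=> c0 LX; apply: (cE_mul sl_ge0 sl_le_sb (lexx 0) (xi := fun=> c)) => //.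
by apply: Lip_cst; rewrite lee_fin.
Qed.

Lemma E0_sup X c : LipO X -> (forall v, X v <= c) -> E0 X <= c.
Proof. by move=> LX Xc; rewrite -[leRHS](E0_cst c); apply: E0_le => //; exact/Lip_cst/leey. Qed.

Lemma E0_cE t X : 0 <= t -> LipO X -> E0 (cE t X) = E0 X.
Proof. exact: cE_tower. Qed.

(** The truncation makes the fourth power bounded and Lipschitz; the moment bound does not depend on
    [N]. *)
Definition trunc4 (N x : R) : R := Num.min `|x| N ^+ 4.

Lemma trunc4_le N x : 0 <= N -> trunc4 N x <= x ^+ 4.
Proof.
move=> N0; rewrite -[x ^+ 4]ger0_norm ?exprn_even_ge0// normrX /trunc4.
by rewrite lerXn2r ?nnegrE ?le_min ?normr_ge0 ?ge_min ?lexx.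
Qed.

Lemma trunc4_ge0 N x : 0 <= N -> 0 <= trunc4 N x.
Proof. by move=> N0; rewrite exprn_ge0// le_min normr_ge0. Qed.

Lemma trunc4_cyl N s t : 0 <= N ->
  cyl (N ^+ 4) (4 * N ^+ 3) [:: s; t] (fun f : R -> R => trunc4 N (f t - f s)).
Proof.
move=> N0; split.
- move=> f; rewrite ger0_norm ?trunc4_ge0// lerXn2r ?nnegrE//.
    by rewrite le_min normr_ge0.
  by rewrite ge_min lexx orbT.
- by rewrite mulr_ge0// exprn_ge0.
move=> f g; rewrite !big_cons big_nil addr0 /trunc4.
set x := f t - f s; set y := g t - g s.
have xy : `|x - y| <= `|f s - g s| + `|f t - g t|.
  have -> : x - y = (f t - g t) - (f s - g s) by rewrite /x /y; ring.
  by rewrite [leRHS]addrC; exact: ler_normB.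
apply: (@le_trans _ _ (4 * N ^+ 3 * `|x - y|)); last by rewrite ler_wpM2l// mulr_ge0// exprn_ge0.
have m0 (z : R) : 0 <= Num.min `|z| N <= N by rewrite le_min normr_ge0 N0 ge_min lexx orbT.
have ml : `|Num.min `|x| N - Num.min `|y| N| <= `|x - y|.
  have := ler_dist_dist x y; rewrite !ler_norml => /andP[? ?].
  have := normr_ge0 (x - y); case: (leP `|x| N); case: (leP `|y| N) => ? ? ?; apply/andP; split; lra.
set u := Num.min `|x| N in ml *; set v := Num.min `|y| N in ml *.
have /andP[u0 uN] := m0 x; have /andP[v0 vN] := m0 y.
have -> : u ^+ 4 - v ^+ 4 = (u - v) * (u ^+ 3 + u ^+ 2 * v + u * v ^+ 2 + v ^+ 3) by ring.
rewrite normrM mulrC; apply: ler_pM => //.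
have n3 (a b c : R) : 0 <= a <= N -> 0 <= b <= N -> 0 <= c <= N -> 0 <= a * b * c <= N ^+ 3.
  move=> /andP[a0 aN] /andP[b0 bN] /andP[c0 cN]; rewrite !mulr_ge0//=.
  have -> : N ^+ 3 = N * N * N by ring.
  by rewrite !ler_pM ?mulr_ge0.
have /andP[? ?] := n3 u u u (m0 x) (m0 x) (m0 x).
have /andP[? ?] := n3 u u v (m0 x) (m0 x) (m0 y).
have /andP[? ?] := n3 u v v (m0 x) (m0 y) (m0 y).
have /andP[? ?] := n3 v v v (m0 y) (m0 y) (m0 y).
have -> : u ^+ 3 + u ^+ 2 * v + u * v ^+ 2 + v ^+ 3 = u * u * u + u * u * v + u * v * v + v * v * v by ring.
by rewrite ger0_norm; lra.
Qed.

Lemma trunc4_Lip (T : \bar R) N s t : 0 <= N -> 0 <= s -> 0 <= t -> (s%:E <= T)%E -> (t%:E <= T)%E ->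
  Lip T (fun w : Omega R => trunc4 N (B t w - B s w)).
Proof.
move=> N0 s0 t0 sT tT; apply: cylindrical_Lip; first by apply: le_trans sT; rewrite lee_fin.
do 4 eexists; split; [exact: (trunc4_cyl s t N0)|by rewrite /= s0 t0 sT tT|by []].
Qed.

(** The constant 6 is twice the Gaussian 3, because [iter_scheme_quartic] freezes the growing
    quadratic coefficient at its final value. *)
Lemma E0_trunc4 N s t : 0 <= N -> 0 <= s -> s <= t ->
  E0 (fun w => trunc4 N (B t w - B s w)) <= 6 * sb ^+ 4 * (t - s) ^+ 2.
Proof.
move=> N0 s0; rewrite le_eqVlt => /predU1P[->|st].
  rewrite subrr expr0n mulr0.
  have -> : (fun w : Omega R => trunc4 N (B t w - B t w)) = fun=> 0.
    by apply/funext => v; rewrite subrr /trunc4 normr0 min_l// expr0n.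
  by rewrite E0_cst.
have C := trunc4_cyl s t N0.
rewrite /E0 (cE_Ev sl_ge0 sl_le_sb _ (lexx 0) C _ (cover_path 0 [:: s; t]))//; last by move=> r; exact: cover_mem.
have p2 : path.path <=%R 0 [:: s; t] by rewrite /= s0 ltW.
rewrite -(Ev_merge sl_ge0 sl_le_sb _ C (cover_path 0 [:: s; t]) p2); last 2 first.
- by move=> r; rewrite mem_sort mem_undup mem_filter => /andP[].
- by move=> r; exact: cover_mem.
set f0 := pathfun _; rewrite /= subr0.
have inner x : Gheat sl sb (fun y => trunc4 N (upd (upd f0 s x) t y t - upd (upd f0 s x) t y s)) (t - s) (upd f0 s x s)
    <= 6 * sb ^+ 4 * (t - s) ^+ 2.
  have d0 : 0 <= t - s by rewrite subr_ge0 ltW.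
  have b := cyl_upd (upd f0 s x) t C.
  apply: (le_trans (@Gheat_moment _ sl sb sl_ge0 sl_le_sb _ _ _ _ _ 0 0 1 b d0 (lexx 0) ltr01 _)).
    move=> y; have -> : upd (upd f0 s x) t y s = upd f0 s x s by rewrite {1}/upd (lt_eqF st).
    by rewrite upd_same mul0r !add0r mul1r; exact: trunc4_le.
  by rewrite le_eqVlt; apply/orP; left; apply/eqP; ring.
have pst : path.path <=%R s [:: t] by rewrite /= ltW.
have [k bk] := Ev_bdlip sl_ge0 sl_le_sb f0 s pst C.
have cb (c : R) : bdlip `|c| 0 (fun=> c) by split=> // y z; rewrite subrr normr0 mul0r.
apply: (@le_trans _ _ (Gheat sl sb (fun=> 6 * sb ^+ 4 * (t - s) ^+ 2) s (f0 0))); last by rewrite Gheat_cst.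
exact: (Gheat_le sl_ge0 sl_le_sb _ bk (cb _) s0 inner).
Qed.

End sublinear_expectation.

(** * Linear functionals dominated by the G-expectation *)

Section path_borel.
Context {R : realType}.
Implicit Types (f g : R -> R) (Phi : (R -> R) -> R) (ts : seq R).

Lemma measurable_lipschitz (L : R) ts Phi : 0 <= L ->
  (forall f g, `|Phi f - Phi g| <= L * \sum_(s <- ts) `|f s - g s|) ->
  measurable_fun setT (fun w : Omega R => Phi (pathfun w)).
Proof.
move=> L0 PL; apply: (@measurability _ _ (Omega R) _ setT _ _ (RGenOInfty.measurableE R)).
move=> _ [_ [x ->] <-]; rewrite setTI; apply: sub_sigma_algebra.
pose O : set ({family compact, R -> R}) := [set f | x < Phi f].
have oO : open O.
  rewrite openE => f /= Of; rewrite /interior.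
  pose d := (Phi f - x) / (L * (size ts)%:R + 1).
  have n0 : 0 <= L * (size ts)%:R by rewrite mulr_ge0.
  have d0 : 0 < d by rewrite /d divr_gt0 ?subr_gt0// ltr_wpDl.
  have h := @fam_nbhs R R compact [set` ts] [set p | ball p.1 d p.2] f
    (@entourage_ball R R (PosNum d0)) (finite_compact (finite_seq ts)).
  apply: filterS h => g fg /=.
  have : `|Phi f - Phi g| <= L * ((size ts)%:R * d).
    apply: (le_trans (PL f g)); rewrite ler_wpM2l//.
    have -> : (size ts)%:R * d = \sum_(s <- ts) d.
      by rewrite big_const_seq count_predT iter_addr_0 mulr_natl.
    rewrite big_seq [leRHS]big_seq; apply: ler_sum => s sts.
    by have := fg s sts; rewrite /ball /= => /ltW.
  rewrite mulrA ler_norml => /andP[_ h2].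
  have : L * (size ts)%:R * d < Phi f - x.
    rewrite /d mulrA ltr_pdivrMr ?ltr_wpDl// mulrC ltr_pM2l ?subr_gt0//.
    by rewrite ltrDl.
  by rewrite /O /=; lra.
exists O => //; rewrite setTI; apply/seteqP; split => w /=.
  by rewrite in_itv /= andbT.
by rewrite in_itv /= andbT.
Qed.

Lemma measurable_B (t : R) : measurable_fun setT (B t : Omega R -> R).
Proof.
apply: (@measurable_lipschitz 1 [:: t] (fun f => f t)) => // f g.
by rewrite big_seq1 mul1r.
Qed.

Lemma measurable_Lip (t : \bar R) X : Lip t X -> measurable_fun setT X.
Proof.
move=> /Lip_cylindrical[M [L [ts [Phi [[_ L0 PL] _ ->]]]]].
exact: measurable_lipschitz PL.
Qed.



(** The filter generated by the uniform balls around [w] on growing intervals converges to [w] for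
    the compact-open structure, so one of these balls lies in the given open set. *)
Lemma path_open_ball (U : set (Omega R)) (w : Omega R) : path_open U -> U w ->
  exists T e : R, 0 < e /\
    forall v : Omega R, (forall s, 0 <= s <= T -> `|B s w - B s v| < e) -> U v.
Proof.
case=> O oO <- [_ Ow].
pose F : set_system (R -> R) := [set P | exists n : nat,
  [set g | forall s : R, `|s| <= n%:R -> `|pathfun w s - g s| < n.+1%:R^-1] `<=` P].
have FF : Filter F.
  split.
  - by exists 0%N.
  - move=> P Q [n nP] [m mQ]; exists (maxn n m) => g gP; split.
      apply: nP => s sn; apply: lt_le_trans (gP s _) _.
        by apply: (le_trans sn); rewrite ler_nat leq_maxl.
      by rewrite lef_pV2 ?posrE// ler_nat ltnS leq_maxl.
    apply: mQ => s sn; apply: lt_le_trans (gP s _) _.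
      by apply: (le_trans sn); rewrite ler_nat leq_maxr.
    by rewrite lef_pV2 ?posrE// ler_nat ltnS leq_maxr.
  - by move=> P Q PQ [n nP]; exists n; exact: subset_trans PQ.
have Fw : F --> (pathfun w : {family compact, R -> R}).
  apply/fam_cvgP => A /= /compact_bounded[M [_ MA]] P /uniform_nbhs[E [entE EP]].
  move: entE; rewrite -entourage_ballE => -[d /= d0 dE].
  pose n := maxn (Num.truncn `|M + 1|).+1 (Num.truncn `|d^-1|).+1.
  exists n => g gw; apply: EP => s As; apply: dE; rewrite /ball /=.
  apply: lt_le_trans (gw s _) _.
    apply: (le_trans (MA (M + 1) _ s As)); first by rewrite ltrDl.
    apply: (le_trans (ler_norm _)); apply: (@le_trans _ _ (Num.truncn `|M + 1|).+1%:R).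
      exact/ltW/truncnS_gt.
    by rewrite ler_nat leq_maxl.
  rewrite invf_ple ?posrE//; apply: (le_trans (ler_norm _)).
  apply: (@le_trans _ _ (Num.truncn `|d^-1|).+1%:R); first exact/ltW/truncnS_gt.
  by rewrite ler_nat leqW// leq_maxr.
have [n nO] := Fw _ (open_nbhs_nbhs (conj oO Ow)).
exists n%:R, n.+1%:R^-1; split; first by rewrite invr_gt0.
move=> v vw; split => //; apply: nO => s sn.
have [s0|s0] := leP 0 s; last by rewrite !path_eq0 ?ltW// subrr normr0 invr_gt0.
by apply: vw; rewrite s0 /= (le_trans (ler_norm _) sn).
Qed.

Lemma path_uniform_mesh (w : Omega R) (T e : R) : 0 < e ->
  exists n : nat, forall s t, 0 <= s <= T -> 0 <= t <= T -> `|s - t| <= 2^-1 ^+ n ->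
    `|B s w - B t w| <= e.
Proof.
move=> e0; apply: contrapT => /forallNP h.
have {}h n : exists st : R * R, [/\ 0 <= st.1 <= T, 0 <= st.2 <= T,
    `|st.1 - st.2| <= 2^-1 ^+ n & e < `|B st.1 w - B st.2 w|].
  have /existsNP[s /existsNP[t /not_implyP[sT /not_implyP[tT /not_implyP[st /negP]]]]] := h n.
  by rewrite -ltNge => ?; exists (s, t).
have [p pP] := choice h.
have b1 n : `|(p n).1| <= T by have [/andP[? ?] _ _ _] := pP n; rewrite ger0_norm.
have b2 n : `|(p n).2| <= T by have [_ /andP[? ?] _ _] := pP n; rewrite ger0_norm.
have c1 := ultra_cvg b1; have c2 := ultra_cvg b2.
set r := lim _ in c1; set q := lim _ in c2.
have c0 : (fun n => 2^-1 ^+ n : R) @ UN --> (0 : R).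
  by apply: UN_cvg; apply: cvg_expr; rewrite ger0_norm//; lra.
have rq : r = q.
  apply/eqP; rewrite -subr_eq0 -normr_le0.
  apply: (UN_le (cvg_norm (cvgB c1 c2)) c0).
  by apply: nearW => n; have [] := pP n.
have d1 : (fun n => B (p n).1 w) @ UN --> B r w.
  exact: (cvg_comp (fun n => (p n).1) (pathfun w) c1 (@path_continuous R w r)).
have d2 : (fun n => B (p n).2 w) @ UN --> B r w.
  by rewrite rq; exact: (cvg_comp (fun n => (p n).2) (pathfun w) c2 (@path_continuous R w q)).
suff : e <= `|B r w - B r w| by rewrite subrr normr0 leNgt e0.
apply: (UN_ge_cst (cvg_norm (cvgB d1 d2))).
by apply: nearW => n; have [_ _ _ /ltW] := pP n.
Qed.


(** A countable family of sets described by dyadic coordinates. On each interval of length 2^-n the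
    path stays near a value with denominator k + 1; of the tolerance 2/(k+1), one half is for the
    oscillation and the other for rounding. *)
Definition tube (k n : nat) (v : seq int) : set (Omega R) :=
  [set w | forall i m j : nat, (i < size v)%N ->
    i%:R / 2 ^+ n <= grid m j :> R -> grid m j <= i.+1%:R / 2 ^+ n :> R ->
    `|B (grid m j) w - (v`_i)%:~R / k.+1%:R| <= 2 / k.+1%:R].

Lemma grid_dense (a b : R) : 0 <= a -> a < b -> exists m j : nat, a < grid m j < b.
Proof.
move=> a0 ab; have d0 : 0 < b - a by rewrite subr_gt0.
pose m := (Num.truncn (b - a)^-1).+1.
have hm : (2 ^+ m)^-1 < b - a.
  rewrite invf_plt ?posrE// ?exprn_gt0//; apply: lt_le_trans (truncnS_gt _) _.
  by rewrite -natrX ler_nat ltnW// ltn_expl.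
have m0 : 0 < 2 ^+ m :> R by rewrite exprn_gt0.
exists m, (Num.truncn (a * 2 ^+ m)).+1; rewrite /grid ltr_pdivlMr// truncnS_gt/=.
have h : (Num.truncn (a * 2 ^+ m))%:R <= a * 2 ^+ m by rewrite truncn_le mulr_ge0// ltW.
rewrite ltr_pdivrMr// -natr1; apply: (@le_lt_trans _ _ (a * 2 ^+ m + 1)); first by rewrite lerD2r.
have : 1 < (b - a) * 2 ^+ m by rewrite -ltr_pdivrMr// div1r.
lra.
Qed.

Lemma tube_diam k n v (w w' : Omega R) s : tube k n v w -> tube k n v w' ->
  0 <= s < (size v)%:R / 2 ^+ n -> `|B s w - B s w'| <= 4 / k.+1%:R.
Proof.
move=> tw tw' /andP[s0 sv]; rewrite leNgt; apply/negP => h.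
have n0 : 0 < 2 ^+ n :> R by rewrite exprn_gt0.
pose i := Num.truncn (s * 2 ^+ n).
have is0 : i%:R <= s * 2 ^+ n by rewrite truncn_le mulr_ge0// ltW.
have is1 : s * 2 ^+ n < i.+1%:R by exact: truncnS_gt.
have iv : (i < size v)%N.
  by move: sv; rewrite ltr_pdivlMr// => /(le_lt_trans is0); rewrite ltr_nat.
have c : {for s, continuous (fun r => `|pathfun w r - pathfun w' r|)}.
  by apply: cvg_norm; apply: cvgB; exact: path_continuous.
have : \forall r \near s, 4 / k.+1%:R < `|pathfun w r - pathfun w' r|.
  by move/cvgr_gt: c; apply.
case/nbhs_ballP => d /= d0 dP.
have b0 : s < Num.min (s + d) (i.+1%:R / 2 ^+ n) by rewrite lt_min ltr_pdivlMr// is1 ltrDl d0.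
have [m [j /andP[sj]]] := grid_dense s0 b0; rewrite lt_min => /andP[js ji].
have := dP (grid m j); rewrite /ball /= distrC => /(_ _)/negP; apply.
  by rewrite ltr_norml; apply/andP; split; lra.
apply/negP; rewrite -leNgt; have i1 : i%:R / 2 ^+ n <= grid m j :> R.
  by apply: le_trans (ltW sj); rewrite ler_pdivrMr.
have := tw i m j iv i1 (ltW ji); have := tw' i m j iv i1 (ltW ji).
rewrite /B; set x := pathfun w _; set y := pathfun w' _; set z := _%:~R / _.
have := ler_distD z x y; rewrite (distrC z y) => a b c'.
apply: (le_trans a); apply: (le_trans (lerD c' b)).
by rewrite -mulrDl -natrD.
Qed.

Lemma tube_cover (w : Omega R) (k N : nat) : exists n v,
  [/\ tube k n v w & N%:R <= (size v)%:R / 2 ^+ n :> R].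
Proof.
have k0 : 0 < k.+1%:R^-1 :> R by rewrite invr_gt0.
have [n hn] := @path_uniform_mesh w N.+1%:R _ k0.
have n0 : 0 < 2 ^+ n :> R by rewrite exprn_gt0.
pose v := mkseq (fun i => Num.floor (k.+1%:R * B (i%:R / 2 ^+ n) w)) (N * 2 ^ n)%N.
exists n, v; split; last by rewrite size_mkseq natrM natrX mulfK// gt_eqF.
move=> i m j; rewrite size_mkseq => iv ij ji.
rewrite nth_mkseq//; set x := B (i%:R / _) w.
have iN : i.+1%:R / 2 ^+ n <= N%:R :> R.
  by rewrite ler_pdivrMr// -natrX -natrM ler_nat.
have i0 : 0 <= i%:R / 2 ^+ n :> R by rewrite divr_ge0// ltW.
have in1 : i.+1%:R / 2 ^+ n = i%:R / 2 ^+ n + (2 ^+ n)^-1 :> R by rewrite -natr1 mulrDl mul1r.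
have N1 : N%:R <= N.+1%:R :> R by rewrite ler_nat.
have h1 : `|B (grid m j) w - x| <= k.+1%:R^-1.
  apply: hn.
  - by rewrite (le_trans i0 ij) (le_trans ji)// (le_trans iN).
  - by rewrite i0 (le_trans ij)// (le_trans ji)// (le_trans iN).
  - by rewrite ger0_norm ?subr_ge0// exprVn; lra.
have kp : 0 < k.+1%:R :> R by [].
have h2 : `|x - (Num.floor (k.+1%:R * x))%:~R / k.+1%:R| <= k.+1%:R^-1.
  have -> : x - (Num.floor (k.+1%:R * x))%:~R / k.+1%:R = (k.+1%:R * x - (Num.floor (k.+1%:R * x))%:~R) / k.+1%:R.
    by rewrite mulrBl mulrAC divff ?mul1r// gt_eqF.
  rewrite normrM [X in _ * X]gtr0_norm// ler_piMl ?ltW//.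
  have /andP[f1 f2] := floor_itv (k.+1%:R * x).
  by move: f2; rewrite rmorphD /= => f2; rewrite ger0_norm ?subr_ge0//; lra.
apply: (le_trans (ler_distD x _ _)); apply: (le_trans (lerD h1 h2)).
by rewrite [leRHS]mulrDl mul1r.
Qed.

(** An open set of paths is the union of the tubes that it contains: a countable union of sets
    determined by countably many coordinates. *)
Lemma measurable_path d (T : measurableType d) (h : T -> Omega R) :
  (forall m j, measurable_fun setT (fun x => B (grid m j) (h x))) -> measurable_fun setT h.
Proof.
move=> hB; apply: (@measurability _ _ T (Omega R) setT h (@path_open R) erefl).
move=> _ [U oU <-]; rewrite setTI.
have mtube k n v : measurable (h @^-1` tube k n v).
  have -> : h @^-1` tube k n v = \bigcap_i \bigcap_m \bigcap_j
     (h @^-1` [set w | (i < size v)%N -> i%:R / 2 ^+ n <= grid m j :> R -> grid m j <= i.+1%:R / 2 ^+ n :> R ->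
    `|B (grid m j) w - (v`_i)%:~R / k.+1%:R| <= 2 / k.+1%:R]).
    apply/seteqP; split => x.
      by move=> tx i _ m _ j _; exact: tx.
    by move=> tx i m j; exact: (tx i I m I j I).
  apply: bigcapT_measurable => i; apply: bigcapT_measurable => m; apply: bigcapT_measurable => j.
  have [[c1 [c2 c3]]|nc] := pselect ((i < size v)%N /\ i%:R / 2 ^+ n <= grid m j :> R /\ grid m j <= i.+1%:R / 2 ^+ n :> R).
    have -> : h @^-1` [set w | (i < size v)%N -> i%:R / 2 ^+ n <= grid m j :> R -> grid m j <= i.+1%:R / 2 ^+ n :> R ->
      `|B (grid m j) w - (v`_i)%:~R / k.+1%:R| <= 2 / k.+1%:R] =
      (fun x => B (grid m j) (h x)) @^-1` `[(v`_i)%:~R / k.+1%:R - 2 / k.+1%:R, (v`_i)%:~R / k.+1%:R + 2 / k.+1%:R].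
      apply/seteqP; split => x /=; rewrite in_itv /= distrC ler_distlC.
        by move=> /(_ c1 c2 c3).
      by move=> + _ _ _.
    by rewrite -[X in measurable X]setTI; exact: hB.
  have -> : h @^-1` [set w | (i < size v)%N -> i%:R / 2 ^+ n <= grid m j :> R -> grid m j <= i.+1%:R / 2 ^+ n :> R ->
      `|B (grid m j) w - (v`_i)%:~R / k.+1%:R| <= 2 / k.+1%:R] = setT.
    by apply/seteqP; split => x //= _ c1 c2 c3; exfalso; exact: nc.
  exact: measurableT.
have -> : h @^-1` U = \bigcup_(c : nat * nat * seq int)
   (if pselect (tube c.1.1 c.1.2 c.2 `<=` U) then h @^-1` tube c.1.1 c.1.2 c.2 else set0).
  apply/seteqP; split => x; last first.
    by case=> c _; case: pselect => // cU /cU.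
  move=> /= Ux; have [T0 [e [e0 TU]]] := path_open_ball oU Ux.
  pose k := Num.truncn (4 / e); pose N := (Num.truncn `|T0|).+1.
  have [n [v [tv Nv]]] := tube_cover (h x) k N.
  exists (k, n, v) => //=; case: pselect => // -[] w tw; apply: TU => s /andP[s0 sT].
  apply: le_lt_trans (tube_diam tv tw _) _.
    rewrite s0 /=; apply: lt_le_trans Nv; apply: (le_lt_trans sT).
    by apply: le_lt_trans (ler_norm _) _; exact: truncnS_gt.
  by rewrite ltr_pdivrMr// mulrC -ltr_pdivrMr//; exact: truncnS_gt.
apply: countable_bigcupT_measurable => [|c]; first exact: countableP.
by case: pselect => _ /=; [exact: mtube|exact: measurable0].
Qed.

End path_borel.

Section expectation.
Context d (T : measurableType d) (R : realType) (P : probability T R).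
Implicit Types f g : T -> R.

Definition Ex f : R := \int[P]_w f w.

Definition bdmeas f := measurable_fun setT f /\ exists M : R, forall w, `|f w| <= M.

Lemma bdmeas_integrable f : bdmeas f -> P.-integrable setT (EFin \o f).
Proof.
move=> [mf [M fM]]; apply: measurable_bounded_integrable => //.
  apply: (@le_lt_trans _ _ 1%E); last exact: ltry.
  by rewrite le_eqVlt; apply/orP; left; apply/eqP; exact: (@probability_setT _ _ _ P).
exists M; split; first by rewrite num_real.
by move=> N MN w _; exact: le_trans (fM w) (ltW MN).
Qed.

Lemma bdmeas_cst c : bdmeas (fun=> c).
Proof. by split; [exact: measurable_cst|exists `|c|]. Qed.

Lemma bdmeas_add f g : bdmeas f -> bdmeas g -> bdmeas (fun w => f w + g w).
Proof.
move=> [mf [M fM]] [mg [N gN]]; split; first exact: measurable_funD.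
by exists (M + N) => w; apply: (le_trans (ler_normD _ _)); exact: lerD.
Qed.

Lemma bdmeas_mul f g : bdmeas f -> bdmeas g -> bdmeas (fun w => f w * g w).
Proof.
move=> [mf [M fM]] [mg [N gN]]; split; first exact: measurable_funM.
by exists (M * N) => w; rewrite normrM ler_pM.
Qed.

Lemma bdmeas_scale c f : bdmeas f -> bdmeas (fun w => c * f w).
Proof. by apply: bdmeas_mul; exact: bdmeas_cst. Qed.

Lemma bdmeas_sub f g : bdmeas f -> bdmeas g -> bdmeas (fun w => f w - g w).
Proof.
move=> bf bg; have -> : (fun w => f w - g w) = (fun w => f w + -1 * g w).
  by apply/funext => w; rewrite mulN1r.
by apply: bdmeas_add => //; exact: bdmeas_scale.
Qed.

Lemma bdmeas_indic A : measurable A -> bdmeas (\1_A : T -> R).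
Proof.
move=> mA; split; first exact: measurable_indic.
by exists 1 => w; rewrite indicE; case: (w \in A); rewrite ?normr1// normr0.
Qed.

Lemma integral_Ex f : bdmeas f -> (\int[P]_w (f w)%:E = (Ex f)%:E)%E.
Proof. by move=> bf; rewrite /Ex /Rintegral fineK//; apply: integrable_fin_num => //; exact: bdmeas_integrable. Qed.

Lemma Ex_add f g : bdmeas f -> bdmeas g -> Ex (fun w => f w + g w) = Ex f + Ex g.
Proof. by move=> bf bg; rewrite /Ex RintegralD//; exact: bdmeas_integrable. Qed.

Lemma Ex_sub f g : bdmeas f -> bdmeas g -> Ex (fun w => f w - g w) = Ex f - Ex g.
Proof. by move=> bf bg; rewrite /Ex RintegralB//; exact: bdmeas_integrable. Qed.

Lemma Ex_scale c f : bdmeas f -> Ex (fun w => c * f w) = c * Ex f.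
Proof. by move=> bf; rewrite /Ex RintegralZl//; exact: bdmeas_integrable. Qed.

Lemma Ex_cst c : Ex (fun=> c) = c.
Proof. rewrite /Ex Rintegral_cst//; transitivity (c * fine (1 : \bar R)); last by rewrite mulr1.
by congr (_ * fine _); exact: (@probability_setT _ _ _ P). Qed.

Lemma Ex_le f g : bdmeas f -> bdmeas g -> (forall w, f w <= g w) -> Ex f <= Ex g.
Proof. by move=> bf bg fg; apply: le_Rintegral => //; exact: bdmeas_integrable. Qed.

Lemma Ex_indic A : measurable A -> Ex \1_A = fine (P A).
Proof. by move=> mA; rewrite /Ex /Rintegral integral_indic// setIT. Qed.

End expectation.

(** * The Daniell-Stone theorem *)

Section daniell_stone.
Context {R : realType} {T : pointedType}.
Variables (L : set (T -> R)) (l : (T -> R) -> R).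
Implicit Types (f g : T -> R) (A : set T) (c : R).

Hypothesis L_cst : forall c, L (fun=> c).
Hypothesis L_add : forall f g, L f -> L g -> L (fun w => f w + g w).
Hypothesis L_mul : forall f g, L f -> L g -> L (fun w => f w * g w).
Hypothesis L_max : forall f g, L f -> L g -> L (fun w => Num.max (f w) (g w)).
Hypothesis l_add : forall f g, L f -> L g -> l (fun w => f w + g w) = l f + l g.
Hypothesis l_scale : forall c f, L f -> l (fun w => c * f w) = c * l f.
Hypothesis l_ge0 : forall f, L f -> (forall w, 0 <= f w) -> 0 <= l f.
Hypothesis l_1 : l (fun=> 1) = 1.
Hypothesis l_daniell : forall X : nat -> T -> R, (forall n, L (X n)) ->
  (forall n w, 0 <= X n w) -> (forall n w, X n.+1 w <= X n w) ->
  (forall w e, 0 < e -> exists n, X n w <= e) ->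
  forall e, 0 < e -> exists n, l (X n) <= e.

Let L_scale c f : L f -> L (fun w => c * f w).
Proof. by move=> Lf; apply: L_mul. Qed.

Let L_sub f g : L f -> L g -> L (fun w => f w - g w).
Proof.
move=> Lf Lg; have -> : (fun w => f w - g w) = (fun w => f w + -1 * g w).
  by apply/funext => w; rewrite mulN1r.
by apply: L_add => //; exact: L_scale.
Qed.

Let L_min f g : L f -> L g -> L (fun w => Num.min (f w) (g w)).
Proof.
move=> Lf Lg; have -> : (fun w => Num.min (f w) (g w)) = fun w => f w + g w - Num.max (f w) (g w).
  by apply/funext => w; rewrite -(addr_max_min (f w)) addrAC subrr add0r.
by apply: L_sub; [exact: L_add|exact: L_max].
Qed.

Let l_sub f g : L f -> L g -> l (fun w => f w - g w) = l f - l g.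
Proof.
move=> Lf Lg; have -> : (fun w => f w - g w) = (fun w => f w + -1 * g w).
  by apply/funext => w; rewrite mulN1r.
by rewrite l_add ?l_scale ?mulN1r//; exact: L_scale.
Qed.

Let l_le f g : L f -> L g -> (forall w, f w <= g w) -> l f <= l g.
Proof.
move=> Lf Lg fg; rewrite -subr_ge0 -l_sub//; apply: l_ge0; first exact: L_sub.
by move=> w; rewrite subr_ge0.
Qed.

Let l_cst c : l (fun=> c) = c.
Proof.
have -> : (fun=> c) = (fun w : T => c * 1) by apply/funext => w; rewrite mulr1.
by rewrite l_scale// l_1 mulr1.
Qed.

(** The supremum of the increasing sequence is at least 1 on [A]. Sequences are used because this
    supremum need not belong to [L]. *)
Definition daniell_cover c A (f : nat -> T -> R) : Prop :=
  [/\ forall n, L (f n), forall n w, 0 <= f n w, forall n w, f n w <= f n.+1 w,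
      forall n, l (f n) <= c &
      forall w e, A w -> e < 1 -> exists n, e < f n w].

Let cover_mono c A (f : nat -> T -> R) m n w : daniell_cover c A f -> (m <= n)%N -> f m w <= f n w.
Proof.
case=> _ _ fi _ _; apply: (@homo_leq _ (f^~ w) <=%R lexx le_trans) => k; exact: fi.
Qed.

Definition daniell_outer A : \bar R :=
  ereal_inf [set c%:E | c in [set c | exists f : nat -> T -> R, daniell_cover c A f]].

Local Notation mu := daniell_outer.

Let mu_le c A (f : nat -> T -> R) : daniell_cover c A f -> (mu A <= c%:E)%E.
Proof. by move=> h; apply: ereal_inf_lbound; exists c => //; exists f. Qed.

Let mu_ge0 A : (0 <= mu A)%E.
Proof.
apply: le_ereal_inf_tmp => _ [c [f [Lf f0 _ lc _]] <-]; rewrite lee_fin.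
by apply: le_trans (lc 0%N); apply: l_ge0.
Qed.

Let mu_le1 A : (mu A <= 1)%E.
Proof.
apply: (@mu_le 1 A (fun _ _ => 1)); split => //; first by move=> n; rewrite l_1.
by move=> w e _ e1; exists 0%N.
Qed.

Let mu_lt A c : (mu A < c%:E)%E -> exists f : nat -> T -> R, daniell_cover c A f.
Proof.
move=> /ereal_inf_lt[_ [c' [f [? ? ? lc ?]] <-]]; rewrite lte_fin => c'c.
by exists f; split => // n; apply: le_trans (lc n) (ltW c'c).
Qed.

Let mu_fin A : mu A \is a fin_num.
Proof. by rewrite ge0_fin_numE// (le_lt_trans (mu_le1 A))// ltry. Qed.

Let mu0 : mu set0 = 0%E.
Proof.
apply/eqP; rewrite eq_le mu_ge0 andbT; apply: (@mu_le 0 _ (fun _ _ => 0)).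
by split => // n; rewrite l_cst.
Qed.

Let mu_mono : {homo mu : A B / A `<=` B >-> (A <= B)%E}.
Proof.
move=> A B AB; apply: ereal_inf_le_tmp => _ [c [f [? ? ? ? fB]] <-].
by exists c => //; exists f; split => // w e /AB; exact: fB.
Qed.

(** Near-optimal covers of the given sets are added diagonally: the n-th function is the sum of the
    n-th terms of the first n covers. *)
Let mu_sigma_subadditive : sigma_subadditive mu.
Proof.
move=> F; apply/lee_addgt0Pr => e e0.
have e0' := ltW e0.
apply: le_trans (epsilon_trick xpredT (fun n => mu_ge0 (F n)) e0').
pose c n := fine (mu (F n)) + e / (2 ^ n.+1)%:R.
have cE n : (mu (F n) + (e / (2 ^ n.+1)%:R)%:E = (c n)%:E)%E.
  by rewrite -[mu (F n)]fineK.
have c0 n : 0 <= c n by rewrite addr_ge0// ?fine_ge0// divr_ge0.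
rewrite (eq_eseriesr (fun i _ => cE i)).
have /choice[f fP] : forall n, exists g : nat -> T -> R, daniell_cover (c n) (F n) g.
  move=> n; apply: mu_lt; rewrite -cE lteDl// lte_fin divr_gt0// ltr0n expn_gt0//.
have : (0 <= \sum_(i <oo) (c i)%:E)%E by apply: nneseries_ge0 => i _ _; rewrite lee_fin.
case sE : (\sum_(i <oo) (c i)%:E)%E => [s| |]// _; last by rewrite leey.
have Lh n m : L (fun w => \sum_(k < n) f k m w).
  elim: n => [|n ih].
    by under eq_fun do rewrite big_ord0.
  by under eq_fun do rewrite big_ord_recr /=; apply: L_add => //; have [] := fP n.
have lh n m : l (fun w => \sum_(k < n) f k m w) <= \sum_(k < n) c k.
  elim: n => [|n ih].
    by under eq_fun do rewrite big_ord0; rewrite l_cst big_ord0.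
  under eq_fun do rewrite big_ord_recr /=; rewrite big_ord_recr /=.
  have [Lf _ _ lf _] := fP n.
  by rewrite (l_add (Lh n m) (Lf m)); exact: lerD ih (lf m).
apply: (@mu_le s _ (fun n w => \sum_(k < n) f k n w)); split => //.
- by move=> n w; apply: sumr_ge0 => k _; have [] := fP k.
- move=> n w; rewrite big_ord_recr /= -[leLHS]addr0; apply: lerD; last by have [] := fP n.
  by apply: ler_sum => k _; have [] := fP k.
- move=> n; apply: (le_trans (lh n n)).
  rewrite -lee_fin -sE -sumEFin -(big_mkord xpredT (fun k => (c k)%:E)).
  by apply: nneseries_lim_ge => i _ _; rewrite lee_fin.
- move=> w e' [k _ Fw] e'1; have [_ _ _ _ /(_ w e' Fw e'1)[n en]] := fP k.
  exists (maxn n k.+1); apply: (lt_le_trans en).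
  apply: (le_trans (cover_mono w (fP k) (leq_maxl n k.+1))).
  have kn : (k < maxn n k.+1)%N by rewrite leq_maxr.
  rewrite (bigD1 (Ordinal kn))//= lerDl; apply: sumr_ge0 => j _.
  by have [] := fP j.
Qed.

HB.instance Definition _ := isOuterMeasure.Build R T mu mu0 mu_ge0 mu_mono mu_sigma_subadditive.

(** The indicator of the set is the increasing limit of functions [h k] in [L] with values in
    [0, 1]. Multiplying a near-optimal cover of [X] by [h] and by [1 - h] splits it into covers of
    the two pieces. *)
Lemma daniell_caratheodory g : L g -> mu.-caratheodory [set w | 0 < g w].
Proof.
move=> Lg; apply: le_caratheodory_measurable => X.
apply/lee_addgt0Pr => e e0.
pose c := fine (mu X) + e / 2.
have [f fX] : exists f : nat -> T -> R, daniell_cover c X f.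
  by apply: mu_lt; rewrite -[mu X]fineK// lte_fin /c ltrDl; lra.
have [Lf f0 fi lf fcov] := fX.
pose h k w := Num.min 1 (k%:R * Num.max (g w) 0).
have Lh k : L (h k) by apply: L_min => //; apply: L_scale; exact: L_max.
have h01 k w : 0 <= h k w <= 1.
  by rewrite /h le_min ler01 mulr_ge0 ?le_max ?lexx ?orbT//= ge_min lexx.
have hi k w : h k w <= h k.+1 w.
  rewrite /h le_min !ge_min lexx /=; apply/orP; right.
  by rewrite ler_wpM2r ?ler_nat// le_max lexx orbT.
have fh n w : 0 <= f n w * h n w by have /andP[? _] := h01 n w; rewrite mulr_ge0.
have fhi n w : f n w * h n w <= f n.+1 w * h n.+1 w.
  by have /andP[? _] := h01 n w; rewrite ler_pM.
pose S := [set l (fun w => f n w * h n w) | n in setT].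
have Sc n : l (fun w => f n w * h n w) <= c.
  apply: le_trans (lf n); apply: l_le => //; first exact: L_mul.
  by move=> w; have /andP[_ ?] := h01 n w; rewrite ler_piMr.
have supS : has_sup S.
  by split; [exists (l (fun w => f 0%N w * h 0%N w)), 0%N|exists c => _ [n _ <-]].
have c1P n : l (fun w => f n w * h n w) <= sup S by apply: sup_upper_bound => //; exists n.
have m1 : (mu (X `&` [set w | (0 < g w)%R]) <= (sup S)%:E)%E.
  apply: (@mu_le _ _ (fun n w => f n w * h n w)); split => //; first by move=> n; apply: L_mul.
  move=> w r [Xw gw] r1.
  have [r0|r0] := ltP r 0; first by exists 0%N; exact: lt_le_trans (fh _ _).
  pose r' := Num.sqrt r; have r'1 : r' < 1 by rewrite -sqrtr1 ltr_sqrt.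
  have r'0 : 0 <= r' by exact: sqrtr_ge0.
  have [n rn] := fcov w r' Xw r'1.
  pose k := (Num.truncn (g w)^-1).+1.
  have hk m : (k <= m)%N -> h m w = 1.
    move=> km; rewrite /h max_l ?ltW// min_l//.
    rewrite -ler_pdivrMr// div1r; apply: (@le_trans _ _ k%:R); last by rewrite ler_nat.
    exact/ltW/truncnS_gt.
  exists (maxn n k); rewrite hk ?leq_maxr// mulr1.
  apply: lt_le_trans (cover_mono w fX (leq_maxl n k)); apply: le_lt_trans rn.
  by rewrite -{1}(sqr_sqrtr r0) expr2 ler_piMr// ltW.
have [_ [k _ <-] hk] := sup_adherent (ltac:(lra) : 0 < e / 2) supS.
(* The index [k] is fixed where [l (f k * h k)] is within e/2 of its supremum; later terms of the
   cover can only increase it, so the remainder [f n * (1 - h k)] costs at most c - sup S + e/2. *)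
have m2 : (mu (X `&` ~` [set w | (0 < g w)%R]) <= (c - sup S + e / 2)%:E)%E.
  apply: (@mu_le _ _ (fun n w => f n w * (1 - h k w))); split.
  - by move=> n; apply: L_mul => //; exact: L_sub.
  - by move=> n w; have /andP[_ ?] := h01 k w; rewrite mulr_ge0// subr_ge0.
  - by move=> n w; have /andP[_ ?] := h01 k w; rewrite ler_wpM2r// subr_ge0.
  - move=> n; apply: (@le_trans _ _ (l (fun w => f (maxn n k) w * (1 - h k w)))).
      apply: l_le; [by apply: L_mul => //; exact: L_sub|by apply: L_mul => //; exact: L_sub|].
      move=> w; have /andP[_ ?] := h01 k w; rewrite ler_wpM2r ?subr_ge0//.
      exact: cover_mono fX (leq_maxl _ _).
    have -> : (fun w => f (maxn n k) w * (1 - h k w)) = fun w => f (maxn n k) w - f (maxn n k) w * h k w.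
      by apply/funext => w; ring.
    rewrite l_sub//; last exact: L_mul.
    have : l (fun w => f k w * h k w) <= l (fun w => f (maxn n k) w * h k w).
      apply: l_le; [exact: L_mul|exact: L_mul|] => w.
      by have /andP[? _] := h01 k w; rewrite ler_wpM2r//; exact: cover_mono fX (leq_maxr _ _).
    by have := lf (maxn n k); lra.
  - move=> w r [Xw gw] r1; have [n rn] := fcov w r Xw r1; exists n.
    suff -> : h k w = 0 by rewrite subr0 mulr1.
    by rewrite /h max_r ?mulr0 ?min_r// leNgt; apply/negP.
apply: (le_trans (leeD m1 m2)); apply: (@le_trans _ _ ((fine (mu X) + e)%:E)).
  by rewrite -EFinD lee_fin /c; lra.
by rewrite EFinD fineK.
Qed.

(** The lower bound rests on [l_daniell]: if [f] covers the whole space, the positive parts of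
    [1 - f n] decrease to 0. *)
Lemma daniell_outerT : mu setT = 1%E.
Proof.
apply/eqP; rewrite eq_le mu_le1 /=; apply: le_ereal_inf_tmp => _ [c [f fT] <-].
have [Lf f0 fi lf fcov] := fT.
rewrite lee_fin; apply/ler_addgt0Pr => e e0.
have [||||n hn] := @l_daniell (fun n w => Num.max (1 - f n w) 0) _ _ _ _ e e0.
- by move=> n; apply: L_max => //; exact: L_sub.
- by move=> n w; rewrite le_max lexx orbT.
- by move=> n w; rewrite ge_max !le_max lexx orbT andbT lerD2l lerN2 fi.
- move=> w e' e'0; have [n hn] := fcov w (1 - e') I (ltac:(lra) : 1 - e' < 1).
  by exists n; rewrite ge_max (ltW e'0) andbT; lra.
have : l (fun=> 1) <= l (fun w => f n w + Num.max (1 - f n w) 0).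
  apply: l_le => //; first by apply: L_add => //; apply: L_max => //; exact: L_sub.
  by move=> w; have : 1 - f n w <= Num.max (1 - f n w) 0; [rewrite le_max lexx|lra].
rewrite l_1 l_add//; last by apply: L_max => //; exact: L_sub.
by have := lf n; lra.
Qed.

Variables (d : measure_display) (U : measurableType d) (h : T -> U).
Hypothesis hsig : forall A : set U, measurable A ->
  <<s [set [set w | 0 < g w] | g in L] >> (h @^-1` A).

Let hm (A : set U) : measurable A -> mu.-caratheodory (h @^-1` A).
Proof.
move=> /hsig; apply: (@smallest_sub _ _ _ mu.-caratheodory) => //.
  exact: (@sigma_algebra_measurable _ (caratheodory_type mu)).
by move=> _ [g Lg <-]; exact: daniell_caratheodory.
Qed.

Definition daniell_measure (A : set U) : \bar R := mu (h @^-1` A).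

Let dm0 : daniell_measure set0 = 0%E.
Proof. by rewrite /daniell_measure preimage_set0 mu0. Qed.

Let dm_ge0 (A : set U) : (0 <= daniell_measure A)%E.
Proof. exact: mu_ge0. Qed.

Let dm_sigma : semi_sigma_additive daniell_measure.
Proof.
move=> F mF tF mUF; rewrite /daniell_measure preimage_bigcup.
have := @caratheodory_measure_sigma_additive R T mu (fun n => h @^-1` F n).
apply => [n||]; [exact: hm| |by rewrite -preimage_bigcup; exact: hm].
apply/trivIsetP => i j _ _ ij; rewrite -preimage_setI.
by move/trivIsetP : tF => /(_ i j I I ij) ->; rewrite preimage_set0.
Qed.

HB.instance Definition _ := isMeasure.Build d U R daniell_measure dm0 dm_ge0 dm_sigma.

Let dm_T : daniell_measure setT = 1%E.
Proof. by rewrite /daniell_measure preimage_setT daniell_outerT. Qed.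

HB.instance Definition _ := Measure_isProbability.Build d U R daniell_measure dm_T.

(** After rescaling to values in [0, 1], the inequality for [g] and for [1 - g] gives equality. It
    is obtained by layers: N (t_{i+1} - t_i), with t_i the minimum of [g] and i/N, equals 1 where g
    > (i+1)/N and so covers this set. Summing over the layers leaves an error 1/N. *)
Lemma daniell_stone : exists P : probability U R,
  forall g : U -> R, bdmeas g -> L (g \o h) -> Ex P g = l (g \o h).
Proof.
exists daniell_measure.
pose P : probability U R := daniell_measure.
suff key (g : U -> R) : measurable_fun setT g -> L (g \o h) -> (forall w, 0 <= g w <= 1) ->
    Ex P g <= l (g \o h).
  move=> g bg Lg; have [mg [M gM]] := bg.
  pose K := `|M| + 1; have K0 : 0 < K by rewrite ltr_wpDl.
  pose g' w := (2 * K)^-1 * (g w + K).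
  have bK : bdmeas (fun _ : U => K) by exact: bdmeas_cst.
  have bg' : bdmeas g' by apply: bdmeas_scale; exact: bdmeas_add.
  have Lg' : L (g' \o h) by apply: (L_scale _ (L_add Lg (L_cst K))).
  have g'01 w : 0 <= g' w <= 1.
    have := gM w; have := ler_norm M; rewrite ler_norml => ? /andP[? ?].
    rewrite /g' mulr_ge0 ?invr_ge0/=; [|lra|rewrite /K; lra].
    by rewrite mulrC ler_pdivrMr; [rewrite /K; lra|lra].
  have h1 : Ex P g' <= l (g' \o h) by apply: key => //; have [] := bg'.
  have h2 : Ex P (fun w => 1 - g' w) <= l ((fun w => 1 - g' w) \o h).
    apply: key; first by have [] := bdmeas_sub (@bdmeas_cst _ U R 1) bg'.
    - exact: (L_sub (L_cst 1) Lg').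
    - by move=> w; have /andP[? ?] := g'01 w; rewrite subr_ge0 gerBl; apply/andP.
  have h3 : Ex P g' = l (g' \o h).
    apply/eqP; rewrite eq_le h1 /=; move: h2.
    rewrite Ex_sub ?Ex_cst//; last exact: bdmeas_cst.
    by rewrite (l_sub (L_cst 1) Lg') l_1; lra.
  have e1 : Ex P g' = (2 * K)^-1 * (Ex P g + K).
    by rewrite /g' (Ex_scale P _ (bdmeas_add bg bK)) (Ex_add P bg bK) Ex_cst.
  have e2 : l (g' \o h) = (2 * K)^-1 * (l (g \o h) + K).
    by rewrite /g' (l_scale _ (L_add Lg (L_cst K))) (l_add Lg (L_cst K)) l_cst.
  have K2 : (2 * K)^-1 != 0 by rewrite invr_neq0// mulf_neq0// gt_eqF.
  by move: h3; rewrite e1 e2 => /(mulfI K2)/addIr.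
move=> mg Lg g01.
apply/ler_addgt0Pr => e e0.
pose N := (Num.truncn e^-1).+1.
have N0 : 0 < N%:R :> R by [].
have N0' : 0 < N%:R^-1 :> R by rewrite invr_gt0.
pose t i w := Num.min (g w) (i%:R / N%:R).
have bt i : bdmeas (t i).
  split; first by apply: measurable_minr => //; exact: measurable_cst.
  exists 1 => w; have /andP[? ?] := g01 w; rewrite ger0_norm ?ge_min ?le_min; first by apply/orP; left.
  by apply/andP; split => //; rewrite divr_ge0.
have Lt i : L (t i \o h) by apply: (L_min Lg (L_cst _)).
pose A i := [set w | i%:R / N%:R < g w].
have mA i : measurable (A i).
  rewrite -[X in measurable X]setTI.
  have -> : A i = g @^-1` `]i%:R / N%:R, +oo[ by apply/seteqP; split => w /=; rewrite in_itv /= andbT.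
  exact: mg.
have lev i : N%:R^-1 * fine (P (A i.+1)) <= l (t i.+1 \o h) - l (t i \o h).
  rewrite mulrC ler_pdivrMr// -lee_fin fineK; last exact: mu_fin.
  apply: (@mu_le _ _ (fun _ w => N%:R * (t i.+1 (h w) - t i (h w)))); split.
  - by move=> _; apply: L_scale; exact: (L_sub (Lt _) (Lt _)).
  - move=> _ w; rewrite mulr_ge0// subr_ge0 /t le_min !ge_min lexx /=.
    by rewrite ler_pM2r// ler_nat leqnSn orbT.
  - by [].
  - by move=> _; rewrite (l_scale _ (L_sub (Lt _) (Lt _))) (l_sub (Lt _) (Lt _)) mulrC.
  - move=> w r /= gw r1; exists 0%N.
    have hi : i%:R / N%:R <= i.+1%:R / N%:R :> R by rewrite ler_pM2r// ler_nat.
    rewrite /t !min_r ?(ltW gw)//; last exact: le_trans hi (ltW gw).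
    by rewrite -mulrBl -natrB// subSnn mul1r divff// gt_eqF.
have main i : Ex P (t i.+1) <= N%:R^-1 + l (t i \o h).
  elim: i => [|i ih].
    apply: (@le_trans _ _ (Ex P (fun=> N%:R^-1))).
      apply: Ex_le => //; first exact: bdmeas_cst.
      by move=> w; rewrite /t div1r ge_min lexx orbT.
    rewrite Ex_cst lerDl; apply: l_ge0; first exact: Lt.
    by move=> w; rewrite /= /t mul0r le_min lexx andbT; have /andP[] := g01 (h w).
  apply: (@le_trans _ _ (Ex P (fun w => t i.+1 w + N%:R^-1 * \1_(A i.+1) w))).
    apply: Ex_le => //.
      by apply: bdmeas_add => //; apply: bdmeas_scale; exact: bdmeas_indic.
    move=> w; rewrite indicE; have [Aw|nAw] := boolP (w \in A i.+1).
      have gw : i.+1%:R / N%:R < g w by move: Aw; rewrite inE.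
      rewrite mulr1 /t (min_r (ltW gw)) ge_min; apply/orP; right.
      by rewrite -natr1 mulrDl mul1r.
    have gw : g w <= i.+1%:R / N%:R.
      by rewrite leNgt; apply: contra nAw => ?; rewrite inE.
    by rewrite mulr0 addr0 /t (min_l gw) ge_min lexx.
  rewrite Ex_add//; last by apply: bdmeas_scale; exact: bdmeas_indic.
  rewrite Ex_scale ?Ex_indic//; last exact: bdmeas_indic.
  by have := lev i; lra.
have <- : t N = g.
  apply/funext => w; rewrite /t divff ?gt_eqF// min_l//.
  by have /andP[] := g01 w.
apply: (le_trans (main _)).
have : l (t (Num.truncn e^-1) \o h) <= l (t N \o h).
  apply: l_le; [exact: Lt|exact: Lt|] => w; rewrite /= /t le_min !ge_min lexx /=.
  by rewrite ler_pM2r// ler_nat leqnSn orbT.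
have : N%:R^-1 <= e.
  by rewrite -[leRHS]invrK lef_pV2 ?posrE ?invr_gt0//; exact/ltW/truncnS_gt.
lra.
Qed.

End daniell_stone.

Lemma clip01_lip (R : realType) (a b : R) :
  `|Num.max 0 (Num.min 1 a) - Num.max 0 (Num.min 1 b)| <= `|a - b|.
Proof.
have clipE (y : R) : [\/ Num.max 0 (Num.min 1 y) = 0 /\ y <= 0,
    Num.max 0 (Num.min 1 y) = y /\ 0 <= y <= 1 | Num.max 0 (Num.min 1 y) = 1 /\ 1 <= y].
  have /orP[y0|y0] := le_total y 0; first by apply: Or31; rewrite min_r ?max_l//; lra.
  have /orP[y1|y1] := le_total y 1; first by apply: Or32; rewrite min_r// max_r// y0 y1.
  by apply: Or33; rewrite min_l ?max_r.
have := ler_norm (a - b); have := ler_norm (b - a); rewrite distrC ler_norml.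
case: (clipE a) => -[-> ?]; case: (clipE b) => -[-> ?] ? ?; apply/andP; split; lra.
Qed.

Section dyadic_cylinders.
Context {R : realType}.
Implicit Types (X Y : Omega R -> R) (Phi : (R -> R) -> R) (ts : seq R).

(** Restricting to dyadic times is what makes Daniell's condition accessible: the limit path is
    obtained from the values of a sequence of paths at dyadic times. *)
Definition dLip X : Prop := exists M L ts Phi, [/\ cyl M L ts Phi,
  forall s, s \in ts -> exists m j, s = grid m j & X = fun w => Phi (pathfun w)].

Lemma grid_ge0 m j : 0 <= grid m j :> R.
Proof. by rewrite /grid divr_ge0// exprn_ge0. Qed.

Lemma dLip_Lip X : dLip X -> Lip +oo%E X.
Proof.
move=> [M [L [ts [Phi [PC tsD ->]]]]]; apply: cylindrical_Lip; first by rewrite leey.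
exists M, L, ts, Phi; split => //; apply/allP => s /tsD[m [j ->]].
by rewrite grid_ge0 leey.
Qed.

Lemma dLip_comp2 X Y (h : R -> R -> R) : loc_lip h ->
  dLip X -> dLip Y -> dLip (fun w => h (X w) (Y w)).
Proof.
move=> hh [M [L [ts [Phi [PC tst ->]]]]] [N [K [us [Psi [QC ust ->]]]]].
have [k [M' [k0 hM hk]]] := hh M N.
exists M', (k * (L + K)), (ts ++ us), (fun f => h (Phi f) (Psi f)); split => //.
  exact: cyl_comp2 PC QC k0 hM hk.
by move=> s; rewrite mem_cat => /orP[/tst|/ust].
Qed.

Lemma dLip_cst c : dLip (fun=> c).
Proof.
by exists `|c|, 0, [::], (fun=> c); split => //; split => // f g; rewrite subrr normr0 mul0r.
Qed.

Lemma dLip_add X Y : dLip X -> dLip Y -> dLip (fun w => X w + Y w).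
Proof. exact: (dLip_comp2 loc_lip_add). Qed.

Lemma dLip_mul X Y : dLip X -> dLip Y -> dLip (fun w => X w * Y w).
Proof. exact: (dLip_comp2 loc_lip_mul). Qed.

Lemma dLip_max X Y : dLip X -> dLip Y -> dLip (fun w => Num.max (X w) (Y w)).
Proof. exact: (dLip_comp2 loc_lip_max). Qed.

Lemma dLip_scale c X : dLip X -> dLip (fun w => c * X w).
Proof. by apply: dLip_mul; exact: dLip_cst. Qed.

Lemma dLip_trunc4 N m j m' j' : 0 <= N ->
  dLip (fun w => trunc4 N (B (grid m j) w - B (grid m' j') w)).
Proof.
move=> N0; exists (N ^+ 4), (4 * N ^+ 3), [:: grid m' j'; grid m j],
  (fun f => trunc4 N (f (grid m j) - f (grid m' j'))); split => //; first exact: trunc4_cyl.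
by move=> s; rewrite !inE => /orP[/eqP ->|/eqP ->]; do 2 eexists.
Qed.

Lemma dLip_sum n (F : nat -> Omega R -> R) : (forall k, dLip (F k)) ->
  dLip (fun w => \sum_(k < n) F k w).
Proof.
move=> FD; elim: n => [|n ih].
  by under eq_fun do rewrite big_ord0; exact: dLip_cst.
by under eq_fun do rewrite big_ord_recr /=; exact: dLip_add.
Qed.

End dyadic_cylinders.

(** * Chaining along the dyadic grids *)

Section chaining.
Context {R : realType}.

Lemma leq_lt2 (i j : nat) : (i <= j)%N -> (j < i.+2)%N -> j = i \/ j = i.+1.
Proof. lia. Qed.

Definition gfloor (n : nat) (t : R) : R := grid n (Num.truncn (2 ^+ n * t)).

Lemma gfloor_le n (t : R) : 0 <= t -> gfloor n t <= t.
Proof.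
move=> t0; rewrite /gfloor /grid ler_pdivrMr ?exprn_gt0// mulrC truncn_le.
by rewrite mulr_ge0// exprn_ge0.
Qed.

Lemma gfloor_gt n (t : R) : t - (2 ^+ n)^-1 < gfloor n t.
Proof.
have n0 : 0 < 2 ^+ n :> R by rewrite exprn_gt0.
rewrite /gfloor /grid ltr_pdivlMr// mulrBl mulVf ?gt_eqF// ltrBlDr mulrC natr1.
exact: truncnS_gt.
Qed.

Lemma gfloor_id n m j : (m <= n)%N -> gfloor n (grid m j) = grid m j :> R.
Proof.
move=> mn; rewrite /gfloor /grid.
have -> : 2 ^+ n * (j%:R / 2 ^+ m) = (2 ^ (n - m) * j)%:R :> R.
  by rewrite natrM natrX -{1}(subnK mn) exprD; field; rewrite expf_neq0.
by rewrite natrK natrM natrX -{2}(subnK mn) exprD; field; rewrite !expf_neq0.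
Qed.

Variables (w : R -> R) (K : R) (N m : nat).
(** Any ratio below 1 with (3/2) r^4 >= 1 would do: 3/2 is the weight per level in [penalty], and
    0.91^4 is just above 2/3. *)
Let r : R := 91 / 100.
Hypothesis K0 : 0 <= K.
Hypothesis wK : forall k i : nat, (k <= m)%N -> (i < k * 2 ^ k)%N ->
  `|w (grid k i.+1) - w (grid k i)| <= K * r ^+ k.

(** Passing from one level to the next moves the dyadic floor by at most one step of the finer grid.
    The constant 11 makes the sum telescope, since r/(1 - r) = 91/9 is less than 11. *)
Lemma chain_level n t : (n <= m)%N -> 0 <= t -> t < n%:R ->
  `|w (gfloor m t) - w (gfloor n t)| <= 11 * K * (r ^+ n - r ^+ m).
Proof.
move=> + t0 tn; elim: m wK => [|m' ih] wK'.
  by rewrite leqn0 => /eqP ->; rewrite !subrr normr0 mulr0.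
rewrite leq_eqVlt => /predU1P[->|nm]; first by rewrite !subrr normr0 mulr0.
have := ih (fun k i km => wK' k i (leqW km)) nm.
have step : `|w (gfloor m'.+1 t) - w (gfloor m' t)| <= K * r ^+ m'.+1.
  rewrite /gfloor; set i := Num.truncn (2 ^+ m' * t); set j := Num.truncn _.
  have g2 : grid m' i = grid m'.+1 (2 * i) :> R.
    by rewrite /grid exprS natrM -mulf_div divff ?mul1r.
  have i1 : i%:R <= 2 ^+ m' * t by rewrite truncn_le mulr_ge0// exprn_ge0.
  have i2 : 2 ^+ m' * t < i.+1%:R by exact: truncnS_gt.
  have j1 : j%:R <= 2 ^+ m'.+1 * t by rewrite truncn_le mulr_ge0// exprn_ge0.
  have j2 : 2 ^+ m'.+1 * t < j.+1%:R by exact: truncnS_gt.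
  have ij1 : (2 * i <= j)%N.
    by rewrite -ltnS -(ltr_nat R) natrM; move: j2; rewrite exprS; lra.
  have ij2 : (j < (2 * i).+2)%N.
    rewrite -addn2 -(ltr_nat R) natrD natrM; move: j1; rewrite exprS => j1.
    by apply: (le_lt_trans j1); move: i2; rewrite -natr1; lra.
  have [->|->] := leq_lt2 ij1 ij2.
    by rewrite g2 subrr normr0 mulr_ge0// exprn_ge0// /r; lra.
  rewrite g2; apply: wK' => //.
  rewrite -(ltr_nat R) !natrM natrX exprS.
  have : n%:R <= m'.+1%:R :> R by rewrite ler_nat ltnW.
  move=> nm'; apply: (@le_lt_trans _ _ (2 * (2 ^+ m' * t))); first lra.
  by rewrite mulrA [ltRHS]mulrC ltr_pM2l ?mulr_gt0 ?exprn_gt0//; apply: lt_le_trans nm'.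
have : 0 <= K * r ^+ m' by rewrite mulr_ge0// exprn_ge0// /r; lra.
have := ler_distD (w (gfloor m' t)) (w (gfloor m'.+1 t)) (w (gfloor n t)).
have e : r ^+ m'.+1 = 91 / 100 * r ^+ m' by rewrite exprS.
by move: step; rewrite e; lra.
Qed.

(** Descending from level m to level n costs 11 for each of the two points; at level n the floors
    are equal or neighbours, which costs 1. The bound does not depend on m. *)
Lemma chain_modulus n s t : (n <= m)%N -> 0 <= s -> s <= t -> t < n%:R ->
  t - s <= (2 ^+ n)^-1 -> `|w (gfloor m t) - w (gfloor m s)| <= 23 * K * r ^+ n.
Proof.
move=> nm s0 st tn ts.
have t0 := le_trans s0 st; have sn := le_lt_trans st tn.
have h1 := chain_level nm t0 tn; have h2 := chain_level nm s0 sn.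
have rn k : 0 <= K * r ^+ k by rewrite mulr_ge0// exprn_ge0// /r; lra.
have h3 : `|w (gfloor n t) - w (gfloor n s)| <= K * r ^+ n.
  rewrite /gfloor; set j := Num.truncn (2 ^+ n * t); set i := Num.truncn (2 ^+ n * s).
  have n0 : 0 < 2 ^+ n :> R by rewrite exprn_gt0.
  have ij : (i <= j)%N by apply: le_truncn; rewrite ler_pM2l.
  have i1 : i%:R <= 2 ^+ n * s by rewrite truncn_le mulr_ge0// ltW.
  have i2 : 2 ^+ n * s < i.+1%:R by exact: truncnS_gt.
  have j1 : j%:R <= 2 ^+ n * t by rewrite truncn_le mulr_ge0// ltW.
  have ji : (j < i.+2)%N.
    rewrite -(ltr_nat R) -(natr1 i.+1); apply: (le_lt_trans j1).
    have : 2 ^+ n * (t - s) <= 1 by rewrite mulrC -ler_pdivlMr// div1r.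
    lra.
  have [->|->] := leq_lt2 ij ji.
    by rewrite subrr normr0.
  apply: wK => //; rewrite -(ltr_nat R) natrM natrX; apply: (le_lt_trans i1).
  by rewrite mulrC ltr_pM2r.
have := ler_distD (w (gfloor n t)) (w (gfloor m t)) (w (gfloor m s)).
have := ler_distD (w (gfloor n s)) (w (gfloor n t)) (w (gfloor m s)).
rewrite (distrC (w (gfloor n s)) (w (gfloor m s))).
by move: (rn n) (rn m); lra.
Qed.

Lemma chain_bound n t : (n <= m)%N -> w 0 = 0 -> 0 <= t -> t < n%:R ->
  `|w (gfloor m t)| <= 11 * K * r ^+ n + (n * 2 ^ n)%:R * (K * r ^+ n).
Proof.
move=> nm w0 t0 tn; have h1 := chain_level nm t0 tn.
have rn k : 0 <= K * r ^+ k by rewrite mulr_ge0// exprn_ge0// /r; lra.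
have h2 : `|w (gfloor n t)| <= (n * 2 ^ n)%:R * (K * r ^+ n).
  rewrite /gfloor; set j := Num.truncn _.
  have jn : (j <= n * 2 ^ n)%N.
    rewrite -(ler_nat R) natrM natrX; apply: (@le_trans _ _ (2 ^+ n * t)).
      by rewrite truncn_le mulr_ge0// exprn_ge0.
    by rewrite mulrC ler_pM2r ?exprn_gt0// ltW.
  apply: (@le_trans _ _ (j%:R * (K * r ^+ n))); last by rewrite ler_wpM2r// ler_nat.
  elim: j jn => [_|j ih jn]; first by rewrite /grid mul0r w0 normr0 mul0r.
  have := ih (ltnW jn); have := wK nm jn.
  have := ler_distD (w (grid n j)) (w (grid n j.+1)) 0; rewrite !subr0.
  by rewrite -natr1; lra.
have := ler_distD (w (gfloor n t)) (w (gfloor m t)) 0; rewrite !subr0.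
by move: (rn n) (rn m); lra.
Qed.

End chaining.

(** * Ultralimits of paths *)

Section ultralimit_path.
Context {R : realType}.

Lemma UN_bounded_cvg (a : nat -> R) (M : R) n0 : (forall n, (n0 <= n)%N -> `|a n| <= M) ->
  a @ UN --> lim (a @ UN).
Proof.
move=> aM; apply/cvg_ex.
pose b n := if (n0 <= n)%N then a n else 0.
have bM n : `|b n| <= `|M|.
  rewrite /b; case: ifP => [/aM h|_]; last by rewrite normr0.
  exact: le_trans (ler_norm _).
exists (lim (b @ UN)); apply: cvg_trans (ultra_cvg bM); apply: near_eq_cvg.
by apply: UN_eventually; exists n0 => // n /= nn; rewrite /b nn.
Qed.

Lemma pos_part_dist (s t e : R) : s <= t + e -> 0 <= e -> Num.max s 0 - Num.max t 0 <= e.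
Proof. by case: (leP s 0); case: (leP t 0) => *; lra. Qed.

(** The n-th path is only controlled on grids of level up to n, so it is read at the dyadic floor of
    level n of each time. The bounds of [chain_modulus] are uniform in n, hence pass to the limit
    and make it continuous. *)
Lemma ultralimit_path (w : nat -> Omega R) (K : R) : 0 <= K ->
  (forall m k i : nat, (k <= m)%N -> (i < k * 2 ^ k)%N ->
    `|B (grid k i.+1) (w m) - B (grid k i) (w m)| <= K * (91 / 100) ^+ k) ->
  exists v : Omega R, forall m j, (fun n => B (grid m j) (w n)) @ UN --> B (grid m j) v.
Proof.
move=> K0 wK.
pose a (t : R) n := pathfun (w n) (gfloor n t).
have a0 t n : t <= 0 -> a t n = 0.
  move=> t0; rewrite /a /gfloor (_ : Num.truncn _ = 0%N); last first.
    by apply/eqP; rewrite -leqn0 truncn_le_nat; apply: le_lt_trans ltr01; rewrite mulr_ge0_le0// exprn_ge0.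
  by rewrite path_eq0// /grid mul0r.
have ac t : a t @ UN --> lim (a t @ UN).
  have [t0|t0] := leP t 0; first by apply: (@UN_bounded_cvg _ 0 0) => n _; rewrite a0// normr0.
  pose n0 := (Num.truncn t).+1.
  apply: (@UN_bounded_cvg _ _ n0) => n nn.
  apply: (chain_bound K0 (wK n) nn _ (ltW t0) (truncnS_gt t)).
  by rewrite path_eq0.
pose f t := lim (a t @ UN).
have f0 t : t <= 0 -> f t = 0.
  by move=> t0; apply: (UN_unique (ac t)); rewrite (_ : a t = fun=> 0); [exact: UN_cst|apply/funext => n; exact: a0].
have fmod n s t : 0 <= s -> s <= t -> t < n%:R -> t - s <= (2 ^+ n)^-1 ->
    `|f t - f s| <= 23 * K * (91 / 100) ^+ n.
  move=> s0 st tn ts; apply: (UN_norm_le (ac t) (ac s)).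
  apply: UN_eventually; exists n => // m /= nm.
  exact: (chain_modulus K0 (wK m) nm s0 st tn ts).
have fc : continuous f.
  move=> t; apply/cvgrPdist_le => e e0.
  have r0 : (fun n => 23 * K * (91 / 100) ^+ n : R) @ \oo --> (23 * K * 0 : R).
    by apply: cvgM; [exact: cvg_cst|apply: cvg_expr; rewrite ger0_norm; lra].
  rewrite mulr0 in r0; move/cvgrPdist_le : r0 => /(_ e e0)[n1 _ hn1].
  pose n := maxn n1 (Num.truncn `|t|).+2.
  have tn : `|t| + 1 < n%:R.
    apply: (@lt_le_trans _ _ ((Num.truncn `|t|).+2%:R)); last by rewrite ler_nat leq_maxr.
    by rewrite -(natr1 (Num.truncn `|t|).+1) ltrD2r; exact: truncnS_gt.
  have en : 23 * K * (91 / 100) ^+ n <= e.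
    by have := hn1 n (leq_maxl _ _); rewrite sub0r normrN; apply: le_trans; exact: ler_norm.
  have n0 : 0 < (2 ^+ n)^-1 :> R by rewrite invr_gt0 exprn_gt0.
  have n1' : (2 ^+ n)^-1 <= 1 :> R by rewrite invf_le1 ?exprn_gt0// exprn_ege1//; lra.
  apply/nbhs_ballP; exists (2 ^+ n)^-1 => //= s; rewrite /ball /= => ts.
  have fE x : f x = f (Num.max x 0).
    by have [x0|x0] := leP x 0; rewrite // !f0.
  rewrite (fE t) (fE s); apply: le_trans en.
  move: ts; rewrite ltr_norml => /andP[ts1 ts2].
  have := ler_norm t; have := ler_norm s => ? ?.
  have [st|st] := leP (Num.max s 0) (Num.max t 0).
  - apply: fmod => //; first by rewrite le_max lexx orbT.
    + by rewrite gt_max; apply/andP; split; have := normr_ge0 t; lra.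
    + by apply: pos_part_dist; [rewrite -lerBlDl ltW|exact: ltW].
  - rewrite distrC; apply: fmod => //; [by rewrite le_max lexx orbT|exact: ltW| |].
    + by rewrite gt_max; apply/andP; split; have := normr_ge0 t; lra.
    + by apply: pos_part_dist; [rewrite -lerBlDl -opprB lerNl ltW|exact: ltW].
exists (Path fc f0) => m j; apply: cvg_trans (ac (grid m j)); apply: near_eq_cvg.
by apply: UN_eventually; exists m => // n /= mn; rewrite /a gfloor_id.
Qed.

End ultralimit_path.

(** * Functionals dominated by the G-expectation are expectations *)

Section Daniell_continuity.
Context {R : realType}.
Variables (sl sb : R).
Hypotheses (sl_ge0 : 0 <= sl) (sl_le_sb : sl <= sb).
Implicit Types (X Y Z : Omega R -> R).

Local Notation LipO := (Lip +oo%E).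
Local Notation E0 := (E0 sl sb).

(** Level k weighs the fourth powers of the increments on the grid of mesh 2^-k over [0, k], so both
    fineness and horizon grow with k. *)
Definition penalty (N : R) (m : nat) (w : Omega R) : R :=
  \sum_(k < m) (3 / 2) ^+ k * \sum_(i < k * 2 ^ k)
    trunc4 N (B (grid k i.+1) w - B (grid k i) w).

Lemma penalty_dLip N m : 0 <= N -> dLip (penalty N m).
Proof.
move=> N0; apply: (@dLip_sum _ m (fun k w => (3 / 2) ^+ k * \sum_(i < k * 2 ^ k)
  trunc4 N (B (grid k i.+1) w - B (grid k i) w))) => k; apply: dLip_scale.
apply: (@dLip_sum _ _ (fun i w => trunc4 N (B (grid k i.+1) w - B (grid k i) w))) => i.
exact: dLip_trunc4.
Qed.

Lemma E0_sum n (F : nat -> Omega R -> R) (c : nat -> R) :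
  (forall k, LipO (F k)) -> (forall k, E0 (F k) <= c k) ->
  E0 (fun w => \sum_(k < n) F k w) <= \sum_(k < n) c k.
Proof.
move=> LF Fc; have LS m : LipO (fun w => \sum_(k < m) F k w).
  elim: m => [|m ih]; first by under eq_fun do rewrite big_ord0; exact/Lip_cst/leey.
  by under eq_fun do rewrite big_ord_recr /=; apply: Lip_add => //; rewrite leey.
elim: n => [|n ih]; first by under eq_fun do rewrite big_ord0; rewrite big_ord0 E0_cst.
under eq_fun do rewrite big_ord_recr /=; rewrite big_ord_recr /=.
apply: (le_trans (E0_add sl_ge0 sl_le_sb (LS n) (LF n))); exact: lerD.
Qed.

(** Level k has k 2^k increments of fourth moment at most 6 sb^4 4^-k. With the weight (3/2)^k it
    contributes 6 sb^4 k (3/4)^k, and the sum of k (3/4)^k is 12. The bound is independent of [N]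
    and [m]. *)
Lemma E0_penalty N m : 0 <= N -> E0 (penalty N m) <= 72 * sb ^+ 4.
Proof.
move=> N0; have sb4 : 0 <= sb ^+ 4 by rewrite exprn_even_ge0.
apply: (@le_trans _ _ (\sum_(k < m) 6 * sb ^+ 4 * (k%:R * (3 / 4) ^+ k))).
  apply: (@E0_sum m (fun k w => (3 / 2) ^+ k * \sum_(i < k * 2 ^ k)
    trunc4 N (B (grid k i.+1) w - B (grid k i) w))
    (fun k => 6 * sb ^+ 4 * (k%:R * (3 / 4) ^+ k))) => k.
    apply/dLip_Lip/dLip_scale.
    apply: (@dLip_sum _ _ (fun i w => trunc4 N (B (grid k i.+1) w - B (grid k i) w))) => i.
    exact: dLip_trunc4.
  have LT i : LipO (fun w : Omega R => trunc4 N (B (grid k i.+1) w - B (grid k i) w)).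
    exact/dLip_Lip/dLip_trunc4.
  rewrite (E0_scale sl_ge0 sl_le_sb); last 2 first.
  - by rewrite exprn_ge0//; lra.
  - apply: dLip_Lip; apply: (@dLip_sum _ _ (fun i w => trunc4 N (B (grid k i.+1) w - B (grid k i) w))) => i.
    exact: dLip_trunc4.
  apply: (@le_trans _ _ ((3 / 2) ^+ k * \sum_(i < k * 2 ^ k) (6 * sb ^+ 4 * (2^-1 ^+ k) ^+ 2))).
    rewrite ler_wpM2l//.
    apply: (@E0_sum _ _ (fun=> 6 * sb ^+ 4 * (2^-1 ^+ k) ^+ 2) LT) => i.
    have gg : grid k i <= grid k i.+1 :> R by rewrite /grid ler_pM2r ?invr_gt0 ?exprn_gt0// ler_nat.
    apply: (le_trans (E0_trunc4 sl_ge0 sl_le_sb N0 (grid_ge0 k i) gg)).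
    by rewrite /grid -mulrBl -natrB// subSnn mul1r exprVn.
  rewrite sumr_const card_ord -[X in _ * X <= _]mulr_natl natrM natrX.
  have -> : (3 / 4) ^+ k = (3 / 2) ^+ k * (2 ^+ k * (2^-1 ^+ k) ^+ 2) :> R.
    rewrite -exprM mulnC exprM -!exprMn; congr (_ ^+ _); lra.
  by rewrite le_eqVlt; apply/orP; left; apply/eqP; ring.
rewrite -mulr_sumr.
(* The second summand is the exact tail of the series, which makes the induction immediate. *)
have sumE : \sum_(k < m) k%:R * (3 / 4) ^+ k + (4 * m%:R + 12) * (3 / 4) ^+ m = 12 :> R.
  elim: m => [|m ih]; first by rewrite big_ord0 expr0; lra.
  by rewrite big_ord_recr /= exprS -(natr1 m); move: ih; lra.
have : 0 <= (4 * m%:R + 12) * (3 / 4) ^+ m :> R.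
  by rewrite mulr_ge0// ?exprn_ge0 ?addr_ge0 ?mulr_ge0//; lra.
move=> h; rewrite (_ : 72 * sb ^+ 4 = 6 * sb ^+ 4 * 12); last by ring.
by apply: ler_wpM2l; [rewrite mulr_ge0|lra].
Qed.

Lemma chain_ratio_lt1 k : (0 < k)%N -> 0 < (91 / 100 : R) ^+ k < 1.
Proof.
have r0 : 0 < 91 / 100 :> R by lra.
move=> k0; rewrite exprn_gt0//= exprn_ilt1 ?ltW//; first by rewrite -lt0n.
by lra.
Qed.

(** One term of the penalty bounds the truncated increment strictly by K r^k. As k is positive, this
    is less than K, so the truncation at K is inactive. *)
Lemma penalty_modulus (K c : R) (w : Omega R) m : 0 <= c -> c < K ^+ 4 -> 0 < K ->
  penalty K m.+1 w <= c -> forall k i : nat, (k <= m)%N -> (i < k * 2 ^ k)%N ->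
  `|B (grid k i.+1) w - B (grid k i) w| <= K * (91 / 100) ^+ k.
Proof.
move=> c0 cK K0 Pc k i km ik; set x := B _ w - B _ w.
have K00 := ltW K0.
have t0 y := trunc4_ge0 y K00.
have h1 : (3 / 2) ^+ k * trunc4 K x <= c.
  apply: le_trans Pc; rewrite /penalty.
  pose F (k : nat) := (3 / 2) ^+ k * \sum_(i < k * 2 ^ k) trunc4 K (B (grid k i.+1) w - B (grid k i) w).
  have F0 j : 0 <= F j by rewrite mulr_ge0 ?exprn_ge0 ?sumr_ge0//; lra.
  apply: le_trans (ler_sum_nth F0 (_ : (k < m.+1)%N)); last by rewrite ltnS.
  rewrite ler_wpM2l ?exprn_ge0//.
  exact: (@ler_sum_nth _ (fun i => trunc4 K (B (grid k i.+1) w - B (grid k i) w))).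
have k0 : (0 < k)%N by case: k ik {km h1 x} => //; rewrite mul0n.
have /andP[r0 r1] := chain_ratio_lt1 k0.
have h2 : Num.min `|x| K < K * (91 / 100) ^+ k.
  rewrite -(@ltr_pXn2r _ 4) ?nnegrE ?le_min ?normr_ge0 ?mulr_ge0 ?ltW//.
  have p0 : 0 < (3 / 2 : R) ^+ k by rewrite exprn_gt0//; lra.
  rewrite -(ltr_pM2l p0); apply: (le_lt_trans h1); apply: (lt_le_trans cK).
  have e4 (q s : R) : q ^+ k * (K * s ^+ k) ^+ 4 = K ^+ 4 * (q * s ^+ 4) ^+ k.
    by rewrite exprMn (exprMn _ q) (exprAC s) mulrCA.
  rewrite e4.
  by rewrite ler_peMr ?exprn_ge0// exprn_ege1//; lra.
move: h2; rewrite gt_min => /orP[/ltW//|].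
by rewrite -[X in X < _]mulr1 ltr_pM2l// ltNge (ltW r1).
Qed.

Variable l : (Omega R -> R) -> R.
Hypothesis l_add : forall X Y, LipO X -> LipO Y -> l (fun w => X w + Y w) = l X + l Y.
Hypothesis l_scale : forall c X, LipO X -> l (fun w => c * X w) = c * l X.
Hypothesis l_le_E0 : forall X, LipO X -> l X <= E0 X.

Let l_sub X Y : LipO X -> LipO Y -> l (fun w => X w - Y w) = l X - l Y.
Proof.
move=> LX LY; have -> : (fun w => X w - Y w) = (fun w => X w + -1 * Y w).
  by apply/funext => w; rewrite mulN1r.
by rewrite l_add ?l_scale ?mulN1r//; apply: Lip_scale; rewrite ?leey.
Qed.

Lemma l_sup X c : LipO X -> (forall w, X w <= c) -> l X <= c.
Proof. by move=> LX Xc; apply: (le_trans (l_le_E0 LX)); exact: E0_sup. Qed.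

Lemma l_inf X c : LipO X -> (forall w, c <= X w) -> c <= l X.
Proof.
move=> LX Xc; have : l (fun w => -1 * X w) <= - c.
  apply: l_sup => [|w]; first by apply: Lip_scale; rewrite ?leey.
  by rewrite mulN1r lerN2.
by rewrite l_scale// mulN1r lerN2.
Qed.

(* If [l (X n)] stayed above [e], some path [w n] would have [X n] bounded below
   and a bounded penalty; an ultralimit of these paths along the dyadics is then
   continuous by chaining, and all [X n] stay bounded below on it. *)
Lemma Daniell_continuity (X : nat -> Omega R -> R) : (forall n, dLip (X n)) ->
  (forall n w, 0 <= X n w) -> (forall n w, X n.+1 w <= X n w) ->
  (forall w e, 0 < e -> exists n, X n w <= e) ->
  forall e, 0 < e -> exists n, l (X n) <= e.
Proof.
move=> XD X0 Xd Xlim e e0; apply: contrapT => /forallNP nX.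
have lX n : e < l (X n) by rewrite ltNge; apply/negP.
have [M M0 XM] := Lip_bounded (dLip_Lip (XD 0%N)).
have Xmono m n w : (m <= n)%N -> X n w <= X m w.
  move=> mn; apply: (@homo_leq _ (X^~ w) (fun x y => y <= x)) => //.
  by move=> y x z xy yz; exact: le_trans xy.
pose C := 72 * sb ^+ 4 + 1.
have C0 : 0 < C by rewrite ltr_wpDl// mulr_ge0// exprn_even_ge0.
(* The penalty times [lam] costs at most e/2 of the value of [l], so [X n] minus it still exceeds
   e/4 at some path. There the penalty is at most c = M / lam, and [K] is any number with K^4 >
   c. *)
pose lam := e / (2 * C); have lam0 : 0 < lam by rewrite divr_gt0// mulr_gt0.
pose c := M / lam; have c0 : 0 <= c by rewrite divr_ge0// ltW.
pose K := c + 1; have K0 : 0 < K by rewrite ltr_wpDl.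
have cK : c < K ^+ 4.
  have K1 : 1 <= K by rewrite /K; lra.
  by apply: (@lt_le_trans _ _ K); [rewrite /K; lra|rewrite exprS ler_peMr ?exprn_ege1// ltW].
have LH m := dLip_Lip (penalty_dLip m (ltW K0)).
have /choice[w wP] : forall n, exists w, e / 4 < X n w - lam * penalty K n.+1 w.
  move=> n; apply: contrapT => /forallNP h.
  have LH' : LipO (fun w => lam * penalty K n.+1 w) by apply: Lip_scale; rewrite ?leey.
  have : l (fun w => X n w - lam * penalty K n.+1 w) <= e / 4.
    apply: l_sup; first by apply: Lip_sub; rewrite ?leey//; exact: dLip_Lip.
    by move=> w; rewrite leNgt; apply/negP.
  rewrite l_sub//; last exact: dLip_Lip.
  rewrite l_scale//.
  have : lam * l (penalty K n.+1) <= lam * C.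
    rewrite ler_pM2l//; apply: (le_trans (l_le_E0 (LH _))).
    by apply: (le_trans (E0_penalty n.+1 (ltW K0))); rewrite /C; lra.
  have -> : lam * C = e / 2 by rewrite /lam; field; rewrite gt_eqF.
  by move: (lX n); lra.
have Hc n : penalty K n.+1 (w n) <= c.
  rewrite /c ler_pdivlMr// mulrC.
  have := XM (w n); rewrite ger0_norm ?X0//.
  by have := Xmono 0%N n (w n) (leq0n n); have := wP n; lra.
have Xw n : e / 4 <= X n (w n).
  suff : 0 <= lam * penalty K n.+1 (w n) by have := wP n; lra.
  rewrite mulr_ge0 ?(ltW lam0)// sumr_ge0// => k _.
  rewrite mulr_ge0 ?exprn_ge0//.
  by apply: sumr_ge0 => i _; exact: trunc4_ge0 (ltW K0).
have [v vP] := ultralimit_path (ltW K0) (fun m => penalty_modulus c0 cK K0 (Hc m)).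
have [j Xj] := Xlim v (e / 8) (ltac:(lra) : 0 < e / 8).
have [N [L [ts [Phi [[_ L0 PL] tsD XE]]]]] := XD j.
have : (fun n => X j (w n)) @ UN --> X j v.
  rewrite XE; apply/cvgrPdist_le => d d0.
  have cs : (fun n => L * \sum_(s <- ts) `|pathfun v s - pathfun (w n) s|) @ UN --> (L * 0 : R).
    apply: cvgM; first exact: cvg_cst.
    elim: ts tsD {PL XE} => [|s ts ih] tsD.
      by under eq_fun do rewrite big_nil; exact: cvg_cst.
    under eq_fun do rewrite big_cons; rewrite -[X in nbhs X]addr0; apply: cvgD.
      have [m [i ->]] := tsD s (mem_head _ _).
      rewrite -(normr0 R) -(subrr (pathfun v (grid m i))).
      by apply: cvg_norm; apply: cvgB; [exact: cvg_cst|exact: vP].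
    by apply: ih => r rts; apply: tsD; rewrite inE rts orbT.
  rewrite mulr0 in cs; move/cvgrPdist_le : cs => /(_ d d0); apply: filterS => n.
  rewrite sub0r normrN => h; apply: (le_trans (PL _ _)); exact: le_trans (ler_norm _) h.
move=> cj; suff : e / 4 <= X j v by move: Xj; lra.
apply: (UN_ge_cst cj); apply: UN_eventually; exists j => // n /= jn.
exact: le_trans (Xw n) (Xmono _ _ _ jn).
Qed.


Lemma trunc_le (N e x : R) : 0 <= N -> 0 < e -> Num.min `|x| N <= e + trunc4 N x / e ^+ 3.
Proof.
move=> N0 e0; rewrite /trunc4; set u := Num.min _ _.
have u0 : 0 <= u by rewrite le_min normr_ge0.
have [ue|ue] := leP u e.
  by rewrite ler_wpDr// divr_ge0 ?exprn_ge0// ltW.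
have e3 : 0 < e ^+ 3 by rewrite exprn_gt0.
have : u <= u ^+ 4 / e ^+ 3.
  rewrite ler_pdivlMr// (exprS u 3) ler_wpM2l// lerXn2r ?nnegrE ?(ltW e0) ?(ltW ue)//.
by lra.
Qed.

Lemma gfloor_dist n (t : R) : 0 <= t -> (t - gfloor n t) ^+ 2 <= 2^-1 ^+ n.
Proof.
move=> t0; have h1 := gfloor_le n t0; have h2 := gfloor_gt n t.
have h3 : t - gfloor n t <= 2^-1 ^+ n by rewrite exprVn; lra.
have h0 : 0 <= t - gfloor n t by rewrite subr_ge0.
rewrite expr2; apply: le_trans h3; rewrite ler_piMl//.
have : (2 ^+ n)^-1 <= 1 :> R by rewrite invf_le1 ?exprn_gt0// exprn_ege1//; lra.
lra.
Qed.

Lemma Ex_cvg (d : measure_display) (T : measurableType d) (P : probability T R)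
    (f : nat -> T -> R) (g : T -> R) (M : R) :
  (forall n, measurable_fun setT (f n)) -> (forall n w, `|f n w| <= M) ->
  (forall w, f n w @[n --> \oo] --> g w) -> Ex P (f n) @[n --> \oo] --> Ex P g.
Proof.
move=> mf fM fg; have mg : measurable_fun setT g.
  by apply: (measurable_fun_cvg mf) => w _; exact: fg.
have gM w : `|g w| <= M.
  by apply: (cvgr_to_le (cvg_norm (fg w))); apply: nearW => n.
have D : (\int[P]_w (f n w)%:E)%E @[n --> \oo] --> (\int[P]_w (g w)%:E)%E.
  apply: (@dominated_cvg _ _ _ P setT measurableT (fun n => EFin \o f n) (EFin \o g) (fun=> M%:E)).
  - by move=> n; exact/measurable_EFinP.
  - by move=> w _; apply: cvg_EFin; [exact: nearW|exact: fg].
  - by [].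
  - exact: (bdmeas_integrable P (@bdmeas_cst _ T R M)).
  - by move=> n w _; rewrite /= lee_fin.
have bg : bdmeas g by split => //; exists M.
by rewrite integral_Ex// in D; exact: fine_cvg D.
Qed.

(** Each time is replaced by its dyadic floor. Convergence on paths is uniform continuity on a
    compact interval; convergence under [l] comes from the fourth moments of the displacements,
    through domination by [E0]. *)
Lemma dyadic_approximation Z : LipO Z -> exists2 Zn : nat -> Omega R -> R,
  (forall n, dLip (Zn n)) /\ (exists M, forall n w, `|Zn n w| <= M) &
  (forall w, Zn n w @[n --> \oo] --> Z w) /\ l (Zn n) @[n --> \oo] --> l Z.
Proof.
move=> LZ; have /Lip_cylindrical[M [L [ts [Phi [PC ts0 ZE]]]]] := LZ.
have [PM L0 PL] := PC.
pose Zn n (w : Omega R) := Phi (fun s => pathfun w (gfloor n s)).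
have ts0' s : s \in ts -> 0 <= s by move=> /(allP ts0)/andP[].
have ZD n : dLip (Zn n).
  exists M, L, (map (gfloor n) ts), (fun f => Phi (fun s => f (gfloor n s))); split => //.
  - split => // [f g]; apply: (le_trans (PL _ _)); by rewrite big_map.
  - by move=> s /mapP[r _ ->]; do 2 eexists.
have hn n : 0 <= 2^-1 ^+ n :> R by rewrite exprn_ge0.
have h0 : (fun n => 2^-1 ^+ n : R) @ \oo --> (0 : R).
  by apply: cvg_expr; rewrite ger0_norm; lra.
exists Zn; split => //.
- by exists M => n w; exact: PM.
- move=> w; rewrite ZE; apply/cvgrPdist_le => e e0.
  pose T : R := \sum_(s <- ts) s.
  have sT s : s \in ts -> s <= T.
    move=> sts; rewrite /T (big_rem s)//= lerDl big_seq sumr_ge0// => r /mem_rem; exact: ts0'.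
  pose e' := e / (L * (size ts)%:R + 1).
  have n0 : 0 <= L * (size ts)%:R by rewrite mulr_ge0.
  have e'0 : 0 < e' by rewrite divr_gt0// ltr_wpDl.
  have [n1 hn1] := path_uniform_mesh w T e'0.
  exists n1 => // n /= n1n; apply: (le_trans (PL _ _)).
  apply: (@le_trans _ _ (L * ((size ts)%:R * e'))).
    rewrite ler_wpM2l//; have -> : (size ts)%:R * e' = \sum_(s <- ts) e'.
      by rewrite big_const_seq count_predT iter_addr_0 mulr_natl.
    rewrite big_seq [leRHS]big_seq; apply: ler_sum => s sts.
    have s0 := ts0' _ sts; have g1 := gfloor_le n s0; have g2 := gfloor_gt n s.
    apply: hn1; first by rewrite s0 sT.
      by rewrite grid_ge0 (le_trans g1)// sT.
    rewrite ger0_norm ?subr_ge0//.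
    have : (2 ^+ n)^-1 <= 2^-1 ^+ n1 :> R.
      by rewrite -exprVn ler_wiXn2l//; lra.
    lra.
  rewrite mulrA /e' mulrA ler_pdivrMr ?ltr_wpDl//.
  by rewrite mulrC ler_pM2l// lerDl.
- have sb4 : 0 <= sb ^+ 4 by rewrite exprn_even_ge0.
  (* Larger than the oscillation 2 M of [Z]: if some displacement exceeds [N], the trivial bound on
     |Z - Zn| suffices, otherwise the truncation at [N] is inactive. *)
  pose N := 2 * M + 1.
  have M0 : 0 <= M by apply: le_trans (PM (fun=> 0)).
  have N0 : 0 <= N by rewrite /N addr_ge0// mulr_ge0.
  have dist n e : 0 < e -> `|l Z - l (Zn n)| <=
      (L + 1) * ((size ts)%:R * (e + 6 * sb ^+ 4 * 2^-1 ^+ n / e ^+ 3)).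
    move=> e0; rewrite -l_sub//; last exact: dLip_Lip.
    pose D s w := e + (e ^+ 3)^-1 * trunc4 N (B s w - B (gfloor n s) w).
    have LD s : s \in ts -> LipO (D s).
      move=> sts; apply: Lip_add; rewrite ?leey//; first exact/Lip_cst/leey.
      by apply: Lip_scale; rewrite ?leey//; apply: trunc4_Lip; rewrite ?leey ?grid_ge0// ts0'.
    have e3 : 0 < (e ^+ 3)^-1 by rewrite invr_gt0 exprn_gt0.
    have ED s : s \in ts -> E0 (D s) <= e + 6 * sb ^+ 4 * 2^-1 ^+ n / e ^+ 3.
      move=> sts; have s0 := ts0' _ sts.
      have LT : LipO (fun w => trunc4 N (B s w - B (gfloor n s) w)).
        by apply: trunc4_Lip; rewrite ?leey ?grid_ge0.
      apply: (le_trans (E0_add sl_ge0 sl_le_sb _ _)); first exact/Lip_cst/leey.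
        by apply: Lip_scale; rewrite ?leey.
      rewrite E0_cst// lerD2l (E0_scale sl_ge0 sl_le_sb (ltW e3) LT) mulrC ler_pM2r//.
      apply: (le_trans (E0_trunc4 sl_ge0 sl_le_sb N0 (grid_ge0 _ _) (gfloor_le n s0))).
      by apply: ler_wpM2l; [rewrite mulr_ge0|exact: gfloor_dist].
    have LH (us : seq R) : {subset us <= ts} -> LipO (fun w => \sum_(s <- us) D s w) /\
        E0 (fun w => \sum_(s <- us) D s w) <= (size us)%:R * (e + 6 * sb ^+ 4 * 2^-1 ^+ n / e ^+ 3).
      elim: us => [_|s us ih sub].
        by under eq_fun do rewrite big_nil; rewrite mul0r E0_cst//; split => //; exact/Lip_cst/leey.
      have [|Lus Eus] := ih; first by move=> r ru; apply: sub; rewrite inE ru orbT.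
      have sts : s \in ts by apply: sub; rewrite mem_head.
      under eq_fun do rewrite big_cons; split; first by apply: Lip_add; rewrite ?leey//; exact: LD.
      apply: (le_trans (E0_add sl_ge0 sl_le_sb (LD _ sts) Lus)).
      by rewrite /= -natr1 mulrDl mul1r [leRHS]addrC lerD// ED.
    have [LS ES] := LH ts (fun s sts => sts).
    have L1 : 0 <= L + 1 by rewrite addr_ge0.
    have LS' : LipO (fun w => (L + 1) * \sum_(s <- ts) D s w) by apply: Lip_scale; rewrite ?leey.
    have key w : `|Z w - Zn n w| <= (L + 1) * \sum_(s <- ts) D s w.
      apply: (@le_trans _ _ ((L + 1) * \sum_(s <- ts) Num.min `|B s w - B (gfloor n s) w| N)); last first.
        rewrite ler_wpM2l// ler_sum// => s _.
        by apply: (le_trans (trunc_le _ N0 e0)); rewrite /D [X in _ + X <= _]mulrC.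
      rewrite ZE /Zn.
      have m0 s : 0 <= Num.min `|B s w - B (gfloor n s) w| N by rewrite le_min normr_ge0.
      have [[s [sts hs]]|hs] := pselect (exists s, s \in ts /\ N < `|B s w - B (gfloor n s) w|).
        apply: (@le_trans _ _ N).
          apply: (le_trans (ler_normB _ _)); have := PM (pathfun w).
          by have := PM (fun s => pathfun w (gfloor n s)); rewrite /N; lra.
        rewrite (big_rem s)//= (min_r (ltW hs)).
        have S0 : 0 <= \sum_(y <- rem s ts) Num.min `|B y w - B (gfloor n y) w| N by exact: sumr_ge0.
        have := mulr_ge0 L0 N0; have := mulr_ge0 L0 S0; lra.
      apply: (le_trans (PL _ _)); apply: ler_pM => //; [exact: sumr_ge0|lra|].
      rewrite big_seq [leRHS]big_seq; apply: ler_sum => s sts.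
      by rewrite min_l// leNgt; apply/negP => ?; apply: hs; exists s.
    have b1 : l (fun w => Z w - Zn n w) <= E0 (fun w => (L + 1) * \sum_(s <- ts) D s w).
      have LZn := dLip_Lip (ZD n).
      have LZZ : LipO (fun w => Z w - Zn n w) by apply: Lip_sub; rewrite ?leey.
      apply: (le_trans (l_le_E0 LZZ)); apply: (E0_le sl_ge0 sl_le_sb) => // w.
      exact: le_trans (ler_norm _) (key w).
    have b2 : - l (fun w => Z w - Zn n w) <= E0 (fun w => (L + 1) * \sum_(s <- ts) D s w).
      have LZn := dLip_Lip (ZD n).
      have LZZ : LipO (fun w => Z w - Zn n w) by apply: Lip_sub; rewrite ?leey.
      rewrite -mulN1r -l_scale//; apply: (le_trans (l_le_E0 _)); first by apply: Lip_scale; rewrite ?leey.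
      apply: (E0_le sl_ge0 sl_le_sb) => //; first by apply: Lip_scale; rewrite ?leey.
      by move=> w; rewrite mulN1r; apply: le_trans (key w); rewrite -normrN ler_norm.
    have : E0 (fun w => (L + 1) * \sum_(s <- ts) D s w) <=
      (L + 1) * ((size ts)%:R * (e + 6 * sb ^+ 4 * 2^-1 ^+ n / e ^+ 3)).
      by rewrite (E0_scale sl_ge0 sl_le_sb L1 LS) ler_wpM2l.
    by rewrite ler_norml => ?; apply/andP; split; lra.
  apply/cvgrPdist_le => e e0.
  pose c := (L + 1) * (size ts)%:R + 1.
  have c0 : 0 < c by rewrite ltr_wpDl// mulr_ge0// addr_ge0.
  pose d := e / (2 * c); have d0 : 0 < d by rewrite divr_gt0// mulr_gt0.
  have h1 : (fun n => 6 * sb ^+ 4 * 2^-1 ^+ n / d ^+ 3) @ \oo --> (6 * sb ^+ 4 * 0 / d ^+ 3 : R).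
    by apply: cvgM; [apply: cvgM => //; exact: cvg_cst|exact: cvg_cst].
  rewrite mulr0 mul0r in h1; move/cvgrPdist_le : h1 => /(_ d d0); apply: filterS => n.
  rewrite sub0r normrN => /(le_trans (ler_norm _)) h; apply: (le_trans (dist n d d0)).
  rewrite mulrA; apply: (@le_trans _ _ ((L + 1) * (size ts)%:R * (2 * d))).
    by rewrite ler_wpM2l ?mulr_ge0 ?addr_ge0//; lra.
  apply: (@le_trans _ _ (c * (2 * d))); first by apply: ler_wpM2r; [rewrite mulr_ge0// ltW|rewrite /c lerDl].
  by rewrite le_eqVlt /d; apply/orP; left; apply/eqP; field; rewrite gt_eqF.
Qed.

(** Daniell-Stone is applied to dyadic cylindrical variables, whose positivity sets generate the
    Borel sets by [measurable_path]; the identity then extends to all times by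
    [dyadic_approximation]. *)
Theorem representation : exists2 P : probability (Omega R) R, Pset sl sb P &
  forall Z, LipO Z -> Ex P Z = l Z.
Proof.
have lD0 : forall X, dLip X -> (forall w, 0 <= X w) -> 0 <= l X.
  by move=> X /dLip_Lip LX; exact: l_inf.
have l1 : l (fun=> 1) = 1.
  have L1 : LipO (fun=> 1 : R) by exact/Lip_cst/leey.
  by apply/eqP; rewrite eq_le l_sup// l_inf.
have ladd : forall X Y, dLip X -> dLip Y -> l (fun w => X w + Y w) = l X + l Y.
  by move=> X Y /dLip_Lip LX /dLip_Lip LY; exact: l_add.
have lscale : forall c X, dLip X -> l (fun w => c * X w) = c * l X.
  by move=> c X /dLip_Lip LX; exact: l_scale.
pose D := @daniell_stone R (Omega R) dLip l (@dLip_cst R) (@dLip_add R) (@dLip_mul R)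
  (@dLip_max R) ladd lscale lD0 l1 Daniell_continuity _ (Omega R) id.
have [A mA|P Pl] := D.
  pose T' := g_sigma_algebraType [set [set w | 0 < g w] | g in @dLip R].
  have : measurable_fun setT (id : T' -> Omega R).
    apply: measurable_path => m j.
    apply: (@measurability _ _ T' _ setT _ _ (RGenOInfty.measurableE R)).
    move=> _ [_ [x ->] <-]; rewrite setTI; apply: sub_sigma_algebra.
    exists (fun w => Num.max 0 (Num.min 1 (B (grid m j) w - x))).
      exists 1, 1, [:: grid m j], (fun f => Num.max 0 (Num.min 1 (f (grid m j) - x))); split => //.
        split => [f||f g]; first by rewrite ger0_norm ?le_max ?lexx// ge_max ler01 ge_min lexx.
          by [].
        rewrite mul1r big_seq1; apply: (le_trans (clip01_lip _ _)).
        by rewrite le_eqVlt; apply/orP; left; apply/eqP; congr `|_|; ring.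
      by move=> s; rewrite inE => /eqP ->; do 2 eexists.
    apply/seteqP; split => w /=; rewrite in_itv /= andbT lt_max ltxx /= lt_min ltr01 subr_gt0//.
  by move=> /(_ measurableT A mA); rewrite setTI.
have PE Z : LipO Z -> Ex P Z = l Z.
  move=> LZ; have [Zn [ZD [M ZM]] [Zw Zl]] := dyadic_approximation LZ.
  have mZ n : measurable_fun setT (Zn n) by apply: measurable_Lip; exact: dLip_Lip (ZD n).
  have := @Ex_cvg _ _ P Zn Z M mZ ZM Zw.
  have -> : (fun n => Ex P (Zn n)) = (fun n => l (Zn n)).
    apply/funext => n; apply: Pl => //; last exact: ZD.
    by split; [exact: mZ|exists M => w; exact: ZM].
  by move=> h; apply: (cvg_unique _ h Zl); exact: norm_hausdorff.
exists P => //; apply: (Pset_intro sl_ge0 sl_le_sb) => Z LZ.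
have [M _ ZM] := Lip_bounded LZ.
rewrite integral_Ex; last by split; [exact: measurable_Lip LZ|exists M].
by rewrite lee_fin PE//; exact: l_le_E0.
Qed.

End Daniell_continuity.

(** * The Hahn-Banach theorem for sublinear functionals *)

Section hahn_banach.
Context {R : realType} {T : Type}.
Variable L : set (T -> R).
Implicit Types (f g : T -> R) (p q : (T -> R) -> R).
Hypothesis L_add : forall f g, L f -> L g -> L (fun w => f w + g w).
Hypothesis L_scale : forall c f, L f -> L (fun w => c * f w).

Definition sublin q : Prop :=
  (forall f g, L f -> L g -> q (fun w => f w + g w) <= q f + q g) /\
  (forall c f, 0 < c -> L f -> q (fun w => c * f w) = c * q f).

Lemma sublin0 q f : sublin q -> L f -> q (fun w => 0 * f w) = 0.
Proof.
move=> [_ qs] Lf; have := qs 2 (fun w => 0 * f w) (ltac:(lra) : 0 < 2) (L_scale 0 Lf).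
have -> : (fun w => 2 * (0 * f w)) = fun w => 0 * f w by apply/funext => w; ring.
lra.
Qed.

Lemma sublin_opp q f : sublin q -> L f -> - q (fun w => -1 * f w) <= q f.
Proof.
move=> sq Lf; have [qa _] := sq; have := qa _ _ Lf (L_scale (-1) Lf).
have -> : (fun w => f w + -1 * f w) = fun w => 0 * f w by apply/funext => w; ring.
by rewrite sublin0//; lra.
Qed.

Lemma inf_le (S : set R) (c x : R) : (forall y, S y -> c <= y) -> S x -> inf S <= x.
Proof. by move=> Sc Sx; apply: inf_lbound => //; exists c. Qed.

Lemma inf_lt_ex (S : set R) (x : R) : S !=set0 -> (exists c, forall y, S y -> c <= y) -> inf S < x ->
  exists2 y, S y & y < x.
Proof.
move=> S0 [c Sc] Sx; have hS : has_inf S by split => //; exists c.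
have [y Sy yx] := @inf_adherent _ S (x - inf S) (ltac:(by rewrite subr_gt0)) hS.
by exists y => //; move: yx; lra.
Qed.

Lemma le_inf_le (S : set R) (x : R) : S !=set0 -> (forall y, S y -> x <= y) -> x <= inf S.
Proof. by move=> S0 h; exact: lb_le_inf. Qed.

(** A sublinear functional below [q], and at most - q(Y) at -Y (take c = 1): the slack of [q] in the
    direction [Y] is removed. *)
Definition tilt q Y f : R :=
  inf [set q (fun w => f w + c * Y w) - c * q Y | c in [set c | 0 <= c]].

Lemma tilt_lb q Y f : sublin q -> L Y -> L f ->
  forall y, [set q (fun w => f w + c * Y w) - c * q Y | c in [set c | 0 <= c]] y ->
  - q (fun w => -1 * f w) <= y.
Proof.
move=> sq LY Lf _ [c /= c0 <-]; have [qa qs] := sq.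
have LcY := L_scale c LY.
have h : q (fun w => c * Y w) = c * q Y.
  move: c0; rewrite le_eqVlt => /predU1P[<-|c0]; last exact: qs.
  by rewrite sublin0// mul0r.
have := qa _ _ (L_add Lf LcY) (L_scale (-1) Lf).
have -> : (fun w => f w + c * Y w + -1 * f w) = fun w => c * Y w by apply/funext => w; ring.
by rewrite h; lra.
Qed.

Lemma tilt_le q Y f c : sublin q -> L Y -> L f -> 0 <= c ->
  tilt q Y f <= q (fun w => f w + c * Y w) - c * q Y.
Proof.
move=> sq LY Lf c0; apply: (inf_le (tilt_lb sq LY Lf)); by exists c.
Qed.

Lemma tilt_le_id q Y f : sublin q -> L Y -> L f -> tilt q Y f <= q f.
Proof.
move=> sq LY Lf; have := tilt_le sq LY Lf (lexx 0).
have -> : (fun w => f w + 0 * Y w) = f by apply/funext => w; ring.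
by rewrite mul0r subr0.
Qed.

Lemma tilt_sublin q Y : sublin q -> L Y -> sublin (tilt q Y).
Proof.
move=> sq LY; have [qa qs] := sq.
have ne f : [set q (fun w => f w + c * Y w) - c * q Y | c in [set c | 0 <= c]] !=set0.
  by eexists; exists 0 => /=.
have scale c f : 0 < c -> L f -> tilt q Y (fun w => c * f w) <= c * tilt q Y f.
  move=> c0 Lf; rewrite mulrC -ler_pdivrMr//; apply: le_inf_le => // _ [d /= d0 <-].
  rewrite ler_pdivrMr//; apply: le_trans (tilt_le sq LY (L_scale c Lf) (mulr_ge0 (ltW c0) d0)) _.
  have -> : (fun w => c * f w + c * d * Y w) = fun w => c * (f w + d * Y w).
    by apply/funext => w; ring.
  by rewrite qs//; [lra|apply: L_add => //; exact: L_scale].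
split.
  move=> f g Lf Lg; apply/ler_addgt0Pr => e e0.
  have [||_ [c /= c0 <-] hc] := @inf_lt_ex _ (tilt q Y f + e / 2) (ne f).
  - by exists (- q (fun w => -1 * f w)); exact: tilt_lb.
  - by rewrite ltrDl; lra.
  have [||_ [d /= d0 <-] hd] := @inf_lt_ex _ (tilt q Y g + e / 2) (ne g).
  - by exists (- q (fun w => -1 * g w)); exact: tilt_lb.
  - by rewrite ltrDl; lra.
  have := tilt_le sq LY (L_add Lf Lg) (addr_ge0 c0 d0).
  have := qa _ _ (L_add Lf (L_scale c LY)) (L_add Lg (L_scale d LY)).
  have -> : (fun w => f w + g w + (c + d) * Y w) = fun w => f w + c * Y w + (g w + d * Y w).
    by apply/funext => w; ring.
  lra.
move=> c f c0 Lf; apply/eqP; rewrite eq_le scale//=.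
have c1 : 0 < c^-1 by rewrite invr_gt0.
have := scale _ _ c1 (L_scale c Lf).
have -> : (fun w => c^-1 * (c * f w)) = f by apply/funext => w; rewrite mulKf// gt_eqF.
by rewrite mulrC ler_pdivlMr// mulrC.
Qed.

Lemma minimal_sublinear p : sublin p -> exists q, [/\ sublin q, forall f, L f -> q f <= p f &
  forall q', sublin q' -> (forall f, L f -> q' f <= q f) -> forall f, L f -> q f <= q' f].
Proof.
move=> sp.
pose S := {q | sublin q /\ forall f, L f -> q f <= p f}.
pose t0 : S := exist _ p (conj sp (fun f _ => lexx _)).
pose r (s t : S) := `[< forall f, L f -> sval t f <= sval s f >].
have [|||[q [sq qp]] qmax] := @ZL_preorder S t0 r.
- by move=> s; apply/asboolP => f _; exact: lexx.
- by move=> a b c /asboolP ab /asboolP bc; apply/asboolP => f Lf; exact: le_trans (bc f Lf) (ab f Lf).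
- move=> A Atot; have [[s0 As0]|A0] := pselect (exists s, A s); last first.
    by exists t0 => s As; exfalso; apply: A0; exists s.
  pose V f := [set sval s f | s in A].
  have Vlb f y : L f -> V f y -> - p (fun w => -1 * f w) <= y.
    move=> Lf [[s [ss sp']] As /= <-]; apply: le_trans (sublin_opp ss Lf).
    by rewrite lerN2 sp'//; exact: L_scale.
  have Vne f : V f !=set0 by exists (sval s0 f), s0.
  pose q f := inf (V f).
  have qle s f : A s -> L f -> q f <= sval s f.
    by move=> As Lf; apply: (inf_le (fun y => Vlb f y Lf)); exists s.
  have scale c f : 0 < c -> L f -> q (fun w => c * f w) <= c * q f.
    move=> c0 Lf; rewrite mulrC -ler_pdivrMr//; apply: le_inf_le => // _ [s As <-].
    rewrite ler_pdivrMr//; apply: le_trans (qle s _ As (L_scale c Lf)) _.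
    by case: s As => s [[_ ss] _] _ /=; rewrite ss// mulrC.
  have sq : sublin q.
    split.
      move=> f g Lf Lg; apply/ler_addgt0Pr => e e0.
      have [||_ [s As <-] hs] := @inf_lt_ex _ (q f + e / 2) (Vne f).
      - by exists (- p (fun w => -1 * f w)) => y; exact: Vlb.
      - by rewrite ltrDl; lra.
      have [||_ [t At <-] ht] := @inf_lt_ex _ (q g + e / 2) (Vne g).
      - by exists (- p (fun w => -1 * g w)) => y; exact: Vlb.
      - by rewrite ltrDl; lra.
      have [u Au [us ut]] : exists2 u, A u & sval u f <= sval s f /\ sval u g <= sval t g.
        have [/asboolP st|/asboolP ts] := Atot s t As At.
          by exists t => //; split => //; exact: st.
        by exists s => //; split => //; exact: ts.
      have h := qle u _ Au (L_add Lf Lg); have [[ua _] _] := svalP u.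
      by have := ua _ _ Lf Lg; lra.
    move=> c f c0 Lf; apply/eqP; rewrite eq_le scale//=.
    have c1 : 0 < c^-1 by rewrite invr_gt0.
    have := scale _ _ c1 (L_scale c Lf).
    have -> : (fun w => c^-1 * (c * f w)) = f by apply/funext => w; rewrite mulKf// gt_eqF.
    by rewrite mulrC ler_pdivlMr// mulrC.
  have qp f : L f -> q f <= p f.
    move=> Lf; apply: (le_trans (qle s0 f As0 Lf)); have [_ h] := svalP s0; exact: h.
  by exists (exist _ q (conj sq qp)) => s As; apply/asboolP => f Lf; exact: qle.
exists q; split => // q' sq' q'q.
have q'p f : L f -> q' f <= p f by move=> Lf; exact: le_trans (q'q f Lf) (qp f Lf).
have := qmax (exist _ q' (conj sq' q'p)); rewrite /r => h.
by apply/asboolP; apply: h; apply/asboolP.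
Qed.

(** A minimal sublinear functional lies below all its tilts, which forces additivity. Starting from
    the tilt of [p] along [Z] makes the value at [Z] equal to [p Z]. *)
Lemma hahn_banach p Z : sublin p -> L Z -> exists l,
  [/\ forall f g, L f -> L g -> l (fun w => f w + g w) = l f + l g,
      forall c f, L f -> l (fun w => c * f w) = c * l f,
      forall f, L f -> l f <= p f & l Z = p Z].
Proof.
move=> sp LZ; have [l [sl lp lmin]] := minimal_sublinear (tilt_sublin sp LZ).
have [la ls] := sl.
have add f g : L f -> L g -> l (fun w => f w + g w) = l f + l g.
  move=> Lf Lg; apply/eqP; rewrite eq_le la//=.
  have := lmin _ (tilt_sublin sl Lg) (fun f Lf => tilt_le_id sl Lg Lf) _ Lf.
  move=> /le_trans/(_ (tilt_le sl Lg Lf ler01)).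
  have -> : (fun w => f w + 1 * g w) = fun w => f w + g w by apply/funext => w; ring.
  lra.
have opp f : L f -> l (fun w => -1 * f w) = - l f.
  move=> Lf; have := add _ _ Lf (L_scale (-1) Lf).
  have -> : (fun w => f w + -1 * f w) = fun w => 0 * f w by apply/funext => w; ring.
  by rewrite sublin0//; lra.
exists l; split => //.
- move=> c f Lf; have [c0|c0|<-] := ltgtP 0 c; first exact: ls; last by rewrite sublin0// mul0r.
  have -> : (fun w => c * f w) = fun w => (- c) * (-1 * f w) by apply/funext => w; ring.
  by rewrite ls ?opp ?oppr_gt0//; [ring|exact: L_scale].
- by move=> f Lf; apply: (le_trans (lp f Lf)); exact: tilt_le_id.
apply/eqP; rewrite eq_le (le_trans (lp Z LZ)) ?tilt_le_id//=.
have := lp _ (L_scale (-1) LZ); rewrite opp//.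
move=> /le_trans/(_ (tilt_le sp LZ (L_scale (-1) LZ) ler01)).
have -> : (fun w => -1 * Z w + 1 * Z w) = fun w => 0 * Z w by apply/funext => w; ring.
by rewrite sublin0//; lra.
Qed.

End hahn_banach.

(** * The set of priors and quasi-sure analysis *)

Section priors.
Context {R : realType}.
Variables (sl sb : R).
Hypotheses (sl_ge0 : 0 <= sl) (sl_le_sb : sl <= sb).
Implicit Types (X Y Z xi : Omega R -> R) (t : R) (P Q : probability (Omega R) R).

Local Notation LipO := (Lip +oo%E).
Local Notation cE := (cE sl sb).
Local Notation E0 := (E0 sl sb).
Local Notation Pset := (Pset sl sb).

Lemma Lip_bdmeas (t : \bar R) Z : Lip t Z -> bdmeas Z.
Proof.
move=> LZ; split; first exact: measurable_Lip LZ.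
by have [M _ ZM] := Lip_bounded LZ; exists M.
Qed.

Lemma Pset_Ex P Z : Pset P -> LipO Z -> Ex P Z <= E0 Z.
Proof.
move=> PP LZ; have := Pset_le sl_ge0 sl_le_sb PP LZ.
by rewrite integral_Ex ?lee_fin//; exact: Lip_bdmeas LZ.
Qed.

Lemma Lip_LipO t Z : Lip t%:E Z -> LipO Z.
Proof. by apply: Lip_le; rewrite leey. Qed.

(* [Q] belongs to P(t, P). *)
Definition agree t P Q : Prop := Pset Q /\ forall Z, Lip t%:E Z -> Ex Q Z = Ex P Z.

Lemma agree_refl t P : Pset P -> agree t P P.
Proof. by []. Qed.

Lemma agree_trans s t P Q Q' : s <= t -> agree s P Q -> agree t Q Q' -> agree s P Q'.
Proof.
move=> st [_ PQ] [PQ' QQ']; split => // Z LZ; rewrite -PQ// QQ'//.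
by apply: Lip_le LZ; rewrite lee_fin.
Qed.

(** [Q] and [P] agree on the right-hand variable, so it suffices that [E0] of xi (Z - cE t Z) is 0,
    which follows by conditioning at [t] and taking out the weight. *)
Lemma agree_le_cE t P Q Z xi : 0 <= t -> agree t P Q -> LipO Z -> Lip t%:E xi ->
  (forall w, 0 <= xi w) -> Ex Q (fun w => Z w * xi w) <= Ex P (fun w => cE t Z w * xi w).
Proof.
move=> t0 [PQ PQE] LZ Lxi xi0; have Lxi' := Lip_LipO Lxi.
have LY := cE_Lip sl_ge0 sl_le_sb t0 LZ; have LY' := Lip_LipO LY.
have t0' : (0 <= t%:E)%E by rewrite lee_fin.
rewrite -(PQE _ (Lip_mul t0' LY Lxi)) -subr_le0 -Ex_sub; last 2 first.
- by apply: bdmeas_mul; [exact: Lip_bdmeas LZ|exact: Lip_bdmeas Lxi].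
- by apply: bdmeas_mul; [exact: Lip_bdmeas LY|exact: Lip_bdmeas Lxi].
have LD : LipO (fun w => Z w - cE t Z w) by apply: Lip_sub; rewrite ?leey.
have -> : (fun w => Z w * xi w - cE t Z w * xi w) = fun w => xi w * (Z w - cE t Z w).
  by apply/funext => w; ring.
have LxD := Lip_mul (leey 0%E) Lxi' LD.
apply: (le_trans (Pset_Ex PQ LxD)); rewrite -(E0_cE sl_ge0 sl_le_sb t0 LxD).
have -> : cE t (fun w => xi w * (Z w - cE t Z w)) = fun=> 0.
  apply/funext => w; rewrite (cE_mul sl_ge0 sl_le_sb t0 Lxi LD (xi0 w)).
  by rewrite (cE_addLip sl_ge0 sl_le_sb w t0 LY LZ) subrr mulr0.
by rewrite E0_cst.
Qed.

(** Hahn-Banach for the sublinear functional E^P[cE t X], made exact at Z xi. The linear functional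
    is dominated by [E0], hence represented by a prior; on variables known at [t] the bound holds
    for X and -X, which gives agreement with [P]. *)
Lemma agree_attained t P Z xi : 0 <= t -> Pset P -> LipO Z -> Lip t%:E xi ->
  (forall w, 0 <= xi w) -> exists2 Q, agree t P Q &
  Ex Q (fun w => Z w * xi w) = Ex P (fun w => cE t Z w * xi w).
Proof.
move=> t0 PP LZ Lxi xi0; have Lxi' := Lip_LipO Lxi.
have LcE X : LipO X -> bdmeas (cE t X) by move=> LX; apply: Lip_bdmeas (cE_Lip sl_ge0 sl_le_sb t0 LX).
pose p X := Ex P (cE t X).
have sp : sublin LipO p.
  split.
    move=> f g Lf Lg; rewrite /p -Ex_add; [|exact: LcE|exact: LcE].
    apply: Ex_le; [by apply: LcE; apply: Lip_add; rewrite ?leey|by apply: bdmeas_add; exact: LcE|] => w.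
    exact: (cE_add sl_ge0 sl_le_sb w t0 Lf Lg).
  move=> c f c0 Lf; rewrite /p -Ex_scale; last exact: LcE.
  congr (Ex _ _); apply/funext => w.
  apply: (cE_mul sl_ge0 sl_le_sb t0 (xi := fun=> c)) => //; last exact: ltW.
  by apply: Lip_cst; rewrite lee_fin.
have LZx : LipO (fun w => Z w * xi w) by apply: Lip_mul; rewrite ?leey.
have [||l [ladd lscale lp lZ]] := @hahn_banach R (Omega R) LipO _ _ p _ sp LZx.
- by move=> f g; apply: Lip_add; rewrite leey.
- by move=> c f; apply: Lip_scale; rewrite leey.
have lE0 X : LipO X -> l X <= E0 X.
  move=> LX; apply: (le_trans (lp X LX)); rewrite -(E0_cE sl_ge0 sl_le_sb t0 LX).
  by apply: Pset_Ex => //; exact/Lip_LipO/(cE_Lip sl_ge0 sl_le_sb t0 LX).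
have [Q PQ QE] := representation sl_ge0 sl_le_sb ladd lscale lE0.
exists Q.
  split => // X LX; have LX' := Lip_LipO LX.
  have pE Y : Lip t%:E Y -> p Y = Ex P Y.
    by move=> LY; congr (Ex _ _); apply/funext => w; exact: cE_id.
  rewrite QE//; apply/eqP; rewrite eq_le -{1}(pE _ LX) lp//=.
  have t0' : (0 <= t%:E)%E by rewrite lee_fin.
  have := lp _ (Lip_scale (-1) (leey 0%E) LX').
  rewrite pE ?lscale// ?Ex_scale//; first lra.
    exact: Lip_bdmeas LX.
  exact: Lip_scale.
rewrite QE// lZ /p; congr (Ex _ _); apply/funext => w.
have -> : (fun w => Z w * xi w) = fun w => xi w * Z w by apply/funext => v; rewrite mulrC.
by rewrite (cE_mul sl_ge0 sl_le_sb t0 Lxi LZ (xi0 w)) mulrC.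
Qed.

Lemma Pset_nonempty : exists P, Pset P.
Proof.
have L0 : LipO (fun=> 0 : R) by apply: Lip_cst; rewrite leey.
have sp : sublin LipO E0.
  split; first by move=> f g Lf Lg; exact: (E0_add sl_ge0 sl_le_sb Lf Lg).
  by move=> c f c0 Lf; apply: (E0_scale sl_ge0 sl_le_sb (ltW c0) Lf).
have [||l [ladd lscale lp _]] := @hahn_banach R (Omega R) LipO _ _ E0 _ sp L0.
- by move=> f g; apply: Lip_add; rewrite leey.
- by move=> c f; apply: Lip_scale; rewrite leey.
by have [Q PQ _] := representation sl_ge0 sl_le_sb ladd lscale lp; exists Q.
Qed.

(** The ultralimit of the expectations is linear and dominated by [E0], hence an expectation by
    [representation], where tightness is hidden in Daniell's condition. *)
Lemma Pset_weak_compact (Qn : nat -> probability (Omega R) R) : (forall n, Pset (Qn n)) ->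
  exists2 Q, Pset Q & forall Z, LipO Z -> (fun n => Ex (Qn n) Z) @ UN --> Ex Q Z.
Proof.
move=> PQ; pose l Z := lim ((fun n => Ex (Qn n) Z) @ UN).
have lc Z : LipO Z -> (fun n => Ex (Qn n) Z) @ UN --> l Z.
  move=> LZ; have [M _ ZM] := Lip_bounded LZ; have bZ := Lip_bdmeas LZ.
  apply: (@ultra_cvg _ _ M) => n; rewrite ler_norml; apply/andP; split.
    rewrite -(Ex_cst (Qn n) (- M)); apply: Ex_le => //; first exact: bdmeas_cst.
    by move=> w; have := ZM w; rewrite ler_norml => /andP[].
  rewrite -(Ex_cst (Qn n) M); apply: Ex_le => //; first exact: bdmeas_cst.
  by move=> w; have := ZM w; rewrite ler_norml => /andP[].
have ladd X Y : LipO X -> LipO Y -> l (fun w => X w + Y w) = l X + l Y.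
  move=> LX LY; have L := Lip_add (leey 0%E) LX LY.
  apply: (UN_unique (lc _ L)); apply: (UN_ext _ (UN_add (lc _ LX) (lc _ LY))) => n.
  by rewrite Ex_add//; [exact: Lip_bdmeas LX|exact: Lip_bdmeas LY].
have lscale c X : LipO X -> l (fun w => c * X w) = c * l X.
  move=> LX; have L := Lip_scale c (leey 0%E) LX.
  apply: (UN_unique (lc _ L)); apply: (UN_ext _ (@UN_scale R _ _ c (lc _ LX))) => n.
  by rewrite Ex_scale//; exact: Lip_bdmeas LX.
have lE0 X : LipO X -> l X <= E0 X.
  by move=> LX; apply: (UN_le_cst (lc _ LX)); apply: nearW => n; exact: Pset_Ex.
have [Q PQ' QE] := representation sl_ge0 sl_le_sb ladd lscale lE0.
by exists Q => // Z LZ; rewrite QE//; exact: lc.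
Qed.

End priors.

Class volatility_bounds (R : realType) (sl sb : R) : Prop :=
  { volatility_ge0 : 0 <= sl ; volatility_le : sl <= sb }.

(** * Quasi-sure relations and the norm *)

Section quasi_sure.
Context {R : realType} {sl sb : R} {bnd : volatility_bounds sl sb}.
Implicit Types (x y z xi : Omega R -> R) (X Y : Omega R -> \bar R) (A N : set (Omega R))
  (t c e : R) (P Q : probability (Omega R) R) (C D : Omega R -> Prop).

Local Notation Pset := (Pset sl sb).
Local Notation qs := (qs sl sb).
Local Notation GE := (GE sl sb).

Let P0 : exists P, Pset P.
Proof. by apply: Pset_nonempty; [exact: volatility_ge0|exact: volatility_le]. Qed.

(** That the capacity of a set null under all priors is 0 rather than -oo relies on the existence of
    a prior. *)
Lemma qsP C : qs C <-> exists N, [/\ measurable N, forall P, Pset P -> P N = 0%E &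
  forall w, ~ N w -> C w].
Proof.
split=> -[N [mN N0 NC]]; exists N; split => //.
  move=> P PP; apply/eqP; rewrite eq_le measure_ge0 andbT -N0.
  by apply: ereal_sup_ubound; exists P.
apply/eqP; rewrite eq_le; apply/andP; split.
  by apply: ge_ereal_sup => _ [P PP <-]; rewrite N0.
by have [P PP] := P0; rewrite -(N0 P PP); apply: ereal_sup_ubound; exists P.
Qed.

Lemma qs_ae C P : qs C -> Pset P -> {ae P, forall w, C w}.
Proof.
move=> /qsP[N [mN N0 NC]] PP; exists N; split => //; first exact: N0.
by move=> w /= nC; apply: contrapT => nN; apply: nC; exact: NC.
Qed.

Lemma qsT C : (forall w, C w) -> qs C.
Proof. by move=> h; apply/qsP; exists set0; split => // P _; rewrite measure0. Qed.

Lemma qs_mono C D : (forall w, C w -> D w) -> qs C -> qs D.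
Proof. by move=> CD [N [? ? NC]]; exists N; split => // w /NC/CD. Qed.

Lemma qs_all (C : nat -> Omega R -> Prop) : (forall n, qs (C n)) -> qs (fun w => forall n, C n w).
Proof.
move=> h; have /choice[N NP] := fun n => (qsP (C n)).1 (h n).
apply/qsP; exists (\bigcup_n N n); split.
- by apply: bigcupT_measurable => n; have [] := NP n.
- move=> P PP; apply: measure_negligible.
    by apply: bigcupT_measurable => n; have [] := NP n.
  apply: negligible_bigcup => n; have [mN N0 _] := NP n.
  by apply/negligibleP => //; exact: N0.
- move=> w nN n; have [_ _] := NP n; apply=> Nw; apply: nN; by exists n.
Qed.

Lemma qs_and C D : qs C -> qs D -> qs (fun w => C w /\ D w).
Proof.
move=> qC qD; have := qs_all (C := fun n => if n is 0%N then C else D).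
move=> h; apply: (qs_mono _ (h _)) => [w hw|[|n]//].
by split; [exact: (hw 0%N)|exact: (hw 1%N)].
Qed.

Lemma qs_null A : measurable A -> (forall P, Pset P -> P A = 0%E) -> qs (fun w => ~ A w).
Proof. by move=> mA A0; apply/qsP; exists A. Qed.

(** A bound on the G-expectation norm, kept as a relation and stated prior by prior, so that
    estimates avoid suprema in the extended reals. *)
Definition Nle x c : Prop := forall P, Pset P -> (\int[P]_w (`|x w|)%:E <= c%:E)%E.

Definition L1q x : Prop := measurable_fun setT x /\ exists c, Nle x c.

Lemma L1q_int x P : L1q x -> Pset P -> P.-integrable setT (EFin \o x).
Proof.
move=> [mx [c xc]] PP; apply/integrableP; split; first exact/measurable_EFinP.
exact: le_lt_trans (xc P PP) (ltry _).
Qed.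

Lemma Nle_le x c d : c <= d -> Nle x c -> Nle x d.
Proof. by move=> cd xc P PP; apply: (le_trans (xc P PP)); rewrite lee_fin. Qed.

Lemma Nle_abs x c P : L1q x -> Nle x c -> Pset P -> Ex P (fun w => `|x w|) <= c.
Proof.
move=> Lx xc PP; rewrite -lee_fin /Ex /Rintegral fineK; first exact: xc.
apply: integrable_fin_num => //; apply: (@integrable_abse _ _ _ P setT (EFin \o x)).
exact: L1q_int.
Qed.

Lemma Nle_intro x c : L1q x -> (forall P, Pset P -> Ex P (fun w => `|x w|) <= c) -> Nle x c.
Proof.
move=> Lx h P PP; have := h P PP; rewrite -lee_fin /Ex /Rintegral fineK//.
apply: integrable_fin_num => //; apply: (@integrable_abse _ _ _ P setT (EFin \o x)).
exact: L1q_int.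
Qed.

Lemma Nle_dom x y c : measurable_fun setT x -> measurable_fun setT y ->
  qs (fun w => `|x w| <= y w) -> Nle y c -> Nle x c.
Proof.
move=> mx my xy yc P PP; apply: le_trans (yc P PP).
apply: ae_ge0_le_integral => //.
- by apply/measurable_EFinP; exact: measurableT_comp.
- by apply/measurable_EFinP; exact: measurableT_comp.
- have := qs_ae xy PP; apply: filterS => w h _.
  by rewrite lee_fin; apply: (le_trans h); exact: ler_norm.
Qed.

Lemma Nle_add x y c d : measurable_fun setT x -> measurable_fun setT y ->
  Nle x c -> Nle y d -> Nle (fun w => `|x w| + `|y w|) (c + d).
Proof.
move=> mx my xc yd P PP; rewrite EFinD.
under eq_integral do rewrite ger0_norm ?addr_ge0// EFinD.
rewrite ge0_integralD//; last 2 first.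
- by apply/measurable_EFinP; exact: measurableT_comp.
- by apply/measurable_EFinP; exact: measurableT_comp.
by apply: leeD; [exact: xc|exact: yd].
Qed.

Lemma Nle_scale x c d : measurable_fun setT x -> 0 <= d -> Nle x c -> Nle (fun w => d * x w) (d * c).
Proof.
move=> mx d0 xc P PP; rewrite EFinM.
under eq_integral do rewrite normrM (ger0_norm d0) EFinM.
rewrite ge0_integralZl//; last by apply/measurable_EFinP; exact: measurableT_comp.
by apply: lee_wpmul2l; [rewrite lee_fin|exact: xc].
Qed.

Lemma L1q_dom x y : measurable_fun setT x -> L1q y -> qs (fun w => `|x w| <= y w) -> L1q x.
Proof. by move=> mx [my [c yc]] xy; split => //; exists c; exact: Nle_dom yc. Qed.

Lemma L1q_addabs x y : L1q x -> L1q y -> L1q (fun w => `|x w| + `|y w|).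
Proof.
move=> [mx [c xc]] [my [d yd]]; split; last by exists (c + d); exact: Nle_add.
by apply: measurable_funD; exact: measurableT_comp.
Qed.

Lemma L1q_add x y : L1q x -> L1q y -> L1q (fun w => x w + y w).
Proof.
move=> Lx Ly; apply: (L1q_dom _ (L1q_addabs Lx Ly)).
  by apply: measurable_funD; [case: Lx|case: Ly].
by apply: qsT => w; exact: ler_normD.
Qed.

Lemma L1q_sub x y : L1q x -> L1q y -> L1q (fun w => x w - y w).
Proof.
move=> Lx Ly; apply: (L1q_dom _ (L1q_addabs Lx Ly)).
  by apply: measurable_funB; [case: Lx|case: Ly].
by apply: qsT => w; exact: ler_normB.
Qed.

Lemma L1q_max x y : L1q x -> L1q y -> L1q (fun w => Num.max (x w) (y w)).
Proof.
move=> Lx Ly; apply: (L1q_dom _ (L1q_addabs Lx Ly)).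
  by apply: measurable_maxr; [case: Lx|case: Ly].
by apply: qsT => w; rewrite /Num.max; case: ifP => _; rewrite ?lerDl ?lerDr.
Qed.

Lemma L1q_abs x : L1q x -> L1q (fun w => `|x w|).
Proof.
move=> Lx; apply: (L1q_dom _ (L1q_addabs Lx Lx)).
  by apply: measurableT_comp => //; case: Lx.
by apply: qsT => w; rewrite normr_id lerDl.
Qed.

Lemma Nle_bdmeas z M : (forall w, `|z w| <= M) -> measurable_fun setT z -> Nle z M.
Proof.
move=> zM mz P PP; rewrite integral_Ex.
  rewrite lee_fin -[leRHS](Ex_cst P M); apply: Ex_le => //; last exact: bdmeas_cst.
  by split; [exact: measurableT_comp|exists M => w; rewrite normr_id].
by split; [exact: measurableT_comp|exists M => w; rewrite normr_id].
Qed.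

Lemma bdmeas_L1q z : bdmeas z -> L1q z.
Proof. by move=> [mz [M zM]]; split => //; exists M; exact: Nle_bdmeas. Qed.

Lemma Nle_mul x z c M : measurable_fun setT x -> measurable_fun setT z -> 0 <= M ->
  (forall w, `|z w| <= M) -> Nle x c -> Nle (fun w => x w * z w) (M * c).
Proof.
move=> mx mz M0 zM xc.
have mMx : measurable_fun setT (fun w => M * `|x w|).
  by apply: measurable_funM; [exact: measurable_cst|exact: measurableT_comp].
apply: (@Nle_dom _ (fun w => M * `|x w|)) => //; first exact: measurable_funM.
  by apply: qsT => w; rewrite normrM mulrC ler_wpM2r.
apply: Nle_scale => //; first exact: measurableT_comp.
by move=> P PP; under eq_integral do rewrite normr_id; exact: xc.
Qed.

Lemma L1q_mul x z : L1q x -> bdmeas z -> L1q (fun w => x w * z w).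
Proof.
move=> [mx [c xc]] [mz [M zM]]; split; first exact: measurable_funM.
exists (`|M| * c); apply: Nle_mul => // w; exact: le_trans (zM w) (ler_norm _).
Qed.

Lemma ExD x y P : L1q x -> L1q y -> Pset P -> Ex P (fun w => x w + y w) = Ex P x + Ex P y.
Proof. by move=> Lx Ly PP; rewrite /Ex RintegralD//; exact: L1q_int. Qed.

Lemma ExB x y P : L1q x -> L1q y -> Pset P -> Ex P (fun w => x w - y w) = Ex P x - Ex P y.
Proof. by move=> Lx Ly PP; rewrite /Ex RintegralB//; exact: L1q_int. Qed.

Lemma L1q_EFin x P : L1q x -> Pset P -> (\int[P]_w (x w)%:E = (Ex P x)%:E)%E.
Proof.
by move=> Lx PP; rewrite /Ex /Rintegral fineK//; apply: integrable_fin_num => //; exact: L1q_int.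
Qed.

Lemma Ex_eq_qs x y P : L1q x -> L1q y -> qs (fun w => x w = y w) -> Pset P -> Ex P x = Ex P y.
Proof.
move=> [mx _] [my _] xy PP; rewrite /Ex /Rintegral; congr fine.
apply: ae_eq_integral => //; [exact/measurable_EFinP|exact/measurable_EFinP|].
by have := qs_ae xy PP; apply: filterS => w -> _.
Qed.

Lemma Ex_le_qs x y P : L1q x -> L1q y -> qs (fun w => x w <= y w) -> Pset P -> Ex P x <= Ex P y.
Proof.
move=> Lx Ly xy PP; have Lm := L1q_max Lx Ly.
rewrite -(Ex_eq_qs Lm Ly _ PP); last by apply: qs_mono xy => w h; rewrite max_r.
apply: le_Rintegral => //; [exact: L1q_int|exact: L1q_int|] => w _.
by rewrite le_max lexx.
Qed.

Lemma Ex_dct (xn : nat -> Omega R -> R) x y P : (forall n, L1q (xn n)) -> L1q x -> L1q y ->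
  qs (fun w => forall n, `|xn n w| <= y w) -> qs (fun w => xn n w @[n --> \oo] --> x w) ->
  Pset P -> Ex P (xn n) @[n --> \oo] --> Ex P x.
Proof.
move=> Ln Lx Ly dom cv PP.
have [] := @dominated_convergence _ _ _ P setT measurableT (fun n => EFin \o xn n) (EFin \o x) (EFin \o y).
- by move=> n; apply/measurable_EFinP; case: (Ln n).
- by apply/measurable_EFinP; case: Lx.
- have := qs_ae cv PP; apply: filterS => w h _; apply: cvg_EFin => //.
  exact: nearW.
- exact: L1q_int.
- by have := qs_ae dom PP; apply: filterS => w h n _; rewrite /= lee_fin.
move=> _ _; rewrite L1q_EFin// => h; exact: (fine_cvg h).
Qed.

Lemma Nle_fatou (xn : nat -> Omega R -> R) x c : (forall n, measurable_fun setT (xn n)) ->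
  measurable_fun setT x -> (forall n, Nle (xn n) c) ->
  qs (fun w => xn n w @[n --> \oo] --> x w) -> Nle x c.
Proof.
move=> mn mx xc cv P PP.
have mE n : measurable_fun setT (fun w => (`|xn n w|)%:E).
  by apply/measurable_EFinP; exact: measurableT_comp.
rewrite (@ge0_ae_eq_integral _ _ _ P setT _ (fun w => limn_einf (fun n => (`|xn n w|)%:E))) => //; last 4 first.
- by apply/measurable_EFinP; exact: measurableT_comp.
- have -> : (fun w => limn_einf (fun n => (`|xn n w|)%:E)) =
      (fun w => - limn_esup (fun n => - (`|xn n w|)%:E))%E.
    by apply/funext => w; rewrite -[LHS]oppeK -limn_esupN.
  apply: measurableT_comp => //; apply: measurable_fun_limn_esup => n.
  exact: measurableT_comp.
- move=> w _; rewrite limn_einf_lim; apply: lime_ge; first exact: is_cvg_einfs.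
  by apply: nearW => n; apply: le_ereal_inf_tmp => _ [m _ <-].
- have := qs_ae cv PP; apply: filterS => w h _; apply/esym.
  rewrite is_cvg_limn_einfE; last by apply/cvg_ex; exists (`|x w|)%:E; apply: cvg_EFin; [exact: nearW|exact: cvg_norm].
  by apply/cvg_lim => //; apply: cvg_EFin; [exact: nearW|exact: cvg_norm].
apply: (le_trans (fatou P measurableT mE _)) => //.
rewrite limn_einf_lim; apply: lime_le; first exact: is_cvg_einfs.
apply: nearW => n; apply: (le_trans _ (xc n P PP)).
by apply: ereal_inf_lbound; exists n => /=.
Qed.

Definition ncvg (xn : nat -> Omega R -> R) x : Prop :=
  forall e, 0 < e -> exists n0, forall n, (n0 <= n)%N -> Nle (fun w => xn n w - x w) e.

Lemma GE_eq_qs X Y : measurable_fun setT X -> measurable_fun setT Y ->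
  qs (fun w => X w = Y w) -> GE X = GE Y.
Proof.
move=> mX mY XY; rewrite /GE; congr ereal_sup; apply/seteqP.
have E P : Pset P -> (\int[P]_w X w = \int[P]_w Y w)%E.
  move=> PP; apply: ae_eq_integral => //.
  by have := qs_ae XY PP; apply: filterS => w -> _.
by split => _ [P PP <-]; exists P => //; rewrite E.
Qed.

Lemma GE_Nle x c : (GE (fun w => (`|x w|)%:E) <= c%:E)%E <-> Nle x c.
Proof.
split=> [h P PP|h].
  by apply: le_trans h; apply: ereal_sup_ubound; exists P.
by apply: ge_ereal_sup => _ [P PP <-]; exact: h.
Qed.

Lemma GE_ge0 X : (forall w, 0 <= X w)%E -> (0 <= GE X)%E.
Proof.
move=> X0; have [P PP] := P0; apply: (@le_trans _ _ (\int[P]_w X w)%E).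
  by apply: integral_ge0 => w _; exact: X0.
by apply: ereal_sup_ubound; exists P.
Qed.

Definition rv X : Omega R -> R := fun w => fine (X w).

Lemma GE_norm_sub X Y x y : measurable_fun setT X -> measurable_fun setT Y ->
  measurable_fun setT x -> measurable_fun setT y ->
  qs (fun w => X w = (x w)%:E) -> qs (fun w => Y w = (y w)%:E) ->
  GE (fun w => `|X w - Y w|)%E = GE (fun w => (`|x w - y w|)%:E).
Proof.
move=> mX mY mx my Xx Yy; apply: GE_eq_qs.
- by apply: measurableT_comp => //; exact: emeasurable_funB.
- by apply/measurable_EFinP; apply: measurableT_comp => //; exact: measurable_funB.
- by apply: qs_mono (qs_and Xx Yy) => w [-> ->].
Qed.

Lemma norm_cvgP (Xn : nat -> Omega R -> \bar R) X (xn : nat -> Omega R -> R) x :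
  (forall n, measurable_fun setT (Xn n)) -> measurable_fun setT X ->
  (forall n, measurable_fun setT (xn n)) -> measurable_fun setT x ->
  (forall n, qs (fun w => Xn n w = (xn n w)%:E)) -> qs (fun w => X w = (x w)%:E) ->
  norm_cvg sl sb Xn X <-> ncvg xn x.
Proof.
move=> mXn mX mxn mx Xxn Xx; rewrite /norm_cvg.
under eq_fun do rewrite (GE_norm_sub (mXn _) mX (mxn _) mx (Xxn _) Xx).
set a := fun n => _; have a0 n : (0 <= a n)%E by apply: GE_ge0 => w.
split=> [h e e0|h].
  have : nbhs (0%E : \bar R) [set y | (y <= e%:E)%E].
    rewrite /nbhs /=; apply/nbhs_ballP; exists e => //= r; rewrite /ball /= sub0r normrN lee_fin => /ltW.
    by apply: le_trans; exact: ler_norm.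
  by move=> /h[n0 _ hn0]; exists n0 => n nn; apply/GE_Nle; exact: hn0.
move=> S; rewrite /nbhs /= => /nbhs_ballP[e /= e0 eS].
have [n0 hn0] := h (e / 2) (ltac:(lra) : 0 < e / 2).
exists n0 => // n /= /hn0/GE_Nle; rewrite -/(a n); move: (a0 n).
case: (a n) => [r| |]//; rewrite !lee_fin => r0 re; apply: eS.
by rewrite /ball /= sub0r normrN ger0_norm//; lra.
Qed.

End quasi_sure.

Arguments Nle {R} sl sb x c.
Arguments L1q {R} sl sb x.
Arguments ncvg {R} sl sb xn x.

(** * Adapted variables and density of Lipschitz weights *)

Section adapted.
Context {R : realType} {sl sb : R} {bnd : volatility_bounds sl sb}.
Implicit Types (x y z xi : Omega R -> R) (A N : set (Omega R))
  (t c e : R) (P Q : probability (Omega R) R).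

Local Notation Pset := (Pset sl sb).
Local Notation qs := (qs sl sb).
Local Notation L1q := (L1q sl sb).

Lemma path_ext (v v' : Omega R) : pathfun v = pathfun v' -> v = v'.
Proof.
case: v v' => [f fc f0] [g gc g0] /= fg; subst g.
by congr Path; exact: Prop_irrelevance.
Qed.

Lemma measurable_stop (t : \bar R) : measurable_fun setT (stop t : Omega R -> Omega R).
Proof.
apply: measurable_path => m j; case: t => [r| |] /=; [|exact: measurable_B|exact: measurable_B].
exact: (measurable_B (Num.min (grid m j) r)).
Qed.

Lemma F_measurable (t : \bar R) A : F t A -> measurable A.
Proof. by move=> [A' mA' <-]; exact: measurable_stop. Qed.

Lemma F_sigma_algebra (t : \bar R) : sigma_algebra setT (F t : set (set (Omega R))).
Proof. apply: sigma_algebra_preimage; exact: sigma_algebra_measurable. Qed.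

Definition Ftype (t : \bar R) := g_sigma_algebraType (F t : set (set (Omega R))).

Lemma FtypeP (t : \bar R) d (T : measurableType d) (f : Omega R -> T) :
  (forall A : set T, measurable A -> F t (f @^-1` A)) <-> measurable_fun setT (f : Ftype t -> T).
Proof.
have E : @measurable _ (Ftype t) = F t := sigma_algebra_id (F_sigma_algebra t).
split=> [h _ A mA|h A mA].
  by rewrite setTI E; exact: h.
by have := h measurableT A mA; rewrite setTI E.
Qed.

Lemma F_le (s t : R) A : s <= t -> F s%:E A -> F t%:E A.
Proof.
move=> st [A' mA' <-]; rewrite setTI; exists (stop s%:E @^-1` A').
  by rewrite -[X in measurable X]setTI; exact: measurable_stop.
rewrite setTI; apply/funext => w.
have E : stop s%:E (stop t%:E w) = stop s%:E w.
  by apply: path_ext; apply/funext => r /=; rewrite -minA (min_l st).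
exact: (congr1 A' E).
Qed.

Lemma Lip_F (t : R) X : Lip t%:E X -> measurable_fun setT (X : Ftype t%:E -> R).
Proof.
move=> LX; apply/FtypeP => A mA.
exists (X @^-1` A); first by rewrite -[X in measurable X]setTI; exact: (measurable_Lip LX).
rewrite setTI; apply/funext => w.
have E : X (stop t%:E w) = X w.
  have [M [L [ts [Phi [PC ts0 ->]]]]] := Lip_cylindrical LX.
  apply: (cyl_agree PC) => s /(allP ts0)/andP[_]; rewrite lee_fin => st /=.
  by rewrite min_l.
exact: (congr1 A E).
Qed.

Definition adaptedq (t : \bar R) y : Prop :=
  exists2 y', measurable_fun setT (y' : Ftype t -> R) & qs (fun w => y w = y' w).

Lemma dist_max_indic (a b : bool) (x y : R) : 0 <= x <= 1 -> 0 <= y <= 1 ->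
  `|(a || b)%:R - Num.max x y| <= `|a%:R - x| + `|b%:R - y|.
Proof.
move=> /andP[? ?] /andP[? ?]; case: a; case: b => /=; rewrite /Num.max;
  case: ifP; rewrite ?normr0 ?sub0r ?normrN ?(ger0_norm) ?subr_ge0//; lra.
Qed.

Section density.
Variables (t : R) (P : probability (Omega R) R) (g : Omega R -> R).
Hypotheses (t0 : 0 <= t) (PP : Pset P) (Lg : L1q g) (g0 : forall w, 0 <= g w).

Let t0' : (0 <= t%:E)%E. Proof. by rewrite lee_fin. Qed.

(** The sets whose indicators are limits of Lipschitz weights in L^1 of the measure with density
    [g]. They form a sigma-algebra, so it is enough to check that it makes the stopped coordinates
    measurable. *)
Definition Lip_approx : set (set (Omega R)) := [set A | measurable A /\
  forall e, 0 < e -> exists xi, [/\ Lip t%:E xi, forall w, 0 <= xi w <= 1 &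
    Ex P (fun w => g w * `|\1_A w - xi w|) <= e]].

Let bd01 A z : measurable A -> measurable_fun setT z -> (forall w, 0 <= z w <= 1) ->
  bdmeas (fun w => `|\1_A w - z w|).
Proof.
move=> mA mz z01; split.
  by apply: measurableT_comp => //; apply: measurable_funB => //; exact: measurable_indic.
exists 1 => w; rewrite normr_id indicE; have /andP[? ?] := z01 w.
by case: (w \in A); rewrite ler_norml /=; apply/andP; split; lra.
Qed.

Let LgA A z : measurable A -> measurable_fun setT z -> (forall w, 0 <= z w <= 1) ->
  L1q (fun w => g w * `|\1_A w - z w|).
Proof. by move=> mA mz z01; apply: L1q_mul => //; exact: bd01. Qed.

Let indic01 A w : 0 <= (\1_A w : R) <= 1.
Proof. by rewrite indicE; case: (w \in A); rewrite /= ?lexx ?ler01. Qed.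

Lemma Lip_approx_lim A (xn : nat -> Omega R -> R) : measurable A ->
  (forall n, measurable_fun setT (xn n)) -> (forall n w, 0 <= xn n w <= 1) ->
  (forall w, xn n w @[n --> \oo] --> (\1_A w : R)) ->
  Ex P (fun w => g w * `|\1_A w - xn n w|) @[n --> \oo] --> (0 : R).
Proof.
move=> mA mx x01 xA; rewrite -(Ex_cst P 0).
apply: (@Ex_dct _ sl sb _ _ _ g) => //.
- by move=> n; exact: LgA.
- by apply: bdmeas_L1q; exact: bdmeas_cst.
- apply: qsT => w n; rewrite normrM (ger0_norm (g0 w)) normr_id ler_piMr//.
  have /andP[? ?] := x01 n w; have /andP[? ?] := indic01 A w.
  by rewrite ler_norml; apply/andP; split; lra.
- apply: qsT => w; rewrite -(mulr0 (g w)) -(normr0 R) -(subrr (\1_A w : R)).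
  by apply: cvgM; [exact: cvg_cst|apply: cvg_norm; apply: cvgB; [exact: cvg_cst|exact: xA]].
Qed.

Lemma Lip_approx_intro A (xn : nat -> Omega R -> R) : measurable A ->
  (forall n, Lip t%:E (xn n)) -> (forall n w, 0 <= xn n w <= 1) ->
  (forall w, xn n w @[n --> \oo] --> (\1_A w : R)) -> Lip_approx A.
Proof.
move=> mA Lx x01 xA; split => // e e0.
have := Lip_approx_lim mA (fun n => measurable_Lip (Lx n)) x01 xA.
move=> /cvgrPdist_le/(_ e e0)[n _ /(_ n (leqnn n))] /=.
by rewrite sub0r normrN => /(le_trans (ler_norm _)) h; exists (xn n).
Qed.

Lemma Lip_approx_sigma : sigma_algebra setT Lip_approx.
Proof.
have set0P : Lip_approx set0.
  apply: (@Lip_approx_intro _ (fun _ _ => 0)) => //.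
  - by move=> n; exact: Lip_cst.
  - by move=> n w; rewrite lexx ler01.
  - by move=> w; rewrite indic0; exact: cvg_cst.
have setUP A B : Lip_approx A -> Lip_approx B -> Lip_approx (A `|` B).
  move=> [mA hA] [mB hB]; split; first exact: measurableU.
  move=> e e0; have e2 : 0 < e / 2 by lra.
  have [xi [Lxi xi01 hxi]] := hA _ e2; have [eta [Leta eta01 heta]] := hB _ e2.
  have Lm := Lip_max t0' Lxi Leta.
  have m01 w : 0 <= Num.max (xi w) (eta w) <= 1.
    have /andP[? ?] := xi01 w; have /andP[? ?] := eta01 w.
    by rewrite le_max ge_max; apply/andP; split; [apply/orP; left|apply/andP].
  exists (fun w => Num.max (xi w) (eta w)); split => //.
  have LA := LgA mA (measurable_Lip Lxi) xi01; have LB := LgA mB (measurable_Lip Leta) eta01.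
  have LU := LgA (measurableU _ _ mA mB) (measurable_Lip Lm) m01.
  apply: (@le_trans _ _ (Ex P (fun w => g w * `|\1_A w - xi w| + g w * `|\1_B w - eta w|))); last first.
    by rewrite (ExD LA LB PP); lra.
  apply: (Ex_le_qs LU (L1q_add LA LB) _ PP); apply: qsT => w.
  by rewrite -mulrDr ler_wpM2l// !indicE in_setU dist_max_indic.
split => //.
- move=> A [mA hA]; rewrite setTD; split; first exact: measurableC.
  move=> e e0; have [xi [Lxi xi01 hxi]] := hA e e0.
  exists (fun w => 1 - xi w); split.
  + by apply: Lip_sub => //; exact: Lip_cst.
  + by move=> w; have /andP[? ?] := xi01 w; apply/andP; split; lra.
  + apply: le_trans hxi; rewrite le_eqVlt; apply/orP; left; apply/eqP; congr (Ex _ _).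
    apply/funext => w; congr (_ * _); rewrite !indicE in_setC.
    by case: (w \in A) => /=; rewrite distrC; congr `|_|; ring.
- move=> F hF; have mF n : measurable (F n) by have [] := hF n.
  have mU : measurable (\bigcup_n F n) by exact: bigcupT_measurable.
  pose G n := \big[setU/set0]_(i < n) F i.
  have GP n : Lip_approx (G n).
    rewrite /G; elim: n => [|n ih]; first by rewrite big_ord0.
    by rewrite big_ord_recr; exact: setUP.
  have mG n : measurable (G n) by have [] := GP n.
  have GU w : (\1_(G n) w : R) @[n --> \oo] --> (\1_(\bigcup_n F n) w : R).
    rewrite [in X in _ --> X]indicE; have [|] := boolP (w \in _); rewrite ?inE.
      move=> [k _ Fkw]; apply: cvg_near_cst; exists k.+1 => // n /= kn.
      rewrite indicE mem_set//; rewrite /G -bigcup_mkord; exists k => //.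
    move=> nU; apply: cvg_near_cst; apply: nearW => n.
    rewrite indicE memNset//; rewrite /G -bigcup_mkord => -[k _ Fkw].
    by move: nU; rewrite notin_setE; apply; exists k.
  split => // e e0; have e2 : 0 < e / 2 by lra.
  have mI n : measurable_fun setT (\1_(G n) : Omega R -> R) by exact: measurable_indic.
  have := Lip_approx_lim mU mI (fun n => indic01 (G n)) GU.
  move=> /cvgrPdist_le/(_ _ e2)[n _ /(_ n (leqnn n))] /=.
  rewrite sub0r normrN => /(le_trans (ler_norm _)) hn.
  have [xi [Lxi xi01 hxi]] := (GP n).2 _ e2.
  exists xi; split => //.
  have LA := LgA mU (mI n) (indic01 (G n)).
  have LB := LgA (mG n) (measurable_Lip Lxi) xi01.
  have LU := LgA mU (measurable_Lip Lxi) xi01.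
  apply: (@le_trans _ _ (Ex P (fun w => g w * `|\1_(\bigcup_n F n) w - \1_(G n) w| + g w * `|\1_(G n) w - xi w|))); last first.
    by rewrite (ExD LA LB PP); lra.
  apply: (Ex_le_qs LU (L1q_add LA LB) _ PP); apply: qsT => w.
  by rewrite -mulrDr ler_wpM2l//; exact: ler_distD.
Qed.

(** Since [stop t] is determined by its dyadic coordinates, the sets to check are {B_s > a} with s a
    dyadic time capped at [t]; steep truncated linear functions of B_s increase to their
    indicators. *)
Lemma F_Lip_approx A : F t%:E A -> Lip_approx A.
Proof.
have E : @measurable _ (g_sigma_algebraType Lip_approx) = Lip_approx := sigma_algebra_id Lip_approx_sigma.
have : measurable_fun setT (stop t%:E : g_sigma_algebraType Lip_approx -> Omega R).
  apply: measurable_path => m j /=.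
  apply: (@measurability _ _ (g_sigma_algebraType Lip_approx) _ setT _ _ (RGenOInfty.measurableE R)).
  move=> _ [_ [a ->] <-]; rewrite setTI E; set s := Num.min (grid m j) t.
  have s0 : 0 <= s by rewrite le_min grid_ge0.
  have st : s <= t by rewrite ge_min lexx orbT.
  pose clip (n : nat) (r : R) := Num.max 0 (Num.min 1 (n%:R * (r - a))).
  apply: (@Lip_approx_intro _ (fun n w => clip n (B s w))).
  - by rewrite -[X in measurable X]setTI; apply: (measurable_B s) => //; exact: measurable_itv.
  - move=> n; apply: cylindrical_Lip => //.
    exists 1, n%:R, [:: s], (fun f => clip n (f s)); split => //; last by rewrite /= s0 lee_fin st.
    split => [f||f f']; first by rewrite ger0_norm ?le_max ?lexx// ge_max ler01 ge_min lexx.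
      by [].
    rewrite big_seq1; apply: (le_trans (clip01_lip _ _)); rewrite -mulrBr normrM ger0_norm//.
    by rewrite ler_wpM2l// le_eqVlt; apply/orP; left; apply/eqP; congr `|_|; ring.
  - by move=> n w; rewrite /clip le_max lexx /= ge_max ler01 ge_min lexx.
  - move=> w; rewrite indicE; have [h|h] := leP (B s w) a.
      rewrite memNset; last by rewrite /= in_itv /= andbT; apply/negP; rewrite -leNgt.
      apply: cvg_near_cst; apply: nearW => n.
      have c0 : n%:R * (B s w - a) <= 0 by rewrite mulr_ge0_le0// subr_le0.
      by rewrite /clip min_r ?max_l// (le_trans c0).
    rewrite mem_set; last by rewrite /= in_itv /= andbT.
    apply: cvg_near_cst; exists (Num.truncn (B s w - a)^-1).+1 => // n /= nn.
    rewrite /clip min_l ?max_r// -ler_pdivrMr ?subr_gt0// div1r.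
    by apply: (le_trans (ltW (truncnS_gt _))); rewrite ler_nat.
move=> h [A' mA' <-]; rewrite -E; exact: h.
Qed.

End density.

(** The optimal weight is the indicator of {y > 0}. It is known at [t], hence approximated by
    Lipschitz weights in L^1 of the measure with density |y|. *)
Lemma Ex_pos_le t P y c : 0 <= t -> Pset P -> L1q y -> adaptedq t%:E y ->
  (forall xi, Lip t%:E xi -> (forall w, 0 <= xi w <= 1) -> Ex P (fun w => y w * xi w) <= c) ->
  Ex P (fun w => Num.max (y w) 0) <= c.
Proof.
move=> t0 PP Ly [y' my' yy'] h; apply/ler_addgt0Pr => e e0.
have Lg : L1q (fun w => `|y w|) by exact: L1q_abs.
pose A := [set w | 0 < y' w].
have FA : F t%:E A.
  have := (FtypeP _ _).2 my' `]0, +oo[%classic (measurable_itv _).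
  by congr (F _ _); apply/seteqP; split => w /=; rewrite in_itv /= andbT.
have mA := F_measurable FA.
have [_ /(_ e e0)[xi [Lxi xi01 hxi]]] := F_Lip_approx t0 PP Lg (fun w => normr_ge0 _) FA.
have bxi := Lip_bdmeas Lxi.
have L0 : L1q (fun=> 0) by apply: bdmeas_L1q; exact: bdmeas_cst.
have Lmax : L1q (fun w => Num.max (y w) 0) by exact: L1q_max.
have Lyx : L1q (fun w => y w * xi w) by exact: L1q_mul.
have Ld : L1q (fun w => `|y w| * `|\1_A w - xi w|).
  apply: L1q_mul => //; split.
    by apply: measurableT_comp => //; apply: measurable_funB; [exact: measurable_indic|case: bxi].
  exists 1 => w; rewrite normr_id indicE; have /andP[? ?] := xi01 w.
  by case: (w \in A); rewrite ler_norml /=; apply/andP; split; lra.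
apply: (@le_trans _ _ (Ex P (fun w => y w * xi w + `|y w| * `|\1_A w - xi w|))); last first.
  by rewrite (ExD Lyx Ld PP); apply: lerD => //; exact: h.
apply: (Ex_le_qs Lmax (L1q_add Lyx Ld) _ PP); apply: qs_mono yy' => w yE.
have /andP[x0 x1] := xi01 w.
rewrite indicE; have [wA|wA] := boolP (w \in A).
  have y0 : 0 < y w by rewrite yE; move: wA; rewrite inE.
  by rewrite max_l ?(ltW y0)// (gtr0_norm y0) ger0_norm ?subr_ge0//=; lra.
have y0 : y w <= 0 by rewrite yE leNgt; apply: contra wA => ?; rewrite inE.
rewrite max_r// (ler0_norm y0) /= sub0r normrN (ger0_norm x0); lra.
Qed.

End adapted.

Arguments adaptedq {R} sl sb t y.

(** * Quasi-sure limits and completeness *)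

Section adaptedq_theory.
Context {R : realType} {sl sb : R} {bnd : volatility_bounds sl sb}.
Implicit Types (x y z xi : Omega R -> R) (t c e : R).

Local Notation qs := (qs sl sb).
Local Notation L1q := (L1q sl sb).
Local Notation Nle := (Nle sl sb).
Local Notation ncvg := (ncvg sl sb).
Local Notation adaptedq := (adaptedq sl sb).

Lemma adaptedq_eq (t : \bar R) x y : qs (fun w => x w = y w) -> adaptedq t y -> adaptedq t x.
Proof.
move=> xy [y' my' yy']; exists y' => //.
by apply: qs_mono (qs_and xy yy') => w [-> ->].
Qed.

Lemma adaptedq_comp2 (t : \bar R) x y (h : R -> R -> R) :
  (forall f g : Ftype t -> R, measurable_fun setT f -> measurable_fun setT g ->
     measurable_fun setT (fun w => h (f w) (g w))) ->
  adaptedq t x -> adaptedq t y -> adaptedq t (fun w => h (x w) (y w)).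
Proof.
move=> hm [x' mx' xx'] [y' my' yy']; exists (fun w => h (x' w) (y' w)).
  exact: hm.
by apply: qs_mono (qs_and xx' yy') => w [-> ->].
Qed.

Lemma adaptedq_sub (t : \bar R) x y : adaptedq t x -> adaptedq t y -> adaptedq t (fun w => x w - y w).
Proof. by apply: (adaptedq_comp2 (h := fun a b => a - b)) => f g mf mg; exact: measurable_funB. Qed.

Lemma adaptedq_Lip t x : Lip t%:E x -> adaptedq t%:E x.
Proof. by move=> Lx; exists x; [exact: Lip_F|exact: qsT]. Qed.

Lemma adaptedq_le s t x : s <= t -> adaptedq s%:E x -> adaptedq t%:E x.
Proof.
move=> st [x' mx' xx']; exists x' => //; apply/FtypeP => A mA.
by apply: (F_le st); exact: (FtypeP _ _).2.
Qed.

(** The limit superior makes the limit total, hence measurable without any exceptional set. *)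
Definition limr (u : nat -> R) : R := fine (limn_esup (fun n => (u n)%:E)).

Lemma limrE (u : nat -> R) l : u n @[n --> \oo] --> l -> limr u = l.
Proof.
move=> ul; have c : (fun n => (u n)%:E) @ \oo --> l%:E by apply: cvg_EFin => //; exact: nearW.
by rewrite /limr (cvg_limn_einf_sup c).2.
Qed.

Lemma measurable_limr d (T : measurableType d) (xn : nat -> T -> R) :
  (forall n, measurable_fun setT (xn n)) -> measurable_fun setT (fun w => limr (xn^~ w)).
Proof.
move=> mx; apply: measurableT_comp => //.
by apply: measurable_fun_limn_esup => n; exact/measurable_EFinP.
Qed.

Lemma adaptedq_lim (t : \bar R) (xn : nat -> Omega R -> R) x : (forall n, adaptedq t (xn n)) ->
  qs (fun w => xn n w @[n --> \oo] --> x w) -> adaptedq t x.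
Proof.
move=> ax cx; have /choice[x' x'P] : forall n, exists x', measurable_fun setT (x' : Ftype t -> R) /\
    qs (fun w => xn n w = x' w) by move=> n; have [x' ? ?] := ax n; exists x'.
exists (fun w => limr (x'^~ w)).
  by apply: measurable_limr => n; have [] := x'P n.
have h : qs (fun w => forall n, xn n w = x' n w) by apply: qs_all => n; have [] := x'P n.
apply: qs_mono (qs_and cx h) => w [cw hw]; apply/esym/limrE.
by rewrite (_ : x'^~ w = xn^~ w)//; apply/funext => n; rewrite hw.
Qed.

Lemma finite_liminf (xn : nat -> Omega R -> R) c : (forall n, measurable_fun setT (xn n)) ->
  (forall n, Nle (xn n) c) -> qs (fun w => (limn_einf (fun n => (`|xn n w|)%:E) < +oo)%E).
Proof.
move=> mx xc.
have mE n : measurable_fun setT (fun w => (`|xn n w|)%:E).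
  by apply/measurable_EFinP; exact: measurableT_comp.
pose f w := limn_einf (fun n => (`|xn n w|)%:E).
have mf : measurable_fun setT f.
  have -> : f = (fun w => - limn_esup (fun n => - (`|xn n w|)%:E))%E.
    by apply/funext => w; rewrite -[LHS]oppeK -limn_esupN.
  apply: measurableT_comp => //; apply: measurable_fun_limn_esup => n.
  exact: measurableT_comp.
have f0 w : (0 <= f w)%E.
  rewrite /f limn_einf_lim; apply: lime_ge; first exact: is_cvg_einfs.
  by apply: nearW => n; apply: le_ereal_inf_tmp => _ [m _ <-].
have mN : measurable [set w | f w = +oo%E].
  by have := mf measurableT [set +oo%E] (emeasurable_set1 _); rewrite setTI.
have : qs (fun w => ~ (f w = +oo%E)).
  apply: (qs_null mN) => P PP; apply: measure_negligible => //.
  have If : P.-integrable setT f.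
    apply/integrableP; split => //; under eq_integral do rewrite gee0_abs//.
    apply: (@le_lt_trans _ _ c%:E); last exact: ltry.
    apply: (le_trans (fatou P measurableT mE _)) => //.
    rewrite limn_einf_lim; apply: lime_le; first exact: is_cvg_einfs.
    apply: nearW => n; apply: (le_trans _ (xc n P PP)).
    by apply: ereal_inf_lbound; exists n => /=.
  have := integrable_ae measurableT If; apply: negligibleS => w /= fw /(_ I).
  by rewrite fw.
by apply: qs_mono => w /= /eqP; rewrite -ltey.
Qed.

(** Fatou's lemma under each prior makes the limit inferior of |xn| finite. The exceptional set is
    the same measurable set for all priors, so the conclusion is quasi-sure although no single prior
    controls the others. *)
Lemma bounded_mono_cvg (xn : nat -> Omega R -> R) c : (forall n, measurable_fun setT (xn n)) ->
  (forall n, Nle (xn n) c) -> qs (fun w => forall n, xn n w <= xn n.+1 w) ->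
  L1q (fun w => limr (xn^~ w)) /\ qs (fun w => xn n w @[n --> \oo] --> limr (xn^~ w)).
Proof.
move=> mx xc xi.
have cv : qs (fun w => xn n w @[n --> \oo] --> limr (xn^~ w)).
  apply: qs_mono (qs_and xi (finite_liminf mx xc)) => w [xw].
  have nd : nondecreasing_seq (xn^~ w) by apply/nondecreasing_seqP.
  rewrite limn_einf_lim => lw.
  have [M wM] : exists M : R, forall n, xn n w <= M.
    move: lw; set L := limn _ => lw.
    have [M LM] : exists M : R, (L < M%:E)%E.
      case: L lw => [r| |]// _; first by exists (r + 1); rewrite lte_fin ltrDl.
      by exists 0; exact: ltNyr.
    exists M => n; rewrite leNgt; apply/negP => Mn.
    have : (M%:E <= L)%E.
      apply: lime_ge; first exact: is_cvg_einfs.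
      exists n => // m /= nm; apply: le_ereal_inf_tmp => _ [k /= mk <-].
      rewrite lee_fin; apply: le_trans (ler_norm _); apply: (le_trans (ltW Mn)).
      by apply: nd; exact: leq_trans mk.
    by rewrite leNgt LM.
  have c' : cvgn (xn^~ w) by apply: nondecreasing_is_cvgn => //; exists M => _ [n _ <-].
  by move/cvg_ex : c' => [l cl]; rewrite (limrE cl).
split => //; split; first exact: measurable_limr.
by exists c; apply: (@Nle_fatou _ _ _ _ xn) => //; exact: measurable_limr.
Qed.

(** Along a subsequence with increments below 2^-k in norm, the partial sums of absolute increments
    are increasing and bounded in norm by 2. They converge quasi-surely by [bounded_mono_cvg], and
    so does the subsequence. *)
Lemma Cauchy_ncvg (t : \bar R) (xn : nat -> Omega R -> R) : (forall n, L1q (xn n)) ->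
  (forall n, adaptedq t (xn n)) ->
  (forall e, 0 < e -> exists n0, forall n m, (n0 <= n)%N -> (n0 <= m)%N -> Nle (fun w => xn n w - xn m w) e) ->
  exists x, [/\ L1q x, adaptedq t x & ncvg xn x].
Proof.
move=> Lx ax Cx; have mx n : measurable_fun setT (xn n) by case: (Lx n).
have h0 k : 0 < 2^-1 ^+ k :> R by rewrite exprn_gt0//; lra.
have /choice[N NP] : forall k : nat, exists n0, forall n m, (n0 <= n)%N -> (n0 <= m)%N ->
    Nle (fun w => xn n w - xn m w) (2^-1 ^+ k) by move=> k; exact: Cx.
(* The successors in the sum make this index nondecreasing and at least both N k and k. *)
pose nk k := (\sum_(j < k.+1) (N j).+1)%N.
have nkN k : (N k <= nk k)%N by rewrite /nk big_ord_recr /= (leq_trans (leqnSn _))// leq_addl.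
have nkS k : (nk k <= nk k.+1)%N by rewrite /nk [leqRHS]big_ord_recr leq_addr.
have nkk k : (k <= nk k)%N.
  elim: k => // k ih; rewrite /nk big_ord_recr /= addnS ltnS; exact: leq_trans ih (leq_addr _ _).
pose u k := xn (nk k).
have du k : Nle (fun w => u k.+1 w - u k w) (2^-1 ^+ k).
  by apply: NP; [exact: leq_trans (nkN k) (nkS k)|exact: nkN].
pose S n w := \sum_(k < n) `|u k.+1 w - u k w|.
have mS n : measurable_fun setT (S n).
  apply: (@measurable_sum _ _ _ setT _ (index_enum 'I_n) (fun (k : 'I_n) w => `|u k.+1 w - u k w|)) => k.
  by apply: measurableT_comp => //; apply: measurable_funB; exact: mx.
have S2 n : Nle (S n) (\sum_(k < n) 2^-1 ^+ k).
  elim: n => [|n ih].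
    rewrite big_ord0; apply: Nle_bdmeas => // w; by rewrite /S big_ord0 normr0.
  rewrite big_ord_recr /=.
  have := Nle_add (mS n) (measurable_funB (mx _) (mx _)) ih (du n).
  apply: Nle_dom => //.
  - apply: measurable_funD; first exact: measurableT_comp (mS n).
    by apply: measurableT_comp => //; apply: measurable_funB; exact: mx.
  - apply: qsT => w; rewrite /S big_ord_recr /=; apply: (le_trans (ler_normD _ _)).
    by rewrite normr_id.
have geo n : \sum_(k < n) 2^-1 ^+ k <= 2 :> R.
  suff : \sum_(k < n) 2^-1 ^+ k + 2 * 2^-1 ^+ n = 2 :> R by have := h0 n; lra.
  elim: n => [|n ih]; first by rewrite big_ord0 expr0; lra.
  by rewrite big_ord_recr /= exprS; lra.
have S2' n : Nle (S n) 2 by apply: Nle_le (S2 n).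
have Smono : qs (fun w => forall n, S n w <= S n.+1 w).
  by apply: qsT => w n; rewrite /S [leRHS]big_ord_recr lerDl.
have [_ Scv] := bounded_mono_cvg mS S2' Smono.
have ucv : qs (fun w => u k w @[k --> \oo] --> limr (u^~ w)).
  apply: qs_mono Scv => w cS.
  have : cvgn (series (fun k => u k.+1 w - u k w)).
    apply: normed_cvg; apply/cvg_ex; exists (limr (S^~ w)).
    rewrite (_ : [normed _] = S^~ w)//; apply/funext => n.
    by rewrite /S -(big_mkord xpredT (fun k => `|u k.+1 w - u k w|)).
  rewrite seriesEnat => /cvg_ex[l cl].
  have E : (fun n => \sum_(0 <= k < n) (u k.+1 w - u k w)) = fun n => u n w - u 0%N w.
    by apply/funext => n; rewrite telescope_sumr.
  have cl' : u n w @[n --> \oo] --> l + u 0%N w.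
    rewrite (_ : u^~ w = fun n => (u n w - u 0%N w) + u 0%N w); last first.
      by apply/funext => n; rewrite subrK.
    by apply: cvgD; [rewrite -E; exact: cl|exact: cvg_cst].
  by rewrite (limrE cl').
pose x w := limr (u^~ w).
have mxx : measurable_fun setT x by apply: measurable_limr => k; exact: mx.
have ncx : ncvg xn x.
  move=> e e0; have [n0 hn0] := Cx e e0; exists n0 => n nn.
  apply: (@Nle_fatou _ _ _ _ (fun k w => xn n w - u (n0 + k)%N w)).
  - by move=> k; apply: measurable_funB; exact: mx.
  - exact: measurable_funB.
  - by move=> k; apply: hn0 => //; apply: leq_trans (nkk _); rewrite leq_addr.
  - apply: qs_mono ucv => w cw; apply: cvgB; first exact: cvg_cst.
    by rewrite -(cvg_shiftn n0) in cw; under eq_fun do rewrite addnC.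
exists x; split => //.
- have [n0 hn0] := ncx 1 ltr01.
  have Lx0 := Lx n0.
  have Ld : L1q (fun w => xn n0 w - x w).
    by split; [exact: measurable_funB|exists 1; exact: hn0].
  have -> : x = fun w => xn n0 w - (xn n0 w - x w) by apply/funext => w; ring.
  exact: L1q_sub.
- by apply: adaptedq_lim ucv => k; exact: ax.
Qed.

End adaptedq_theory.

(** * Conditional G-expectations on the extended spaces *)

Section conditional.
Context {R : realType} {sl sb : R} {bnd : volatility_bounds sl sb}.
Implicit Types (x y z xi : Omega R -> R) (t c e : R) (P Q : probability (Omega R) R).

Local Notation qs := (qs sl sb).
Local Notation L1q := (L1q sl sb).
Local Notation Nle := (Nle sl sb).
Local Notation ncvg := (ncvg sl sb).
Local Notation adaptedq := (adaptedq sl sb).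
Local Notation Pset := (Pset sl sb).
Local Notation agree := (agree sl sb).
Local Notation LipO := (Lip +oo%E).

Let sl_ge0 : 0 <= sl. Proof. exact: volatility_ge0. Qed.
Let sl_le_sb : sl <= sb. Proof. exact: volatility_le. Qed.

(* [y w = ess sup E^Q[x | F_t] w], where the essential supremum over [agree t P]
   is tested against nonnegative Lipschitz cylindrical weights. *)
Definition CE t x y : Prop := [/\ L1q x, L1q y, adaptedq t%:E y,
  forall P Q xi, Pset P -> agree t P Q -> Lip t%:E xi -> (forall w, 0 <= xi w) ->
    Ex Q (fun w => x w * xi w) <= Ex P (fun w => y w * xi w) &
  forall P xi e, Pset P -> Lip t%:E xi -> (forall w, 0 <= xi w) -> 0 < e ->
    exists2 Q, agree t P Q & Ex P (fun w => y w * xi w) <= Ex Q (fun w => x w * xi w) + e].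

(* The density that makes [E^P[x xi]] weakly continuous in [P]. *)
Definition qcont x : Prop := forall e, 0 < e -> exists2 Z, LipO Z & Nle (fun w => Z w - x w) e.

Lemma Lip_L1q (t : \bar R) Z : Lip t Z -> L1q Z.
Proof. by move=> LZ; apply: bdmeas_L1q; exact: Lip_bdmeas LZ. Qed.

Lemma L1q_mulLip (t : \bar R) x xi : L1q x -> Lip t xi -> L1q (fun w => x w * xi w).
Proof. by move=> Lx Lxi; apply: L1q_mul => //; exact: Lip_bdmeas Lxi. Qed.

Lemma CE_Lip t Z : 0 <= t -> LipO Z -> CE t Z (cE sl sb t Z).
Proof.
move=> t0 LZ; have LcE := cE_Lip sl_ge0 sl_le_sb t0 LZ.
split; [exact: Lip_L1q LZ|exact: Lip_L1q LcE|exact: adaptedq_Lip| |].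
  by move=> P Q xi PP PQ Lxi xi0; exact: agree_le_cE.
move=> P xi e PP Lxi xi0 e0.
have [Q PQ QE] := agree_attained sl_ge0 sl_le_sb t0 PP LZ Lxi xi0.
by exists Q => //; rewrite QE lerDl ltW.
Qed.

Lemma Nle_Ex x y xi c M P (t : \bar R) : L1q x -> L1q y -> Nle (fun w => x w - y w) c -> Lip t xi ->
  0 <= M -> (forall w, `|xi w| <= M) -> Pset P ->
  `|Ex P (fun w => x w * xi w) - Ex P (fun w => y w * xi w)| <= M * c.
Proof.
move=> Lx Ly xyc Lxi M0 xiM PP.
have Lxx := L1q_mulLip Lx Lxi; have Lyx := L1q_mulLip Ly Lxi.
rewrite -(ExB Lxx Lyx PP).
have Ld : L1q (fun w => x w - y w) by exact: L1q_sub.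
have Ldx := L1q_mulLip Ld Lxi.
have -> : (fun w => x w * xi w - y w * xi w) = fun w => (x w - y w) * xi w.
  by apply/funext => w; rewrite mulrBl.
have h : Nle (fun w => (x w - y w) * xi w) (M * c).
  by apply: Nle_mul => //; [case: Ld|exact: measurable_Lip Lxi].
apply: le_trans (Nle_abs Ldx h PP).
by apply: le_normr_Rintegral => //; exact: (L1q_int Ldx PP).
Qed.

Lemma CE_norm t (xn yn : nat -> Omega R -> R) x y : (forall n, CE t (xn n) (yn n)) ->
  L1q x -> L1q y -> adaptedq t%:E y -> ncvg xn x -> ncvg yn y -> CE t x y.
Proof.
move=> C Lx Ly ay cx cy.
have near xi e : Lip t%:E xi -> 0 < e -> exists n, forall P, Pset P ->
    `|Ex P (fun w => xn n w * xi w) - Ex P (fun w => x w * xi w)| <= e /\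
    `|Ex P (fun w => yn n w * xi w) - Ex P (fun w => y w * xi w)| <= e.
  move=> Lxi e0; have [M M0 xiM] := Lip_bounded Lxi.
  have d0 : 0 < e / (M + 1) by rewrite divr_gt0// ltr_wpDl.
  have [n1 h1] := cx _ d0; have [n2 h2] := cy _ d0.
  exists (maxn n1 n2) => P PP; have [Lxn Lyn _ _ _] := C (maxn n1 n2).
  have Me : M * (e / (M + 1)) <= e.
    by rewrite mulrA ler_pdivrMr ?ltr_wpDl//; lra.
  split; apply: le_trans Me.
    exact: (Nle_Ex Lxn Lx (h1 _ (leq_maxl _ _)) Lxi M0 xiM PP).
  exact: (Nle_Ex Lyn Ly (h2 _ (leq_maxr _ _)) Lxi M0 xiM PP).
split => //.
  move=> P Q xi PP PQ Lxi xi0; apply/ler_addgt0Pr => e e0.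
  have [n hn] := near xi (e / 2) Lxi (ltac:(lra) : 0 < e / 2).
  have [_ _ _ I1 _] := C n; have := I1 P Q xi PP PQ Lxi xi0.
  have [h1 _] := hn Q PQ.1; have [_ h2] := hn P PP.
  by move: h1 h2; rewrite !ler_norml => /andP[? ?] /andP[? ?]; lra.
move=> P xi e PP Lxi xi0 e0.
have [n hn] := near xi (e / 4) Lxi (ltac:(lra) : 0 < e / 4).
have [_ _ _ _ I2] := C n.
have [Q PQ QE] := I2 P xi (e / 4) PP Lxi xi0 (ltac:(lra) : 0 < e / 4).
exists Q => //; have [h1 _] := hn Q PQ.1; have [_ h2] := hn P PP.
by move: h1 h2; rewrite !ler_norml => /andP[? ?] /andP[? ?]; lra.
Qed.

Lemma qcont_UN x xi (t : \bar R) (Qn : nat -> probability (Omega R) R) Q : L1q x -> qcont x ->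
  Lip t xi -> Pset Q -> (forall n, Pset (Qn n)) ->
  (forall Z, LipO Z -> (fun n => Ex (Qn n) Z) @ UN --> Ex Q Z) ->
  (fun n => Ex (Qn n) (fun w => x w * xi w)) @ UN --> Ex Q (fun w => x w * xi w).
Proof.
move=> Lx qx Lxi PQ PQn cQ; apply/cvgrPdist_le => e e0.
have [M M0 xiM] := Lip_bounded Lxi.
have d0 : 0 < e / (3 * (M + 1)) by rewrite divr_gt0// mulr_gt0// ltr_wpDl.
have [Z LZ Zx] := qx _ d0.
have Lxi' : LipO xi by apply: Lip_le Lxi; rewrite leey.
have LZx : LipO (fun w => Z w * xi w) by apply: Lip_mul; rewrite ?leey.
have Me : M * (e / (3 * (M + 1))) <= e / 3.
  have M1 : 0 < 3 * (M + 1) by rewrite mulr_gt0// ltr_wpDl.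
  by rewrite mulrA ler_pdivrMr//; have := mulr_ge0 M0 (ltW e0); lra.
have hP P : Pset P -> `|Ex P (fun w => Z w * xi w) - Ex P (fun w => x w * xi w)| <= e / 3.
  by move=> PP; apply: le_trans Me; exact: (Nle_Ex (Lip_L1q LZ) Lx Zx Lxi M0 xiM PP).
have := cQ _ LZx => /cvgrPdist_le/(_ (e / 3) (ltac:(lra) : 0 < e / 3)); apply: filterS => n hn.
move: hn (hP _ PQ) (hP _ (PQn n)).
by rewrite !ler_norml => /andP[? ?] /andP[? ?] /andP[? ?]; apply/andP; split; lra.
Qed.

Definition qs_dec (xn : nat -> Omega R -> R) x : Prop :=
  qs (fun w => (forall n, xn n.+1 w <= xn n w) /\ xn n w @[n --> \oo] --> x w).

Definition qs_inc (xn : nat -> Omega R -> R) x : Prop :=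
  qs (fun w => (forall n, xn n w <= xn n.+1 w) /\ xn n w @[n --> \oo] --> x w).

Lemma qs_dec_le xn x : qs_dec xn x -> qs (fun w => forall n m, (n <= m)%N -> x w <= xn m w <= xn n w).
Proof.
apply: qs_mono => w [xd xc] n m nm.
have mono i j : (i <= j)%N -> xn j w <= xn i w.
  move=> ij; apply: (@homo_leq _ (xn^~ w) (fun a b => b <= a)) => //.
  by move=> a b c ab bc; exact: le_trans ab.
rewrite mono// andbT; apply: (cvgr_to_le xc); exists m => // k /= mk; exact: mono.
Qed.

Lemma qs_inc_le xn x : qs_inc xn x -> qs (fun w => forall n m, (n <= m)%N -> xn n w <= xn m w <= x w).
Proof.
apply: qs_mono => w [xd xc] n m nm.
have mono i j : (i <= j)%N -> xn i w <= xn j w.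
  by move=> ij; apply: (@homo_leq _ (xn^~ w) <=%R) => //; exact: le_trans.
rewrite mono//=; apply: (cvgr_to_ge xc); exists m => // k /= mk; exact: mono.
Qed.

Lemma Ex_mono_cvg (xn : nat -> Omega R -> R) x xi (t : \bar R) P : (forall n, L1q (xn n)) -> L1q x ->
  qs_dec xn x \/ qs_inc xn x -> Lip t xi -> Pset P ->
  Ex P (fun w => xn n w * xi w) @[n --> \oo] --> Ex P (fun w => x w * xi w).
Proof.
move=> Ln Lx mono Lxi PP; have [M M0 xiM] := Lip_bounded Lxi.
have Lg : L1q (fun w => (`|xn 0%N w| + `|x w|) * M).
  by apply: L1q_mul; [exact: L1q_addabs|exact: bdmeas_cst].
have dom : qs (fun w => forall n, `|xn n w| <= `|xn 0%N w| + `|x w|).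
  case: mono => [/qs_dec_le|/qs_inc_le]; apply: qs_mono => w h n; have := h 0%N n (leq0n n) => /andP[];
  have := ler_norm (x w); have := ler_norm (xn 0%N w); have := ler_norm (- x w); have := ler_norm (- xn 0%N w);
  by rewrite !normrN ler_norml => *; apply/andP; split; lra.
have cv : qs (fun w => xn n w @[n --> \oo] --> x w) by case: mono; apply: qs_mono => w [].
apply: (Ex_dct (fun n => L1q_mulLip (Ln n) Lxi) (L1q_mulLip Lx Lxi) Lg _ _ PP).
  by apply: qs_mono dom => w h n; rewrite normrM ler_pM.
by apply: qs_mono cv => w h; apply: cvgM => //; exact: cvg_cst.
Qed.

(** The near-optimal priors depend on n; an ultralimit [Q] of them again agrees with [P] up to [t].
    For fixed m and n >= m, replacing x_n by x_m only increases the expectation; as x_m is [qcont],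
    the bound passes to [Q], and then m tends to infinity. *)
Lemma CE_dec t (xn yn : nat -> Omega R -> R) x y : (forall n, CE t (xn n) (yn n)) ->
  (forall n, qcont (xn n)) -> L1q x -> L1q y -> adaptedq t%:E y -> qs_dec xn x -> qs_dec yn y -> CE t x y.
Proof.
move=> C qx Lx Ly ay dx dy.
have Lxn n : L1q (xn n) by have [] := C n.
have Lyn n : L1q (yn n) by have [] := C n.
split => //.
  move=> P Q xi PP PQ Lxi xi0.
  apply: (ler_cvg_to (Ex_mono_cvg Lxn Lx (or_introl dx) Lxi PQ.1) (Ex_mono_cvg Lyn Ly (or_introl dy) Lxi PP)).
  by apply: nearW => n; have [_ _ _ I1 _] := C n; exact: I1.
move=> P xi e PP Lxi xi0 e0.
have /choice[Qn QnP] : forall n, exists Q, agree t P Q /\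
    Ex P (fun w => yn n w * xi w) <= Ex Q (fun w => xn n w * xi w) + e.
  by move=> n; have [_ _ _ _ I2] := C n; have [Q ? ?] := I2 P xi e PP Lxi xi0 e0; exists Q.
have PQn n : Pset (Qn n) by have [[]] := QnP n.
have [Q PQ cQ] := Pset_weak_compact sl_ge0 sl_le_sb PQn.
exists Q.
  split => // Z LZ; apply: (UN_unique (cQ _ (Lip_LipO LZ))).
  rewrite (_ : (fun n => _) = fun=> Ex P Z); first exact: UN_cst.
  by apply/funext => n; have [[_ h] _] := QnP n; exact: h.
have xleP m : Ex P (fun w => y w * xi w) - e <= Ex Q (fun w => xn m w * xi w).
  apply: (UN_ge_cst (qcont_UN (Lxn m) (qx m) Lxi PQ PQn cQ)).
  apply: UN_eventually; exists m => // n /= mn.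
  have [_ hn] := QnP n.
  have h1 : Ex P (fun w => y w * xi w) <= Ex P (fun w => yn n w * xi w).
    apply: (Ex_le_qs (L1q_mulLip Ly Lxi) (L1q_mulLip (Lyn n) Lxi) _ PP).
    by apply: qs_mono (qs_dec_le dy) => w h; rewrite ler_wpM2r//; have /andP[] := h n n (leqnn n).
  have h2 : Ex (Qn n) (fun w => xn n w * xi w) <= Ex (Qn n) (fun w => xn m w * xi w).
    apply: (Ex_le_qs (L1q_mulLip (Lxn n) Lxi) (L1q_mulLip (Lxn m) Lxi) _ (PQn n)).
    by apply: qs_mono (qs_dec_le dx) => w h; rewrite ler_wpM2r//; have /andP[] := h m n mn.
  lra.
have : Ex P (fun w => y w * xi w) - e <= Ex Q (fun w => x w * xi w).
  by apply: (cvgr_to_ge (Ex_mono_cvg Lxn Lx (or_introl dx) Lxi PQ)); apply: nearW => m; exact: xleP.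
lra.
Qed.

(** For a given [P], a near-optimal prior for one large n is near-optimal for the limit, since
    replacing [xn n] by [x] only increases the expectation. *)
Lemma CE_inc t (xn yn : nat -> Omega R -> R) x y : (forall n, CE t (xn n) (yn n)) ->
  L1q x -> L1q y -> adaptedq t%:E y -> qs_inc xn x -> qs_inc yn y -> CE t x y.
Proof.
move=> C Lx Ly ay dx dy.
have Lxn n : L1q (xn n) by have [] := C n.
have Lyn n : L1q (yn n) by have [] := C n.
split => //.
  move=> P Q xi PP PQ Lxi xi0.
  apply: (ler_cvg_to (Ex_mono_cvg Lxn Lx (or_intror dx) Lxi PQ.1) (Ex_mono_cvg Lyn Ly (or_intror dy) Lxi PP)).
  by apply: nearW => n; have [_ _ _ I1 _] := C n; exact: I1.
move=> P xi e PP Lxi xi0 e0; have e2 : 0 < e / 2 by lra.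
have := Ex_mono_cvg Lyn Ly (or_intror dy) Lxi PP.
move=> /cvgrPdist_le/(_ _ e2)[n _ /(_ n (leqnn n))] /= hn.
have [_ _ _ _ I2] := C n; have [Q PQ hQ] := I2 P xi (e / 2) PP Lxi xi0 e2.
exists Q => //.
have : Ex Q (fun w => xn n w * xi w) <= Ex Q (fun w => x w * xi w).
  apply: (Ex_le_qs (L1q_mulLip (Lxn n) Lxi) (L1q_mulLip Lx Lxi) _ PQ.1).
  by apply: qs_mono (qs_inc_le dx) => w h; rewrite ler_wpM2r//; have /andP[] := h n n (leqnn n).
by move: hn; rewrite ler_norml => /andP[? ?]; lra.
Qed.

Lemma qs_le_pos x y : L1q x -> L1q y ->
  (forall P, Pset P -> Ex P (fun w => Num.max (x w - y w) 0) <= 0) -> qs (fun w => x w <= y w).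
Proof.
move=> Lx Ly h; pose A := [set w | 0 < x w - y w].
have Ld : L1q (fun w => x w - y w) by exact: L1q_sub.
have L0 : L1q (fun=> 0) by apply: bdmeas_L1q; exact: bdmeas_cst.
have Lm : L1q (fun w => Num.max (x w - y w) 0) by exact: L1q_max.
have [md _] := Ld; have [mm _] := Lm.
have mA : measurable A.
  have := md measurableT _ (measurable_itv `]0, +oo[); rewrite setTI.
  by congr (measurable _); apply/seteqP; split => w /=; rewrite in_itv /= andbT.
have : qs (fun w => ~ A w).
  apply: (qs_null mA) => P PP.
  have E : (\int[P]_w `|(Num.max (x w - y w) 0)%:E| = 0)%E.
    apply/eqP; rewrite eq_le integral_ge0 ?andbT//.
    under eq_integral do rewrite /= ger0_norm ?le_max ?lexx ?orbT//.
    by rewrite (L1q_EFin Lm PP) lee_fin; exact: h.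
  have mm' : measurable_fun setT (fun w => (Num.max (x w - y w) 0)%:E) by exact/measurable_EFinP.
  have [H _] := ae_eq_integral_abs P measurableT mm'.
  apply: measure_negligible => //; apply: negligibleS (H E) => w Aw /= /(_ I) /eqP.
  by rewrite eqe => /eqP; rewrite max_l ?ltW// => e0; move: Aw; rewrite /A /= e0 ltxx.
apply: qs_mono => w nA; rewrite -subr_le0 leNgt; exact/negP.
Qed.

(** Common source of monotonicity (c = 0) and of the norm estimate. A near-optimal prior for [x] is
    merely admissible for [x'], so comparing expectations of [x] and [x'] under that one prior
    compares [y] and [y']. *)
Lemma CE_pos_le t x y x' y' c : 0 <= t -> CE t x y -> CE t x' y' ->
  (forall Q xi, Pset Q -> Lip t%:E xi -> (forall w, 0 <= xi w <= 1) ->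
     Ex Q (fun w => x w * xi w) <= Ex Q (fun w => x' w * xi w) + c) ->
  forall P, Pset P -> Ex P (fun w => Num.max (y w - y' w) 0) <= c.
Proof.
move=> t0 [Lx Ly ay I1 I2] [Lx' Ly' ay' I1' I2'] h P PP.
apply: (Ex_pos_le t0 PP); [exact: L1q_sub|exact: adaptedq_sub|].
move=> xi Lxi xi01; have xi0 w : 0 <= xi w by have /andP[] := xi01 w.
apply/ler_addgt0Pr => e e0; have [Q PQ hQ] := I2 P xi e PP Lxi xi0 e0.
have -> : (fun w => (y w - y' w) * xi w) = fun w => y w * xi w - y' w * xi w.
  by apply/funext => w; rewrite mulrBl.
rewrite (ExB (L1q_mulLip Ly Lxi) (L1q_mulLip Ly' Lxi) PP).
have := h Q xi PQ.1 Lxi xi01; have := I1' P Q xi PP PQ Lxi xi0; lra.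
Qed.

Lemma CE_mono t x y x' y' : 0 <= t -> CE t x y -> CE t x' y' -> qs (fun w => x w <= x' w) ->
  qs (fun w => y w <= y' w).
Proof.
move=> t0 C C' xx'; have [Lx Ly _ _ _] := C; have [Lx' Ly' _ _ _] := C'.
apply: qs_le_pos => //; apply: (CE_pos_le t0 C C') => Q xi PQ Lxi xi01; rewrite addr0.
apply: (Ex_le_qs (L1q_mulLip Lx Lxi) (L1q_mulLip Lx' Lxi) _ PQ).
by apply: qs_mono xx' => w h; rewrite ler_wpM2r//; have /andP[] := xi01 w.
Qed.

(** The positive and negative parts of y - y' are bounded by c separately, whence the factor 2. *)
Lemma CE_contraction t x y x' y' c : 0 <= t -> CE t x y -> CE t x' y' ->
  Nle (fun w => x w - x' w) c -> Nle (fun w => y w - y' w) (2 * c).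
Proof.
move=> t0 C C' xx'; have [Lx Ly _ _ _] := C; have [Lx' Ly' _ _ _] := C'.
have Ld : L1q (fun w => y w - y' w) by exact: L1q_sub.
have Ld' : L1q (fun w => y' w - y w) by exact: L1q_sub.
have L0 : L1q (fun=> 0) by apply: bdmeas_L1q; exact: bdmeas_cst.
have Lm : L1q (fun w => Num.max (y w - y' w) 0) by exact: L1q_max.
have Lm' : L1q (fun w => Num.max (y' w - y w) 0) by exact: L1q_max.
have key Q xi : Pset Q -> Lip t%:E xi -> (forall w, 0 <= xi w <= 1) ->
    `|Ex Q (fun w => x w * xi w) - Ex Q (fun w => x' w * xi w)| <= c.
  move=> PQ Lxi xi01; rewrite -[leRHS]mul1r.
  apply: (Nle_Ex Lx Lx' xx' Lxi ler01 _ PQ) => w.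
  by have /andP[? ?] := xi01 w; rewrite ger0_norm.
apply: Nle_intro => // P PP.
have h1 : Ex P (fun w => Num.max (y w - y' w) 0) <= c.
  apply: (CE_pos_le t0 C C') => // Q xi PQ Lxi xi01.
  by have := key Q xi PQ Lxi xi01; rewrite ler_norml => /andP[? ?]; lra.
have h2 : Ex P (fun w => Num.max (y' w - y w) 0) <= c.
  apply: (CE_pos_le t0 C' C) => // Q xi PQ Lxi xi01.
  by have := key Q xi PQ Lxi xi01; rewrite ler_norml => /andP[? ?]; lra.
have -> : (fun w => `|y w - y' w|) = fun w => Num.max (y w - y' w) 0 + Num.max (y' w - y w) 0.
  apply/funext => w; case: (leP (y w) (y' w)) => h.
    by rewrite (max_r (ltac:(lra) : y w - y' w <= 0)) max_l ?subr_ge0// ler0_norm ?subr_le0//; ring.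
  by rewrite max_l ?(max_r (ltac:(lra) : y' w - y w <= 0)) ?ger0_norm ?addr0// subr_ge0 ltW.
by rewrite (ExD Lm Lm' PP); lra.
Qed.

End conditional.

Arguments CE {R} sl sb t x y.
Arguments qcont {R} sl sb x.
Arguments qs_dec {R} sl sb xn x.
Arguments qs_inc {R} sl sb xn x.

(** * The spaces of random variables through their real versions *)

Section levels.
Context {R : realType} {sl sb : R} {bnd : volatility_bounds sl sb}.
Implicit Types (x y z xi : Omega R -> R) (X Y : Omega R -> \bar R) (c e : R) (P Q : probability (Omega R) R).

Local Notation qs := (qs sl sb).
Local Notation GE := (GE sl sb).
Local Notation L1q := (L1q sl sb).
Local Notation Nle := (Nle sl sb).
Local Notation ncvg := (ncvg sl sb).
Local Notation adaptedq := (adaptedq sl sb).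
Local Notation Pset := (Pset sl sb).
Local Notation agree := (agree sl sb).
Local Notation LL1 := (LL1 sl sb).

Lemma adaptedq_oo x : measurable_fun setT x -> adaptedq +oo%E x.
Proof.
move=> mx; exists x; last exact: qsT.
apply/FtypeP => A mA; exists (x @^-1` A); first by rewrite -[X in measurable X]setTI; exact: mx.
by rewrite setTI.
Qed.

Lemma adaptedq_lee (s t : \bar R) x : (0 <= s)%E -> (s <= t)%E -> measurable_fun setT x -> adaptedq s x -> adaptedq t x.
Proof.
case: s t => [s| |] [t| |]//; rewrite ?lee_fin => _ st mx ax; try exact: adaptedq_oo.
exact: adaptedq_le ax.
Qed.

Lemma qs_fin_num X c : measurable_fun setT X -> (forall P, Pset P -> (\int[P]_w `|X w| <= c%:E)%E) ->
  qs (fun w => X w \is a fin_num).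
Proof.
move=> mX Xc; have mA : measurable [set w | X w \is a fin_num].
  have -> : [set w | X w \is a fin_num] = ~` (X @^-1` [set -oo%E]) `&` ~` (X @^-1` [set +oo%E]).
    by apply/seteqP; split => w /=; case: (X w) => // -[].
  by apply: measurableI; apply: measurableC; rewrite -[X in measurable X]setTI; apply: mX => //; exact: emeasurable_set1.
apply: (@qs_mono _ _ _ (fun w => ~ ~ X w \is a fin_num)) => [w|]; first exact: contrapT.
apply: (@qs_null _ _ _ _ (~` [set w | X w \is a fin_num])); first exact: measurableC.
move=> P PP; apply: measure_negligible; first exact: measurableC.
have If : P.-integrable setT X.
  by apply/integrableP; split => //; apply: le_lt_trans (Xc P PP) (ltry _).
by have := integrable_ae measurableT If; apply: negligibleS => w /= fw /(_ I).
Qed.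

Lemma LL1_rv (t : \bar R) X : LL1 t X ->
  [/\ measurable_fun setT X, L1q (rv X), qs (fun w => X w = (rv X w)%:E) & adaptedq t (rv X)].
Proof.
move=> [mX [X' mX' XX'] Xoo].
have mrv : measurable_fun setT (rv X) by exact: measurableT_comp.
have [c Xc] : exists c, forall P, Pset P -> (\int[P]_w `|X w| <= c%:E)%E.
  have h P : Pset P -> (\int[P]_w `|X w| <= GE (fun w => `|X w|))%E.
    by move=> PP; apply: ereal_sup_ubound; exists P.
  case: (GE _) Xoo h => [r| |]// _ h; first by exists r.
  by exists 0 => P PP; apply: (le_trans (h P PP)); rewrite leNye.
have fX := qs_fin_num mX Xc.
have qX : qs (fun w => X w = (rv X w)%:E) by apply: qs_mono fX => w h; rewrite /rv fineK.
split => //.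
  split => //; exists c => P PP; apply: le_trans (Xc P PP).
  apply: ge0_le_integral => //.
  - by apply/measurable_EFinP; exact: measurableT_comp.
  - by apply: measurableT_comp.
  - by move=> w _; rewrite /rv; case: (X w) => [r| |]//=; rewrite normr0 ?lee_fin ?leey.
exists (rv X'); last by apply: qs_mono XX' => w; rewrite /rv => ->.
by apply: measurableT_comp => //; exact/FtypeP.
Qed.

Lemma LL1_intro (t : \bar R) X x : measurable_fun setT X -> qs (fun w => X w = (x w)%:E) ->
  L1q x -> adaptedq t x -> LL1 t X.
Proof.
move=> mX Xx [mx [c xc]] [x' mx' xx']; split => //.
  exists (EFin \o x'); first by apply/FtypeP; apply/measurable_EFinP.
  by apply: qs_mono (qs_and Xx xx') => w [-> /= ->].
have -> : GE (fun w => `|X w|)%E = GE (fun w => (`|x w|)%:E).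
  apply: GE_eq_qs.
  - exact: measurableT_comp.
  - by apply/measurable_EFinP; exact: measurableT_comp.
  - by apply: qs_mono Xx => w ->.
by apply: le_lt_trans ((GE_Nle _ _).2 xc) (ltry _).
Qed.

Lemma EFin_LL1 (t : \bar R) x : L1q x -> adaptedq t x -> LL1 t (EFin \o x).
Proof. by move=> Lx ax; apply: (@LL1_intro _ _ x) => //; [apply/measurable_EFinP; case: Lx|exact: qsT]. Qed.

Lemma LL1_le (s t : \bar R) X : (0 <= s)%E -> (s <= t)%E -> LL1 s X -> LL1 t X.
Proof.
move=> s0 st /LL1_rv[mX Lx Xx ax]; apply: (LL1_intro mX Xx Lx).
by apply: (adaptedq_lee s0 st) ax; case: Lx.
Qed.

Lemma norm_cvg_rv (s t : \bar R) (Xn : nat -> Omega R -> \bar R) X : (forall n, LL1 s (Xn n)) -> LL1 t X ->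
  norm_cvg sl sb Xn X <-> ncvg (fun n => rv (Xn n)) (rv X).
Proof.
move=> h /LL1_rv[mX Lx Xx _]; apply: norm_cvgP => //.
- by move=> n; have /LL1_rv[] := h n.
- by move=> n; have /LL1_rv[_ []] := h n.
- by case: Lx.
- by move=> n; have /LL1_rv[] := h n.
Qed.

Lemma norm_cvg_EFin (t : \bar R) (xn : nat -> Omega R -> R) X : (forall n, L1q (xn n)) -> LL1 t X ->
  norm_cvg sl sb (fun n => EFin \o xn n) X <-> ncvg xn (rv X).
Proof.
move=> h /LL1_rv[mX Lx Xx _]; apply: norm_cvgP => //.
- by move=> n; apply/measurable_EFinP; case: (h n).
- by move=> n; case: (h n).
- by case: Lx.
- by move=> n; exact: qsT.
Qed.

Lemma cvg_rv (Xn : nat -> Omega R -> \bar R) X w : (forall n, Xn n w = (rv (Xn n) w)%:E) ->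
  X w = (rv X w)%:E -> (Xn n w @[n --> \oo] --> X w) <-> (rv (Xn n) w @[n --> \oo] --> rv X w).
Proof.
move=> Xn' X'; rewrite X' (_ : Xn^~ w = fun n => (rv (Xn n) w)%:E); last by apply/funext.
split => [h|h]; first exact: (fine_cvg h).
by apply: cvg_EFin => //; exact: nearW.
Qed.

Lemma qs_dec_rv (s t : \bar R) (Xn : nat -> Omega R -> \bar R) X : (forall n, LL1 s (Xn n)) -> LL1 t X ->
  qs_nonincreasing_cvg sl sb Xn X <-> qs_dec sl sb (fun n => rv (Xn n)) (rv X).
Proof.
move=> h /LL1_rv[mX Lx Xx _].
have Xxn : qs (fun w => forall n, Xn n w = (rv (Xn n) w)%:E) by apply: qs_all => n; have /LL1_rv[] := h n.
split => H; apply: qs_mono (qs_and (qs_and Xx Xxn) H) => w [[xw xnw]] [mono cv].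
  split; last exact/cvg_rv.
  by move=> n; rewrite -lee_fin -!xnw; exact: mono.
split; last exact/cvg_rv.
apply/nonincreasing_seqP => n; rewrite !xnw lee_fin; exact: mono.
Qed.

Lemma qs_inc_rv (s t : \bar R) (Xn : nat -> Omega R -> \bar R) X : (forall n, LL1 s (Xn n)) -> LL1 t X ->
  qs_nondecreasing_cvg sl sb Xn X <-> qs_inc sl sb (fun n => rv (Xn n)) (rv X).
Proof.
move=> h /LL1_rv[mX Lx Xx _].
have Xxn : qs (fun w => forall n, Xn n w = (rv (Xn n) w)%:E) by apply: qs_all => n; have /LL1_rv[] := h n.
split => H; apply: qs_mono (qs_and (qs_and Xx Xxn) H) => w [[xw xnw]] [mono cv].
  split; last exact/cvg_rv.
  by move=> n; rewrite -lee_fin -!xnw; exact: mono.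
split; last exact/cvg_rv.
apply/nondecreasing_seqP => n; rewrite !xnw lee_fin; exact: mono.
Qed.

(** The real-valued form of [LG1], phrased by approximation within e instead of by sequences. *)
Definition lg1 (t : \bar R) x : Prop :=
  L1q x /\ forall e, 0 < e -> exists2 Z, Lip t Z & Nle (fun w => Z w - x w) e.

Lemma lg1_seq (t : \bar R) x : lg1 t x -> exists2 Z, (forall n, Lip t (Z n)) & ncvg Z x.
Proof.
move=> [_ h]; have h0 (n : nat) : 0 < n.+1%:R^-1 :> R by rewrite invr_gt0.
have /choice[Z ZP] : forall n : nat, exists Z, Lip t Z /\ Nle (fun w => Z w - x w) n.+1%:R^-1.
  by move=> n; have [Z ? ?] := h _ (h0 n); exists Z.
exists Z => [n|e e0]; first by have [] := ZP n.
exists (Num.truncn e^-1).+1 => n nn; apply: (@Nle_le _ _ _ _ n.+1%:R^-1); last by have [] := ZP n.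
rewrite -[e]invrK lef_pV2 ?posrE ?invr_gt0//; apply: (le_trans (ltW (truncnS_gt _))).
by rewrite ler_nat (leq_trans nn).
Qed.

Lemma ncvg_lg1 (t : \bar R) x Z : L1q x -> (forall n, Lip t (Z n)) -> ncvg Z x -> lg1 t x.
Proof. by move=> Lx LZ h; split => // e /h[n /(_ n (leqnn n)) hn]; exists (Z n). Qed.

Lemma ncvg_Cauchy (xn : nat -> Omega R -> R) x : (forall n, L1q (xn n)) -> L1q x -> ncvg xn x ->
  forall e, 0 < e -> exists n0, forall n m, (n0 <= n)%N -> (n0 <= m)%N -> Nle (fun w => xn n w - xn m w) e.
Proof.
move=> Ln Lx h e e0; have [n0 hn0] := h (e / 2) (ltac:(lra) : 0 < e / 2).
exists n0 => n m nn mn; have -> : e = e / 2 + e / 2 by lra.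
have Ln' k : L1q (fun w => xn k w - x w) by exact: L1q_sub.
have [mx _] := Ln' n; have [my _] := Ln' m.
have [mxn _] := Ln n; have [mym _] := Ln m.
apply: (Nle_dom _ _ _ (Nle_add mx my (hn0 n nn) (hn0 m mn))).
- exact: measurable_funB.
- by apply: measurable_funD; exact: measurableT_comp.
- apply: qsT => w; rewrite (_ : xn n w - xn m w = (xn n w - x w) - (xn m w - x w)); last by ring.
  exact: ler_normB.
Qed.

Lemma Nle0_eq x y : L1q x -> L1q y -> (forall e, 0 < e -> Nle (fun w => x w - y w) e) ->
  qs (fun w => x w = y w).
Proof.
move=> Lx Ly h.
have le a b : L1q a -> L1q b -> (forall e, 0 < e -> Nle (fun w => a w - b w) e) -> qs (fun w => a w <= b w).
  move=> La Lb hab; have Ld : L1q (fun w => a w - b w) by exact: L1q_sub.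
  have L0 : L1q (fun=> 0) by apply: bdmeas_L1q; exact: bdmeas_cst.
  have Lm : L1q (fun w => Num.max (a w - b w) 0) by exact: L1q_max.
  apply: qs_le_pos => // P PP; apply/ler_addgt0Pr => e e0; rewrite add0r.
  apply: le_trans (Nle_abs Ld (hab e e0) PP).
  apply: (Ex_le_qs Lm (L1q_abs Ld) _ PP); apply: qsT => w.
  by rewrite ge_max normr_ge0 ler_norm.
have h' e : 0 < e -> Nle (fun w => y w - x w) e.
  by move=> e0; have := h e e0 => H P PP; under eq_integral do rewrite distrC; exact: H.
by apply: qs_mono (qs_and (le _ _ Lx Ly h) (le _ _ Ly Lx h')) => w [? ?]; apply/eqP; rewrite eq_le; apply/andP.
Qed.

Lemma ncvg_unique (xn : nat -> Omega R -> R) x y : (forall n, L1q (xn n)) -> L1q x -> L1q y ->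
  ncvg xn x -> ncvg xn y -> qs (fun w => x w = y w).
Proof.
move=> Ln Lx Ly cx cy; apply: Nle0_eq => // e e0.
have [n1 h1] := cx (e / 2) (ltac:(lra) : 0 < e / 2).
have [n2 h2] := cy (e / 2) (ltac:(lra) : 0 < e / 2).
pose n := maxn n1 n2; have -> : e = e / 2 + e / 2 by lra.
have [mx _] : L1q (fun w => xn n w - x w) by exact: L1q_sub.
have [my _] : L1q (fun w => xn n w - y w) by exact: L1q_sub.
have [mx' _] := Lx; have [my' _] := Ly.
apply: (Nle_dom _ _ _ (Nle_add mx my (h1 n (leq_maxl _ _)) (h2 n (leq_maxr _ _)))).
- exact: measurable_funB.
- by apply: measurable_funD; exact: measurableT_comp.
- apply: qsT => w; rewrite (_ : x w - y w = (xn n w - y w) - (xn n w - x w)); last by ring.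
  by rewrite [leRHS]addrC; exact: ler_normB.
Qed.

Lemma lg1_adapted (t : \bar R) x : lg1 t x -> adaptedq t x.
Proof.
move=> lx; have [Lx _] := lx; have [Z LZ cZ] := lg1_seq lx.
have LZ1 n : L1q (Z n) by exact: Lip_L1q (LZ n).
have aZ n : adaptedq t (Z n).
  case: t LZ {lx} => [t| |] LZ; [exact: adaptedq_Lip|exact: adaptedq_oo (measurable_Lip (LZ n))|].
  by have [[|s ts] [phi []]] := LZ n => //= _ /andP[/andP[_]]; rewrite leeNy_eq.
have [y [Ly ay cy]] := Cauchy_ncvg LZ1 aZ (ncvg_Cauchy LZ1 Lx cZ).
exact: adaptedq_eq (ncvg_unique LZ1 Lx Ly cZ cy) ay.
Qed.

Lemma lg1_eq (t : \bar R) x y : L1q y -> qs (fun w => x w = y w) -> lg1 t x -> lg1 t y.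
Proof.
move=> Ly xy [Lx h]; split => // e e0; have [Z LZ Zx] := h e e0; exists Z => //.
have LZ1 := Lip_L1q LZ.
have [mx _] : L1q (fun w => Z w - x w) by exact: L1q_sub.
have [my _] : L1q (fun w => Z w - y w) by exact: L1q_sub.
apply: (@Nle_dom _ _ _ _ _ (fun w => `|Z w - x w|)) => //; first exact: measurableT_comp.
  by apply: qs_mono xy => w ->.
by move=> P PP; under eq_integral do rewrite normr_id; exact: Zx.
Qed.

Lemma Lip_lg1 (t : \bar R) Z : Lip t Z -> lg1 t Z.
Proof.
move=> LZ; split => [|e e0]; first exact: Lip_L1q LZ.
exists Z => //; apply: Nle_le (ltW e0) _; apply: Nle_bdmeas; first by move=> w; rewrite subrr normr0.
by apply: measurable_funB; exact: measurable_Lip LZ.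
Qed.

Lemma lg1_le (s t : \bar R) x : (s <= t)%E -> lg1 s x -> lg1 t x.
Proof. by move=> st [Lx h]; split => // e /h[Z LZ Zx]; exists Z => //; exact: Lip_le LZ. Qed.

Lemma lg1_opp (t : \bar R) x : (0 <= t)%E -> lg1 t x -> lg1 t (fun w => - x w).
Proof.
move=> t0 [Lx h].
have Lx' : L1q (fun w => - x w).
  apply: (L1q_dom _ (L1q_abs Lx)); first by apply: measurableT_comp => //; case: Lx.
  by apply: qsT => w; rewrite normrN.
split => // e /h[Z LZ Zx]; exists (fun w => - Z w); first exact: Lip_opp.
move=> P PP; under eq_integral do rewrite -opprD normrN; exact: Zx.
Qed.

Lemma lg1_max (t : \bar R) x y : (0 <= t)%E -> lg1 t x -> lg1 t y -> lg1 t (fun w => Num.max (x w) (y w)).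
Proof.
move=> t0 [Lx hx] [Ly hy]; have Lm : L1q (fun w => Num.max (x w) (y w)) by exact: L1q_max.
split => // e e0; have e2 : 0 < e / 2 by lra.
have [Z LZ Zx] := hx _ e2; have [W LW Wy] := hy _ e2.
exists (fun w => Num.max (Z w) (W w)); first exact: Lip_max.
have LZ1 := Lip_L1q LZ; have LW1 := Lip_L1q LW.
have [mx _] : L1q (fun w => Z w - x w) by exact: L1q_sub.
have [my _] : L1q (fun w => W w - y w) by exact: L1q_sub.
have LZW : L1q (fun w => Num.max (Z w) (W w)) by exact: L1q_max.
have [mm _] : L1q (fun w => Num.max (Z w) (W w) - Num.max (x w) (y w)) by exact: L1q_sub.
have -> : e = e / 2 + e / 2 by lra.
apply: (Nle_dom mm _ _ (Nle_add mx my Zx Wy)); first by apply: measurable_funD; exact: measurableT_comp.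
apply: qsT => w; rewrite ler_norml.
have := ler_norm (Z w - x w); have := ler_norm (- (Z w - x w)).
have := ler_norm (W w - y w); have := ler_norm (- (W w - y w)); rewrite !normrN => *.
have := normr_ge0 (Z w - x w); have := normr_ge0 (W w - y w) => *.
by case: (leP (Z w) (W w)) => ?; case: (leP (x w) (y w)) => ?; apply/andP; split; lra.
Qed.

(** The property that makes an adapted variable its own conditional G-expectation ([CE_id]). It
    holds on [lg1] by density and passes to monotone limits. *)
Definition agr t x : Prop := forall P Q xi, Pset P -> agree t P Q -> Lip t%:E xi ->
  Ex Q (fun w => x w * xi w) = Ex P (fun w => x w * xi w).

Lemma lg1_agr t x : 0 <= t -> lg1 t%:E x -> agr t x.
Proof.
move=> t0 [Lx h] P Q xi PP PQ Lxi; have [M M0 xiM] := Lip_bounded Lxi.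
have M1 : 0 < M + 1 by lra.
apply/eqP; rewrite -subr_eq0 -normr_le0; apply/ler_addgt0Pr => e e0; rewrite add0r.
have d0 : 0 < e / (2 * (M + 1)) by rewrite divr_gt0// mulr_gt0.
have [Z LZ Zx] := h _ d0; have LZ1 : L1q Z by exact: Lip_L1q LZ.
have hP := Nle_Ex LZ1 Lx Zx Lxi M0 xiM PP.
have hQ := Nle_Ex LZ1 Lx Zx Lxi M0 xiM PQ.1.
have Me : M * (e / (2 * (M + 1))) <= e / 2.
  by rewrite mulrA ler_pdivrMr ?mulr_gt0//; have := mulr_ge0 M0 (ltW e0); lra.
have E : Ex Q (fun w => Z w * xi w) = Ex P (fun w => Z w * xi w).
  by apply: PQ.2; apply: Lip_mul; rewrite ?lee_fin.
move: (hP bnd) (hQ bnd); rewrite E !ler_norml => /andP[? ?] /andP[? ?]; apply/andP; split; lra.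
Qed.

Lemma agr_cvg t (xn : nat -> Omega R -> R) x : (forall n, L1q (xn n)) -> L1q x ->
  qs_dec sl sb xn x \/ qs_inc sl sb xn x -> (forall n, agr t (xn n)) -> agr t x.
Proof.
move=> Ln Lx mono a P Q xi PP PQ Lxi.
have h := Ex_mono_cvg Ln Lx mono Lxi PQ.1; have h' := Ex_mono_cvg Ln Lx mono Lxi PP.
apply: (cvg_unique _ (h bnd)) => //=; rewrite (_ : (fun n => _) = fun n => Ex P (fun w => xn n w * xi w)); first exact: h'.
by apply/funext => n; apply: a.
Qed.

Lemma CE_id t x : L1q x -> adaptedq t%:E x -> agr t x -> CE sl sb t x x.
Proof.
move=> Lx ax a; split => //.
  by move=> P Q xi PP PQ Lxi _; rewrite (a P Q).
by move=> P xi e PP Lxi _ e0; exists P; rewrite ?lerDl ?ltW//; exact: agree_refl.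
Qed.

End levels.

Arguments lg1 {R} sl sb t x.
Arguments agr {R} sl sb t x.

(** * Soundness and existence of the conditional G-expectation on each space *)

Section existence.
Context {R : realType} {sl sb : R} {bnd : volatility_bounds sl sb}.
Implicit Types (x y z xi : Omega R -> R) (X Y : Omega R -> \bar R) (t c e : R) (P Q : probability (Omega R) R).

Local Notation qs := (qs sl sb).
Local Notation L1q := (L1q sl sb).
Local Notation Nle := (Nle sl sb).
Local Notation ncvg := (ncvg sl sb).
Local Notation adaptedq := (adaptedq sl sb).
Local Notation LL1 := (LL1 sl sb).
Local Notation LG1 := (LG1 sl sb).
Local Notation CE := (CE sl sb).
Local Notation lg1 := (lg1 sl sb).

Let sl_ge0 : 0 <= sl. Proof. exact: volatility_ge0. Qed.
Let sl_le_sb : sl <= sb. Proof. exact: volatility_le. Qed.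

Lemma lg1_CE_id t x : 0 <= t -> lg1 t%:E x -> CE t x x.
Proof.
move=> t0 lx; apply: CE_id; [by case: lx|exact: lg1_adapted|exact: lg1_agr].
Qed.

Lemma CE_cst t c : 0 <= t -> CE t (fun=> c) (fun=> c).
Proof. by move=> t0; apply: lg1_CE_id => //; apply: Lip_lg1; apply: Lip_cst; rewrite lee_fin. Qed.

Lemma CE_Nle t x y c : 0 <= t -> CE t x y -> Nle x c -> Nle y (2 * c).
Proof.
move=> t0 C xc; have h : Nle (fun w => x w - 0) c by move=> P PP; under eq_integral do rewrite subr0; exact: xc.
have := CE_contraction t0 C (CE_cst 0 t0) h => H P PP.
by have := H bnd P PP; under eq_integral do rewrite subr0.
Qed.

Lemma CE_unique t x y y' : 0 <= t -> CE t x y -> CE t x y' -> qs (fun w => y w = y' w).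
Proof.
move=> t0 C C'; have xx : qs (fun w => x w <= x w) by exact: qsT.
apply: qs_mono (qs_and (CE_mono t0 C C' xx) (CE_mono t0 C' C xx)) => w [? ?].
by apply/eqP; rewrite eq_le; apply/andP.
Qed.

Lemma CE_ncvg_limit t (xn yn : nat -> Omega R -> R) x : 0 <= t -> (forall n, CE t (xn n) (yn n)) ->
  L1q x -> ncvg xn x -> exists y, [/\ L1q y, adaptedq t%:E y & ncvg yn y].
Proof.
move=> t0 C Lx cx; have Lxn n : L1q (xn n) by have [] := C n.
apply: Cauchy_ncvg; [by move=> n; have [] := C n|by move=> n; have [] := C n|].
move=> e e0; have [n0 hn0] := ncvg_Cauchy Lxn Lx cx (ltac:(lra) : 0 < e / 2).
exists n0 => n m nn mn; have -> : e = 2 * (e / 2) by lra.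
exact: (CE_contraction t0 (C n) (C m) (hn0 n m nn mn)).
Qed.

Lemma CE_inc_limit t (xn yn : nat -> Omega R -> R) x : 0 <= t -> (forall n, CE t (xn n) (yn n)) ->
  L1q x -> qs_inc sl sb xn x -> exists y, [/\ L1q y, adaptedq t%:E y & qs_inc sl sb yn y].
Proof.
move=> t0 C Lx ix; have Lxn n : L1q (xn n) by have [] := C n.
have Lyn n : L1q (yn n) by have [] := C n.
have [mg [c gc]] := L1q_addabs (Lxn 0%N) Lx.
have xc n : Nle (xn n) c.
  apply: (Nle_dom _ mg _ gc); first by case: (Lxn n).
  apply: qs_mono (qs_inc_le ix) => w h; have /andP[] := h 0%N n (leq0n n).
  have := ler_norm (x w); have := ler_norm (xn 0%N w); have := ler_norm (- x w); have := ler_norm (- xn 0%N w).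
  by rewrite !normrN ler_norml => *; apply/andP; split; lra.
have yc n : Nle (yn n) (2 * c) by exact: (CE_Nle t0 (C n)).
have yi : qs (fun w => forall n, yn n w <= yn n.+1 w).
  by apply: qs_all => n; apply: (CE_mono t0 (C n) (C n.+1)); apply: qs_mono ix => w [].
have [Ly cy] := bounded_mono_cvg (fun n => (Lyn n).1) yc yi.
exists (fun w => limr (yn^~ w)); split => //; last exact: qs_and yi cy.
by apply: adaptedq_lim cy => n; have [] := C n.
Qed.

Lemma CE_dec_limit t (xn yn : nat -> Omega R -> R) x : 0 <= t -> (forall n, CE t (xn n) (yn n)) ->
  L1q x -> qs_dec sl sb xn x -> exists y, [/\ L1q y, adaptedq t%:E y & qs_dec sl sb yn y].
Proof.
move=> t0 C Lx ix; have Lxn n : L1q (xn n) by have [] := C n.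
have Lyn n : L1q (yn n) by have [] := C n.
have [mg [c gc]] := L1q_addabs (Lxn 0%N) Lx.
have xc n : Nle (xn n) c.
  apply: (Nle_dom _ mg _ gc); first by case: (Lxn n).
  apply: qs_mono (qs_dec_le ix) => w h; have /andP[] := h 0%N n (leq0n n).
  have := ler_norm (x w); have := ler_norm (xn 0%N w); have := ler_norm (- x w); have := ler_norm (- xn 0%N w).
  by rewrite !normrN ler_norml => *; apply/andP; split; lra.
have yc n : Nle (fun w => - yn n w) (2 * c).
  by move=> P PP; under eq_integral do rewrite normrN; exact: (CE_Nle t0 (C n)).
have yi : qs (fun w => forall n, yn n.+1 w <= yn n w).
  by apply: qs_all => n; apply: (CE_mono t0 (C n.+1) (C n)); apply: qs_mono ix => w [].
have yi' : qs (fun w => forall n, - yn n w <= - yn n.+1 w).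
  by apply: qs_mono yi => w h n; rewrite lerN2.
have my n : measurable_fun setT (fun w => - yn n w) by apply: measurableT_comp => //; case: (Lyn n).
have [Ly cy] := bounded_mono_cvg my yc yi'.
have cy' : qs (fun w => yn n w @[n --> \oo] --> - limr (fun n => - yn n w)).
  by apply: qs_mono cy => w h; under eq_fun do rewrite -[yn _ w]opprK; exact: cvgN.
exists (fun w => - limr (fun n => - yn n w)); split; last exact: qs_and yi cy'.
  apply: (L1q_dom _ (L1q_abs Ly)); last by apply: qsT => w; rewrite normrN.
  by apply: measurableT_comp => //; case: Ly.
by apply: adaptedq_lim cy' => n; have [] := C n.
Qed.

Lemma LG1_rv (t : \bar R) X : LG1 t X -> [/\ LL1 t X, measurable_fun setT X, qs (fun w => X w = (rv X w)%:E) & lg1 t (rv X)].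
Proof.
move=> [LX [Xn LXn cX]]; have [mX Lx Xx ax] := LL1_rv LX; split => //.
have Ln n : L1q (Xn n) by exact: Lip_L1q (LXn n).
exact: ncvg_lg1 Lx LXn ((norm_cvg_EFin Ln LX).1 cX).
Qed.

Lemma LG1_intro (t : \bar R) X x : measurable_fun setT X -> qs (fun w => X w = (x w)%:E) -> lg1 t x -> LG1 t X.
Proof.
move=> mX Xx lx; have LX : LL1 t X by exact: LL1_intro mX Xx lx.1 (lg1_adapted lx).
have [_ Lrx Xrx _] := LL1_rv LX.
have lrx : lg1 t (rv X) by apply: lg1_eq Lrx _ lx; apply: qs_mono Xx => w h; rewrite /rv h.
have [Z LZ cZ] := lg1_seq lrx.
split => //; exists Z => //; apply/(norm_cvg_EFin _ LX) => // n; exact: Lip_L1q (LZ n).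
Qed.

Lemma EFin_LG1 (t : \bar R) x : lg1 t x -> LG1 t (EFin \o x).
Proof.
by move=> lx; apply: (LG1_intro _ _ lx); [apply/measurable_EFinP; case: lx.1|exact: qsT].
Qed.

(** The property [qcont] is kept along because the next level, decreasing limits, uses it in
    [CE_dec]. *)
Lemma condE_LG1_sound t X Y : condE_LG1 sl sb t X Y ->
  [/\ 0 <= t, LL1 +oo%E X, LL1 t%:E Y, qcont sl sb (rv X) & CE t (rv X) (rv Y)].
Proof.
move=> [LX LY [Xn [Yn [h cX cY]]]].
have h' n := condE_LipP sl_ge0 sl_le_sb (h n).
have t0 : 0 <= t by have [] := h' 0%N.
have [_ Lx _ _] := LL1_rv LX; have [_ Ly _ ay] := LL1_rv LY.
have C n : CE t (Xn n) (Yn n) by have [_ LXn ->] := h' n; exact: CE_Lip.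
have cx : ncvg Xn (rv X) by apply/(norm_cvg_EFin _ LX) => // n; have [] := C n.
have cy : ncvg Yn (rv Y) by apply/(norm_cvg_EFin _ LY) => // n; have [] := C n.
split => //; last exact: (CE_norm C).
move=> e e0; have [n /(_ n (leqnn n)) hn] := cx e e0.
by exists (Xn n) => //; have [] := h' n.
Qed.

Lemma condE_LG1_ex t X : 0 <= t -> LG1 +oo%E X -> exists2 Y, condE_LG1 sl sb t X Y & LG1 t%:E Y.
Proof.
move=> t0 [LX [Z LZ cZ]]; have [_ Lx _ _] := LL1_rv LX.
have C n : CE t (Z n) (cE sl sb t (Z n)) by exact: CE_Lip.
have cz : ncvg Z (rv X) by apply/(norm_cvg_EFin _ LX) => // n; have [] := C n.
have [y [Ly ay cy]] := CE_ncvg_limit t0 C Lx cz.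
have LY : LL1 t%:E (EFin \o y) by exact: EFin_LL1.
have cY : norm_cvg sl sb (fun n => EFin \o cE sl sb t (Z n)) (EFin \o y).
  by apply/(norm_cvg_EFin _ LY) => // n; have [] := C n.
exists (EFin \o y).
  split => //; exists Z, (fun n => cE sl sb t (Z n)); split => // n.
  exact: condE_Lip_cE.
by split => //; exists (fun n => cE sl sb t (Z n)) => // n; exact: cE_Lip.
Qed.

Lemma condE_LG1_s_sound t X Y : condE_LG1_s sl sb t X Y ->
  [/\ 0 <= t, LL1 +oo%E X, LL1 t%:E Y & CE t (rv X) (rv Y)].
Proof.
move=> [LX LY [Xn [Yn [h cX cY]]]]; have h' n := condE_LG1_sound (h n).
have hX n : LL1 +oo%E (Xn n) by have [_ ? _ _ _] := h' n.
have hY n : LL1 t%:E (Yn n) by have [_ _ ? _ _] := h' n.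
have [_ Lx _ _] := LL1_rv LX; have [_ Ly _ ay] := LL1_rv LY.
have t0 : 0 <= t by have [] := h' 0%N.
split => //; apply: (@CE_dec _ _ _ _ t (fun n => rv (Xn n)) (fun n => rv (Yn n))) => //.
- by move=> n; have [] := h' n.
- by move=> n; have [] := h' n.
- exact/(qs_dec_rv hX LX).
- exact/(qs_dec_rv hY LY).
Qed.

Lemma condE_LG1_s_ex t X : 0 <= t -> LG1_s sl sb +oo%E X -> exists Y, condE_LG1_s sl sb t X Y.
Proof.
move=> t0 [LX [Xn LXn cX]]; have [_ Lx _ _] := LL1_rv LX.
have /choice[Yn YnP] n : exists Y, condE_LG1 sl sb t (Xn n) Y.
  by have [Y ? _] := condE_LG1_ex t0 (LXn n); exists Y.
have h n := condE_LG1_sound (YnP n).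
have hX n : LL1 +oo%E (Xn n) by have [_ ? _ _ _] := h n.
have hY n : LL1 t%:E (Yn n) by have [_ _ ? _ _] := h n.
have [] := @CE_dec_limit t (fun n => rv (Xn n)) (fun n => rv (Yn n)) (rv X) => //.
- by move=> n; have [] := h n.
- exact/(qs_dec_rv hX LX).
move=> y [Ly ay cy]; have LY : LL1 t%:E (EFin \o y) by exact: EFin_LL1.
exists (EFin \o y); split => //; exists Xn, Yn; split => //.
exact/(qs_dec_rv hY LY).
Qed.

Lemma condE_LG1_ss_sound t X Y : condE_LG1_ss sl sb t X Y ->
  [/\ 0 <= t, LL1 +oo%E X, LL1 t%:E Y & CE t (rv X) (rv Y)].
Proof.
move=> [LX LY [Xn [Yn [h cX cY]]]]; have h' n := condE_LG1_s_sound (h n).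
have hX n : LL1 +oo%E (Xn n) by have [_ ? _ _] := h' n.
have hY n : LL1 t%:E (Yn n) by have [_ _ ? _] := h' n.
have [_ Lx _ _] := LL1_rv LX; have [_ Ly _ ay] := LL1_rv LY.
have t0 : 0 <= t by have [] := h' 0%N.
split => //; apply: (@CE_inc _ _ _ _ t (fun n => rv (Xn n)) (fun n => rv (Yn n))) => //.
- by move=> n; have [] := h' n.
- exact/(qs_inc_rv hX LX).
- exact/(qs_inc_rv hY LY).
Qed.

Lemma condE_LG1_ss_ex t X : 0 <= t -> LG1_ss sl sb +oo%E X -> exists Y, condE_LG1_ss sl sb t X Y.
Proof.
move=> t0 [LX [Xn LXn cX]]; have [_ Lx _ _] := LL1_rv LX.
have /choice[Yn YnP] n := condE_LG1_s_ex t0 (LXn n).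
have h n := condE_LG1_s_sound (YnP n).
have hX n : LL1 +oo%E (Xn n) by have [_ ? _ _] := h n.
have hY n : LL1 t%:E (Yn n) by have [_ _ ? _] := h n.
have [] := @CE_inc_limit t (fun n => rv (Xn n)) (fun n => rv (Yn n)) (rv X) => //.
- by move=> n; have [] := h n.
- exact/(qs_inc_rv hX LX).
move=> y [Ly ay cy]; have LY : LL1 t%:E (EFin \o y) by exact: EFin_LL1.
exists (EFin \o y); split => //; exists Xn, Yn; split => //.
exact/(qs_inc_rv hY LY).
Qed.

Lemma condE_LG1_ss_bar_sound t X Y : condE_LG1_ss_bar sl sb t X Y ->
  LL1 t%:E Y /\ CE t (rv X) (rv Y).
Proof.
move=> [LX LY [Xn [Yn [h cX cY]]]]; have h' n := condE_LG1_ss_sound (h n).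
have hX n : LL1 +oo%E (Xn n) by have [_ ? _ _] := h' n.
have hY n : LL1 t%:E (Yn n) by have [_ _ ? _] := h' n.
have [_ Lx _ _] := LL1_rv LX; have [_ Ly _ ay] := LL1_rv LY.
split => //; apply: (@CE_norm _ _ _ _ t (fun n => rv (Xn n)) (fun n => rv (Yn n))) => //.
- by move=> n; have [] := h' n.
- exact/(norm_cvg_rv hX LX).
- exact/(norm_cvg_rv hY LY).
Qed.

Lemma condE_LG1_ss_bar_ex t X : 0 <= t -> LG1_ss_bar sl sb +oo%E X -> exists Y, condE_LG1_ss_bar sl sb t X Y.
Proof.
move=> t0 [LX [Xn LXn cX]]; have [_ Lx _ _] := LL1_rv LX.
have /choice[Yn YnP] n := condE_LG1_ss_ex t0 (LXn n).
have h n := condE_LG1_ss_sound (YnP n).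
have hX n : LL1 +oo%E (Xn n) by have [_ ? _ _] := h n.
have hY n : LL1 t%:E (Yn n) by have [_ _ ? _] := h n.
have [] := @CE_ncvg_limit t (fun n => rv (Xn n)) (fun n => rv (Yn n)) (rv X) => //.
- by move=> n; have [] := h n.
- exact/(norm_cvg_rv hX LX).
move=> y [Ly ay cy]; have LY : LL1 t%:E (EFin \o y) by exact: EFin_LL1.
exists (EFin \o y); split => //; exists Xn, Yn; split => //.
exact/(norm_cvg_rv hY LY).
Qed.

(** [condE] is an arbitrary choice: existence ensures that the chosen value satisfies the defining
    relation, and soundness turns this into [CE]. *)
Lemma condE_CE t X : 0 <= t -> LG1_ss_bar sl sb +oo%E X ->
  LL1 t%:E (condE sl sb t X) /\ CE t (rv X) (rv (condE sl sb t X)).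
Proof.
move=> t0 /(condE_LG1_ss_bar_ex t0)[Y hY]; apply: condE_LG1_ss_bar_sound.
exact: (xgetI (fun=> 0%E) hY).
Qed.

Lemma ncvg_cst x : L1q x -> ncvg (fun=> x) x.
Proof.
move=> Lx e e0; exists 0%N => n _; apply: Nle_le (ltW e0) _; apply: Nle_bdmeas.
  by move=> w; rewrite subrr normr0.
by apply: measurable_funB; case: Lx.
Qed.

Lemma LG1_LG1_s (t : \bar R) X : LG1 t X -> LG1_s sl sb t X.
Proof.
move=> LX; split; first by case: LX.
by exists (fun=> X) => //; apply: qsT => w; split; [by apply/nonincreasing_seqP|exact: cvg_cst].
Qed.

Lemma LG1_s_LG1_ss (t : \bar R) X : LG1_s sl sb t X -> LG1_ss sl sb t X.
Proof.
move=> LX; split; first by case: LX.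
by exists (fun=> X) => //; apply: qsT => w; split; [by apply/nondecreasing_seqP|exact: cvg_cst].
Qed.

Lemma LG1_ss_LG1_ss_bar (t : \bar R) X : LG1_ss sl sb t X -> LG1_ss_bar sl sb t X.
Proof.
move=> LX; have LX1 : LL1 t X by case: LX.
split=> //; exists (fun=> X) => //; apply/(norm_cvg_rv (fun=> LX1) LX1).
by apply: ncvg_cst; have [] := LL1_rv LX1.
Qed.

Lemma LG1_le (s t : \bar R) X : (0 <= s)%E -> (s <= t)%E -> LG1 s X -> LG1 t X.
Proof.
by move=> s0 st [LX [Z LZ cZ]]; split; [exact: LL1_le LX|exists Z => // n; exact: Lip_le (LZ n)].
Qed.

Lemma LG1_s_le (s t : \bar R) X : (0 <= s)%E -> (s <= t)%E -> LG1_s sl sb s X -> LG1_s sl sb t X.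
Proof.
by move=> s0 st [LX [Z LZ cZ]]; split; [exact: LL1_le LX|exists Z => // n; exact: LG1_le (LZ n)].
Qed.

Lemma LG1_ss_le (s t : \bar R) X : (0 <= s)%E -> (s <= t)%E -> LG1_ss sl sb s X -> LG1_ss sl sb t X.
Proof.
by move=> s0 st [LX [Z LZ cZ]]; split; [exact: LL1_le LX|exists Z => // n; exact: LG1_s_le (LZ n)].
Qed.

Lemma LG1_ss_bar_le (s t : \bar R) X : (0 <= s)%E -> (s <= t)%E ->
  LG1_ss_bar sl sb s X -> LG1_ss_bar sl sb t X.
Proof.
by move=> s0 st [LX [Z LZ cZ]]; split; [exact: LL1_le LX|exists Z => // n; exact: LG1_ss_le (LZ n)].
Qed.

(** The choice in [condE] is made on the largest space, where membership of the value in [lg1] is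
    not visible; it is inherited, by uniqueness, from the value constructed on [LG1]. *)
Lemma condE_LG1_CE t X : 0 <= t -> LG1 +oo%E X ->
  [/\ LL1 t%:E (condE sl sb t X), lg1 t%:E (rv (condE sl sb t X)) & CE t (rv X) (rv (condE sl sb t X))].
Proof.
move=> t0 LX; have Lb := LG1_ss_LG1_ss_bar (LG1_s_LG1_ss (LG1_LG1_s LX)).
have [LY C] := condE_CE t0 Lb; split => //.
have [Y /condE_LG1_sound[_ _ _ _ C'] /LG1_rv[_ _ _ lY]] := condE_LG1_ex t0 LX.
by apply: lg1_eq (CE_unique t0 C' C) lY; have [] := LL1_rv LY.
Qed.

End existence.

(** * The Snell envelopes along the dyadic grids *)

Section SG_space.
Context {R : realType} {sl sb : R} {bnd : volatility_bounds sl sb}.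
Implicit Types (x y z xi : Omega R -> R) (t c e : R) (P Q : probability (Omega R) R).

Local Notation qs := (qs sl sb).
Local Notation L1q := (L1q sl sb).
Local Notation Nle := (Nle sl sb).
Local Notation Pset := (Pset sl sb).
Local Notation lg1 := (lg1 sl sb).

Lemma SG0_Lip (T : R) (eta : R -> Omega R -> R) t : 0 <= t <= T -> SG0 T eta -> Lip t%:E (eta t).
Proof.
move=> tT [ts [h [tsT [[M hM] [L hL]] etaE]]]; have /andP[t0 _] := tT.
(* The leading [t] makes the list nonempty and keeps the sizes right; the coordinate B_t itself is
   discarded, and the time [t] takes its place as first argument of [h]. *)
exists (t :: [seq Num.min s t | s <- ts]), (fun xs => h (t :: behead xs)); split => //.
- rewrite /= t0 lee_fin lexx /=; apply/allP => _ /mapP[s sts ->].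
  have /andP[s0 _] := allP tsT s sts.
  by rewrite le_min s0 t0 lee_fin ge_min lexx orbT.
- rewrite /= size_map; split.
    by exists M => x sx; apply: hM; rewrite /= size_behead sx.
  exists `|L| => x y sx sy.
  have sx' : size (t :: behead x) = (size ts).+1 by rewrite /= size_behead sx.
  have sy' : size (t :: behead y) = (size ts).+1 by rewrite /= size_behead sy.
  apply: (le_trans (hL _ _ sx' sy')).
  apply: (le_trans (ler_wpM2r (sumr_ge0 _ (fun _ _ => normr_ge0 _)) (ler_norm L))).
  apply: ler_wpM2l => //.
  rewrite !big_ord_recl /= subrr normr0; apply: lerD => //; apply: ler_sum => i _.
  by rewrite !nth_behead.
- by apply/funext => w; rewrite etaE//= -map_comp.
Qed.

Lemma SG0_bounded (T : R) (eta : R -> Omega R -> R) : SG0 T eta ->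
  exists M, forall t w, 0 <= t <= T -> `|eta t w| <= M.
Proof.
move=> [ts [h [_ [[M hM] _] etaE]]]; exists M => t w tT; rewrite etaE//; apply: hM.
by rewrite /= size_map.
Qed.

(** Where z > d, write z = z^{1-b} z^b with z^{1-b} at most d^{1-b}. This turns a bound on the
    moment of order b into a bound in norm. *)
Lemma powR_bound (b d z : R) : 1 < b -> 0 < d -> 0 <= z -> z <= d + d `^ (1 - b) * z `^ b.
Proof.
move=> b1 d0 z0; have [zd|dz] := leP z d; first by apply: (le_trans zd); rewrite lerDl mulr_ge0// powR_ge0.
have z0' : 0 < z by exact: lt_trans dz.
apply: (@le_trans _ _ (d `^ (1 - b) * z `^ b)); last by rewrite lerDr ltW.
have -> : z `^ b = z `^ (b - 1) * z by rewrite -[X in _ * X](powRr1 z0) -powRD ?subrK// (gt_eqF z0') implybT.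
rewrite mulrA ler_peMl// (_ : 1 - b = - (b - 1)); last by ring.
rewrite powRN mulrC ler_pdivlMr ?powR_gt0// mul1r.
by apply: ge0_ler_powR; rewrite ?nnegrE ?subr_ge0 ?ltW.
Qed.

(** A near-optimal Borel majorant [Z] of the supremum satisfies GE(Z^b) < d^b with d = e/2. By
    [powR_bound] it lies below h = d + d^{1-b} Z^b, whose norm is at most 2 d = e. *)
Lemma SG_approx (b : R) (X : R -> Omega R -> R) e : 1 < b -> SG sl sb b 1 X -> 0 < e ->
  exists eta h, [/\ SG0 1 eta, measurable_fun setT h, Nle h e &
    qs (fun w => forall t, 0 <= t <= 1 -> `|eta t w - X t w| <= h w)].
Proof.
move=> b1 [mX [etan eta0 cv]] e0; have b0 : 0 < b by lra.
pose d := e / 2; have d0 : 0 < d by rewrite /d; lra.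
have [n hn] : exists n, (SGnorm sl sb b 1 (fun t w => (etan n t w - X t w)%R) <= (d / 2)%:E)%E.
  have : nbhs (0%E : \bar R) [set y | (y <= (d / 2)%:E)%E].
    rewrite /nbhs /=; apply/nbhs_ballP; exists (d / 2) => /=; first lra.
    move=> r; rewrite /ball /= sub0r normrN lee_fin => /ltW.
    by apply: le_trans; exact: ler_norm.
  by move=> /cv[n _ /(_ n (leqnn n))]; exists n.
move: hn; rewrite /SGnorm; set I := ereal_inf _ => hn.
have I0 : (0 <= I)%E.
  by apply: le_ereal_inf_tmp => _ [Z _ <-]; apply: GE_ge0 => w; exact: poweR_ge0.
have Id : (I < (d `^ b)%:E)%E.
  have : ((I `^ b^-1) `^ b <= ((d / 2)%:E) `^ b)%E.
    by apply: gt0_ler_poweR => //; rewrite ?in_itv /= ?poweR_ge0 ?leey ?lee_fin; lra.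
  rewrite -poweRrM mulVf ?gt_eqF// poweRe1// => h; apply: (le_lt_trans h).
  by rewrite poweR_EFin lte_fin gt0_ltr_powR ?nnegrE; lra.
have /ereal_inf_lt[_ [Z [mZ hZ] <-] Zd] := Id.
pose h w := d + d `^ (1 - b) * fine (Z w `^ b)%E.
have mW : measurable_fun setT (fun w => Z w `^ b)%E by apply: (measurableT_comp (measurable_poweR _)).
have mf : measurable_fun setT (fun w => fine (Z w `^ b)%E) by exact: measurableT_comp.
have Wc P : Pset P -> (\int[P]_w `|Z w `^ b| <= (d `^ b)%:E)%E.
  move=> PP; under eq_integral do rewrite gee0_abs ?poweR_ge0//.
  by apply: le_trans (ltW Zd); apply: ereal_sup_ubound; exists P.
have Nf : Nle (fun w => fine (Z w `^ b)%E) (d `^ b).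
  move=> P PP; apply: le_trans (Wc P PP); apply: ge0_le_integral => //.
  - by apply/measurable_EFinP; exact: measurableT_comp.
  - exact: measurableT_comp.
  - by move=> w _; case: (Z w `^ b)%E => [r| |]//=; rewrite normr0 leey.
have fW : qs (fun w => (Z w `^ b)%E \is a fin_num) by exact: qs_fin_num mW Wc.
exists (etan n), h; split => //.
- by apply: measurable_funD => //; exact: measurable_funM.
- have Ns := Nle_scale mf (powR_ge0 d (1 - b)) Nf.
  have Nd : Nle (fun=> d) d by apply: Nle_bdmeas => // w; rewrite ger0_norm// ltW.
  have md : measurable_fun setT (fun w => d `^ (1 - b) * fine (Z w `^ b)%E) by exact: measurable_funM.
  have -> : e = d + d `^ (1 - b) * d `^ b.
    rewrite -powRD; last by rewrite (gt_eqF d0) implybT.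
    by rewrite subrK powRr1 ?ltW// /d; lra.
  apply: (Nle_dom _ _ _ (Nle_add _ md Nd Ns)) => //.
  + exact: measurable_funD.
  + by apply: measurable_funD; exact: measurableT_comp.
  + by apply: qsT => w; exact: ler_normD.
- apply: qs_mono (qs_and hZ fW) => w [hw fw] t t01.
  have := hw t t01; move: fw; rewrite /h; case: (Z w) => [r| |].
  + rewrite poweR_EFin /= lee_fin => _ le_r; apply: (le_trans le_r).
    by apply: powR_bound => //; apply: le_trans le_r.
  + by rewrite /poweR gt_eqF.
  + by move=> _; rewrite leeNy_eq.
Qed.

Lemma SG_lg1 (b : R) (X : R -> Omega R -> R) t : 1 < b -> SG sl sb b 1 X -> 0 <= t <= 1 -> lg1 t%:E (X t).
Proof.
move=> b1 SX t01; have [mX _] := SX.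
have hX e : 0 < e -> exists2 Z, Lip t%:E Z & Nle (fun w => Z w - X t w) e.
  move=> e0; have [eta [h [eta0 mh hn hh]]] := SG_approx b1 SX e0.
  exists (eta t); first exact: SG0_Lip eta0.
  apply: Nle_dom hn => //; last by apply: qs_mono hh => w; exact.
  by apply: measurable_funB; [exact: measurable_Lip (SG0_Lip t01 eta0)|exact: mX].
split => //; have [Z LZ Zx] := hX 1 ltr01.
have LZ1 : L1q Z by exact: Lip_L1q LZ.
have Ld : L1q (fun w => Z w - X t w).
  by split; [apply: measurable_funB; [case: LZ1|exact: mX]|exists 1].
have -> : X t = fun w => Z w - (Z w - X t w) by apply/funext => w; ring.
exact: L1q_sub.
Qed.

Lemma SG_dominated (b : R) (X : R -> Omega R -> R) : 1 < b -> SG sl sb b 1 X ->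
  exists2 g, L1q g & qs (fun w => forall t, 0 <= t <= 1 -> `|X t w| <= g w).
Proof.
move=> b1 SX; have [eta [h [eta0 mh hn hh]]] := SG_approx b1 SX ltr01.
have [M etaM] := SG0_bounded eta0.
have Lh : L1q h by split => //; exists 1.
have LM : L1q (fun=> M) by apply: bdmeas_L1q; exact: bdmeas_cst.
exists (fun w => M + h w); first exact: L1q_add.
apply: qs_mono hh => w hw t t01; have := hw t t01; have := etaM t w t01.
rewrite -{2}(subKr (eta t w) (X t w)) => h1 h2; apply: (le_trans (ler_normB _ _)).
exact: lerD.
Qed.

End SG_space.

(** * Measurability of pointwise limits *)

Section measurable_limn.
Context {R : realType}.

Lemma limn_einf_esup_cvg (u : nat -> \bar R) : limn_einf u = limn_esup u -> u @ \oo --> limn_esup u.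
Proof.
move=> E; apply: (@squeeze_cvge _ _ _ _ (einfs u) u (esups u)).
- apply: nearW => n; apply/andP; split; first by apply: ereal_inf_lbound; exists n => /=.
  by apply: ereal_sup_ubound; exists n => /=.
- by rewrite -E limn_einf_lim; exact: is_cvg_einfs.
- by rewrite limn_esup_lim; exact: is_cvg_esups.
Qed.

(** [limn] takes the value [point] at divergent sequences, and the limit process has to be Borel
    there too. *)
Lemma limnE (u : nat -> \bar R) :
  limn u = if limn_einf u == limn_esup u then limn_esup u else point.
Proof.
case: eqP => [E|nE]; first by apply/cvg_lim => //; exact: limn_einf_esup_cvg.
apply: dvgP => c; apply: nE; move/cvg_ex : c => [l c].
by have [-> ->] := cvg_limn_einf_sup c.
Qed.

Lemma limn_shift (n : nat) (u : nat -> \bar R) : limn u = limn (fun m => u (n + m)%N).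
Proof.
have E l : (u @ \oo --> l) = ((fun m => u (n + m)%N) @ \oo --> l).
  apply/propext; rewrite -(cvg_shiftn n).
  by rewrite (_ : (fun m => u (n + m)%N) = [sequence u (m + n)%N]_m)//; apply/funext => m; rewrite addnC.
have [c|c] := pselect (cvgn u).
  by apply/esym/cvg_lim => //; rewrite -E.
rewrite (dvgP c) dvgP// => /cvg_ex[l]; rewrite -E => h; apply: c; apply/cvg_ex; by exists l.
Qed.

(** The shift by [n] is there because [V m] is only known to be Borel at a time of level n when m >=
    n. *)
Lemma measurable_limn d (T : measurableType d) (n : nat) (f : nat -> T -> \bar R) :
  (forall m, measurable_fun setT (f (n + m)%N)) -> measurable_fun setT (fun w => limn (f^~ w)).
Proof.
move=> mf; pose h m := f (n + m)%N.
have -> : (fun w => limn (f^~ w)) = fun w =>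
    if limn_einf (h^~ w) == limn_esup (h^~ w) then limn_esup (h^~ w) else point.
  by apply/funext => w; rewrite (limn_shift n) limnE.
have ms : measurable_fun setT (fun w => limn_esup (h^~ w)) by apply: measurable_fun_limn_esup => m; exact: mf.
have mi : measurable_fun setT (fun w => limn_einf (h^~ w)).
  have -> : (fun w => limn_einf (h^~ w)) = (fun w => - limn_esup (fun n => - h n w))%E.
    by apply/funext => w; rewrite -[LHS]oppeK -limn_esupN.
  by apply: measurableT_comp => //; apply: measurable_fun_limn_esup => m; exact: measurableT_comp (mf m).
by apply: measurable_fun_ifT => //; exact: measurable_fun_eqe.
Qed.

End measurable_limn.

Section dyadic_grid.
Context {R : realType}.
Local Notation grid := (@grid R).

Lemma grid_max n : grid n (2 ^ n) = 1.
Proof. by rewrite /grid natrX divff// expf_neq0. Qed.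

Lemma grid_01 n k : (k <= 2 ^ n)%N -> 0 <= grid n k <= 1.
Proof.
move=> kn; rewrite /grid divr_ge0 ?exprn_ge0//=.
by rewrite ler_pdivrMr ?exprn_gt0// mul1r -natrX ler_nat.
Qed.

Lemma grid_le n j k : (j <= k)%N -> grid n j <= grid n k.
Proof. by move=> jk; rewrite /grid ler_wpM2r ?invr_ge0 ?exprn_ge0// ler_nat. Qed.

Lemma grid_refine m n k : grid (n + m) (k * 2 ^ m) = grid n k.
Proof.
by rewrite /grid natrM natrX exprD -mulf_div divff ?mulr1// expf_neq0.
Qed.

Lemma grid_double n k : grid n.+1 (k * 2) = grid n k.
Proof. by rewrite -(grid_refine 1 n k) addn1 expn1. Qed.

End dyadic_grid.

(** * Supermartingale inequalities under all priors *)

Section supermartingale.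
Context {R : realType} {sl sb : R} {bnd : volatility_bounds sl sb}.
Implicit Types (x y z xi a b : Omega R -> R) (s t c e : R) (P Q : probability (Omega R) R).

Local Notation qs := (qs sl sb).
Local Notation L1q := (L1q sl sb).
Local Notation Pset := (Pset sl sb).
Local Notation lg1 := (lg1 sl sb).
Local Notation CE := (CE sl sb).
Local Notation LG1 := (LG1 sl sb).

(* [E^Q[b | F_t] <= a] for every [Q] in [Pset]. *)
Definition supermart t a b : Prop := forall Q xi, Pset Q -> Lip t%:E xi -> (forall w, 0 <= xi w) ->
  Ex Q (fun w => b w * xi w) <= Ex Q (fun w => a w * xi w).

Lemma CE_supermart t x y : CE t x y -> supermart t y x.
Proof. by move=> [_ _ _ I1 _] Q xi PQ; apply: I1 => //; exact: agree_refl. Qed.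

Lemma supermart_trans t x y z : supermart t x y -> supermart t y z -> supermart t x z.
Proof. by move=> xy yz Q xi PQ Lxi xi0; apply: (le_trans (yz Q xi PQ Lxi xi0)); exact: xy. Qed.

Lemma supermart_le s t x y : s <= t -> supermart t x y -> supermart s x y.
Proof. by move=> st xy Q xi PQ Lxi; apply: xy => //; apply: Lip_le Lxi; rewrite lee_fin. Qed.

Lemma qs_supermart t x y : L1q x -> L1q y -> qs (fun w => y w <= x w) -> supermart t x y.
Proof.
move=> Lx Ly xy Q xi PQ Lxi xi0.
apply: (Ex_le_qs (L1q_mulLip Ly Lxi) (L1q_mulLip Lx Lxi) _ PQ).
by apply: qs_mono xy => w h; rewrite ler_wpM2r.
Qed.

Lemma CE_le_supermart t x y a : 0 <= t -> CE t x y -> CE t a a -> supermart t a x ->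
  qs (fun w => y w <= a w).
Proof.
move=> t0 C Ca ax; have [_ Ly _ _ _] := C; have [La _ _ _ _] := Ca.
apply: qs_le_pos => //; apply: (CE_pos_le t0 C Ca) => Q xi PQ Lxi xi01; rewrite addr0.
by apply: ax => // w; have /andP[] := xi01 w.
Qed.

(** A prior near-optimal for [z], which agrees with [Q] up to [t], agrees with it up to [s] as well,
    hence is admissible for [y]. *)
Lemma CE_tower s t x y z : s <= t -> CE s x y -> CE t x z -> supermart s y z.
Proof.
move=> st [Lx Ly _ I1 _] [_ Lz _ _ I2] Q xi PQ Lxi xi0.
have Lxi' : Lip t%:E xi by apply: Lip_le Lxi; rewrite lee_fin.
apply/ler_addgt0Pr => e e0; have [Q' QQ' h] := I2 Q xi e PQ Lxi' xi0 e0.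
apply: (le_trans h); rewrite lerD2r; apply: I1 => //.
exact: (@agree_trans _ sl sb s t Q Q Q' st (agree_refl s PQ) QQ').
Qed.

Lemma lg1_CE_ex t x : 0 <= t -> lg1 +oo%E x -> exists2 y, lg1 t%:E y & CE t x y.
Proof.
move=> t0 lx; have LX : LG1 +oo%E (EFin \o x) by exact: EFin_LG1.
by have [_ ly C] := condE_LG1_CE t0 LX; exists (rv (condE sl sb t (EFin \o x))).
Qed.

End supermartingale.
Arguments supermart {R} sl sb t a b.

(** * The envelopes along the grids and their limit *)

Section snell.
Context {R : realType} {sl sb : R} {bnd : volatility_bounds sl sb}.
Implicit Types (x y z : Omega R -> R) (s t c e : R).

Local Notation qs := (qs sl sb).
Local Notation L1q := (L1q sl sb).
Local Notation Nle := (Nle sl sb).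
Local Notation lg1 := (lg1 sl sb).
Local Notation CE := (CE sl sb).
Local Notation LG1 := (LG1 sl sb).
Local Notation LL1 := (LL1 sl sb).
Local Notation supermart := (supermart sl sb).
Local Notation condE := (condE sl sb).

Variables (beta : R) (beta_gt1 : 1 < beta) (X : R -> Omega R -> R) (X_SG : SG sl sb beta 1 X)
  (V : nat -> R -> Omega R -> \bar R)
  (V_Borel : forall n k : nat, (k <= 2 ^ n)%N -> measurable_fun setT (V n (grid n k)))
  (V_terminal : forall n : nat, qs (fun w => V n 1 w = (X 1 w)%:E))
  (V_backward : forall n k : nat, (k < 2 ^ n)%N ->
     qs (fun w => V n (grid n k) w =
       Order.max (X (grid n k) w)%:E (condE (grid n k) (V n (grid n k.+1)) w))).

Local Notation v n k := (rv (V n (grid n k))).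

Lemma grid_ind n (K : nat -> Prop) : K (2 ^ n)%N -> (forall k, (k < 2 ^ n)%N -> K k.+1 -> K k) ->
  forall k, (k <= 2 ^ n)%N -> K k.
Proof.
move=> K1 KS k kn.
have : forall j, (j <= 2 ^ n)%N -> K (2 ^ n - j)%N.
  elim => [|j ih] jn; first by rewrite subn0.
  apply: KS; first by rewrite ltn_subrL expn_gt0.
  by rewrite -subSn//; apply: ih; exact: ltnW.
by move=> /(_ (2 ^ n - k)%N); rewrite subKn//; apply; exact: leq_subr.
Qed.

Lemma X_lg1 n k : (k <= 2 ^ n)%N -> lg1 (grid n k)%:E (X (grid n k)).
Proof. by move=> kn; apply: (SG_lg1 beta_gt1 X_SG); exact: grid_01. Qed.

Lemma EFin_grid_ge0 n k : (0 <= (@grid R n k)%:E)%E.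
Proof. by rewrite lee_fin /grid divr_ge0// exprn_ge0. Qed.

Lemma V_LG1 n k : (k <= 2 ^ n)%N -> LG1 (grid n k)%:E (V n (grid n k)).
Proof.
move: k; apply: grid_ind => [|k kn LV].
  apply: (@LG1_intro _ _ _ _ _ _ (X (grid n (2 ^ n)))); [exact: V_Borel| |exact: X_lg1].
  by rewrite grid_max; exact: V_terminal.
have t0 := EFin_grid_ge0 n k.
have LV' : LG1 +oo%E (V n (grid n k.+1)) by apply: LG1_le LV; rewrite ?leey ?EFin_grid_ge0.
have [LY ly C] := condE_LG1_CE t0 LV'; have [_ _ Yy _] := LL1_rv LY.
apply: (@LG1_intro _ _ _ _ _ _ (fun w => Num.max (X (grid n k) w) (rv (condE (grid n k) (V n (grid n k.+1))) w))).
- exact: V_Borel (ltnW kn).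
- by apply: qs_mono (qs_and (V_backward kn) Yy) => w [-> ->]; rewrite EFin_max.
- by apply: lg1_max => //; exact: X_lg1 (ltnW kn).
Qed.

Lemma V_rv n k : (k <= 2 ^ n)%N -> lg1 (grid n k)%:E (v n k) /\ qs (fun w => V n (grid n k) w = (v n k w)%:E).
Proof. by move=> /V_LG1/LG1_rv[_ _ ? ?]. Qed.

Lemma V_step n k : (k < 2 ^ n)%N -> exists y, [/\ lg1 (grid n k)%:E y, CE (grid n k) (v n k.+1) y,
  qs (fun w => condE (grid n k) (V n (grid n k.+1)) w = (y w)%:E) &
  qs (fun w => v n k w = Num.max (X (grid n k) w) (y w))].
Proof.
move=> kn; have t0 := EFin_grid_ge0 n k.
have LV' : LG1 +oo%E (V n (grid n k.+1)) by apply: LG1_le (V_LG1 kn); rewrite ?leey ?EFin_grid_ge0.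
have [LY ly C] := condE_LG1_CE t0 LV'; have [_ _ Yy _] := LL1_rv LY.
exists (rv (condE (grid n k) (V n (grid n k.+1)))); split => //.
by apply: qs_mono (qs_and (V_backward kn) Yy) => w; rewrite /rv => -[-> ->]; rewrite -EFin_max.
Qed.

Lemma V_last n : qs (fun w => v n (2 ^ n) w = X 1 w).
Proof. by rewrite grid_max; apply: qs_mono (V_terminal n) => w; rewrite /rv => ->. Qed.

Lemma V_ge_X n k : (k <= 2 ^ n)%N -> qs (fun w => X (grid n k) w <= v n k w).
Proof.
rewrite leq_eqVlt => /predU1P[->|kn].
  by apply: qs_mono (V_last n) => w ->; rewrite grid_max.
by have [y [_ _ _ h]] := V_step kn; apply: qs_mono h => w ->; rewrite le_max lexx.
Qed.

Lemma V_L1q n k : (k <= 2 ^ n)%N -> L1q (v n k).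
Proof. by move=> /V_rv[[]]. Qed.

Lemma V_supermart_step n k : (k < 2 ^ n)%N -> supermart (grid n k) (v n k) (v n k.+1).
Proof.
move=> kn; have [y [ly C _ h]] := V_step kn.
apply: (supermart_trans _ (CE_supermart C)); apply: qs_supermart; [exact: V_L1q (ltnW kn)|by case: ly|].
by apply: qs_mono h => w ->; rewrite le_max lexx orbT.
Qed.

Lemma V_supermart n j k : (j <= k)%N -> (k <= 2 ^ n)%N -> supermart (grid n j) (v n j) (v n k).
Proof.
elim: k => [|k ih].
  by rewrite leqn0 => /eqP -> _; apply: qs_supermart; [exact: V_L1q|exact: V_L1q|exact: qsT].
rewrite leq_eqVlt => /predU1P[->|jk] kn.
  by apply: qs_supermart; [exact: V_L1q|exact: V_L1q|exact: qsT].
apply: (supermart_trans (ih jk (ltnW kn))).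
by apply: supermart_le (V_supermart_step kn); exact: grid_le.
Qed.

(** One coarse step is two fine ones, over which the finer envelope is a supermartingale; so it
    dominates the conditional expectation of its later value, hence of the coarse one by
    induction. *)
Lemma V_mono n k : (k <= 2 ^ n)%N -> qs (fun w => v n k w <= v n.+1 (k * 2) w).
Proof.
have ES j : grid n.+1 (j * 2) = grid n j :> R := grid_double n j.
have S2 j : (j <= 2 ^ n)%N -> (j * 2 <= 2 ^ n.+1)%N by move=> jn; rewrite expnSr leq_mul2r jn orbT.
move: k; apply: grid_ind => [|k kn ih].
  rewrite -expnSr; apply: qs_mono (qs_and (V_last n) (V_last n.+1)) => w [-> ->] //.
have [y [ly C _ h]] := V_step kn.
have k2 : (k * 2 <= 2 ^ n.+1)%N by exact: S2 (ltnW kn).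
have k2' : (k.+1 * 2 <= 2 ^ n.+1)%N by exact: S2.
have [la _] := V_rv k2; rewrite ES in la.
have t0 := EFin_grid_ge0 n k.
have ya : qs (fun w => y w <= v n.+1 (k * 2) w).
  rewrite ES; apply: (CE_le_supermart t0 C (lg1_CE_id t0 la)).
  have := @V_supermart n.+1 (k * 2) (k.+1 * 2); rewrite ES => /(_ _ k2')/(_ _)-H.
  apply: (supermart_trans (H _)); first by rewrite leq_mul2r leqnSn orbT.
  apply: qs_supermart ih; [exact: V_L1q|exact: V_L1q].
have := V_ge_X k2; rewrite ES => Xa; rewrite ES in ya.
by apply: qs_mono (qs_and h (qs_and Xa ya)) => w [-> [? ?]]; rewrite ge_max; apply/andP.
Qed.

(** The majorant of [SG_dominated] is only known to be integrable, while [lg1_CE_ex] conditions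
    variables in [lg1]. The maximum over the grid is in [lg1] and still dominated by that majorant,
    uniformly in n. *)
Lemma X_max n : exists g, [/\ lg1 1%:E g, qs (fun w => forall j, (j <= 2 ^ n)%N -> X (grid n j) w <= g w) &
  forall G, qs (fun w => forall t, 0 <= t <= 1 -> `|X t w| <= G w) -> qs (fun w => `|g w| <= G w)].
Proof.
have lX j : (j <= 2 ^ n)%N -> lg1 1%:E (X (grid n j)).
  by move=> jn; apply: lg1_le (X_lg1 jn); rewrite lee_fin; have /andP[] := @grid_01 R n j jn.
suff h m : (m <= 2 ^ n)%N -> exists g, [/\ lg1 1%:E g, qs (fun w => forall j, (j <= m)%N -> X (grid n j) w <= g w) &
    forall G, qs (fun w => forall t, 0 <= t <= 1 -> `|X t w| <= G w) -> qs (fun w => `|g w| <= G w)].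
  exact: h.
elim: m => [|m ih] mn.
  exists (X (grid n 0)); split; first exact: lX.
    by apply: qsT => w j; rewrite leqn0 => /eqP ->.
  by move=> G; apply: qs_mono => w; apply; exact: grid_01.
have [g [lg Xg gG]] := ih (ltnW mn).
exists (fun w => Num.max (g w) (X (grid n m.+1) w)); split.
- by apply: lg1_max => //; exact: lX.
- apply: qs_mono Xg => w h j; rewrite leq_eqVlt => /predU1P[->|jm]; first by rewrite le_max lexx orbT.
  by rewrite le_max h.
- move=> G XG; apply: qs_mono (qs_and XG (gG G XG)) => w [h1 h2].
  by rewrite /Num.max; case: ifP => _ //; apply: h1; exact: grid_01.
Qed.

Lemma V_le_CE n g : lg1 1%:E g -> qs (fun w => forall j, (j <= 2 ^ n)%N -> X (grid n j) w <= g w) ->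
  forall k, (k <= 2 ^ n)%N -> forall d, lg1 (grid n k)%:E d -> CE (grid n k) g d -> qs (fun w => v n k w <= d w).
Proof.
move=> lg Xg.
have Xd k d : (k <= 2 ^ n)%N -> CE (grid n k) g d -> qs (fun w => X (grid n k) w <= d w).
  move=> kn C; have t0 := EFin_grid_ge0 n k.
  apply: (CE_mono t0 (lg1_CE_id t0 (X_lg1 kn)) C).
  by apply: qs_mono Xg => w; apply.
apply: grid_ind => [d _ C|k kn ih d ld C].
  by apply: qs_mono (qs_and (V_last n) (Xd _ _ (leqnn _) C)) => w [-> ]; rewrite grid_max.
have t0 := EFin_grid_ge0 n k; have t0' := EFin_grid_ge0 n k.+1.
have lg' : lg1 +oo%E g by apply: lg1_le lg; rewrite leey.
have [d' ld' C'] := lg1_CE_ex t0' lg'.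
have [y [ly Cy _ h]] := V_step kn.
have yd : qs (fun w => y w <= d w).
  apply: (CE_le_supermart t0 Cy (lg1_CE_id t0 ld)).
  apply: (supermart_trans (CE_tower (grid_le n (leqnSn k)) C C')).
  by apply: qs_supermart (ih _ ld' C'); [case: ld'|exact: V_L1q].
by apply: qs_mono (qs_and h (qs_and (Xd _ _ (ltnW kn) C) yd)) => w [-> [? ?]]; rewrite ge_max; apply/andP.
Qed.

(** The envelope lies between [X] and the conditional expectation of the grid maximum. The former
    contributes c and the latter 2 c, by [CE_Nle]. *)
Lemma V_bounded : exists c, forall n k, (k <= 2 ^ n)%N -> Nle (v n k) c.
Proof.
have [G LG XG] := SG_dominated beta_gt1 X_SG; have [mG [c Gc]] := LG.
exists (c + 2 * c) => n k kn; have t0 := EFin_grid_ge0 n k.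
have [g [lg Xg /(_ G XG) gG]] := X_max n.
have gc : Nle g c by apply: (Nle_dom _ mG gG Gc); case: lg.1.
have lg' : lg1 +oo%E g by apply: lg1_le lg; rewrite leey.
have [d ld C] := lg1_CE_ex t0 lg'.
have dc : Nle d (2 * c) by exact: CE_Nle t0 C gc.
have md : measurable_fun setT d by case: ld.1.
apply: (Nle_dom _ _ _ (Nle_add mG md Gc dc)); first by case: (V_L1q kn).
  by apply: measurable_funD; exact: measurableT_comp.
apply: qs_mono (qs_and XG (qs_and (V_ge_X kn) (V_le_CE lg Xg kn ld C))) => w [h1 [h2 h3]].
have := h1 _ (grid_01 kn); have := ler_norm (d w); have := ler_norm (- X (grid n k) w).
have := ler_norm (G w); have := normr_ge0 (d w); rewrite normrN ler_norml => ? ? ? ? /andP[? ?].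
by rewrite ler_norml; apply/andP; split; lra.
Qed.

Local Notation Vinf t := (fun w => limn (fun m => V m t w)).

Lemma Vinf_inc n k : (k <= 2 ^ n)%N ->
  LL1 (grid n k)%:E (Vinf (grid n k)) /\
  qs_inc sl sb (fun m => v (n + m) (k * 2 ^ m)) (rv (Vinf (grid n k))).
Proof.
move=> kn; have [c Vc] := V_bounded.
have km m : (k * 2 ^ m <= 2 ^ (n + m))%N by rewrite expnD leq_mul2r kn orbT.
pose u m := v (n + m) (k * 2 ^ m).
have ui : qs (fun w => forall m, u m w <= u m.+1 w).
  apply: qs_all => m; have := V_mono (km m).
  by rewrite /u -mulnA -expnSr addnS.
have [Ll cl] := bounded_mono_cvg (fun m => (V_L1q (km m)).1) (fun m => Vc _ _ (km m)) ui.
have Vu : qs (fun w => forall m, V (n + m)%N (grid n k) w = (u m w)%:E).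
  by apply: qs_all => m; have [_] := V_rv (km m); rewrite /u grid_refine.
have VE : qs (fun w => Vinf (grid n k) w = (limr (u^~ w))%:E).
  apply: qs_mono (qs_and Vu cl) => w [hu cu]; rewrite (limn_shift n).
  under eq_fun do rewrite hu.
  by apply/cvg_lim => //; apply: cvg_EFin => //; exact: nearW.
have mV : measurable_fun setT (Vinf (grid n k)).
  by apply: (measurable_limn (n := n)) => m; rewrite -(grid_refine m); exact: V_Borel.
split.
  apply: (LL1_intro mV VE Ll); apply: adaptedq_lim cl => m.
  by have [/lg1_adapted] := V_rv (km m); rewrite grid_refine.
by apply: qs_mono (qs_and (qs_and ui cl) VE) => w [[h1 h2] h3]; rewrite /rv h3.
Qed.

Lemma Vinf_LG1_ss n k : (k <= 2 ^ n)%N -> LG1_ss sl sb (grid n k)%:E (Vinf (grid n k)).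
Proof.
move=> kn; have [LV iV] := Vinf_inc kn.
have km m : (k * 2 ^ m <= 2 ^ (n + m))%N by rewrite expnD leq_mul2r kn orbT.
have LVm m : LG1 (grid n k)%:E (V (n + m)%N (grid (n + m) (k * 2 ^ m))).
  by have := V_LG1 (km m); rewrite {1}grid_refine.
split => //; exists (fun m => V (n + m)%N (grid (n + m) (k * 2 ^ m))).
  by move=> m; apply: LG1_LG1_s.
have LVm' m : LL1 (grid n k)%:E (V (n + m)%N (grid (n + m) (k * 2 ^ m))) by case: (LVm m).
exact/(qs_inc_rv LVm' LV).
Qed.

Lemma Vinf_LGs_1 n k : (k <= 2 ^ n)%N -> LGs_1 sl sb (grid n k)%:E (Vinf (grid n k)).
Proof.
move=> kn; have [LV iV] := Vinf_inc kn; have t0 := EFin_grid_ge0 n k.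
have [mV Lv Vv av] := LL1_rv LV.
have km m : (k * 2 ^ m <= 2 ^ (n + m))%N by rewrite expnD leq_mul2r kn orbT.
have lO : lg1 (grid n k)%:E (fun=> 0) by apply: Lip_lg1; exact: Lip_cst.
have LO : LG1 (grid n k)%:E (EFin \o (fun=> 0)).
  exact: EFin_LG1.
split => //; exists (EFin \o (fun=> 0)), (EFin \o (fun w => - rv (Vinf (grid n k)) w)); split.
- exact: LG1_LG1_s.
- have lm m : lg1 (grid n k)%:E (fun w => - v (n + m) (k * 2 ^ m) w).
    by apply: lg1_opp => //; have [] := V_rv (km m); rewrite {1}grid_refine.
  have Lm m : LG1 (grid n k)%:E (EFin \o (fun w => - v (n + m) (k * 2 ^ m) w)).
    exact: EFin_LG1.
  have Lm' m : LL1 (grid n k)%:E (EFin \o (fun w => - v (n + m) (k * 2 ^ m) w)) by case: (Lm m).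
  have LN : LL1 (grid n k)%:E (EFin \o (fun w => - rv (Vinf (grid n k)) w)).
    apply: EFin_LL1.
      apply: (L1q_dom _ (L1q_abs Lv)); last by apply: qsT => w; rewrite normrN.
      by apply: measurableT_comp => //; case: Lv.
    have [x' mx' xx'] := av; exists (fun w => - x' w); first exact: measurableT_comp.
    by apply: qs_mono xx' => w ->.
  split => //; exists (fun m => EFin \o (fun w => - v (n + m) (k * 2 ^ m) w)); first exact: Lm.
  apply/(qs_dec_rv Lm' LN); apply: qs_mono iV => w [h1 h2]; split => [m|].
    by rewrite /rv /= lerN2; exact: h1.
  exact: cvgN.
- by apply: qs_mono Vv => w -> /=; rewrite -EFinB sub0r opprK.
Qed.

Lemma dyadic_common s t : dyadic s -> dyadic t -> s <= t -> exists n j k,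
  [/\ (k <= 2 ^ n)%N, (j <= k)%N, s = grid n j & t = grid n k].
Proof.
move=> [n [j [jn ->]]] [m [k [km ->]]] st; exists (n + m)%N, (j * 2 ^ m)%N, (k * 2 ^ n)%N.
rewrite grid_refine addnC grid_refine; split => //; first by rewrite expnD leq_mul2r km orbT.
move: st; rewrite -(grid_refine m n j) -(grid_refine n m k) addnC /grid ler_pM2r ?invr_gt0 ?exprn_gt0//.
by rewrite ler_nat.
Qed.

(** The limit at the earlier time is its own conditional G-expectation, since [agr] passes to
    increasing limits. It remains to pass to the limit in the weighted inequalities between the
    envelopes at the two times, on common grids. *)
Lemma Vinf_supermartingale : G_supermartingale sl sb dyadic (fun t => Vinf t).
Proof.
split=> [_ [n [k [kn ->]]]|s t ds dt st]; first exact: LG1_ss_LG1_ss_bar (Vinf_LG1_ss kn).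
have [n [j [k [kn jk -> ->]]]] := dyadic_common ds dt st.
have jn := leq_trans jk kn; have t0 := EFin_grid_ge0 n j.
have [LVt iVt] := Vinf_inc kn; have [LVs iVs] := Vinf_inc jn.
have km m : (k * 2 ^ m <= 2 ^ (n + m))%N by rewrite expnD leq_mul2r kn orbT.
have jm m : (j * 2 ^ m <= 2 ^ (n + m))%N by rewrite expnD leq_mul2r jn orbT.
have LVt' : LG1_ss_bar sl sb +oo%E (Vinf (grid n k)).
  by apply: LG1_ss_bar_le (LG1_ss_LG1_ss_bar (Vinf_LG1_ss kn)); rewrite ?leey ?EFin_grid_ge0.
have [LY C] := condE_CE t0 LVt'.
have [_ Lvs Vs as_] := LL1_rv LVs; have [_ Lvt _ _] := LL1_rv LVt; have [_ _ Yy _] := LL1_rv LY.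
have gs : agr sl sb (grid n j) (rv (Vinf (grid n j))).
  apply: (agr_cvg (fun m => V_L1q (jm m)) Lvs (or_intror iVs)) => m; apply: lg1_agr => //.
  by have [] := V_rv (jm m); rewrite {1}grid_refine.
have h : qs (fun w => rv (condE (grid n j) (Vinf (grid n k))) w <= rv (Vinf (grid n j)) w).
  apply: (CE_le_supermart t0 C (CE_id Lvs as_ gs)) => Q xi PQ Lxi xi0.
  apply: (ler_cvg_to (Ex_mono_cvg (fun m => V_L1q (km m)) Lvt (or_intror iVt) Lxi PQ)
    (Ex_mono_cvg (fun m => V_L1q (jm m)) Lvs (or_intror iVs) Lxi PQ)).
  apply: nearW => m; apply: (V_supermart _ (km m)) => //; first by rewrite leq_mul2r jk orbT.
  by rewrite grid_refine.
by apply: qs_mono (qs_and h (qs_and Vs Yy)) => w [? [-> ->]]; rewrite lee_fin.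
Qed.

Lemma Vinf_dominates : dominates sl sb dyadic (fun t => Vinf t) (fun t w => (X t w)%:E).
Proof.
move=> _ [n [k [kn ->]]]; have [LV iV] := Vinf_inc kn; have [_ _ Vv _] := LL1_rv LV.
have := V_ge_X kn; have := qs_inc_le iV => hi hX.
apply: qs_mono (qs_and hX (qs_and hi Vv)) => w [h1 [h2 ->]]; rewrite lee_fin.
have /andP[_] := h2 0%N 0%N (leqnn 0); rewrite addn0 expn0 muln1; exact: le_trans.
Qed.

Lemma Vinf_smallest U : G_supermartingale sl sb dyadic U ->
  dominates sl sb dyadic U (fun t w => (X t w)%:E) -> dominates sl sb dyadic U (fun t => Vinf t).
Proof.
move=> [LU sU] dU.
have dg n k : (k <= 2 ^ n)%N -> dyadic (@grid R n k) by move=> kn; exists n, k.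
have Uu n k : (k <= 2 ^ n)%N -> qs (fun w => U (grid n k) w = (rv (U (grid n k)) w)%:E).
  by move=> kn; have [/LL1_rv[]] := LU _ (dg n k kn).
have VU n k : (k <= 2 ^ n)%N -> qs (fun w => v n k w <= rv (U (grid n k)) w).
  (* Backward along the n-th grid: [CE_mono] carries the inequality at one grid point to the
     conditional expectations at the previous one, where [U] dominates both terms of the maximum. *)
  move: k; apply: grid_ind => [|k kn ih].
    have := dU _ (dg n (2 ^ n)%N (leqnn _)) => h.
    apply: qs_mono (qs_and h (qs_and (V_last n) (Uu n _ (leqnn _)))) => w [hX [-> UE]].
    by move: hX; rewrite UE lee_fin {1}grid_max.
  have t0 := EFin_grid_ge0 n k.
  have [y [ly C _ h]] := V_step kn.
  have LU' : LG1_ss_bar sl sb +oo%E (U (grid n k.+1)).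
    by apply: LG1_ss_bar_le (LU _ (dg n k.+1 kn)); rewrite ?leey ?EFin_grid_ge0.
  have [LY CU] := condE_CE t0 LU'; have [_ _ Yy _] := LL1_rv LY.
  have yY : qs (fun w => y w <= rv (condE (grid n k) (U (grid n k.+1))) w) by exact: CE_mono t0 C CU ih.
  have YU := sU _ _ (dg n k (ltnW kn)) (dg n k.+1 kn) (grid_le n (leqnSn k)).
  have XU := dU _ (dg n k (ltnW kn)).
  apply: qs_mono (qs_and h (qs_and (qs_and Yy (Uu _ _ (ltnW kn))) (qs_and yY (qs_and YU XU)))).
  move=> w [-> [[Ye Ue] [h1 [+ +]]]]; rewrite Ye Ue !lee_fin => h2 h3.
  by rewrite ge_max h3 /=; exact: le_trans h2.
move=> _ [n [k [kn ->]]]; have [LV iV] := Vinf_inc kn; have [_ _ Vv _] := LL1_rv LV.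
have km m : (k * 2 ^ m <= 2 ^ (n + m))%N by rewrite expnD leq_mul2r kn orbT.
have hU : qs (fun w => forall m, v (n + m) (k * 2 ^ m) w <= rv (U (grid n k)) w).
  by apply: qs_all => m; have := VU _ _ (km m); rewrite grid_refine.
apply: qs_mono (qs_and hU (qs_and (Uu _ _ kn) (qs_and Vv iV))) => w [h1 [-> [-> [_ h2]]]].
by rewrite lee_fin; apply: (cvgr_to_le h2); exact: nearW.
Qed.

Lemma V_le n k : (k <= 2 ^ n)%N -> qs (fun w => (V n (grid n k) w <= V n.+1 (grid n k) w)%E).
Proof.
move=> kn; have kn2 : (k * 2 <= 2 ^ n.+1)%N by rewrite expnSr leq_mul2r kn orbT.
have E : grid n.+1 (k * 2) = grid n k :> R := grid_double n k.
have [_ h1] := V_rv kn; have [_ h2] := V_rv kn2; have h3 := V_mono kn; rewrite E in h2 h3.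
by apply: qs_mono (qs_and h1 (qs_and h2 h3)) => w [-> [-> ?]]; rewrite lee_fin.
Qed.

End snell.

Theorem proposition4p2 (R : realType) (sl sb : R)
    (sl_ge0 : 0 <= sl) (sl_le_sb : sl <= sb)
    (beta : R) (beta_gt1 : 1 < beta)
    (X : R -> Omega R -> R) (X_SG : SG sl sb beta 1 X)
    (V : nat -> R -> Omega R -> \bar R)
    (V_Borel : forall n k : nat, (k <= 2 ^ n)%N ->
       measurable_fun setT (V n (grid n k)))
    (V_terminal : forall n : nat,
       qs sl sb (fun w => V n 1 w = (X 1 w)%:E))
    (V_backward : forall n k : nat, (k < 2 ^ n)%N ->
       qs sl sb (fun w => V n (grid n k) w =
         Order.max (X (grid n k) w)%:E
                   (condE sl sb (grid n k) (V n (grid n k.+1)) w))) :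
  let Vinf := fun (t : R) (w : Omega R) => limn (fun m => V m t w) in
  [/\ forall n k : nat, (k <= 2 ^ n)%N ->
        qs sl sb (fun w => (V n (grid n k) w <= V n.+1 (grid n k) w)%E),
      forall t : R, dyadic t -> LGs_1 sl sb t%:E (Vinf t) &
      smallest_G_supermartingale_dominating sl sb dyadic Vinf
        (fun t w => (X t w)%:E)].
Proof.
have bnd : volatility_bounds sl sb by split.
move=> Vinf; split.
- by move=> n k; exact: (V_le beta_gt1 X_SG V_Borel V_terminal V_backward).
- move=> _ [n [k [kn ->]]].
  exact: (Vinf_LGs_1 beta_gt1 X_SG V_Borel V_terminal V_backward kn).
split.
- exact: (Vinf_supermartingale beta_gt1 X_SG V_Borel V_terminal V_backward).
- exact: (Vinf_dominates beta_gt1 X_SG V_Borel V_terminal V_backward).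
- exact: (Vinf_smallest beta_gt1 X_SG V_Borel V_terminal V_backward).
Qed.
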